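(* Let $0<p<1$ and let $\mathcal Z$ be a sequence of distinct points of $\mathbb D$, separated in the pseudo-hyperbolic metric. The following are equivalent: (a) $\mathcal Z$ is an interpolating sequence for $A^p$; (b) for every $q\ge1$ there is a constant $C$ such that for every $f\in L^p_{q,\mathcal Z}$ the equation $(1-|z|^2)\frac{\partial u}{\partial\bar z}=f$ has a solution $u$ with $\|u\|_{p,\mathcal Z}\le C\|f\|_{p,q,\mathcal Z}$; (c) there exist $q\ge1$ and a constant $C$ such that for every $f\in L^p_{q,\mathcal Z}$ the equation $(1-|z|^2)\frac{\partial u}{\partial\bar z}=f$ has a solution $u$ with $\|u\|_{p,\mathcal Z}\le C\|f\|_{p,q,\mathcal Z}$.
   Context: $\mathbb D$ is the open unit disk, $dA$ area measure, $A^p$ the analytic functions with $\|f\|_p^p=\int_{\mathbb D}|f|^pdA<\infty$. $\psi(z,w)=\left|\frac{z-w}{1-\bar wz}\right|$, $D(z,r)=\{w:\psi(z,w)<r\}$; separated means $\inf\{\psi(a,b):a\ne b\in\mathcal Z\}>0$. $\ell^p(\mathcal Z)$ consists of $(c_a)$ with $\sum_{a\in\mathcal Z}|c_a|^p(1-|a|^2)^2<\infty$; $\mathcal Z$ is interpolating for $A^p$ if $f\mapsto(f(a))_{a\in\mathcal Z}$ maps $A^p$ onto $\ell^p(\mathcal Z)$. $k_{\mathcal Z}(z)=\frac{|z|^2}{2}\sum_{a\in\mathcal Z}\frac{(1-|a|^2)^2}{|1-\bar az|^2}$ and $\|u\|_{p,\mathcal Z}=\left(\int_{\mathbb D}|ue^{k_{\mathcal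 Z}}|^pdA\right)^{1/p}$. Fix $R\in(0,1)$ and let $D_z=D(z,R)$. For $|f|^q$ locally integrable, $m_q(f,z)=\left(\frac1{|D_z|}\int_{D_z}|f|^q\,dA\right)^{1/q}$ ($|D_z|$ = area). $L^p_{q,\mathcal Z}$ is the set of measurable $f$ with $\|f\|_{p,q,\mathcal Z}=\left(\int_{\mathbb D}m_q(fe^{k_{\mathcal Z}},z)^p\,dA(z)\right)^{1/p}<\infty$. $\frac{\partial}{\partial\bar z}=\frac12(\partial_x+i\partial_y)$; the equation holds in the distributional sense. *)

(* Defs.v *)
(* MathComp + MathComp-Analysis (R : realType), complex numbers R[i]
   from mathcomp-real-closed.  Points of the disk are pairs (x, y) : R * R
   (so that the area measure = Lebesgue product measure is available);
   they are identified with x + i y via [toC]. *)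
From HB Require Import structures.
From mathcomp Require Import all_boot all_order all_algebra.
From mathcomp Require Import all_classical all_reals all_analysis.
From mathcomp.real_closed Require Import complex.
Import Order.TTheory GRing.Theory Num.Theory.
Import numFieldNormedType.Exports.

Set Implicit Arguments.
Unset Strict Implicit.
Unset Printing Implicit Defensive.

Local Open Scope classical_set_scope.
Local Open Scope ring_scope.

Section Defs.
Variable R : realType.

Definition areaM := product_measure1 (@lebesgue_measure R) (@lebesgue_measure R).

Definition toC (z : R * R) : R[i] := Complex z.1 z.2.
Definition ofC (w : R[i]) : R * R := (complex.Re w, complex.Im w).

Definition rC (x : R) : R[i] := Complex x 0.

Definition cabs (w : R[i]) : R := ComplexField.Normc.normc w.

Definition disk : set (R * R) := [set z | cabs (toC z) < 1].

Definition psi (z w : R * R) : R :=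
  cabs ((toC z - toC w) / (1 - conjc (toC w) * toC z)).

Definition pdisk (z : R * R) (r : R) : set (R * R) := [set w | psi z w < r].

Definition ph_separated (Z : set (R * R)) : Prop :=
  exists delta : R, 0 < delta /\
    forall a b, Z a -> Z b -> a <> b -> delta <= psi a b.

Definition holomorphic_on_disk (f : R * R -> R[i]) : Prop :=
  forall z, disk z -> exists l : R[i], forall eps : R, 0 < eps ->
    exists delta : R, 0 < delta /\ forall h : R[i], h != 0 -> cabs h < delta ->
      cabs ((f (ofC (toC z + h)) - f z) / h - l) < eps.

Definition in_Ap (p : R) (f : R * R -> R[i]) : Prop :=
  holomorphic_on_disk f /\
  (\int[areaM]_(z in disk) ((cabs (f z)) `^ p)%:E < +oo)%E.

Definition in_lp (p : R) (Z : set (R * R)) (c : R * R -> R[i]) : Prop :=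
  (\esum_(a in Z) ((cabs (c a)) `^ p * (1 - cabs (toC a) ^+ 2) ^+ 2)%:E < +oo)%E.

Definition interpolating (p : R) (Z : set (R * R)) : Prop :=
  (forall f, in_Ap p f -> in_lp p Z f) /\
  (forall c, in_lp p Z c -> exists f, in_Ap p f /\ forall a, Z a -> f a = c a).

(* k_Z(z) = |z|^2/2 sum_{a in Z} (1-|a|^2)^2 / |1 - conj(a) z|^2
   (the series converges for ph_separated Z in the disk; [fine] reads it as a real) *)
Definition kZ (Z : set (R * R)) (z : R * R) : R :=
  (cabs (toC z) ^+ 2 / 2) *
  fine (\esum_(a in Z) (((1 - cabs (toC a) ^+ 2) ^+ 2) /
                        (cabs (1 - conjc (toC a) * toC z)) ^+ 2)%:E)%E.

Definition normZ (p : R) (Z : set (R * R)) (u : R * R -> R[i]) : \bar R :=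
  ((\int[areaM]_(z in disk) ((cabs (u z) * expR (kZ Z z)) `^ p)%:E) `^ (p^-1))%E.

Definition mq (Rr q : R) (g : R * R -> R[i]) (z : R * R) : \bar R :=
  ((((fine (areaM (pdisk z Rr)))^-1)%:E *
    \int[areaM]_(w in pdisk z Rr) ((cabs (g w)) `^ q)%:E) `^ (q^-1))%E.

Definition normpqZ (p q Rr : R) (Z : set (R * R)) (f : R * R -> R[i]) : \bar R :=
  ((\int[areaM]_(z in disk)
      (mq Rr q (fun w => (f w * rC (expR (kZ Z w)))%R) z) `^ p) `^ (p^-1))%E.

Definition in_Lpq (p q Rr : R) (Z : set (R * R)) (f : R * R -> R[i]) : Prop :=
  measurable_fun disk (fun z => complex.Re (f z)) /\
  measurable_fun disk (fun z => complex.Im (f z)) /\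
  (normpqZ p q Rr Z f < +oo)%E.

Definition dirder (s : seq (R * R)) (phi : R * R -> R) : R * R -> R :=
  foldr (fun v g => 'D_v g) phi s.

Definition smooth (phi : R * R -> R) : Prop :=
  forall (s : seq (R * R)) (x : R * R), differentiable (dirder s phi) x.

(* real test functions C_c^infty(D) (complex ones are combinations of these) *)
Definition test_fun (phi : R * R -> R) : Prop :=
  smooth phi /\
  exists K : set (R * R), compact K /\ K `<=` disk /\
    forall z, ~ K z -> phi z = 0.

Definition dbar (phi : R * R -> R) (z : R * R) : R[i] :=
  Complex ('D_(1, 0) phi z / 2) ('D_(0, 1) phi z / 2).

Definition loc_integrable_disk (g : R * R -> R[i]) : Prop :=
  forall K : set (R * R), compact K -> K `<=` disk ->
    areaM.-integrable K (fun z => (complex.Re (g z))%:E) /\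
    areaM.-integrable K (fun z => (complex.Im (g z))%:E).

Definition cint (g : R * R -> R[i]) : R[i] :=
  Complex (Rintegral areaM disk (fun z => complex.Re (g z)))
          (Rintegral areaM disk (fun z => complex.Im (g z))).

(* u solves (1 - |z|^2) du/dzbar = f in the sense of distributions on D,
   i.e. du/dzbar = f / (1 - |z|^2) as distributions:
   <du/dzbar, phi> = - int u dphi/dzbar = int f/(1-|z|^2) phi. *)
Definition dbar_solution (f u : R * R -> R[i]) : Prop :=
  let g := fun z => f z / rC (1 - cabs (toC z) ^+ 2) in
  loc_integrable_disk u /\ loc_integrable_disk g /\
  forall phi, test_fun phi ->
    cint (fun z => u z * dbar phi z) = - cint (fun z => g z * rC (phi z)).

Definition dbar_solvable (p q Rr : R) (Z : set (R * R)) : Prop :=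
  exists C : R, forall f, in_Lpq p q Rr Z f ->
    exists u, dbar_solution f u /\
      (normZ p Z u <= C%:E * normpqZ p q Rr Z f)%E.

End Defs.

(* Main.v *)
Require Import Defs.
From HB Require Import structures.
From mathcomp Require Import all_boot all_order all_algebra.
From mathcomp Require Import all_classical all_reals all_analysis.
From mathcomp.real_closed Require Import complex.
From mathcomp Require Import measurable_realfun ring lra.
Import Order.TTheory GRing.Theory Num.Theory.
Import numFieldNormedType.Exports.

Set Implicit Arguments.
Unset Strict Implicit.
Unset Printing Implicit Defensive.

Local Open Scope classical_set_scope.
Local Open Scope ring_scope.

(* The weight [kZ] is realized by a holomorphic [Psi], an infinite product vanishing exactly on [Z] with
[|Psi|] comparable to [exp kZ] times the pseudo-hyperbolic distance to [Z]. If the equation is solvable,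
glue the data [c_a] by cutoffs into [g]; solving with right-hand side built from [dbar g / Psi], the
function [g - Psi u] is holomorphic by Weyl's lemma and takes the values [c_a] on [Z]. Conversely,
interpolation with uniform constants (open mapping through Baire) followed by division by [Psi] gives, for
the points [l] of a separated grid, holomorphic [h_l] with [|h_l| exp kZ] bounded below near [l] and
[int |h_l exp kZ|^p] at most [K (1 - |l|)^2]; with the disk cut into cells [A_l] near [l], the solution is the sum
over [l] of [h_l(z)] times the Cauchy transform of [1_{A_l} f / ((1 - |w|^2) h_l)]. Since [p < 1],
[p]-th powers are subadditive and the norms of the terms add up. *)

Local Notation letr := le_trans.
Local Notation lelt := le_lt_trans.
Local Notation ltle := lt_le_trans.
Local Notation mEFP := measurable_EFinP.
Local Notation mcomp := measurableT_comp.
Local Notation mfunM := measurable_funM.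
Local Notation lerMr := ler_wpM2r.
Local Notation lerMl := ler_wpM2l.
Local Notation leeMl := lee_wpmul2l.

(** For [p < 1] there is neither convexity nor duality, and a bound on the [p]-th power integral
    does not control local averages. Hence the data are measured by [m_q]: it bounds the [L^1] mass
    on each cell, which is what a Cauchy transform needs. The factors of [Psi] are [(1 - s) exp s]
    with [s = (1 - |a|^2) / (1 - conj(a) z)]. With [y = |1 - s|] their modulus is
    [y exp((1 - y^2)/2) exp(|s|^2/2)], and the last exponentials multiply to [exp kZ] up to a
    bounded factor, because [(1 - |z|^2) sum |s|^2] is bounded. A solution [u] is only locally
    integrable, so [Psi u] has no value at a zero [a] of [Psi]; the value [c_a] is recovered by
    testing the equation against a cutoff times [Psi / (z - a)]. A grid point [l] away from [Z] is
    not an interpolation node. There one starts from a high power of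
    [(1 - |l|^2) / (1 - conj(l) z)], equal to [1] at [l], and cancels its values on [Z] by an
    interpolating function times a factor vanishing at [l]. Cauchy theory is done with area
    integrals against derivatives of cutoffs, so that it also covers weak solutions; the constant
    [kappa] takes the place of pi. *)

Lemma eq_ler (R : numDomainType) (x y : R) : x = y -> x <= y.
by move=> ->. Qed.

Lemma le_via d (T : porderType d) (y x z : T) : (x <= y -> y <= z -> x <= z)%O.
exact: letr. Qed.
Arguments le_via {d T} y {x z} _ _.

Section Disk.
Variable R : realType.
Local Notation C := (R[i]).
Local Notation PT := (measurableTypeR R * measurableTypeR R)%type.
Local Notation PP := (PT * PT)%type.
Local Notation A := (@areaM R).
Local Notation Dk := (@disk R).
Local Notation DP := (@disk R : set PT).
Local Notation nC z := (cabs (toC z)).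
Local Notation dC z w := (cabs (toC z - toC w)).
Local Notation dd a := (1 - cabs (toC a)).
Local Notation re := (@complex.Re R).
Local Notation im := (@complex.Im R).
Local Notation RR := (R * R)%type.
Local Notation tz z w := (toC z - toC w).
Local Notation ek Z z := (expR (kZ Z z)).
Local Notation mfun := measurable_fun.

(** * Modulus and components of complex numbers *)

Section ComplexModulus.
Implicit Types (x y z w : C) (a b : R).

Lemma nc_ge0 x : 0 <= cabs x.
by case: x => a b; exact: sqrtr_ge0. Qed.

Lemma sqr_cabs x : cabs x ^+ 2 = re x ^+ 2 + im x ^+ 2.
by case: x => a b /=; rewrite /cabs /= sqr_sqrtr // addr_ge0 ?sqr_ge0. Qed.

Lemma cabs0 : cabs (0 : C) = 0. exact: ComplexField.Normc.normc0. Qed.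
Lemma cabs1 : cabs (1 : C) = 1. exact: ComplexField.Normc.normc1. Qed.
Lemma cabsM x y : cabs (x * y) = cabs x * cabs y.
exact: ComplexField.Normc.normcM. Qed.
Lemma cabsV x : cabs (x^-1) = (cabs x)^-1.
exact: ComplexField.Normc.normcV. Qed.
Lemma nc_div x y : cabs (x / y) = cabs x / cabs y.
by rewrite cabsM cabsV. Qed.
Lemma cabsX x n : cabs (x ^+ n) = cabs x ^+ n.
by elim: n => [|n ih]; rewrite ?expr0 ?cabs1 // !exprS cabsM ih. Qed.
Lemma cabsN x : cabs (- x) = cabs x.
by case: x => a b; rewrite /cabs /= !sqrrN. Qed.
Lemma cabsD x y : cabs (x + y) <= cabs x + cabs y.
exact: le_normcD. Qed.
Lemma cabsB x y : cabs (x - y) <= cabs x + cabs y.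
by rewrite -[cabs y]cabsN; exact: cabsD. Qed.
Lemma nc_distC x y : cabs (x - y) = cabs (y - x).
by rewrite -cabsN opprB. Qed.
Lemma nc_distD z x y : cabs (x - y) <= cabs (x - z) + cabs (z - y).
by rewrite (_ : x - y = (x - z) + (z - y)) ?cabsD //; ring. Qed.
Lemma nc_eq0 x : (cabs x == 0) = (x == 0).
by apply/eqP/eqP => [/ComplexField.Normc.eq0_normc //|->]; rewrite cabs0. Qed.
Lemma nc_gt0 x : (0 < cabs x) = (x != 0).
by rewrite lt_def nc_ge0 andbT nc_eq0. Qed.
Lemma cabsJ x : cabs (conjc x) = cabs x.
by case: x => a b; rewrite /cabs /= sqrrN. Qed.
Lemma nc_leB x y : cabs x - cabs y <= cabs (x - y).
by rewrite lerBlDr (letr _ (cabsD _ _)) // subrK. Qed.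
Lemma Re_le_cabs x : `|re x| <= cabs x.
rewrite -ler_sqr ?nnegrE ?nc_ge0 // sqr_cabs real_normK ?num_real //.
by rewrite lerDl sqr_ge0.
Qed.
Lemma Im_le_cabs x : `|im x| <= cabs x.
rewrite -ler_sqr ?nnegrE ?nc_ge0 // sqr_cabs real_normK ?num_real //.
by rewrite lerDr sqr_ge0.
Qed.
Lemma nc_le_ReIm x : cabs x <= `|re x| + `|im x|.
rewrite -ler_sqr ?nnegrE ?nc_ge0 ?addr_ge0 // sqr_cabs sqrrD.
rewrite !real_normK ?num_real // -addrA lerD2l lerDr.
by rewrite mulrn_wge0 // mulr_ge0.
Qed.
Lemma nc_rC a : cabs (rC a) = `|a|.
by rewrite /cabs /= expr0n /= addr0 sqrtr_sqr. Qed.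

Lemma rCD a b : rC (a + b) = rC a + rC b.
by apply/eqP; rewrite eq_complex /= eqxx addr0 eqxx. Qed.
Lemma rCM a b : rC (a * b) = rC a * rC b.
by apply/eqP; rewrite eq_complex /= !mulr0 mul0r subr0 addr0 !eqxx. Qed.
Lemma rCN a : rC (- a) = - rC a.
by apply/eqP; rewrite eq_complex /= oppr0 !eqxx. Qed.
Lemma rC0 : rC 0 = 0 :> C. by []. Qed.
Lemma rC1 : rC 1 = 1 :> C. by []. Qed.
Lemma rC_eq0 a : (rC a == 0) = (a == 0).
by rewrite eq_complex /= eqxx andbT. Qed.
Lemma mulJ x : x * conjc x = rC (cabs x ^+ 2).
by rewrite sqr_cabs; case: x => a b; apply/eqP; rewrite eq_complex /=; apply/andP; split; apply/eqP; ring. Qed.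

Lemma ReD x y : re (x + y) = re x + re y.
by case: x; case: y. Qed.
Lemma ImD x y : im (x + y) = im x + im y.
by case: x; case: y. Qed.
Lemma ReN x : re (- x) = - re x. by case: x. Qed.
Lemma ImN x : im (- x) = - im x. by case: x. Qed.
Lemma ReM x y : re (x * y) = re x * re y - im x * im y.
by case: x; case: y. Qed.
Lemma ImM x y : im (x * y) = re x * im y + im x * re y.
by case: x; case: y. Qed.
Lemma ReV x : re x^-1 = re x / cabs x ^+ 2.
by rewrite sqr_cabs; case: x. Qed.
Lemma ImV x : im x^-1 = - im x / cabs x ^+ 2.
by rewrite sqr_cabs; case: x => a b /=; rewrite mulNr. Qed.

Lemma ceqP x y : re x = re y -> im x = im y -> x = y.
by case: x; case: y => /= ? ? ? ? -> ->. Qed.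

Lemma toCK (z : RR) : ofC (toC z) = z. by case: z. Qed.
Lemma ofCK x : toC (ofC x) = x. by case: x. Qed.
Lemma toC_inj : injective (@toC R).
exact: (can_inj toCK). Qed.
End ComplexModulus.

(** * Complex differentiability *)

Section ComplexDerivative.
Implicit Types (f g : RR -> C) (z w : RR) (U : set RR).

(** Little-o form without division: [w = z] is allowed, and each derivative rule becomes an
    algebraic identity plus a bound on the remainder. *)
Definition cderiv f z (l : C) := forall eps : R, 0 < eps -> exists2 delta : R, 0 < delta &
 forall w, dC w z < delta ->
  cabs (f w - f z - l * tz w z) <= eps * dC w z.

Definition holo U f := forall z, U z -> exists l, cderiv f z l.

Lemma holo_diskP f : holomorphic_on_disk f <-> holo Dk f.
split=> hf z dz; have [l hl] := hf z dz; exists l => eps e0.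
 have [d [d0 hd]] := hl eps e0; exists d => // w wd.
 have [->|wz] := eqVneq w z; first by rewrite !subrr mulr0 subrr cabs0 mulr0.
 have h0 : toC w - toC z != 0 by rewrite subr_eq0 (inj_eq (@toC_inj)).
 have := hd _ h0 wd; rewrite (addrC (toC z)) subrK toCK => H.
 have -> : f w - f z - l * tz w z = ((f w - f z) / tz w z - l) * (tz w z).
  by field.
 by rewrite cabsM ler_pM2r ?nc_gt0 // ltW.
(* Half of [eps] turns the non-strict bound of [cderiv] into the strict one. *)
have e2 : 0 < eps / 2 by rewrite divr_gt0.
have [d d0 hd] := hl _ e2; exists d; split=> // h h0 hlt.
have := hd (ofC (toC z + h)); rewrite !ofCK addrC addKr => /(_ hlt) H.
have -> : (f (ofC (toC z + h)) - f z) / h - l = (f (ofC (toC z + h)) - f z - l * h) / h by field.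
rewrite nc_div ltr_pdivrMr ?nc_gt0 //; apply: (lelt H).
by rewrite ltr_pM2r ?nc_gt0 // ltr_pdivrMr // mulr_natr mulr2n ltrDl.
Qed.

Lemma cderiv_cst (c : C) z : cderiv (fun _ => c) z 0.
by move=> e e0; exists 1 => // w _; rewrite subrr mul0r subr0 cabs0 mulr_ge0 ?nc_ge0 // ltW. Qed.

Lemma cderiv_toC z : cderiv (@toC R) z 1.
by move=> e e0; exists 1 => // w _; rewrite mul1r subrr cabs0 mulr_ge0 ?nc_ge0 // ltW. Qed.

Lemma cderiv_lip f z l : cderiv f z l -> exists2 delta : R, 0 < delta &
 forall w, dC w z < delta -> cabs (f w - f z) <= (cabs l + 1) * dC w z.
move=> /(_ 1 ltr01)[d d0 hd]; exists d => // w /hd h.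
have -> : f w - f z = (f w - f z - l * tz w z) + l * (tz w z) by ring.
by apply: (letr (cabsD _ _)); rewrite cabsM; lra.
Qed.

Lemma cderivD f g z l m : cderiv f z l -> cderiv g z m -> cderiv (fun w => f w + g w) z (l + m).
move=> hf hg e e0; have e2 : 0 < e / 2 by rewrite divr_gt0.
have [d d0 hd] := hf _ e2; have [d' d'0 hd'] := hg _ e2.
exists (Num.min d d') => [|w]; first by rewrite lt_min d0.
rewrite lt_min => /andP[/hd h1 /hd' h2].
have -> : f w + g w - (f z + g z) - (l + m) * tz w z =
 (f w - f z - l * tz w z) + (g w - g z - m * tz w z) by ring.
by apply: (letr (cabsD _ _)); lra.
Qed.

Lemma cderivM f g z l m : cderiv f z l -> cderiv g z m ->
 cderiv (fun w => f w * g w) z (l * g z + f z * m).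
move=> hf hg e e0.
have [df df0 hlf] := cderiv_lip hf.
(* [K] dominates every size in play. Each of the three remainder terms gets [e / 4]; the product of
   the two increments does so thanks to [r = e / (4 K^2)]. *)
pose K := cabs l + 1 + cabs (g z) + 1 + cabs (f z) + (cabs m + 1).
have lK : 1 <= K by rewrite /K; have := nc_ge0 l; have := nc_ge0 (g z); have := nc_ge0 (f z); have := nc_ge0 m; lra.
have K0 : 0 < K by lra.
have e2 : 0 < e / (4 * K) by rewrite divr_gt0 // mulr_gt0.
have [d d0 hd] := hf _ e2; have [d' d'0 hd'] := hg _ e2.
have [dg dg0 hlg] := cderiv_lip hg.
pose r := e / (4 * K * K).
have r0 : 0 < r by rewrite /r divr_gt0 // !mulr_gt0.
exists (Num.min (Num.min d d') (Num.min (Num.min df dg) r)) => [|w].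
 by rewrite !lt_min d0 d'0 df0 dg0.
rewrite !lt_min => /andP[/andP[/hd h1 /hd' h2] /andP[/andP[/hlf h3 /hlg h4] h5]].
have -> : f w * g w - f z * g z - (l * g z + f z * m) * tz w z =
 (f w - f z - l * tz w z) * g z + f z * (g w - g z - m * tz w z) +
 (f w - f z) * (g w - g z) by ring.
set t := dC w z in h1 h2 h3 h4 h5 *.
have t0 : 0 <= t := nc_ge0 _.
have eK : e / (4 * K) * K = e / 4 by field; lra.
have rK : K * K * r = e / 4 by rewrite /r; field; lra.
have H1 : cabs ((f w - f z - l * tz w z) * g z) <= e / 4 * t.
 rewrite cabsM -eK mulrAC; apply: ler_pM; rewrite ?nc_ge0 //.
 by rewrite /K; have := nc_ge0 l; have := nc_ge0 (f z); have := nc_ge0 m; lra.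
have H2 : cabs (f z * (g w - g z - m * tz w z)) <= e / 4 * t.
 rewrite cabsM -eK mulrAC mulrC; apply: ler_pM; rewrite ?nc_ge0 //.
 by rewrite /K; have := nc_ge0 l; have := nc_ge0 (g z); have := nc_ge0 m; lra.
have H3 : cabs ((f w - f z) * (g w - g z)) <= e / 4 * t.
 rewrite cabsM; apply: (le_via ((K * t) * (K * t))).
  apply: ler_pM; rewrite ?nc_ge0 //.
   apply: (letr h3); apply: lerMr => //.
   by rewrite /K; have := nc_ge0 l; have := nc_ge0 (f z); have := nc_ge0 m; have := nc_ge0 (g z); lra.
  apply: (letr h4); apply: lerMr => //.
  by rewrite /K; have := nc_ge0 l; have := nc_ge0 (f z); have := nc_ge0 m; have := nc_ge0 (g z); lra.
 rewrite -rK; have -> : K * t * (K * t) = K * K * t * t by ring.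
 rewrite [K * K * r * t]mulrAC; apply: lerMl; last exact: ltW.
 by rewrite !mulr_ge0 // ltW.
apply: (letr (cabsD _ _)).
have := cabsD ((f w - f z - l * tz w z) * g z) (f z * (g w - g z - m * tz w z)).
have : 0 <= e * t by rewrite mulr_ge0 // ltW.
lra.
Qed.

Lemma cderivV f z l : f z != 0 -> cderiv f z l -> cderiv (fun w => (f w)^-1) z (- l / f z ^+ 2).
move=> f0 hf e e0.
have [df df0 hlf] := cderiv_lip hf.
have a0 : 0 < cabs (f z) by rewrite nc_gt0.
set a := cabs (f z) in a0 *.
pose L := cabs l + 1.
have L1 : 1 <= L by rewrite /L; have := nc_ge0 l; lra.
have ea : 0 < e * a ^+ 2 / 4 by rewrite divr_gt0 // mulr_gt0 // exprn_gt0.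
have [d d0 hd] := hf _ ea.
(* [r1] keeps [|f w| >= a / 2], and [r2] makes the quadratic remainder [(f w - f z)^2 / (f w f z^2)]
   at most [e / 2] times the distance. *)
pose r1 := a / (2 * L); pose r2 := e * a ^+ 3 / (4 * L ^+ 2).
have r10 : 0 < r1 by rewrite /r1 divr_gt0 //; lra.
have r20 : 0 < r2 by rewrite /r2 divr_gt0 // mulr_gt0 // exprn_gt0 //; lra.
exists (Num.min (Num.min d df) (Num.min r1 r2)) => [|w]; first by rewrite !lt_min d0 df0 r10.
rewrite !lt_min => /andP[/andP[/hd h1 /hlf h2] /andP[h3 h4]].
set t := dC w z in h1 h2 h3 h4 *.
have t0 : 0 <= t := nc_ge0 _.
have hfw : a / 2 <= cabs (f w).
 have h5 := nc_leB (f z) (f z - f w).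
 move: h5; have -> : f z - (f z - f w) = f w by ring.
 rewrite (nc_distC (f z)) -/a => h5.
 have : (cabs l + 1) * t <= L * r1 by apply: lerMl; rewrite -?/L; lra.
 have -> : L * r1 = a / 2 by rewrite /r1; field; lra.
 lra.
have fw0 : f w != 0 by rewrite -nc_gt0; lra.
have -> : (f w)^-1 - (f z)^-1 - - l / f z ^+ 2 * tz w z =
 - (f w - f z - l * tz w z) / (f z ^+ 2) + (f w - f z) ^+ 2 / (f w * f z ^+ 2).
 by field; rewrite f0.
have H1 : cabs (- (f w - f z - l * tz w z) / (f z ^+ 2)) <= e / 4 * t.
 rewrite nc_div cabsN cabsX -/a ler_pdivrMr ?exprn_gt0 //.
 by apply: (letr h1); apply: eq_ler; ring.
have H2 : cabs ((f w - f z) ^+ 2 / (f w * f z ^+ 2)) <= e / 2 * t.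
 rewrite nc_div cabsM !cabsX -/a ler_pdivrMr; last by rewrite mulr_gt0 ?exprn_gt0 //; lra.
 apply: (le_via ((L * t) ^+ 2)).
  by rewrite ler_sqr ?nnegrE ?nc_ge0 // mulr_ge0 //; lra.
 apply: (le_via (e / 2 * t * (a / 2 * a ^+ 2))); last first.
  apply: lerMl; first by rewrite mulr_ge0 // divr_ge0 // ltW.
  by apply: lerMr => //; rewrite exprn_ge0 // ltW.
 have : L ^+ 2 * t <= L ^+ 2 * r2 by apply: lerMl; [exact: sqr_ge0|exact: ltW].
 have -> : L ^+ 2 * r2 = e * a ^+ 3 / 4 by rewrite /r2; field; lra.
 move=> H; have := lerMr t0 H.
 have -> : (L * t) ^+ 2 = L ^+ 2 * t * t by ring.
 have -> : e / 2 * t * (a / 2 * a ^+ 2) = e * a ^+ 3 / 4 * t by field.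
 by [].
apply: (letr (cabsD _ _)).
have : 0 <= e * t by rewrite mulr_ge0 // ltW.
lra.
Qed.

Lemma cderiv_eq f g z l m : (exists2 r : R, 0 < r & forall w, dC w z < r -> f w = g w) ->
 l = m -> cderiv f z l -> cderiv g z m.
move=> [r r0 hr] <- hf e e0; have [d d0 hd] := hf e e0.
exists (Num.min d r) => [|w]; first by rewrite lt_min d0.
rewrite lt_min => /andP[/hd + wr]; rewrite (hr _ wr) (hr z) //.
by rewrite subrr cabs0.
Qed.

Lemma holo_cst U c : holo U (fun _ => c).
by move=> z _; exists 0; exact: cderiv_cst. Qed.
Lemma holo_toC U : holo U (@toC R).
by move=> z _; exists 1; exact: cderiv_toC. Qed.
Lemma holoD U f g : holo U f -> holo U g -> holo U (fun w => f w + g w).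
by move=> hf hg z Uz; have [l hl] := hf z Uz; have [m hm] := hg z Uz; eexists; exact: cderivD hl hm. Qed.
Lemma holoM U f g : holo U f -> holo U g -> holo U (fun w => f w * g w).
by move=> hf hg z Uz; have [l hl] := hf z Uz; have [m hm] := hg z Uz; eexists; exact: cderivM hl hm. Qed.
Lemma holoV U f : (forall z, U z -> f z != 0) -> holo U f -> holo U (fun w => (f w)^-1).
by move=> f0 hf z Uz; have [l hl] := hf z Uz; eexists; exact: cderivV (f0 z Uz) hl. Qed.
Lemma holoN U f : holo U f -> holo U (fun w => - f w).
move=> hf z Uz; have [l hl] := hf z Uz; eexists.
apply: cderiv_eq (cderivM (cderiv_cst (-1) z) hl); last reflexivity.
by exists 1 => // w _; rewrite mulN1r.
Qed.
Lemma holoB U f g : holo U f -> holo U g -> holo U (fun w => f w - g w).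
by move=> hf hg; apply: holoD => //; exact: holoN. Qed.
Lemma holoX U f n : holo U f -> holo U (fun w => f w ^+ n).
move=> hf; elim: n => [|n ih] z Uz; first by exists 0; apply: cderiv_cst.
have [l hl] := ih z Uz; have [m hm] := hf z Uz; eexists.
by apply: cderiv_eq (cderivM hm hl) => //; exists 1 => // w _; rewrite exprS.
Qed.
End ComplexDerivative.

(** * Measurability and area in the plane *)

Section PlaneMeasure.
Implicit Types (D E : set PT).
Local Notation mu := (@lebesgue_measure R).

(** An open set is the union of the squares contained in it with rational centre and radius
    [1 / (n + 1)]: a countable family of products of intervals. *)
Lemma open_plane_measurable (U : set RR) : open U -> measurable (U : set PT).
move=> oA.
pose Q := [set q : rat * rat * nat | ball ((ratr q.1.1 : R), (ratr q.1.2 : R)) (q.2.+1%:R^-1) `<=` U].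
rewrite (_ : U = \bigcup_(q in Q) (ball (ratr q.1.1 : R) (q.2.+1%:R^-1) `*` ball (ratr q.1.2 : R) (q.2.+1%:R^-1))).
 rewrite bigcup_mkcond; apply: countable_bigcupT_measurable => // q.
 case: ifP => _; last exact: measurable0.
 by apply: measurableX; exact: measurable_ball.
apply/seteqP; split=> [[x y] Axy|[x y] [q Qq [/= h1 h2]]]; last exact: Qq.
have /nbhs_ballP[e /= e0 he] := open_nbhs_nbhs (conj oA Axy).
have [n hn] : exists n : nat, 2 * n.+1%:R^-1 < e.
 have e2 : 0 < e / 2 by rewrite divr_gt0.
 by have [n hn] := ltr_add_invr e2; exists n; move: hn; rewrite add0r; set i := _^-1; clearbody i; lra.
pose i : R := n.+1%:R^-1.
have i0 : 0 < i by rewrite invr_gt0.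
rewrite -/i in hn.
have xi : x - i < x + i by lra.
have yi : y - i < y + i by lra.
have [q1 hq1] := rat_in_itvoo xi; have [q2 hq2] := rat_in_itvoo yi.
move: hq1 hq2; rewrite !in_itv /= => /andP[a1 a2] /andP[b1 b2].
exists (q1, q2, n) => /=; rewrite -/i; last first.
 by split; rewrite /ball /= ltr_distlC; apply/andP; split; lra.
rewrite /Q /= -/i => -[x' y'] [/= h1 h2]; apply: he; split => /=.
 move: h1; rewrite /ball /= !ltr_distlC => /andP[c1 c2]; apply/andP; split; lra.
move: h2; rewrite /ball /= !ltr_distlC => /andP[c1 c2]; apply/andP; split; lra.
Qed.

Lemma open_continuous_measurable (D : set RR) (f : RR -> R) :
 open D -> {in D, continuous f} -> mfun D f.
move=> oD cf mD; apply: (measurability _ (RGenOInfty.measurableE R)) => //.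
move=> _ [_ [a ->] <-]; apply: open_plane_measurable; rewrite openE => z [Dz fz].
have h := cf z (mem_set Dz).
apply: filterI; first exact: open_nbhs_nbhs.
by apply: h; apply: open_nbhs_nbhs; split => //; exact: interval_open.
Qed.

Definition cmeas D (g : RR -> C) :=
 mfun D (fun z => re (g z)) /\ mfun D (fun z => im (g z)).

Lemma cmeas_cst D c : cmeas D (fun _ => c). by []. Qed.
Lemma cmeasD D f g : cmeas D f -> cmeas D g -> cmeas D (fun z => f z + g z).
move=> [f1 f2] [g1 g2]; split.
 by under eq_fun do rewrite ReD; exact: measurable_funD.
by under eq_fun do rewrite ImD; exact: measurable_funD.
Qed.
Lemma cmeasN D f : cmeas D f -> cmeas D (fun z => - f z).
move=> [f1 f2]; split.
 by under eq_fun do rewrite ReN; exact: mcomp.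
by under eq_fun do rewrite ImN; exact: mcomp.
Qed.
Lemma cmeasB D f g : cmeas D f -> cmeas D g -> cmeas D (fun z => f z - g z).
by move=> hf /cmeasN; exact: cmeasD. Qed.
Lemma cmeasM D f g : cmeas D f -> cmeas D g -> cmeas D (fun z => f z * g z).
move=> [f1 f2] [g1 g2]; split.
 by under eq_fun do rewrite ReM; apply: measurable_funB; exact: mfunM.
by under eq_fun do rewrite ImM; apply: measurable_funD; exact: mfunM.
Qed.
Lemma cmeas_rC D (f : PT -> R) : mfun D f -> cmeas D (fun z => rC (f z)).
by move=> mf; split => //=. Qed.
Lemma cmeas_sqr_cabs D f : cmeas D f -> mfun D (fun z => cabs (f z) ^+ 2).
move=> [f1 f2]; under eq_fun do rewrite sqr_cabs.
by apply: measurable_funD; exact: measurable_funX.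
Qed.
Lemma cmeas_cabs D f : cmeas D f -> mfun D (fun z => cabs (f z)).
move=> mf; rewrite (_ : (fun z => _) = (fun z => (cabs (f z) ^+ 2) `^ 2^-1)).
 exact: (mcomp (measurable_powR _) (cmeas_sqr_cabs mf)).
by apply/funext => z; rewrite powR12_sqrt ?sqr_ge0 // sqrtr_sqr ger0_norm ?nc_ge0.
Qed.
Lemma meas_fun_inv D (f : PT -> R) : (forall z, D z -> 0 <= f z) -> mfun D f ->
 mfun D (fun z => (f z)^-1).
move=> f0 mf; apply: (@eq_measurable_fun _ _ _ _ _ (fun z => (f z) `^ (-1))).
 by move=> z; rewrite inE => Dz; rewrite powR_inv1 ?f0.
exact: (mcomp (measurable_powR _) mf).
Qed.
Lemma cmeasV D f : cmeas D f -> cmeas D (fun z => (f z)^-1).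
move=> mf; have [f1 f2] := mf.
have mi : mfun D (fun z => (cabs (f z) ^+ 2)^-1).
 by apply: meas_fun_inv => [z _|]; [exact: sqr_ge0|exact: cmeas_sqr_cabs].
split.
 by under eq_fun do rewrite ReV; exact: mfunM.
under eq_fun do rewrite ImV; apply: mfunM => //.
exact: mcomp.
Qed.
Lemma cmeas_toC D : cmeas D (@toC R).
by split => /=; [exact: measurable_funTS measurable_fst|exact: measurable_funTS measurable_snd]. Qed.
Lemma cmeasX D f n : cmeas D f -> cmeas D (fun z => f z ^+ n).
move=> mf; elim: n => [|n ih]; first by split.
by under eq_fun do rewrite exprS; exact: cmeasM.
Qed.
Definition eball (c : RR) (r : R) : set RR := [set z | dC z c < r].

Lemma meas_lt_cabs D f (r : R) : measurable D -> cmeas D f -> measurable (D `&` [set z | cabs (f z) < r]).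
move=> mD mf; have := cmeas_cabs mf => /(_ mD _ (measurable_itv `]-oo, r[)).
by congr measurable; apply/seteqP; split => z /=; rewrite in_itv.
Qed.
Lemma meball c r : measurable (eball c r : set PT).
have := @meas_lt_cabs setT (fun z => toC z - toC c) r measurableT.
by rewrite setTI; apply; apply: cmeasB; [exact: cmeas_toC|exact: cmeas_cst].
Qed.
Lemma mdisk : measurable DP.
have := @meas_lt_cabs setT (fun z => toC z) 1 measurableT.
by rewrite setTI; apply; exact: cmeas_toC.
Qed.

Lemma area_box (a b c d : R) : a <= b -> c <= d ->
 areaM (`]a, b[%classic `*` `]c, d[%classic) = ((b - a) * (d - c))%:E.
move=> ab cd; rewrite [LHS]product_measure1E; [|exact: measurable_itv|exact: measurable_itv].
have L (x y : R) : mu `]x, y[%classic = (if (x%:E < y%:E)%E then (y - x)%:E else 0%E).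
 by rewrite lebesgue_measure_itv.
rewrite [X in (X * _)%E]L [X in (_ * X)%E]L !lte_fin.
have [ab'|] := ltP a b; have [cd'|] := ltP c d; rewrite ?EFinM // => h1.
- by have -> : c = d; [lra|]; rewrite mule0 subrr mule0.
- by have -> : a = b; [lra|]; rewrite mul0e subrr mul0e.
- by move=> h2; have -> : a = b; [lra|]; rewrite mul0e subrr mul0e.
Qed.

(** Circumscribed and, in the next lemma, inscribed squares give [r^2 <= area <= 4 r^2]; these crude
    bounds suffice everywhere, so the exact area of a disk never enters. *)
Lemma area_eball_le c (r : R) : 0 <= r -> (areaM (eball c r) <= (4 * r ^+ 2)%:E)%E.
move=> r0.
have -> : (4 * r ^+ 2) = ((c.1 + r - (c.1 - r)) * (c.2 + r - (c.2 - r))) by ring.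
rewrite -area_box; [|lra|lra].
apply: le_measure; rewrite ?inE; [exact: meball|by apply: measurableX; exact: measurable_itv|].
move=> z zc; split; rewrite /= in_itv /=.
 have := Re_le_cabs (tz z c); rewrite ReD ReN /= => h.
 have := lelt h zc; rewrite ltr_norml => /andP[h1 h2]; apply/andP; split; lra.
have := Im_le_cabs (tz z c); rewrite ImD ImN /= => h.
have := lelt h zc; rewrite ltr_norml => /andP[h1 h2]; apply/andP; split; lra.
Qed.

Lemma area_eball_ge c (r : R) : 0 <= r -> ((r ^+ 2)%:E <= areaM (eball c r))%E.
move=> r0.
have -> : (r ^+ 2) = ((c.1 + r / 2 - (c.1 - r / 2)) * (c.2 + r / 2 - (c.2 - r / 2))) by field.
rewrite -area_box; [|lra|lra].
apply: le_measure; rewrite ?inE; [by apply: measurableX; exact: measurable_itv|exact: meball|].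
move=> z [/=]; rewrite !in_itv /= => /andP[h1 h2] /andP[h3 h4].
apply: (lelt (nc_le_ReIm _)); rewrite ReD ReN ImD ImN /=.
have : `|z.1 - c.1| < r / 2 by rewrite ltr_norml; apply/andP; split; lra.
have : `|z.2 - c.2| < r / 2 by rewrite ltr_norml; apply/andP; split; lra.
lra.
Qed.

Lemma eball_disk c (r : R) : r <= 1 - nC c -> eball c r `<=` Dk.
move=> h z zc; have : dC z c < r := zc => {}zc.
have : nC z <= dC z c + nC c by rewrite (letr _ (cabsD _ _)) // subrK.
by move=> h2; apply: (lelt h2); lra.
Qed.

Lemma diskE : Dk = eball (0, 0) 1.
by apply/funext => z; rewrite /disk /eball; congr (cabs _ < _ : Prop); rewrite [X in _ - X](_ : _ = 0) ?subr0. Qed.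

Lemma area_disk_le : (areaM Dk <= 4%:E)%E.
by rewrite diskE; have := @area_eball_le (0, 0) 1 ler01; rewrite expr1n mulr1. Qed.

Lemma area_lty D : measurable D -> D `<=` Dk -> (A D < +oo)%E.
move=> mD DD; apply: (@lelt _ _ 4%:E); last exact: ltry.
by apply: (letr _ area_disk_le); apply: le_measure; rewrite ?inE //; exact: mdisk.
Qed.

(** The integral of a nonnegative function is a supremum over the simple functions below it, and a
    larger function has more of them. *)
Lemma le_int d (T : measurableType d) (m : {measure set T -> \bar R}) (D : set T) (f g : T -> \bar R) :
 (forall x, D x -> (0 <= f x)%E) -> (forall x, D x -> (f x <= g x)%E) ->
 (\int[m]_(x in D) f x <= \int[m]_(x in D) g x)%E.
move=> f0 fg; rewrite !ge0_integralE //; last by move=> x Dx; exact: letr (f0 _ Dx) (fg _ Dx).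
apply: le_ereal_sup => _ [h hf <-]; exists h => // x.
apply: (letr (hf x)); rewrite !patchE; case: ifPn => // /set_mem Dx; exact: fg.
Qed.

Lemma int_subset d (T : measurableType d) (m : {measure set T -> \bar R}) (D E : set T) (f : T -> \bar R) :
 D `<=` E -> (forall x, E x -> (0 <= f x)%E) ->
 (\int[m]_(x in D) f x <= \int[m]_(x in E) f x)%E.
move=> DE f0; rewrite [leLHS]integral_mkcond [leRHS]integral_mkcond; apply: le_int => x _.
 by rewrite patchE; case: ifPn => // /set_mem /DE /f0.
rewrite !patchE; case: ifPn => [/set_mem/DE Ex|_]; first by rewrite mem_set.
by case: ifPn => // /set_mem /f0.
Qed.
End PlaneMeasure.

(** * Complex integrals over plane sets *)

Section PlaneIntegral.
Implicit Types (D E : set PT) (f g : RR -> C) (r M a : R) (z : RR) (c : C).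

(** Dyadic balls: [1 / |z - c|] is at most the sum over [k] of [2^(k+1) / r] times the indicator of
    the ball of radius [r / 2^k]. The [k]-th term integrates to at most [8 r / 2^k], and the sum of
    these is [16 r]. *)
Lemma integral_inv_dist (c : RR) r : 0 < r ->
 (\int[A]_(z in eball c r) ((dC z c)^-1)%:E <= (16 * r)%:E)%E.
move=> r0.
pose F (k : nat) z : \bar R := ((2 ^+ k.+1 / r) * \1_(eball c (r / 2 ^+ k)) z)%:E.
have F0 k z : (0 <= F k z)%E by rewrite lee_fin mulr_ge0 // divr_ge0 ?exprn_ge0 // ltW.
have mF k : mfun (eball c r) (F k).
 apply/mEFP; apply: mfunM => //.
 by apply: measurable_funTS; apply: measurable_indic; exact: meball.
apply: (le_via (\int[A]_(z in eball c r) \sum_(k <oo) F k z)%E).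
 apply: le_int => z zc; first by rewrite lee_fin invr_ge0 nc_ge0.
 (* At the centre the inverse is [0] by convention, and there is nothing to bound. *)
 have [->|t0] := eqVneq (dC z c) 0.
  by rewrite invr0; apply: nneseries_ge0.
 have {}t0 : 0 < dC z c by rewrite lt_def t0 nc_ge0.
 set t := dC z c in t0 *.
 have tr : t < r := zc.
 have [n] : exists n, r / 2 ^+ n <= t.
  have [n] := ltr_add_invr (divr_gt0 t0 r0); rewrite add0r => hn; exists n.
  rewrite ler_pdivrMr ?exprn_gt0 //.
  have h1 : (n.+1%:R : R) <= 2 ^+ n by rewrite -natrX ler_nat ltn_expl.
  have h2 : r < t * n.+1%:R.
   by move: hn; rewrite ltr_pdivlMr // mulrC ltr_pdivrMr.
  by rewrite (letr (ltW h2)) // lerMl // ltW.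
 elim: n => [|n ih hn]; first by rewrite expr0 divr1 leNgt tr.
 have [/ih //|tn] := leP (r / 2 ^+ n) t.
 apply: (le_via (F n z)); last first.
  rewrite (@nneseriesD1 _ (fun k => F k z) n xpredT (fun k _ => F0 k z) isT) ?leeDl //.
  by apply: nneseries_ge0.
 rewrite /F indicE mem_set ?mulr1 // lee_fin.
 by rewrite -[leRHS]invrK lef_pV2 ?posrE ?invr_gt0 ?divr_gt0 ?exprn_gt0 // invf_div.
rewrite integral_nneseries //; last exact: meball.
apply: (le_via (\sum_(k <oo) ((16 * r) / (2 ^ k.+1)%:R)%:E)%E); last first.
 by apply: epsilon_trick0; rewrite mulr_ge0 // ltW.
apply: lee_nneseries => [k _|k _].
 by move=> _; apply: integral_ge0 => z _.
have r2 : 0 <= r / 2 ^+ k by rewrite divr_ge0 ?exprn_ge0 // ltW.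
have c0 : 0 <= 2 ^+ k.+1 / r by rewrite divr_ge0 ?exprn_ge0 // ltW.
rewrite (_ : (fun z => F k z) = fun z => ((2 ^+ k.+1 / r)%:E * (\1_(eball c (r / 2 ^+ k)) z)%:E)%E); last first.
 by apply/funext => z; rewrite /F EFinM.
rewrite ge0_integralZl_EFin //=; [|exact: meball|]; last first.
 apply/mEFP; apply: measurable_funTS; apply: measurable_indic; exact: meball.
rewrite integral_indic; [|exact: meball|exact: meball].
apply: (le_via ((2 ^+ k.+1 / r)%:E * (4 * (r / 2 ^+ k) ^+ 2)%:E)%E).
 rewrite leeMl ?lee_fin // (letr _ (area_eball_le c r2)) //.
 apply: le_measure; rewrite ?inE; [|exact: meball|exact: subIsetl].
 by apply: measurableI; exact: meball.
rewrite -EFinM lee_fin natrX exprS le_eqVlt; apply/orP; left; apply/eqP.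
by field; rewrite expf_neq0 ?pnatr_eq0 //= gt_eqF.
Qed.

Lemma int_inv_dist (c : RR) r w : 0 < r ->
 (\int[A]_(z in eball c r) ((dC z w)^-1)%:E <= (16 * (r + dC c w))%:E)%E.
move=> r0; apply: (letr _ (@integral_inv_dist w _ _)); last first.
 by rewrite ltr_wpDr ?nc_ge0.
apply: int_subset => z; last by rewrite lee_fin invr_ge0 nc_ge0.
move=> zc; have {}zc : dC z c < r := zc.
by apply: (lelt (nc_distD (toC c) _ _)); lra.
Qed.

Definition cL1 D g := A.-integrable D (fun z => (re (g z))%:E) /\
 A.-integrable D (fun z => (im (g z))%:E).
Definition cinteg D g : C := Complex (Rintegral A D (fun z => re (g z)))
 (Rintegral A D (fun z => im (g z))).

Lemma cintE g : cint g = cinteg Dk g. by []. Qed.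

Lemma cL1_meas D g : measurable D -> cL1 D g -> cmeas D g.
by move=> mD [/integrableP[m1 _] /integrableP[m2 _]]; split; apply/mEFP. Qed.

Lemma cL1P D g : measurable D -> cL1 D g <->
 cmeas D g /\ (\int[A]_(z in D) (cabs (g z))%:E < +oo)%E.
move=> mD; split=> [h|[mg gi]].
 split; first exact: cL1_meas.
 case: h => /integrableP[m1 i1] /integrableP[m2 i2].
 apply: (@lelt _ _ (\int[A]_(z in D) (`|(re (g z))%:E| + `|(im (g z))%:E|))%E).
  apply: le_int => z _; first by rewrite lee_fin nc_ge0.
  by rewrite /= -EFinD lee_fin nc_le_ReIm.
 rewrite ge0_integralD //; first by rewrite lte_add_pinfty.
  exact: (mcomp (@abse_measurable R setT) m1).
 exact: (mcomp (@abse_measurable R setT) m2).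
case: mg => m1 m2; split; apply/integrableP; split; try exact/mEFP.
 apply: lelt gi; apply: le_int => z _ //=.
 by rewrite lee_fin Re_le_cabs.
apply: lelt gi; apply: le_int => z _ //=.
by rewrite lee_fin Im_le_cabs.
Qed.

Lemma cL1_cabs D g : measurable D -> cL1 D g -> A.-integrable D (fun z => (cabs (g z))%:E).
move=> mD /(cL1P _ mD)[mg gi]; apply/integrableP; split.
 by apply/mEFP; exact: cmeas_cabs.
by apply: lelt gi; apply: le_int => z _ //=; rewrite lee_fin ger0_norm ?nc_ge0.
Qed.

Lemma le_cL1 D f g : measurable D -> cmeas D f -> (forall z, D z -> cabs (f z) <= cabs (g z)) ->
 cL1 D g -> cL1 D f.
move=> mD mf fg /(cL1P _ mD)[mg gi]; apply/(cL1P _ mD); split=> //.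
by apply: lelt gi; apply: le_int => z Dz; rewrite lee_fin ?nc_ge0 ?fg.
Qed.

Lemma cL1D D f g : measurable D -> cL1 D f -> cL1 D g ->
 cL1 D (fun z => f z + g z).
move=> mD [f1 f2] [g1 g2]; split.
 under eq_fun do rewrite ReD EFinD; exact: integrableD.
under eq_fun do rewrite ImD EFinD; exact: integrableD.
Qed.

Lemma cL1M_bounded D f g M : measurable D -> cL1 D f -> cmeas D g ->
 (forall z, D z -> cabs (g z) <= M) -> cL1 D (fun z => g z * f z).
move=> mD hf mg gM; have [mf fi] := (cL1P f mD).1 hf.
apply/(cL1P _ mD); split; first exact: cmeasM.
apply: (@lelt _ _ (\int[A]_(z in D) (`|M|%:E * (cabs (f z))%:E))%E).
 apply: le_int => z Dz; first by rewrite lee_fin nc_ge0.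
 by rewrite -EFinM lee_fin cabsM lerMr ?nc_ge0 // (letr (gM z Dz)) // ler_norm.
have mcf : mfun D (fun z => (cabs (f z))%:E).
 by apply/mEFP; exact: cmeas_cabs.
have c0 z : D z -> (0 <= (cabs (f z))%:E)%E by rewrite lee_fin nc_ge0.
by rewrite (ge0_integralZl_EFin A mD c0 mcf) // lte_mul_pinfty.
Qed.

Lemma cL1Z D f c : measurable D -> cL1 D f -> cL1 D (fun z => c * f z).
by move=> mD hf; apply: (@cL1M_bounded _ _ _ (cabs c)). Qed.

Lemma cL1N D f : measurable D -> cL1 D f -> cL1 D (fun z => - f z).
by move=> mD /(cL1Z (-1) mD); under eq_fun do rewrite mulN1r. Qed.

Lemma cL1B D f g : measurable D -> cL1 D f -> cL1 D g ->
 cL1 D (fun z => f z - g z).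
by move=> mD hf hg; apply: cL1D => //; exact: cL1N. Qed.

Lemma cL1S D E f : measurable D -> measurable E -> D `<=` E -> cL1 E f -> cL1 D f.
by move=> mD mE DE [f1 f2]; split; [apply: (integrableS mE mD DE f1)|apply: (integrableS mE mD DE f2)]. Qed.

Lemma cL1_bounded D g M : measurable D -> (A D < +oo)%E -> cmeas D g ->
 (forall z, D z -> cabs (g z) <= M) -> cL1 D g.
move=> mD fD mg gM; apply/(cL1P _ mD); split=> //.
apply: (@lelt _ _ (\int[A]_(z in D) `|M|%:E)%E).
 by apply: le_int => z Dz; rewrite lee_fin ?nc_ge0 // (letr (gM z Dz)) // ler_norm.
by rewrite integral_cst // lte_mul_pinfty.
Qed.

Lemma eq_cinteg D f g : (forall z, D z -> f z = g z) -> cinteg D f = cinteg D g.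
by move=> fg; congr Complex; apply: eq_Rintegral => z /set_mem /fg ->.
Qed.

Lemma eq_cL1 D f g : measurable D -> (forall z, D z -> f z = g z) -> cL1 D f -> cL1 D g.
move=> mD fg [f1 f2]; split.
 by apply: (eq_integrable mD _ _ _ f1) => z /set_mem /fg ->.
by apply: (eq_integrable mD _ _ _ f2) => z /set_mem /fg ->.
Qed.

Lemma cintegD D f g : measurable D -> cL1 D f -> cL1 D g ->
 cinteg D (fun z => f z + g z) = cinteg D f + cinteg D g.
move=> mD [f1 f2] [g1 g2]; apply: ceqP; rewrite ?ReD ?ImD /=.
 by under eq_Rintegral do rewrite ReD; rewrite RintegralD.
by under eq_Rintegral do rewrite ImD; rewrite RintegralD.
Qed.

Lemma cintegZ D f c : measurable D -> cL1 D f ->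
 cinteg D (fun z => c * f z) = c * cinteg D f.
move=> mD [f1 f2].
have i1 a : A.-integrable D (EFin \o (fun z => a * re (f z))) := integrableZl mD a f1.
have i2 a : A.-integrable D (EFin \o (fun z => a * im (f z))) := integrableZl mD a f2.
apply: ceqP; rewrite ?ReM ?ImM /=.
 under eq_Rintegral do rewrite ReM; rewrite (RintegralB mD (i1 _) (i2 _)).
 by rewrite (RintegralZl _ mD f1) (RintegralZl _ mD f2).
under eq_Rintegral do rewrite ImM; rewrite (RintegralD mD (i2 _) (i1 _)).
by rewrite (RintegralZl _ mD f1) (RintegralZl _ mD f2).
Qed.

Lemma cintegN D f : measurable D -> cL1 D f -> cinteg D (fun z => - f z) = - cinteg D f.
by move=> mD hf; rewrite -mulN1r -cintegZ //; apply: eq_cinteg => z _; rewrite mulN1r. Qed.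

Lemma cintegB D f g : measurable D -> cL1 D f -> cL1 D g ->
 cinteg D (fun z => f z - g z) = cinteg D f - cinteg D g.
by move=> mD hf hg; rewrite cintegD ?cintegN //; exact: cL1N. Qed.

Lemma cinteg0 D : cinteg D (fun _ => 0) = 0.
by apply: ceqP => /=; rewrite /Rintegral integral0. Qed.

(** The factor [2] comes from bounding the real and imaginary parts separately; the sharp constant
    is never at stake. *)
Lemma cinteg_bound D f : measurable D -> cL1 D f ->
 ((cabs (cinteg D f))%:E <= 2%:E * \int[A]_(z in D) (cabs (f z))%:E)%E.
move=> mD hf; have [f1 f2] := hf.
have hc := cL1_cabs mD hf.
have fc := integrable_fin_num mD hc.
rewrite -(fineK fc) -EFinM lee_fin.
have h1 : `|Rintegral A D (fun z => re (f z))| <= fine (\int[A]_(z in D) (cabs (f z))%:E)%E.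
 apply: (letr (le_normr_Rintegral mD f1)); apply: le_Rintegral => //.
  by apply: (integrable_norm f1).
 by move=> z _; exact: Re_le_cabs.
have h2 : `|Rintegral A D (fun z => im (f z))| <= fine (\int[A]_(z in D) (cabs (f z))%:E)%E.
 apply: (letr (le_normr_Rintegral mD f2)); apply: le_Rintegral => //.
  by apply: (integrable_norm f2).
 by move=> z _; exact: Im_le_cabs.
by apply: (letr (nc_le_ReIm _)); rewrite /= mulr_natl mulr2n lerD.
Qed.

Lemma cinteg_le D f M a : measurable D -> (A D <= a%:E)%E -> cmeas D f ->
 0 <= M -> (forall z, D z -> cabs (f z) <= M) -> cabs (cinteg D f) <= 2 * (M * a).
move=> mD Da mf M0 fM.
have hf : cL1 D f.
 by apply: cL1_bounded fM => //; apply: lelt Da _; rewrite ltry.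
rewrite -lee_fin; apply: (letr (cinteg_bound mD hf)).
rewrite EFinM leeMl // EFinM.
apply: (le_via (\int[A]_(z in D) M%:E)%E).
 by apply: le_int => z Dz; rewrite lee_fin ?nc_ge0 ?fM.
by rewrite integral_cst // leeMl.
Qed.

Lemma cinteg_sub D E f : measurable D -> measurable E -> D `<=` E ->
 (forall z, E z -> ~ D z -> f z = 0) -> cinteg E f = cinteg D f.
move=> mD mE DE f0.
have P (h : PT -> R) : (forall z, E z -> ~ D z -> h z = 0) -> Rintegral A E h = Rintegral A D h.
 move=> h0; rewrite Rintegral_mkcond [RHS]Rintegral_mkcond; congr Rintegral; apply/funext => z.
 rewrite !patchE; case: ifPn => [/set_mem Ez|/negP nE]; last first.
  by case: ifPn => // /set_mem /DE /mem_set.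
 by case: ifPn => // /negP nD; apply: h0 => // Dz; apply: nD; rewrite inE.
by congr Complex; apply: P => z Ez nD; rewrite f0.
Qed.

Lemma cL1_sub D E f : measurable D -> measurable E -> D `<=` E ->
 (forall z, E z -> ~ D z -> f z = 0) -> cL1 D f -> cL1 E f.
move=> mD mE DE f0 [f1 f2].
have P (h : PT -> R) : (forall z, E z -> ~ D z -> h z = 0) -> A.-integrable D (EFin \o h) -> A.-integrable E (EFin \o h).
 move=> h0 hf; have hi := (integrable_mkcond (EFin \o h) mD).1 hf; apply/(integrable_mkcond (EFin \o h) mE).
 rewrite (_ : _ \_ E = (EFin \o h) \_ D) //; apply/funext => z.
 rewrite !patchE; case: ifPn => [/set_mem Ez|/negP nE]; last first.
  by case: ifPn => // /set_mem /DE /mem_set.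
 by case: ifPn => // /negP nD; rewrite /= h0 // => Dz; apply: nD; rewrite inE.
by split; [apply: P f1|apply: P f2] => z Ez nD; rewrite f0.
Qed.
End PlaneIntegral.

Local Notation ID := (cinteg Dk).
Local Notation L1D := (cL1 Dk).

(** * Smooth functions and a smooth step *)

Section SmoothFunctions.
Implicit Types (f g l : RR -> R) (v b z : RR) (a : R).

(* [flate 0] is the classical flat function; the factor [x ^- n] makes the family
  stable under differentiation. *)
Definition flate (n : nat) (x : R) : R := if 0 < x then x ^- n * expR (- x^-1) else 0.

Lemma flate_ge0 n x : 0 <= flate n x.
rewrite /flate; case: ifPn => // x0.
by rewrite mulr_ge0 ?expR_ge0 // invr_ge0 exprn_ge0 // ltW.
Qed.
Lemma flate_gt0 n x : 0 < x -> 0 < flate n x.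
by move=> x0; rewrite /flate x0 mulr_gt0 ?expR_gt0 // invr_gt0 exprn_gt0. Qed.
Lemma flate_le0 n x : x <= 0 -> flate n x = 0.
by move=> x0; rewrite /flate ltNge x0. Qed.

(** With [k = n + 2], the inequality [exp(1/x) = exp(1/(k x))^k >= (1/(k x))^k] absorbs [x^-n] and
    leaves [x^2]. This quadratic decay gives the derivative at the origin. *)
Lemma flate_bound n x : flate n x <= n.+2%:R ^+ n.+2 * x ^+ 2.
rewrite /flate; case: ifPn => [x0|_]; last by rewrite mulr_ge0 ?sqr_ge0 // exprn_ge0.
have k0 : 0 < n.+2%:R :> R by [].
set k : R := n.+2%:R in k0 *.
have h : (x^-1 / k) ^+ n.+2 <= expR (x^-1).
 have {2}-> : x^-1 = k * (x^-1 / k) by rewrite mulrC divfK // gt_eqF.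
 rewrite /k expRM_natl; apply: lerXn2r; rewrite ?nnegrE ?expR_ge0 // -/k.
  by rewrite divr_ge0 // ?invr_ge0 ltW.
 by apply: letr (expR_ge1Dx _); rewrite lerDr.
rewrite expRN ler_pdivrMr ?expR_gt0 //.
apply: (le_via (k ^+ n.+2 * x ^+ 2 * (x^-1 / k) ^+ n.+2)); last first.
 by rewrite lerMl // mulr_ge0 ?sqr_ge0 // exprn_ge0 // ltW.
apply: eq_ler.
rewrite expr_div_n exprVn -[in x ^- n.+2]addn2 exprD.
by field; rewrite !expf_neq0 ?gt_eqF.
Qed.

Lemma is_derive_flate n (x : R) :
 is_derive x 1 (flate n) (- (n%:R * flate n.+1 x) + flate n.+2 x).
have [x0|x0|<-] := ltgtP 0 x.
- have xn0 : x != 0 by rewrite gt_eqF.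
 apply: (@near_eq_is_derive R R^o R^o (fun y : R => y ^- n * expR (- y^-1))) => //.
 + by near=> y; rewrite /flate ifT //; near: y; exact: lt_nbhsr.
 + have hV : is_derive x 1 (fun y : R => y^-1) (- x ^- 2) .
   apply: is_derive_eq; first exact: is_deriveV.
   by rewrite /GRing.scale /= mulr1.
  have hX : is_derive x 1 (fun y : R => y ^- n) (- (n%:R * x ^- n.+1)).
   case: n => [|n].
    rewrite mul0r oppr0 (_ : (fun y : R => y ^- 0) = cst 1); first exact: is_derive_cst.
    by apply/funext => y; rewrite expr0 invr1.
   rewrite (_ : (fun y : R => y ^- n.+1) = (fun y : R => y^-1) ^+ n.+1); last by apply/funext => y; rewrite exprfctE exprVn.
   apply: is_derive_eq.
   by rewrite /GRing.scale /= exprVn mulrN -mulrA -invfM -exprD addn2.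
  have hE : is_derive x 1 (fun y : R => expR (- y^-1)) (expR (- x^-1) * x ^- 2).
   apply: is_derive_eq.
   by rewrite opprK.
  apply: is_derive_eq (is_deriveM hX hE) _.
  rewrite /flate x0 /GRing.scale /= expr2 !exprSr !invfM.
  move: (x ^+ n)^-1 (x^-1) (expR _) n%:R => a b c d; ring.
- apply: (@near_eq_is_derive R R^o R^o (fun _ : R => 0)) => //.
 + by near=> y; rewrite flate_le0 //; apply: ltW; near: y; exact: lt_nbhsl.
 + by rewrite !flate_le0 ?(ltW x0) // mulr0 oppr0 addr0; exact: is_derive_cst.
rewrite !flate_le0 // mulr0 oppr0 addr0.
(* At the origin [flate_bound] makes the difference quotient tend to [0]. *)
have cv : h^-1 *: (flate n (h + 0) - flate n 0) @[h --> (0:R)^'] --> (0 : R).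
 apply/cvgrPdist_le => e e0.
 near=> h; rewrite addr0 (flate_le0 _ (lexx 0)) subr0 sub0r normrN /GRing.scale /= normrM normfV.
 have h0 : h != 0 by near: h; exact: nbhs_dnbhs_neq.
 rewrite ler_pdivrMl ?normr_gt0 // (ger0_norm (flate_ge0 _ _)).
 apply: (letr (flate_bound _ _)).
 rewrite -real_normK ?num_real // expr2 mulrA [leRHS]mulrC lerMr //.
 have K0 : 0 < n.+2%:R ^+ n.+2 :> R by rewrite exprn_gt0.
 rewrite -ler_pdivlMl //; near: h; apply: dnbhs0_le; by rewrite mulr_gt0 // invr_gt0.
apply: DeriveDef.
 apply/cvg_ex; exists 0.
 by under eq_fun do rewrite /GRing.scale /= mulr1; exact: cv.
by rewrite /derive; apply/cvg_lim => //; under eq_fun do rewrite /GRing.scale /= mulr1; exact: cv.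
Unshelve. all: by end_near. Qed.

Lemma differentiable_flate n x : differentiable (flate n : R^o -> R^o) x.
by apply/derivable1_diffP; have [] := is_derive_flate n x. Qed.

Lemma derive_flate_comp n f (x v : RR) : differentiable f x ->
 differentiable (fun y => flate n (f y)) x /\
 'D_v (fun y => flate n (f y)) x =
 (- (n%:R * flate n.+1 (f x)) + flate n.+2 (f x)) * 'D_v f x.
move=> df; have dg := @differentiable_flate n (f x).
have dfg : differentiable (fun y => flate n (f y)) x by exact: differentiable_comp.
split=> //; rewrite deriveE // diff_comp //= deriveE //.
have [dv eD] := is_derive_flate n (f x).
by rewrite (deriv1E dv) derive1E eD /GRing.scale /= mulrC.
Qed.

(* Each of these operations is differentiable and has directional derivatives obtained by
  the same operations, which gives the closure properties of [smooth] by coinduction. *)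
Inductive salg : (RR -> R) -> Prop :=
| salg_smooth f : smooth f -> salg f
| salg_add f g : salg f -> salg g -> salg (fun x => f x + g x)
| salg_mul f g : salg f -> salg g -> salg (fun x => f x * g x)
| salg_inv f : (forall x, f x != 0) -> salg f -> salg (fun x => (f x)^-1)
| salg_flat n f : salg f -> salg (fun x => flate n (f x)).

(** [smooth] is the largest class of differentiable functions stable under directional derivatives,
    so it contains any class with these two properties. *)
Lemma smooth_coind (F : (RR -> R) -> Prop) :
 (forall f, F f -> forall x, differentiable f x) ->
 (forall f v, F f -> F ('D_v f)) -> forall f, F f -> smooth f.
move=> h1 h2 f Ff s x; apply: h1; elim: s => [//|v s ih] /=.
exact: h2.
Qed.

Lemma smooth_diff f x : smooth f -> differentiable f x.
by move=> /(_ [::] x). Qed.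
Lemma smooth_derive f v : smooth f -> smooth ('D_v f).
by move=> sf s x; have := sf (rcons s v) x; rewrite /dirder foldr_rcons. Qed.

Lemma smooth_cst (c : R) : smooth (fun _ => c).
apply: (@smooth_coind (fun f => exists c, f = fun _ => c)); last by exists c.
 by move=> _ [k ->] x; exact: differentiable_cst.
by move=> _ v [k ->]; exists 0; apply/funext => x; exact: derive_cst.
Qed.

Lemma salg_diff f : salg f -> forall x, differentiable f x.
elim=> {f} [f sf|f g _ hf _ hg|f g _ hf _ hg|f f0 _ hf|n f _ hf] x.
- exact: smooth_diff.
- exact: differentiableD.
- exact: differentiableM.
- exact: differentiableV.
- exact: (derive_flate_comp n 0 (hf x)).1.
Qed.

Lemma salg_derive f v : salg f -> salg ('D_v f).
elim=> {f} [f sf|f g af hf ag hg|f g af hf ag hg|f f0 af hf|n f af hf].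
- exact/salg_smooth/smooth_derive.
- rewrite (_ : 'D_v _ = fun x => 'D_v f x + 'D_v g x); first exact: salg_add.
 by apply/funext => x; rewrite deriveD //; exact/diff_derivable/salg_diff.
- rewrite (_ : 'D_v _ = fun x => f x * 'D_v g x + g x * 'D_v f x).
  by apply: salg_add; exact: salg_mul.
 by apply/funext => x; rewrite deriveM //; exact/diff_derivable/salg_diff.
- rewrite (_ : 'D_v _ = fun x => (-1 : R) * (((f x)^-1 * (f x)^-1) * 'D_v f x)).
  apply: salg_mul; first exact/salg_smooth/smooth_cst.
  by apply: salg_mul => //; apply: salg_mul; exact: salg_inv.
 apply/funext => x; rewrite (deriveV (f0 x)); last exact/diff_derivable/salg_diff.
 by rewrite /GRing.scale /= mulN1r -mulNr -expr2 exprVn mulNr.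
- rewrite (_ : 'D_v _ = fun x => ((- n%:R : R) * flate n.+1 (f x) + flate n.+2 (f x)) * 'D_v f x).
  apply: salg_mul => //; apply: salg_add; last exact: salg_flat.
  by apply: salg_mul; [exact/salg_smooth/smooth_cst|exact: salg_flat].
 apply/funext => x; have [_ ->] := derive_flate_comp n v (salg_diff af x).
 by rewrite mulNr.
Qed.

Lemma salgP f : salg f -> smooth f.
exact: (smooth_coind salg_diff (fun f v => @salg_derive f v)). Qed.

Lemma smoothD f g : smooth f -> smooth g -> smooth (fun x => f x + g x).
by move=> sf sg; apply: salgP; apply: salg_add; exact: salg_smooth. Qed.
Lemma smoothM f g : smooth f -> smooth g -> smooth (fun x => f x * g x).
by move=> sf sg; apply: salgP; apply: salg_mul; exact: salg_smooth. Qed.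
Lemma smoothV f : (forall x, f x != 0) -> smooth f -> smooth (fun x => (f x)^-1).
by move=> f0 sf; apply: salgP; apply: salg_inv => //; exact: salg_smooth. Qed.
Lemma smooth_flat n f : smooth f -> smooth (fun x => flate n (f x)).
by move=> sf; apply: salgP; apply: salg_flat; exact: salg_smooth. Qed.
Lemma smoothN f : smooth f -> smooth (fun x => - f x).
by move=> /(smoothM (smooth_cst (-1))); under eq_fun do rewrite mulN1r. Qed.
Lemma smoothB f g : smooth f -> smooth g -> smooth (fun x => f x - g x).
by move=> sf /smoothN; exact: smoothD. Qed.

Lemma is_diff_proj l x v : (forall a (y b : RR), l (a *: y + b) = a * l y + l b) ->
 continuous l -> differentiable l x /\ 'D_v l x = l v.
move=> hl cl.
pose M := GRing.isLinear.Build R RR R^o *:%R l hl.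
pose L : {linear RR -> R^o} := HB.pack l M.
have dl : differentiable (L : RR -> R^o) x by apply: linear_differentiable; exact: cl.
split=> //; rewrite deriveE //.
have -> : 'd (L : RR -> R^o) x = L :> (_ -> _) by apply: diff_lin; exact: cl.
by [].
Qed.

Lemma smooth_linear l : (forall a (y b : RR), l (a *: y + b) = a * l y + l b) ->
 continuous l -> smooth l.
move=> hl cl; apply: (@smooth_coind (fun f => f = l \/ exists c, f = fun _ => c)); last by left.
 move=> _ [->|[c ->]] x; first exact: (is_diff_proj x 0 hl cl).1.
 exact: differentiable_cst.
move=> _ v [->|[c ->]]; right.
 by exists (l v); apply/funext => x; exact: (is_diff_proj x v hl cl).2.
by exists 0; apply/funext => x; exact: derive_cst.
Qed.

Lemma smooth_fst : smooth (fun z => z.1).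
by apply: smooth_linear => // z; exact: cvg_fst. Qed.
Lemma smooth_snd : smooth (fun z => z.2).
by apply: smooth_linear => // z; exact: cvg_snd. Qed.
Lemma derive_fst z v : 'D_v (fun z => z.1) z = v.1.
by apply: (is_diff_proj z v _ _).2 => // y; exact: cvg_fst. Qed.
Lemma derive_snd z v : 'D_v (fun z => z.2) z = v.2.
by apply: (is_diff_proj z v _ _).2 => // y; exact: cvg_snd. Qed.

Lemma smooth_deriveD f g z v : smooth f -> smooth g ->
 'D_v (fun x => f x + g x) z = 'D_v f z + 'D_v g z.
by move=> sf sg; rewrite deriveD //; exact/diff_derivable/smooth_diff. Qed.
Lemma smooth_deriveM f g z v : smooth f -> smooth g ->
 'D_v (fun x => f x * g x) z = f z * 'D_v g z + g z * 'D_v f z.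
by move=> sf sg; rewrite deriveM //; exact/diff_derivable/smooth_diff. Qed.

Lemma smooth_cont f : smooth f -> continuous f.
by move=> sf x; exact: differentiable_continuous (smooth_diff x sf). Qed.

Definition step (x : R) : R := flate 0 x / (flate 0 x + flate 0 (1 - x)).
(** The derivative of [step], by the quotient rule and the fact that [flate 2] is the derivative of
    [flate 0]. In this form its sign and its vanishing outside [(0, 1)] are visible. *)
Definition dstep (x : R) : R :=
 (flate 2 x * flate 0 (1 - x) + flate 0 x * flate 2 (1 - x)) /
 (flate 0 x + flate 0 (1 - x)) ^+ 2.

Lemma step_den_gt0 x : 0 < flate 0 x + flate 0 (1 - x).
have [x0|x0] := ltP 0 x; first by rewrite ltr_pwDl ?flate_gt0 ?flate_ge0.
by rewrite ltr_wpDl ?flate_ge0 // flate_gt0 //; lra.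
Qed.
Lemma step_le0 x : x <= 0 -> step x = 0.
by move=> x0; rewrite /step flate_le0 // mul0r. Qed.
Lemma step_ge1 x : 1 <= x -> step x = 1.
move=> x1; rewrite /step (@flate_le0 _ (1 - x)); last by lra.
by rewrite addr0 divff // gt_eqF // flate_gt0 //; lra.
Qed.
Lemma step_ge0 x : 0 <= step x.
by rewrite divr_ge0 ?flate_ge0 // ltW ?step_den_gt0. Qed.
Lemma step_le1 x : step x <= 1.
by rewrite ler_pdivrMr ?step_den_gt0 // mul1r lerDl flate_ge0. Qed.
Lemma dstep_ge0 x : 0 <= dstep x.
by rewrite divr_ge0 ?sqr_ge0 // addr_ge0 // mulr_ge0 ?flate_ge0. Qed.
Lemma dstep_gt0 x : 0 < x < 1 -> 0 < dstep x.
move=> /andP[x0 x1]; rewrite divr_gt0 ?exprn_gt0 ?step_den_gt0 //.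
have y0 : 0 < 1 - x by lra.
by rewrite addr_gt0 // mulr_gt0 ?flate_gt0.
Qed.
Lemma dstep_le0 x : x <= 0 -> dstep x = 0.
by move=> x0; rewrite /dstep !(flate_le0 _ x0) !mul0r addr0 mul0r. Qed.
Lemma dstep_ge1 x : 1 <= x -> dstep x = 0.
move=> x1; have h : 1 - x <= 0 by lra.
by rewrite /dstep !(flate_le0 _ h) !mulr0 addr0 mul0r.
Qed.

Lemma smooth_step f : smooth f -> smooth (fun x => step (f x)).
move=> sf; apply: smoothM; first exact: smooth_flat.
apply: smoothV => [x|]; first by rewrite gt_eqF ?step_den_gt0.
by apply: smoothD; apply: smooth_flat => //; apply: smoothB => //; exact: smooth_cst.
Qed.
Lemma smooth_dstep f : smooth f -> smooth (fun x => dstep (f x)).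
move=> sf; have s1 : smooth (fun x => 1 - f x) by apply: smoothB => //; exact: smooth_cst.
apply: smoothM; first by apply: smoothD; apply: smoothM; exact: smooth_flat.
apply: smoothV => [x|]; first by rewrite expf_neq0 // gt_eqF ?step_den_gt0.
by under eq_fun do rewrite expr2; apply: smoothM; apply: smoothD; exact: smooth_flat.
Qed.

Lemma derive_step f z v : smooth f ->
 'D_v (fun x => step (f x)) z = dstep (f z) * 'D_v f z.
move=> sf; have s1 : smooth (fun x => 1 - f x) by apply: smoothB => //; exact: smooth_cst.
have dF n : 'D_v (fun x => flate n (f x)) z =
  (- (n%:R * flate n.+1 (f z)) + flate n.+2 (f z)) * 'D_v f z.
 exact: (derive_flate_comp n v (smooth_diff z sf)).2.
have dG n : 'D_v (fun x => flate n (1 - f x)) z =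
  - (- (n%:R * flate n.+1 (1 - f z)) + flate n.+2 (1 - f z)) * 'D_v f z.
 rewrite (derive_flate_comp n v (smooth_diff z s1)).2.
 rewrite (_ : 'D_v (fun x => 1 - f x) z = - 'D_v f z) ?mulrN ?mulNr //.
 rewrite (@smooth_deriveD (fun _ => 1) (fun x => - f x)) ?derive_cst ?add0r.
 + by rewrite deriveN //; exact/diff_derivable/smooth_diff.
 + exact: smooth_cst.
 + exact: smoothN.
pose D := fun x => flate 0 (f x) + flate 0 (1 - f x).
have D0 x : D x != 0 by rewrite gt_eqF ?step_den_gt0.
have sD : smooth D by apply: smoothD; exact: smooth_flat.
rewrite (@smooth_deriveM (fun x => flate 0 (f x)) (fun x => (D x)^-1)); last 2 first.
- exact: smooth_flat.
- exact: smoothV.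
rewrite (deriveV (D0 z)); last exact/diff_derivable/smooth_diff.
rewrite (@smooth_deriveD (fun x => flate 0 (f x)) (fun x => flate 0 (1 - f x))); last 2 first.
- exact: smooth_flat.
- exact: smooth_flat.
rewrite dF dG /dstep -/(D z) /GRing.scale /= !mul0r !oppr0 !add0r.
have : D z = flate 0 (f z) + flate 0 (1 - f z) by [].
move: (D0 z) => d0 eD; rewrite eD in d0 *.
by field.
Qed.
End SmoothFunctions.

(** * The dbar operator on smooth functions and the smoothed pole *)

Section ComplexTestFunctions.
Implicit Types (f g : RR -> C) (z w : RR) (a b e : R).
Local Notation Ii := (Complex 0 1 : C).

Definition csmooth g := smooth (fun z => re (g z)) /\ smooth (fun z => im (g z)).
Definition cdbar g z : C := dbar (fun z => re (g z)) z + Ii * dbar (fun z => im (g z)) z.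

Lemma csmooth_cst c : csmooth (fun _ => c).
by split; exact: smooth_cst. Qed.
Lemma csmooth_rC (f : RR -> R) : smooth f -> csmooth (fun z => rC (f z)).
by move=> sf; split => //=; exact: smooth_cst. Qed.
Lemma csmoothD f g : csmooth f -> csmooth g -> csmooth (fun z => f z + g z).
move=> [f1 f2] [g1 g2]; split.
 by under eq_fun do rewrite ReD; exact: smoothD.
by under eq_fun do rewrite ImD; exact: smoothD.
Qed.
Lemma csmoothM f g : csmooth f -> csmooth g -> csmooth (fun z => f z * g z).
move=> [f1 f2] [g1 g2]; split.
 by under eq_fun do rewrite ReM; apply: smoothB; exact: smoothM.
by under eq_fun do rewrite ImM; apply: smoothD; exact: smoothM.
Qed.
Lemma csmooth_toC : csmooth (@toC R).
by split; [exact: smooth_fst|exact: smooth_snd]. Qed.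
Lemma csmooth_conj f : csmooth f -> csmooth (fun z => conjc (f z)).
move=> [f1 f2]; split.
 by rewrite (_ : (fun z => _) = (fun z => re (f z))) //; apply/funext => z; case: (f z).
rewrite (_ : (fun z => _) = (fun z => - im (f z))); first exact: smoothN.
by apply/funext => z; case: (f z).
Qed.

Lemma cdbarE g z : cdbar g z =
 Complex (('D_(1, 0) (fun z => re (g z)) z - 'D_(0, 1) (fun z => im (g z)) z) / 2)
     (('D_(0, 1) (fun z => re (g z)) z + 'D_(1, 0) (fun z => im (g z)) z) / 2).
rewrite /cdbar /dbar.
move: ('D_(1, 0) (fun z => re (g z)) z) ('D_(1, 0) (fun z => im (g z)) z)
 ('D_(0, 1) (fun z => re (g z)) z) ('D_(0, 1) (fun z => im (g z)) z).
by move=> a b c d; apply: ceqP; rewrite ?ReD ?ImD ?ReM ?ImM /=; ring.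
Qed.

Lemma cdbar_cst c z : cdbar (fun _ => c) z = 0.
by rewrite cdbarE !derive_cst subr0 addr0 mul0r. Qed.

Lemma cdbarD f g z : csmooth f -> csmooth g -> cdbar (fun z => f z + g z) z = cdbar f z + cdbar g z.
move=> [f1 f2] [g1 g2]; rewrite !cdbarE.
have -> : (fun z => re (f z + g z)) = (fun z => re (f z) + re (g z)).
 by apply/funext => y; rewrite ReD.
have -> : (fun z => im (f z + g z)) = (fun z => im (f z) + im (g z)).
 by apply/funext => y; rewrite ImD.
rewrite !smooth_deriveD //; apply: ceqP; rewrite ?ReD ?ImD /=; ring.
Qed.

Lemma cdbarM f g z : csmooth f -> csmooth g ->
 cdbar (fun z => f z * g z) z = f z * cdbar g z + g z * cdbar f z.
move=> [f1 f2] [g1 g2]; rewrite !cdbarE.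
have E1 v : 'D_v (fun z => re (f z * g z)) z =
  re (f z) * 'D_v (fun z => re (g z)) z + re (g z) * 'D_v (fun z => re (f z)) z
  - (im (f z) * 'D_v (fun z => im (g z)) z + im (g z) * 'D_v (fun z => im (f z)) z).
 rewrite (_ : (fun z => _) = (fun z => re (f z) * re (g z) + (-1) * (im (f z) * im (g z)))).
  rewrite smooth_deriveD; [|exact: smoothM|by apply: smoothM; [exact: smooth_cst|exact: smoothM]].
  rewrite !smooth_deriveM //; try exact: smoothM; last exact: smooth_cst.
  by rewrite derive_cst mulr0 addr0 mulN1r.
 by apply/funext => y; rewrite ReM mulN1r.
have E2 v : 'D_v (fun z => im (f z * g z)) z =
  re (f z) * 'D_v (fun z => im (g z)) z + im (g z) * 'D_v (fun z => re (f z)) z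
  + (im (f z) * 'D_v (fun z => re (g z)) z + re (g z) * 'D_v (fun z => im (f z)) z).
 rewrite (_ : (fun z => _) = (fun z => re (f z) * im (g z) + im (f z) * re (g z))).
  by rewrite smooth_deriveD ?smooth_deriveM //; exact: smoothM.
 by apply/funext => y; rewrite ImM.
rewrite !E1 !E2.
move: ('D_(1, 0) (fun z => re (f z)) z) ('D_(1, 0) (fun z => im (f z)) z)
 ('D_(0, 1) (fun z => re (f z)) z) ('D_(0, 1) (fun z => im (f z)) z)
 ('D_(1, 0) (fun z => re (g z)) z) ('D_(1, 0) (fun z => im (g z)) z)
 ('D_(0, 1) (fun z => re (g z)) z) ('D_(0, 1) (fun z => im (g z)) z).
case: (f z) (g z) => [p q] [s t] /= a1 a2 a3 a4 b1 b2 b3 b4.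
by apply: ceqP; rewrite ?ReD ?ImD ?ReM ?ImM /=; ring.
Qed.

Lemma cdbar_rC (f : RR -> R) z : cdbar (fun z => rC (f z)) z = dbar f z.
by rewrite cdbarE /= !derive_cst /dbar subr0 addr0. Qed.

Lemma cdbar_toC z : cdbar (@toC R) z = 0.
by rewrite cdbarE /= !derive_fst !derive_snd /= subrr addr0 mul0r. Qed.

Lemma cdbar_conj z : cdbar (fun z => conjc (toC z)) z = 1.
rewrite cdbarE.
have -> : (fun z => re (conjc (toC z))) = (fun z => z.1) by [].
have -> : (fun z => im (conjc (toC z))) = (fun z => (-1) * z.2).
 by apply/funext => y; rewrite mulN1r.
rewrite !smooth_deriveM; try exact: smooth_cst; try exact: smooth_snd.
rewrite !derive_fst !derive_snd !derive_cst /=.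
by apply: ceqP => /=; field.
Qed.

Lemma dbar_step (f : RR -> R) z : smooth f ->
 dbar (fun z => step (f z)) z = rC (dstep (f z)) * dbar f z.
by move=> sf; rewrite /dbar !derive_step //; apply: ceqP; rewrite ?ReM ?ImM /=; field.
Qed.

Definition sqdist w z : R := (z.1 - w.1) ^+ 2 + (z.2 - w.2) ^+ 2.

Lemma sqdistE w z : sqdist w z = dC z w ^+ 2.
by rewrite sqr_cabs ReD ImD ReN ImN. Qed.

Lemma sqdist_ge0 w z : 0 <= sqdist w z.
by rewrite sqdistE sqr_ge0. Qed.

Lemma smooth_sqdist w : smooth (sqdist w).
apply: smoothD; under eq_fun do rewrite expr2; apply: smoothM; apply: smoothB;
 try exact: smooth_cst; try exact: smooth_fst; exact: smooth_snd.
Qed.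

Lemma derive_sqdist w z v : 'D_v (sqdist w) z = 2 * (z.1 - w.1) * v.1 + 2 * (z.2 - w.2) * v.2.
have s1 : smooth (fun z => z.1 - w.1) by apply: smoothB; [exact: smooth_fst|exact: smooth_cst].
have s2 : smooth (fun z => z.2 - w.2) by apply: smoothB; [exact: smooth_snd|exact: smooth_cst].
have d1 : 'D_v (fun z => z.1 - w.1) z = v.1.
 by rewrite smooth_deriveD ?derive_fst ?derive_cst ?addr0 //; [exact: smooth_fst|exact: smooth_cst].
have d2 : 'D_v (fun z => z.2 - w.2) z = v.2.
 by rewrite smooth_deriveD ?derive_snd ?derive_cst ?addr0 //; [exact: smooth_snd|exact: smooth_cst].
rewrite (_ : sqdist w = fun z => (z.1 - w.1) * (z.1 - w.1) + (z.2 - w.2) * (z.2 - w.2)).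
 by rewrite smooth_deriveD ?smooth_deriveM ?d1 ?d2 //; [ring|exact: smoothM|exact: smoothM].
by apply/funext => y; rewrite /sqdist !expr2.
Qed.

Lemma dbar_sqdist w z : dbar (sqdist w) z = toC z - toC w.
by rewrite /dbar !derive_sqdist; apply: ceqP; rewrite ?ReD ?ImD ?ReN ?ImN /=; field. Qed.

Lemma dbar_affine a b (f : RR -> R) z : smooth f ->
 dbar (fun z => a * f z + b) z = rC a * dbar f z.
move=> sf; rewrite /dbar.
have E v : 'D_v (fun z => a * f z + b) z = a * 'D_v f z.
 rewrite smooth_deriveD ?smooth_deriveM ?derive_cst ?mulr0 ?addr0 //; try exact: smooth_cst.
 by apply: smoothM => //; exact: smooth_cst.
by rewrite !E; apply: ceqP; rewrite ?ReM ?ImM /=; field.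
Qed.

Lemma smooth_affine a b (f : RR -> R) : smooth f -> smooth (fun z => a * f z + b).
by move=> sf; apply: smoothD; [apply: smoothM => //|]; exact: smooth_cst. Qed.

(* [pole w e] is a smooth version of [1 / (z - w)]: it agrees with it where
  [|z - w|^2 >= e] and vanishes where [|z - w|^2 <= e / 2]. *)
Definition pole_ratio w e z : R :=
 step (2 / e * sqdist w z + (-1)) / (1 * sqdist w z + 1 - step (4 / e * sqdist w z + (-1))).
Definition pole w e z : C := conjc (tz z w) * rC (pole_ratio w e z).

(** The term [1 - step] keeps the denominator positive at [w] and vanishes once
    [|z - w|^2 >= e / 2]. The numerator of [pole_ratio] is zero below that threshold, so wherever
    the quotient is non-zero its denominator is exactly [|z - w|^2]; this is [pole_ratioM]. *)
Lemma pole_ratio_den w e z : 0 < e -> 1 * sqdist w z + 1 - step (4 / e * sqdist w z + (-1)) != 0.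
move=> e0; have := sqdist_ge0 w z; rewrite le_eqVlt => /orP[/eqP<-|s0].
 by rewrite !mulr0 !add0r step_le0 ?subr0 ?oner_eq0 //; lra.
by rewrite gt_eqF //; have := step_le1 (4 / e * sqdist w z + (-1)); lra.
Qed.

Lemma smooth_pole_ratio w e : 0 < e -> smooth (pole_ratio w e).
move=> e0; have ss := smooth_sqdist w; apply: smoothM.
 by apply: smooth_step; exact: smooth_affine.
apply: smoothV => [z|]; first exact: pole_ratio_den.
apply: smoothB; first exact: smooth_affine.
by apply: smooth_step; exact: smooth_affine.
Qed.

Lemma pole_ratioM w e z : 0 < e -> sqdist w z * pole_ratio w e z = step (2 / e * sqdist w z + (-1)).
move=> e0; have d0 := pole_ratio_den w z e0.
have [h|h] := lerP (2 / e * sqdist w z) 1.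
 by rewrite /pole_ratio step_le0 ?mul0r ?mulr0 //; lra.
have h4 : 1 <= 4 / e * sqdist w z + (-1).
 have -> : 4 / e * sqdist w z = 2 * (2 / e * sqdist w z) by ring.
 lra.
move: d0; rewrite /pole_ratio (step_ge1 h4) mul1r addrK => d0.
by rewrite mulrC divfK.
Qed.

Lemma csmooth_conjB w : csmooth (fun z => conjc (tz z w)).
apply: csmooth_conj; apply: csmoothD; [exact: csmooth_toC|exact: csmooth_cst].
Qed.

Lemma csmooth_pole w e : 0 < e -> csmooth (pole w e).
move=> e0; apply: csmoothM; first exact: csmooth_conjB.
by apply: csmooth_rC; exact: smooth_pole_ratio.
Qed.

Lemma poleE w e z : 0 < e -> pole w e z = rC (step (2 / e * sqdist w z + (-1))) / (tz z w).
move=> e0; rewrite -pole_ratioM // rCM /pole.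
have [->|zw] := eqVneq (toC z) (toC w); first by rewrite subrr conjc0 mul0r invr0 mulr0.
have h : toC z - toC w != 0 by rewrite subr_eq0.
rewrite sqdistE -mulJ; move: (tz z w) h => t t0.
by field.
Qed.

(** A bump living on [e / 2 < |z - w|^2 < e]. It is the dbar-derivative of [pole w e] and plays the
    role of the point mass at [w] that is the derivative of [1 / (z - w)]. *)
Definition pmass w e z : R := 2 / e * dstep (2 / e * sqdist w z + (-1)).

Lemma cdbar_conjB w z : cdbar (fun z => conjc (tz z w)) z = 1.
rewrite (_ : (fun z => _) = (fun z => conjc (toC z) + - conjc (toC w))).
 rewrite cdbarD ?cdbar_conj ?cdbar_cst ?addr0 //; last exact: csmooth_cst.
 by apply: csmooth_conj; exact: csmooth_toC.
by apply/funext => y; rewrite rmorphB.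
Qed.

(** Differentiating the identity [pole_ratioM] avoids differentiating the quotient. Away from [w]
    the result is compared after multiplication by [z - w]; at [w] everything vanishes. *)
Lemma cdbar_pole w e z : 0 < e -> cdbar (pole w e) z = rC (pmass w e z).
move=> e0; have ss := smooth_sqdist w; have sp := smooth_pole_ratio w e0.
rewrite cdbarM ?cdbar_conjB ?cdbar_rC //; [|exact: csmooth_conjB|exact: csmooth_rC].
rewrite mulr1.
have [zw|zw] := eqVneq (toC z) (toC w).
 have s0 : sqdist w z = 0 by rewrite sqdistE zw subrr cabs0 expr0n.
 rewrite zw subrr conjc0 mul0r add0r /pmass /pole_ratio s0 !mulr0 !add0r step_le0 ?dstep_le0 ?mulr0 ?mul0r //; lra.
have h : toC z - toC w != 0 by rewrite subr_eq0.
have E : rC (sqdist w z) * dbar (pole_ratio w e) z + rC (pole_ratio w e z) * tz z w =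
  rC (dstep (2 / e * sqdist w z + (-1))) * (rC (2 / e) * tz z w).
 transitivity (dbar (fun z => step (2 / e * sqdist w z + (-1))) z).
  rewrite -dbar_sqdist -(cdbar_rC (pole_ratio w e)) -(cdbar_rC (sqdist w)) -cdbarM; [|exact: csmooth_rC|exact: csmooth_rC].
  by rewrite -cdbar_rC; congr (cdbar _ z); apply/funext => y; rewrite -rCM pole_ratioM.
 by rewrite dbar_step ?dbar_affine ?dbar_sqdist //; exact: smooth_affine.
apply: (mulIf h); rewrite mulrDl [X in X + _ = _](_ : _ = rC (sqdist w z) * dbar (pole_ratio w e) z).
 by rewrite E /pmass (rCM (2 / e)); ring.
by rewrite sqdistE -mulJ; ring.
Qed.
End ComplexTestFunctions.

(** * Integrals over rectangles: subdivision, Fubini, fundamental theorem *)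

Section RectangleIntegrals.
Implicit Types (g : RR -> R) (h F : R -> R) (a b x y M : R).
Local Notation mu := (@lebesgue_measure R).

Definition LI a b h := Rintegral mu `]a, b]%classic h.
(** Half-open on each axis, so that a subdivision is an exact disjoint partition. *)
Definition rect x0 x1 y0 y1 : set PT := `]x0, x1]%classic `*` `]y0, y1]%classic.
Definition RI x0 x1 y0 y1 g := Rintegral A (rect x0 x1 y0 y1) g.

Lemma mrect x0 x1 y0 y1 : measurable (rect x0 x1 y0 y1).
by apply: measurableX; exact: measurable_itv. Qed.

Lemma lebesgue_itv_oc a b : a <= b -> mu `]a, b]%classic = (b - a)%:E.
move=> ab; rewrite lebesgue_measure_itv /= lte_fin; case: ltP => // ba.
by have -> : a = b; [lra|rewrite subrr].
Qed.

Lemma area_rect x0 x1 y0 y1 : x0 <= x1 -> y0 <= y1 ->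
 A (rect x0 x1 y0 y1) = ((x1 - x0) * (y1 - y0))%:E.
move=> hx hy; rewrite [LHS]product_measure1E; [|exact: measurable_itv|exact: measurable_itv].
by rewrite EFinM -(lebesgue_itv_oc hx) -(lebesgue_itv_oc hy).
Qed.

Lemma cont_bounded_rect g x0 x1 y0 y1 : continuous g ->
 exists M, forall z, x0 <= z.1 <= x1 -> y0 <= z.2 <= y1 -> `|g z| <= M.
move=> cg; pose K : set RR := `[x0, x1]%classic `*` `[y0, y1]%classic.
have cK : compact K by apply: compact_setX; exact: segment_compact.
have cgK : compact (g @` K).
 by apply: continuous_compact => //; apply: continuous_subspaceT.
have [M [_ hM]] := compact_bounded cgK.
exists (M + 1) => z h1 h2; apply: hM; first by rewrite ltrDl.
by exists z => //; split; rewrite /= in_itv.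
Qed.

Lemma intble_rect g x0 x1 y0 y1 : x0 <= x1 -> y0 <= y1 -> continuous g ->
 A.-integrable (rect x0 x1 y0 y1) (EFin \o g).
move=> hx hy cg; have [M hM] := cont_bounded_rect x0 x1 y0 y1 cg.
apply: measurable_bounded_integrable.
- exact: mrect.
- have h : (A (rect x0 x1 y0 y1) < +oo)%E by rewrite area_rect // ltry.
 exact: h.
- apply: measurable_funTS; apply: open_continuous_measurable; first exact: openT.
 by move=> z _; exact: cg.
exists M; split; first exact: num_real.
move=> N MN z [/=]; rewrite !in_itv /= => /andP[a b] /andP[c d].
by apply: (letr (hM z _ _) (ltW MN)); apply/andP; split => //; exact: ltW.
Qed.

Lemma intble_oc h a b : a <= b -> continuous h -> mu.-integrable `]a, b]%classic (EFin \o h).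
move=> ab ch; have : mu.-integrable `[a, b]%classic (EFin \o h).
 apply: continuous_compact_integrable; first exact: segment_compact.
 exact: continuous_subspaceT.
apply: integrableS; [exact: measurable_itv|exact: measurable_itv|].
by move=> x; rewrite /= !in_itv /= => /andP[/ltW -> ->].
Qed.

Lemma LI_split h a b c : a <= b -> b <= c -> continuous h -> LI a c h = LI a b h + LI b c h.
move=> ab bc ch.
have E : `]a, c]%classic = `]a, b]%classic `|` `]b, c]%classic :> set R.
 apply/seteqP; split => x /=; rewrite !in_itv /=.
  by move=> /andP[ax xc]; case: (leP x b) => xb; [left; rewrite ax|right].
 by move=> [/andP[-> xb]|/andP[bx ->]]; rewrite ?(letr xb bc) ?(lelt ab bx).
rewrite /LI E; apply: Rintegral_setU; [exact: measurable_itv|exact: measurable_itv| |].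
 by rewrite -E; apply: intble_oc => //; exact: letr bc.
rewrite disj_set2E; apply/eqP/seteqP; split => // x [/=]; rewrite !in_itv /= => /andP[_ h1] /andP[h2 _].
by move: (ltle h2 h1); rewrite ltxx.
Qed.

Lemma rect_splitx x0 xm x1 y0 y1 : x0 <= xm -> xm <= x1 ->
 rect x0 x1 y0 y1 = rect x0 xm y0 y1 `|` rect xm x1 y0 y1 /\ [disjoint rect x0 xm y0 y1 & rect xm x1 y0 y1].
move=> h1 h2; split.
 apply/seteqP; split => z; rewrite /rect /= !in_itv /=.
  by move=> [/andP[a b] c]; case: (leP z.1 xm) => zb; [left|right]; rewrite ?a ?zb.
 by move=> [[/andP[a b] c]|[/andP[a b] c]]; split=> //; rewrite ?a ?b ?(letr b h2) ?(lelt h1 a).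
rewrite disj_set2E; apply/eqP/seteqP; split => // z [[/=]]; rewrite !in_itv /= => /andP[_ a] _ [/=].
by rewrite in_itv /= => /andP[b _]; move: (ltle b a); rewrite ltxx.
Qed.

Lemma rect_splity x0 x1 y0 ym y1 : y0 <= ym -> ym <= y1 ->
 rect x0 x1 y0 y1 = rect x0 x1 y0 ym `|` rect x0 x1 ym y1 /\ [disjoint rect x0 x1 y0 ym & rect x0 x1 ym y1].
move=> h1 h2; split.
 apply/seteqP; split => z; rewrite /rect /= !in_itv /=.
  by move=> [c /andP[a b]]; case: (leP z.2 ym) => zb; [left|right]; rewrite ?a ?zb.
 by move=> [[c /andP[a b]]|[c /andP[a b]]]; split=> //; rewrite ?a ?b ?(letr b h2) ?(lelt h1 a).
rewrite disj_set2E; apply/eqP/seteqP; split => // z [[/=]] _; rewrite !in_itv /= => /andP[_ a] [/=] _.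
by rewrite in_itv /= => /andP[b _]; move: (ltle b a); rewrite ltxx.
Qed.

Lemma RI_splitx g x0 xm x1 y0 y1 : x0 <= xm -> xm <= x1 -> y0 <= y1 -> continuous g ->
 RI x0 x1 y0 y1 g = RI x0 xm y0 y1 g + RI xm x1 y0 y1 g.
move=> h1 h2 hy cg; have [E D] := rect_splitx y0 y1 h1 h2.
rewrite /RI E; apply: Rintegral_setU => //; [exact: mrect|exact: mrect|].
by rewrite -E; apply: intble_rect => //; exact: letr h2.
Qed.
Lemma RI_splity g x0 x1 y0 ym y1 : y0 <= ym -> ym <= y1 -> x0 <= x1 -> continuous g ->
 RI x0 x1 y0 y1 g = RI x0 x1 y0 ym g + RI x0 x1 ym y1 g.
move=> h1 h2 hy cg; have [E D] := rect_splity x0 x1 h1 h2.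
rewrite /RI E; apply: Rintegral_setU => //; [exact: mrect|exact: mrect|].
by rewrite -E; apply: intble_rect => //; exact: letr h2.
Qed.

Lemma LI_bound h a b M : a <= b -> continuous h -> (forall x, a < x <= b -> `|h x| <= M) ->
 `|LI a b h| <= M * (b - a).
move=> ab ch hM; have mI : measurable (`]a, b]%classic : set (measurableTypeR R)) by exact: measurable_itv.
have ih := intble_oc ab ch.
apply: (letr (le_normr_Rintegral mI ih)).
apply: (le_via (Rintegral mu `]a, b]%classic (fun _ => M))).
 apply: (le_Rintegral mI (integrable_norm ih)).
  by apply: (@intble_oc (fun=> M)) => //; exact: cst_continuous.
 by move=> x; rewrite /= in_itv /= => /hM.
rewrite (Rintegral_cst _ mI); change (M * fine (mu `]a, b]%classic) <= M * (b - a)).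
by rewrite lebesgue_itv_oc.
Qed.

Lemma RI_bound g x0 x1 y0 y1 M : x0 <= x1 -> y0 <= y1 -> continuous g ->
 (forall z, x0 < z.1 <= x1 -> y0 < z.2 <= y1 -> `|g z| <= M) ->
 `|RI x0 x1 y0 y1 g| <= M * ((x1 - x0) * (y1 - y0)).
move=> hx hy cg hM; have mI := mrect x0 x1 y0 y1.
have ih := intble_rect hx hy cg.
apply: (letr (le_normr_Rintegral mI ih)).
apply: (le_via (Rintegral A (rect x0 x1 y0 y1) (fun _ => M))).
 apply: (le_Rintegral mI (integrable_norm ih)).
  by apply: (@intble_rect (fun=> M)) => //; exact: cst_continuous.
 by move=> z [/=]; rewrite !in_itv /=; exact: hM.
rewrite (Rintegral_cst _ mI); change (M * fine (A (rect x0 x1 y0 y1)) <= M * ((x1 - x0) * (y1 - y0))).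
by rewrite area_rect.
Qed.

Lemma LIB h k a b : a <= b -> continuous h -> continuous k ->
 LI a b (fun x => h x - k x) = LI a b h - LI a b k.
move=> ab ch ck; apply: RintegralB; [exact: measurable_itv|exact: intble_oc|exact: intble_oc].
Qed.
Lemma RIB g k x0 x1 y0 y1 : x0 <= x1 -> y0 <= y1 -> continuous g -> continuous k ->
 RI x0 x1 y0 y1 (fun z => g z - k z) = RI x0 x1 y0 y1 g - RI x0 x1 y0 y1 k.
move=> hx hy cg ck; apply: RintegralB; [exact: mrect|exact: intble_rect|exact: intble_rect].
Qed.

Lemma LI_FTC F h a b : a <= b -> continuous h -> (forall x, is_derive x 1 F (h x)) ->
 LI a b h = F b - F a.
rewrite le_eqVlt => /orP[/eqP<-|ab] ch dF.
 by rewrite subrr /LI set_itv_ge -?leNgt //= Rintegral_set0.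
have cF x : {for x, continuous F}.
 by apply: differentiable_continuous; apply/derivable1_diffP; have [] := dF x.
rewrite /LI /Rintegral integral_itv_obnd_cbnd //; last first.
 apply/mEFP; apply: measurable_funTS; exact: continuous_measurable_fun.
rewrite (@continuous_FTC2 _ h F a b) //.
- exact: continuous_subspaceT.
- split.
 + by move=> x _; have [] := dF x.
 + exact: cvg_at_right_filter (cF a).
 + exact: cvg_at_left_filter (cF b).
- by move=> x _; rewrite derive1E; have [_ ->] := dF x.
Qed.

Lemma RI_fubinix g x0 x1 y0 y1 : x0 <= x1 -> y0 <= y1 -> continuous g ->
 RI x0 x1 y0 y1 g = fine (\int[mu]_(y in `]y0, y1]) \int[mu]_(x in `]x0, x1]) (g (x, y))%:E)%E.
move=> hx hy cg; rewrite /RI /Rintegral; congr fine.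
have := intble_rect hx hy cg => /(integrable_mkcond _ (mrect _ _ _ _)) ig.
rewrite integral_mkcond.
rewrite -[LHS](integral21_prod_meas1 ig) [RHS]integral_mkcond; apply: eq_integral => y _.
rewrite /fubini_G patchE; case: ifPn => [|] yin.
 rewrite [RHS]integral_mkcond; apply: eq_integral => x _; rewrite !patchE.
 suff -> : ((x, y) \in rect x0 x1 y0 y1) = (x \in `]x0, x1]%classic) by [].
 apply/idP/idP; rewrite !inE /rect /=; first by move=> [].
 by move=> h; split=> //; move: yin; rewrite inE.
rewrite integral0_eq // => x _; rewrite patchE ifF //; apply/negbTE; move: yin; apply: contra.
by rewrite !inE /rect /= => -[].
Qed.
Lemma RI_fubiniy g x0 x1 y0 y1 : x0 <= x1 -> y0 <= y1 -> continuous g ->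
 RI x0 x1 y0 y1 g = fine (\int[mu]_(x in `]x0, x1]) \int[mu]_(y in `]y0, y1]) (g (x, y))%:E)%E.
move=> hx hy cg; rewrite /RI /Rintegral; congr fine.
have := intble_rect hx hy cg => /(integrable_mkcond _ (mrect _ _ _ _)) ig.
rewrite integral_mkcond.
rewrite -[LHS](integral12_prod_meas1 ig) [RHS]integral_mkcond; apply: eq_integral => x _.
rewrite /fubini_F patchE; case: ifPn => [|] yin.
 rewrite [RHS]integral_mkcond; apply: eq_integral => y _; rewrite !patchE.
 suff -> : ((x, y) \in rect x0 x1 y0 y1) = (y \in `]y0, y1]%classic) by [].
 apply/idP/idP; rewrite !inE /rect /=; first by move=> [].
 by move=> h; split=> //; move: yin; rewrite inE.
rewrite integral0_eq // => y _; rewrite patchE ifF //; apply/negbTE; move: yin; apply: contra.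
by rewrite !inE /rect /= => -[].
Qed.

Lemma cont_slicex g y : continuous g -> continuous (fun x => g (x, y)).
move=> cg x; apply: (@continuous_comp _ _ _ (fun x => (x, y)) g); last exact: cg.
apply: (@differentiable_continuous R R^o (R^o * R^o)%type).
by apply: differentiable_pair => //; exact: differentiable_cst.
Qed.
Lemma cont_slicey g x : continuous g -> continuous (fun y => g (x, y)).
move=> cg y; apply: (@continuous_comp _ _ _ (fun y => (x, y)) g); last exact: cg.
apply: (@differentiable_continuous R R^o (R^o * R^o)%type).
by apply: differentiable_pair => //; exact: differentiable_cst.
Qed.

Lemma is_derive_slicex g x y : differentiable g (x, y) ->
 is_derive x 1 (fun x => g (x, y)) ('D_(1, 0) g (x, y)).
move=> /(@diff_derivable R (R^o * R^o)%type R^o _ _ (1, 0)) dg.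
have E : (fun h : R => h^-1 *: (g (h *: (1, 0) + (x, y)) - g (x, y))) =
     (fun h : R => h^-1 *: (g (h *: 1 + x, y) - g (x, y))).
 apply/funext => h; congr (_ *: (g _ - _)).
 by apply: injective_projections; rewrite /= ?scaler0 ?add0r.
apply: DeriveDef.
 by rewrite /derivable -E; exact: dg.
by rewrite /derive -E.
Qed.
Lemma is_derive_slicey g x y : differentiable g (x, y) ->
 is_derive y 1 (fun y => g (x, y)) ('D_(0, 1) g (x, y)).
move=> /(@diff_derivable R (R^o * R^o)%type R^o _ _ (0, 1)) dg.
have E : (fun h : R => h^-1 *: (g (h *: (0, 1) + (x, y)) - g (x, y))) =
     (fun h : R => h^-1 *: (g (x, h *: 1 + y) - g (x, y))).
 apply/funext => h; congr (_ *: (g _ - _)).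
 by apply: injective_projections; rewrite /= ?scaler0 ?add0r.
apply: DeriveDef.
 by rewrite /derivable -E; exact: dg.
by rewrite /derive -E.
Qed.

Lemma RI_derivex g x0 x1 y0 y1 : x0 <= x1 -> y0 <= y1 -> smooth g ->
 RI x0 x1 y0 y1 ('D_(1, 0) g) = LI y0 y1 (fun y => g (x1, y)) - LI y0 y1 (fun y => g (x0, y)).
move=> hx hy sg; have cg := smooth_cont sg.
have cd : continuous ('D_(1, 0) g) by apply/smooth_cont/smooth_derive.
rewrite RI_fubinix // -LIB //; [|exact: cont_slicey|exact: cont_slicey].
congr fine; apply: eq_integral => y _.
have := @LI_FTC (fun x => g (x, y)) (fun x => 'D_(1, 0) g (x, y)) x0 x1 hx
 (@cont_slicex _ y cd) (fun x => is_derive_slicex (smooth_diff (x, y) sg)).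
rewrite /LI /Rintegral => <-; rewrite fineK //.
apply: integrable_fin_num; first exact: measurable_itv.
exact: (intble_oc hx (@cont_slicex _ y cd)).
Qed.
Lemma RI_derivey g x0 x1 y0 y1 : x0 <= x1 -> y0 <= y1 -> smooth g ->
 RI x0 x1 y0 y1 ('D_(0, 1) g) = LI x0 x1 (fun x => g (x, y1)) - LI x0 x1 (fun x => g (x, y0)).
move=> hx hy sg; have cg := smooth_cont sg.
have cd : continuous ('D_(0, 1) g) by apply/smooth_cont/smooth_derive.
rewrite RI_fubiniy // -LIB //; [|exact: cont_slicex|exact: cont_slicex].
congr fine; apply: eq_integral => x _.
have := @LI_FTC (fun y => g (x, y)) (fun y => 'D_(0, 1) g (x, y)) y0 y1 hy
 (@cont_slicey _ x cd) (fun y => is_derive_slicey (smooth_diff (x, y) sg)).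
rewrite /LI /Rintegral => <-; rewrite fineK //.
apply: integrable_fin_num; first exact: measurable_itv.
exact: (intble_oc hy (@cont_slicey _ x cd)).
Qed.
End RectangleIntegrals.

(** * Stokes' formula for complex differentiable functions by bisection *)

Section Goursat.
Implicit Types (phi : RR -> R) (f g : RR -> C) (z w : RR) (P : set RR) (r x y : R) (l : C).

(** Goursat's argument in the abstract: a function of squares that is subadditive under quartering
    and [o(s^2)] at every point vanishes, since repeated quartering would otherwise lead to a point
    where [|t| / s^2] stays bounded below. *)
Lemma bisection_zero (t : R -> R -> R -> R) :
 (forall x y s, 0 < s -> `|t x y s| <= `|t x y (s / 2)| + `|t (x + s / 2) y (s / 2)| +
   `|t x (y + s / 2) (s / 2)| + `|t (x + s / 2) (y + s / 2) (s / 2)|) ->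
 (forall (z1 z2 e : R), 0 < e -> exists2 d : R, 0 < d & forall x y s, 0 < s -> s < d ->
   x <= z1 <= x + s -> y <= z2 <= y + s -> `|t x y s| <= e * s ^+ 2) ->
 forall x y s, 0 < s -> t x y s = 0.
move=> sub loc x0 y0 s0 s00; apply/eqP; rewrite -normr_eq0; apply/negPn/negP => nz.
have {}nz : 0 < `|t x0 y0 s0| by rewrite lt_def nz normr_ge0.
pose T (q : RR * R) := `|t q.1.1 q.1.2 q.2|.
pose c1 (q : RR * R) := (q.1.1, q.1.2, q.2 / 2).
pose c2 (q : RR * R) := (q.1.1 + q.2 / 2, q.1.2, q.2 / 2).
pose c3 (q : RR * R) := (q.1.1, q.1.2 + q.2 / 2, q.2 / 2).
pose c4 (q : RR * R) := (q.1.1 + q.2 / 2, q.1.2 + q.2 / 2, q.2 / 2).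
(* The first quarter carrying at least a fourth of [|t|]; by subadditivity the last one qualifies
   when the other three fail. *)
pose nxt q := if T q <= 4 * T (c1 q) then c1 q else if T q <= 4 * T (c2 q) then c2 q
 else if T q <= 4 * T (c3 q) then c3 q else c4 q.
have nxtP q : 0 < q.2 -> [/\ (nxt q).2 = q.2 / 2, q.1.1 <= (nxt q).1.1,
  (nxt q).1.1 + (nxt q).2 <= q.1.1 + q.2, q.1.2 <= (nxt q).1.2 &
  (nxt q).1.2 + (nxt q).2 <= q.1.2 + q.2] /\ T q <= 4 * T (nxt q).
 move=> q0; have := sub q.1.1 q.1.2 q.2 q0.
 rewrite -[`|t q.1.1 q.1.2 q.2|]/(T q) -[`|t q.1.1 q.1.2 _|]/(T (c1 q)) -[`|t _ q.1.2 _|]/(T (c2 q)).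
 rewrite -[`|t q.1.1 _ _|]/(T (c3 q)) -[`|t _ _ _|]/(T (c4 q)) /nxt => h.
 case: ifPn => [h1|]; [by split=> //; split=> //=; lra|rewrite -ltNge => h1].
 case: ifPn => [h2|]; [by split=> //; split=> //=; lra|rewrite -ltNge => h2].
 case: ifPn => [h3|]; [by split=> //; split=> //=; lra|rewrite -ltNge => h3].
 split; first by split=> //=; lra.
 by lra.
pose q n := iter n nxt (x0, y0, s0).
have qS n : q n.+1 = nxt (q n) by [].
have s_pos n : 0 < (q n).2.
 by elim: n => [//|n ih]; rewrite qS; have [[-> _ _ _ _] _] := nxtP _ ih; rewrite divr_gt0.
have sE n : (q n).2 = s0 / 2 ^+ n.
 elim: n => [|n ih]; first by rewrite expr0 divr1.
 by rewrite qS; have [[-> _ _ _ _] _] := nxtP _ (s_pos n); rewrite ih exprSr invfM mulrA.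
(* The ratio [|t| / s^2] never decreases along the chosen squares. *)
have TE n : `|t x0 y0 s0| / s0 ^+ 2 * (q n).2 ^+ 2 <= T (q n).
 elim: n => [|n ih]; first by rewrite /T /= divfK // expf_neq0 // gt_eqF.
 rewrite qS; have [[-> _ _ _ _] h] := nxtP _ (s_pos n).
 have -> : `|t x0 y0 s0| / s0 ^+ 2 * ((q n).2 / 2) ^+ 2 = (`|t x0 y0 s0| / s0 ^+ 2 * (q n).2 ^+ 2) / 4 by field; rewrite gt_eqF.
 lra.
pose X n := (q n).1.1; pose Y n := (q n).1.2.
have mono n m : (n <= m)%N -> [/\ X n <= X m, X m + (q m).2 <= X n + (q n).2, Y n <= Y m & Y m + (q m).2 <= Y n + (q n).2].
 move=> /subnK <-; elim: (m - n)%N => [|k [h1 h2 h3 h4]]; first by rewrite add0n.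
 have [[_ a b c d] _] := nxtP _ (s_pos (k + n)%N).
 by split; [exact: letr a|exact: letr b _|exact: letr c|exact: letr d _].
have cmp n m : X n <= X m + (q m).2 /\ Y n <= Y m + (q m).2.
 have [nm|mn] := leqP n m.
  by have [a b c d] := mono _ _ nm; have := s_pos m; split; lra.
 by have [a b c d] := mono _ _ (ltnW mn); have := s_pos n; split; lra.
(* The suprema of the lower-left coordinates give a point common to all the nested squares. *)
have hs (Z : nat -> R) : (forall n m, Z n <= Z m + (q m).2) -> forall n, Z n <= sup (range Z) <= Z n + (q n).2.
 move=> hZ n; apply/andP; split.
  by apply: ub_le_sup; [exists (Z n + (q n).2) => _ [m _ <-]|exists n].
 by apply: ge_sup; [exists (Z n), n|move=> _ [m _ <-]].
have c0 : 0 < `|t x0 y0 s0| / s0 ^+ 2 / 2 by rewrite !divr_gt0 // exprn_gt0.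
have [d d0 hd] := loc (sup (range X)) (sup (range Y)) _ c0.
have [n hn] : exists n, (q n).2 < d.
 have [n] := ltr_add_invr (divr_gt0 d0 s00); rewrite add0r => hn; exists n.
 rewrite sE ltr_pdivrMr ?exprn_gt0 //.
 have h1 : (n.+1%:R : R) <= 2 ^+ n by rewrite -natrX ler_nat ltn_expl.
 have h2 : s0 < d * n.+1%:R by move: hn; rewrite ltr_pdivlMr // mulrC ltr_pdivrMr.
 by rewrite (ltle h2) // lerMl // ltW.
have := hd (X n) (Y n) (q n).2 (s_pos n) hn (hs X (fun n m => (cmp n m).1) n) (hs Y (fun n m => (cmp n m).2) n).
rewrite -[`|t _ _ _|]/(T (q n)) => h; have := letr (TE n) h.
rewrite ler_pM2r ?exprn_gt0 // => {}h.
have : 0 < `|t x0 y0 s0| / s0 ^+ 2 by rewrite divr_gt0 // exprn_gt0.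
by lra.
Qed.

(** Neighbourhoods of pairs come from the maximum norm; Euclidean disks define the same ones, at the
    cost of a factor [2] in the radius. *)
Lemma nbhs_eballP z P : nbhs z P <-> exists2 r, 0 < r & eball z r `<=` P.
split.
 move=> /nbhs_ballP[r /= r0 hr]; exists r => // w wz; apply: hr.
 have wz' : dC w z < r := wz.
 split; rewrite /ball /=.
  rewrite distrC; apply: lelt wz'.
  by have := Re_le_cabs (tz w z); rewrite ReD ReN.
 rewrite distrC; apply: lelt wz'.
 by have := Im_le_cabs (tz w z); rewrite ImD ImN.
move=> [r r0 hr]; apply/nbhs_ballP; exists (r / 2) => /=; first by rewrite divr_gt0.
move=> w [h1 h2]; apply: hr.
change (dC w z < r); apply: (lelt (nc_le_ReIm _)); rewrite ReD ReN ImD ImN /=.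
move: h1 h2; rewrite /ball /= => h1 h2; rewrite (distrC w.1) (distrC w.2); lra.
Qed.

Lemma cont_eballP (g : RR -> R) z : {for z, continuous g} <->
 forall e, 0 < e -> exists2 r, 0 < r & forall w, dC w z < r -> `|g w - g z| < e.
split.
 move=> cg e e0; have /cvgrPdist_lt/(_ e e0)/nbhs_eballP[r r0 hr] := cg.
 by exists r => // w /hr; rewrite /= distrC.
move=> h; apply/cvgrPdist_lt => e e0; have [r r0 hr] := h e e0.
by apply/nbhs_eballP; exists r => // w /hr /=; rewrite distrC.
Qed.

Lemma cderiv_cont f z l : cderiv f z l ->
 {for z, continuous (fun z => re (f z))} /\ {for z, continuous (fun z => im (f z))}.
move=> /cderiv_lip[d d0 hd].
have E e : 0 < e -> exists2 r, 0 < r & forall w, dC w z < r -> cabs (f w - f z) < e.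
 move=> e0; have l0 : 0 < cabs l + 1 by have := nc_ge0 l; lra.
 exists (Num.min d (e / (cabs l + 1))) => [|w]; first by rewrite lt_min d0 divr_gt0.
 rewrite lt_min => /andP[/hd h1]; rewrite ltr_pdivlMr // mulrC => h2.
 exact: lelt h2.
split; apply/cont_eballP => e /E[r r0 hr]; exists r => // w /hr; apply: lelt.
 by have := Re_le_cabs (f w - f z); rewrite ReD ReN.
by have := Im_le_cabs (f w - f z); rewrite ImD ImN.
Qed.

(** Lets [f] be arbitrary off the disk: near such a point the test function vanishes and the product
    extends by zero, so the rectangles need not stay in the disk. *)
Definition hol0 f phi := forall z, (exists l, cderiv f z l) \/
 (exists2 r, 0 < r & forall w, dC w z < r -> phi w = 0).

Lemma vanish_dbar (h : RR -> R) z v :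
 (exists2 r, 0 < r & forall w, dC w z < r -> h w = 0) -> 'D_v h z = 0.
move=> [r r0 hr]; rewrite -(derive_cst (0 : R) z v).
apply: near_eq_derive; apply/nbhs_eballP; exists r => // w hw; exact: hr.
Qed.
Lemma vanish_near (h : RR -> R) z r v w : 0 < r -> (forall w, dC w z < r -> h w = 0) -> dC w z < r / 2 -> 'D_v h w = 0.
move=> r0 hr wz; apply: vanish_dbar; exists (r / 2) => [|y yw]; first by rewrite divr_gt0.
by apply: hr; apply: (lelt (nc_distD (toC w) _ _)); lra.
Qed.

Lemma hol0_derive f phi v : hol0 f phi -> hol0 f ('D_v phi).
move=> h z; case: (h z) => [|[r r0 hr]]; [by left|right].
by exists (r / 2) => [|w]; [rewrite divr_gt0|exact: vanish_near].
Qed.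

Lemma hol0_cont f phi : hol0 f phi -> continuous phi ->
 continuous (fun z => re (f z) * phi z) /\ continuous (fun z => im (f z) * phi z).
move=> h cp; split=> z; case: (h z) => [[l hl]|[r r0 hr]].
- by apply: (@continuousM R RR (fun z => re (f z)) phi); [exact: (cderiv_cont hl).1|exact: cp].
- apply/cont_eballP => e e0; exists r => // w wz.
 by rewrite (hr w) // (hr z) ?subrr ?cabs0 // !mulr0 subrr normr0.
- by apply: (@continuousM R RR (fun z => im (f z)) phi); [exact: (cderiv_cont hl).2|exact: cp].
- apply/cont_eballP => e e0; exists r => // w wz.
 by rewrite (hr w) // (hr z) ?subrr ?cabs0 // !mulr0 subrr normr0.
Qed.

(* Twice the real part of [\int_Q f dbar phi] minus the boundary term of Stokes' formula. *)
Definition stokes f phi x0 x1 y0 y1 : R :=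
 RI x0 x1 y0 y1 (fun z => re (f z) * 'D_(1, 0) phi z - im (f z) * 'D_(0, 1) phi z)
 - (LI y0 y1 (fun y => re (f (x1, y)) * phi (x1, y)) - LI y0 y1 (fun y => re (f (x0, y)) * phi (x0, y)))
 + (LI x0 x1 (fun x => im (f (x, y1)) * phi (x, y1)) - LI x0 x1 (fun x => im (f (x, y0)) * phi (x, y0))).

Lemma stokes_cont f phi : smooth phi -> hol0 f phi ->
 [/\ continuous (fun z => re (f z) * 'D_(1, 0) phi z - im (f z) * 'D_(0, 1) phi z),
   continuous (fun z => re (f z) * phi z) & continuous (fun z => im (f z) * phi z)].
move=> sp hp.
have [a1 a2] := hol0_cont hp (smooth_cont sp).
have [b1 _] := hol0_cont (hol0_derive (1, 0) hp) (smooth_cont (smooth_derive (1, 0) sp)).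
have [_ b2] := hol0_cont (hol0_derive (0, 1) hp) (smooth_cont (smooth_derive (0, 1) sp)).
by split=> // z; apply: cvgB; [exact: b1|exact: b2].
Qed.

Lemma stokes_split f phi x0 xm x1 y0 ym y1 : smooth phi -> hol0 f phi ->
 x0 <= xm -> xm <= x1 -> y0 <= ym -> ym <= y1 ->
 stokes f phi x0 x1 y0 y1 = stokes f phi x0 xm y0 ym + stokes f phi xm x1 y0 ym +
  stokes f phi x0 xm ym y1 + stokes f phi xm x1 ym y1.
move=> sp hp hx0 hx1 hy0 hy1; have [cm cu cv] := stokes_cont sp hp.
rewrite /stokes (RI_splitx hx0 hx1 (letr hy0 hy1) cm) (RI_splity hy0 hy1 hx0 cm) (RI_splity hy0 hy1 hx1 cm).
rewrite !(LI_split hy0 hy1 (@cont_slicey _ _ cu)) !(LI_split hx0 hx1 (@cont_slicex _ _ cv)).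
by ring.
Qed.

Lemma stokes_close f g phi x0 x1 y0 y1 (rho : R) : smooth phi -> hol0 f phi -> hol0 g phi ->
 x0 <= x1 -> y0 <= y1 ->
 (forall z, x0 <= z.1 <= x1 -> y0 <= z.2 <= y1 -> cabs (f z - g z) * `|phi z| <= rho /\
   cabs (f z - g z) * `|'D_(1, 0) phi z| <= rho /\ cabs (f z - g z) * `|'D_(0, 1) phi z| <= rho) ->
 `|stokes f phi x0 x1 y0 y1 - stokes g phi x0 x1 y0 y1| <=
  2 * rho * ((x1 - x0) * (y1 - y0)) + 2 * rho * (y1 - y0) + 2 * rho * (x1 - x0).
move=> sp hf hg hx hy hr; have [fm fu fv] := stokes_cont sp hf; have [gm gu gv] := stokes_cont sp hg.
have mulB z (a : R) : `|re (f z) * a - re (g z) * a| <= cabs (f z - g z) * `|a|.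
 by rewrite -mulrBl normrM lerMr //; have := Re_le_cabs (f z - g z); rewrite ReD ReN.
have mulB' z (a : R) : `|im (f z) * a - im (g z) * a| <= cabs (f z - g z) * `|a|.
 by rewrite -mulrBl normrM lerMr //; have := Im_le_cabs (f z - g z); rewrite ImD ImN.
have Lu x : x0 <= x <= x1 -> `|LI y0 y1 (fun y => re (f (x, y)) * phi (x, y)) - LI y0 y1 (fun y => re (g (x, y)) * phi (x, y))| <= rho * (y1 - y0).
 move=> hxx; have c1 := @cont_slicey _ x fu; have c2 := @cont_slicey _ x gu.
 rewrite -LIB //; apply: LI_bound => //.
  by move=> y; apply: cvgB; [exact: c1|exact: c2].
 move=> y /andP[a b]; apply: (letr (mulB _ _)).
 have yy : y0 <= (x, y).2 <= y1 by rewrite /= b ltW.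
 by have [h _] := hr (x, y) hxx yy.
have Lv y : y0 <= y <= y1 -> `|LI x0 x1 (fun x => im (f (x, y)) * phi (x, y)) - LI x0 x1 (fun x => im (g (x, y)) * phi (x, y))| <= rho * (x1 - x0).
 move=> hyy; have c1 := @cont_slicex _ y fv; have c2 := @cont_slicex _ y gv.
 rewrite -LIB //; apply: LI_bound => //.
  by move=> x; apply: cvgB; [exact: c1|exact: c2].
 move=> x /andP[a b]; apply: (letr (mulB' _ _)).
 have xx : x0 <= (x, y).1 <= x1 by rewrite /= b ltW.
 by have [h _] := hr (x, y) xx hyy.
have Mm : `|RI x0 x1 y0 y1 (fun z => re (f z) * 'D_(1, 0) phi z - im (f z) * 'D_(0, 1) phi z) -
  RI x0 x1 y0 y1 (fun z => re (g z) * 'D_(1, 0) phi z - im (g z) * 'D_(0, 1) phi z)| <= 2 * rho * ((x1 - x0) * (y1 - y0)).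
 rewrite -RIB //; apply: RI_bound => //.
  by move=> z; apply: cvgB; [exact: fm|exact: gm].
 move=> z /andP[a b] /andP[c d].
 have [_ [h1 h2]] := hr z ltac:(by rewrite b ltW) ltac:(by rewrite d ltW).
 set a1 := 'D_(1, 0) phi z in h1 *; set a2 := 'D_(0, 1) phi z in h2 *.
 have -> : re (f z) * a1 - im (f z) * a2 - (re (g z) * a1 - im (g z) * a2) =
  (re (f z) * a1 - re (g z) * a1) - (im (f z) * a2 - im (g z) * a2) by ring.
 apply: (letr (ler_normB _ _)).
 have := letr (mulB z a1) h1; have := letr (mulB' z a2) h2; lra.
have hx0 : x0 <= x0 <= x1 by rewrite lexx.
have hx1 : x0 <= x1 <= x1 by rewrite hx lexx.
have hy0 : y0 <= y0 <= y1 by rewrite lexx.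
have hy1 : y0 <= y1 <= y1 by rewrite hy lexx.
move: Mm (Lu _ hx0) (Lu _ hx1) (Lv _ hy0) (Lv _ hy1); rewrite /stokes !ler_norml.
set M1 := RI _ _ _ _ _; set M2 := RI _ _ _ _ _; set a1 := LI y0 _ _; set a2 := LI y0 _ _; set a3 := LI y0 _ _; set a4 := LI y0 _ _.
set b1 := LI x0 _ _; set b2 := LI x0 _ _; set b3 := LI x0 _ _; set b4 := LI x0 _ _.
move=> /andP[? ?] /andP[? ?] /andP[? ?] /andP[? ?] /andP[? ?]; apply/andP; split; lra.
Qed.

Lemma cderiv_affine (a l : C) z0 z : cderiv (fun w => a + l * tz w z0) z l.
move=> e e0; exists 1 => // w _; rewrite [X in cabs X](_ : _ = 0) ?cabs0 ?mulr_ge0 ?nc_ge0 //; last by ring.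
exact: ltW.
Qed.

(** For affine [f] the product [f phi] is smooth, so the fundamental theorem applies, and the
    Cauchy-Riemann equations remove the derivatives of [f]. *)
Lemma stokes_affine (a l : C) z0 phi x0 x1 y0 y1 : smooth phi -> x0 <= x1 -> y0 <= y1 ->
 stokes (fun w => a + l * tz w z0) phi x0 x1 y0 y1 = 0.
move=> sp hx hy.
pose P w := a + l * (tz w z0).
have sP : csmooth P.
 apply: csmoothD; first exact: csmooth_cst.
 apply: csmoothM; first exact: csmooth_cst.
 by apply: csmoothD; [exact: csmooth_toC|exact: csmooth_cst].
have [s1 s2] := sP.
have hP : hol0 P phi by move=> z; left; exists l; exact: cderiv_affine.
have [cm cu cv] := stokes_cont sp hP.
have su : smooth (fun z => re (P z) * phi z) by exact: smoothM.
have sv : smooth (fun z => im (P z) * phi z) by exact: smoothM.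
have := RI_derivex hx hy su; have := RI_derivey hx hy sv.
rewrite /stokes -/P => <- <-.
have c1 := smooth_cont (smooth_derive (1, 0) su); have c2 := smooth_cont (smooth_derive (0, 1) sv).
suff -> : (fun z => re (P z) * 'D_(1, 0) phi z - im (P z) * 'D_(0, 1) phi z) =
 (fun z => 'D_(1, 0) (fun z => re (P z) * phi z) z - 'D_(0, 1) (fun z => im (P z) * phi z) z).
 by rewrite RIB // [LHS]addrAC subrK subrr.
apply/funext => z; rewrite !smooth_deriveM //.
have CR : cdbar P z = 0.
 rewrite cdbarD ?cdbar_cst ?add0r; [|exact: csmooth_cst|].
  rewrite cdbarM ?cdbar_cst ?mulr0 ?addr0; [|exact: csmooth_cst|].
   rewrite cdbarD ?cdbar_toC ?cdbar_cst ?addr0 ?mulr0 //; [exact: csmooth_toC|exact: csmooth_cst].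
  by apply: csmoothD; [exact: csmooth_toC|exact: csmooth_cst].
 apply: csmoothM; first exact: csmooth_cst.
 by apply: csmoothD; [exact: csmooth_toC|exact: csmooth_cst].
move: CR; rewrite cdbarE => -[/eqP + _]; rewrite mulf_eq0 invr_eq0 pnatr_eq0 orbF subr_eq0 => /eqP ->.
by ring.
Qed.

Lemma cont_le_near (g : RR -> R) z : continuous g ->
 exists2 r, 0 < r & forall w, dC w z < r -> `|g w| <= `|g z| + 1.
move=> cg; have [r r0 hr] := (cont_eballP g z).1 (cg z) 1 ltr01.
exists r => // w /hr h; have := ler_normD (g w - g z) (g z); rewrite subrK; lra.
Qed.

Lemma smooth_C1_bounded phi z : smooth phi -> exists2 B : R, 0 < B & exists2 r, 0 < r &
 forall w, dC w z < r -> [/\ `|phi w| <= B, `|'D_(1, 0) phi w| <= B & `|'D_(0, 1) phi w| <= B].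
move=> sp.
have [r1 r10 hr1] := cont_le_near z (smooth_cont sp).
have [r2 r20 hr2] := cont_le_near z (smooth_cont (smooth_derive (1, 0) sp)).
have [r3 r30 hr3] := cont_le_near z (smooth_cont (smooth_derive (0, 1) sp)).
move: hr1 hr2 hr3 (normr_ge0 (phi z)) (normr_ge0 ('D_(1, 0) phi z)) (normr_ge0 ('D_(0, 1) phi z)).
move: `|phi z| `|'D_(1, 0) phi z| `|'D_(0, 1) phi z| => a b c hr1 hr2 hr3 a0 b0 c0.
exists (a + b + c + 1); first by clear -a0 b0 c0; lra.
exists (Num.min r1 (Num.min r2 r3)) => [|w]; first by rewrite !lt_min r10 r20.
rewrite !lt_min => /andP[/hr1 h1 /andP[/hr2 h2 /hr3 h3]].
split; [apply: (letr h1)|apply: (letr h2)|apply: (letr h3)]; clear -a0 b0 c0; lra.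
Qed.

(** Near a point [f] differs from its first-order polynomial by [o(s)] on a square of side [s].
    Stokes' formula is exact for the polynomial, and the perimeter contributes another factor [s],
    so the defect is [o(s^2)] and [bisection_zero] applies. *)
Lemma stokes_zero f phi x y s : smooth phi -> hol0 f phi -> 0 < s ->
 stokes f phi x (x + s) y (y + s) = 0.
move=> sp hp s0; apply: (@bisection_zero (fun x y s => stokes f phi x (x + s) y (y + s))) s0.
 move=> {}x {}y {}s s0.
 rewrite (@stokes_split f phi x (x + s / 2) (x + s) y (y + s / 2) (y + s)) //; try lra.
 have -> : x + s = x + s / 2 + s / 2 by lra.
 have -> : y + s = y + s / 2 + s / 2 by lra.
 set a := stokes _ _ _ _ _ _; set b := stokes _ _ _ _ _ _; set c := stokes _ _ _ _ _ _; set d := stokes _ _ _ _ _ _.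
 have := ler_normD (a + b + c) d; have := ler_normD (a + b) c; have := ler_normD a b; lra.
move=> z1 z2 e e0; pose z : RR := (z1, z2).
have cl a b t : 0 < t -> a <= z1 <= a + t -> b <= z2 <= b + t -> forall w, a <= w.1 <= a + t -> b <= w.2 <= b + t ->
  dC w z <= 2 * t.
 move=> t0 /andP[h1 h2] /andP[h3 h4] w /andP[h5 h6] /andP[h7 h8].
 apply: (letr (nc_le_ReIm _)); rewrite ReD ReN ImD ImN /=.
 have : `|w.1 - z1| <= t by rewrite ler_norml; apply/andP; split; lra.
 have : `|w.2 - z2| <= t by rewrite ler_norml; apply/andP; split; lra.
 lra.
case: (hp z) => [[l hl]|[r r0 hr]]; last first.
 have hr' v w := @vanish_near phi z r v w r0 hr.
 exists (r / 4) => [|a b t t0 t1 ha hb]; first by rewrite divr_gt0.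
 have h0 : hol0 (fun=> 0 : C) phi by move=> u; left; exists 0; exact: cderiv_cst.
 have := @stokes_close f (fun=> 0 : C) phi a (a + t) b (b + t) 0 sp hp h0 ltac:(lra) ltac:(lra).
 have -> : stokes (fun=> 0 : C) phi a (a + t) b (b + t) = 0.
  have := @stokes_affine 0 0 z phi a (a + t) b (b + t) sp ltac:(lra) ltac:(lra).
  have E : (fun w => 0 + 0 * tz w z) = (fun=> 0 : C).
   by apply/funext => w; rewrite mul0r addr0.
  by rewrite E.
 rewrite subr0 => h; apply: (letr (h _)).
  move=> w h1 h2; have := cl a b t t0 ha hb w h1 h2 => cw.
  rewrite (hr w) ?hr' ?normr0 ?mulr0 //; lra.
 by rewrite mulr0 !mul0r !addr0 mulr_ge0 ?sqr_ge0 // ltW.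
have [B B0 [rB rB0 hB]] := smooth_C1_bounded z sp.
(* With error [e / (12 B)] times a distance at most [2 t], the area term is [e t^3 / 3] and the four
   sides give [2 e t^2 / 3]; since [t < 1] the total is at most [e t^2]. *)
have eB : 0 < e / (12 * B) by rewrite divr_gt0 // mulr_gt0.
have [r4 r40 hr4] := hl _ eB.
exists (Num.min 1 (Num.min (r4 / 2) (rB / 2))) => [|a b t t0].
 by rewrite !lt_min !divr_gt0 // ltr01.
rewrite !lt_min => /andP[t1 /andP[t4 t5]] ha hb.
pose P w := f z + l * (tz w z).
have hP : hol0 P phi by move=> u; left; exists l; exact: cderiv_affine.
have := @stokes_close f P phi a (a + t) b (b + t) (e / (12 * B) * (2 * t) * B) sp hp hP.
have at_ : a <= a + t by rewrite lerDl ltW.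
have bt_ : b <= b + t by rewrite lerDl ltW.
rewrite (stokes_affine _ _ _ sp at_ bt_) subr0 => /(_ at_ bt_) h; apply: (letr (h _)).
 move=> w h1 h2; have cw := cl a b t t0 ha hb w h1 h2.
 have fP : cabs (f w - P w) <= e / (12 * B) * (2 * t).
  have -> : f w - P w = f w - f z - l * (tz w z) by rewrite /P; ring.
  apply: (letr (hr4 w _)); first by apply: (lelt cw); clear -t4; lra.
  by rewrite lerMl // ltW.
 have wB : dC w z < rB by apply: (lelt cw); clear -t5; lra.
 have [b1 b2 b3] := hB w wB.
 by split; [|split]; apply: ler_pM; rewrite ?nc_ge0 ?normr_ge0.
have -> : e / (12 * B) * (2 * t) * B = e * t / 6 by field; rewrite gt_eqF.
have -> : a + t - a = t by ring.
have -> : b + t - b = t by ring.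
have : e * t * t * t <= e * t * t.
 rewrite -[leRHS]mulr1 lerMl ?ltW //; by rewrite !mulr_gt0.
have : 0 < e * t * t by rewrite !mulr_gt0.
have -> : 2 * (e * t / 6) * (t * t) = e * t * t * t / 3 by field.
have -> : 2 * (e * t / 6) * t = e * t * t / 3 by field.
rewrite expr2 mulrA; clear; lra.
Qed.

(** On a square containing the support of [phi] the boundary terms of Stokes' formula vanish. *)
Lemma hol_weak_rect f phi (L : R) : smooth phi -> hol0 f phi -> 0 < L ->
 (forall z, L <= nC z -> phi z = 0) ->
 Rintegral A (rect (- L) L (- L) L) (fun z => re (f z * dbar phi z)) = 0.
move=> sp hp L0 pL.
have h1 y : phi (L, y) = 0.
 by apply: pL; apply: letr (Re_le_cabs _); rewrite /= ger0_norm // ltW.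
have h2 y : phi (- L, y) = 0.
 by apply: pL; apply: letr (Re_le_cabs _); rewrite /= normrN ger0_norm // ltW.
have h3 y : phi (y, L) = 0.
 by apply: pL; apply: letr (Im_le_cabs _); rewrite /= ger0_norm // ltW.
have h4 y : phi (y, - L) = 0.
 by apply: pL; apply: letr (Im_le_cabs _); rewrite /= normrN ger0_norm // ltW.
have := @stokes_zero f phi (- L) (- L) (2 * L) sp hp ltac:(lra).
have -> : - L + 2 * L = L by ring.
rewrite /stokes.
have Z1 (g : RR -> R) a : (forall y, phi (a, y) = 0) -> LI (- L) L (fun y => g (a, y) * phi (a, y)) = 0.
 move=> ha; rewrite /LI /Rintegral integral0_eq // => y _; by rewrite ha mulr0.
have Z2 (g : RR -> R) a : (forall y, phi (y, a) = 0) -> LI (- L) L (fun y => g (y, a) * phi (y, a)) = 0.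
 move=> ha; rewrite /LI /Rintegral integral0_eq // => y _; by rewrite ha mulr0.
rewrite (Z1 (fun z => re (f z)) _ h1) (Z1 (fun z => re (f z)) _ h2).
rewrite (Z2 (fun z => im (f z)) _ h3) (Z2 (fun z => im (f z)) _ h4) !subrr subr0 addr0 => m0.
have [cm _ _] := stokes_cont sp hp.
have -> : (fun z => re (f z * dbar phi z)) =
  (fun z => 2^-1 * (re (f z) * 'D_(1, 0) phi z - im (f z) * 'D_(0, 1) phi z)).
 by apply/funext => z; rewrite ReM /=; field.
rewrite RintegralZl; [by rewrite -/(RI _ _ _ _ _) m0 mulr0|exact: mrect|].
by apply: intble_rect => //; lra.
Qed.
End Goursat.

(** * Translation invariance, sets generated by rectangles, Fubini *)

Section PlaneFubini.
Implicit Types (a b : R) (F : set PT).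
Local Notation RM := (measurableTypeR R).
Local Notation mu := (@lebesgue_measure R).

Lemma meas_shift (t : R) : mfun setT (fun x : RM => (x + t : RM)).
by apply: measurable_funD. Qed.

Lemma lebesgue_shift (t : R) (E : set RM) : measurable E ->
 mu E = mu ((fun x : RM => (x + t : RM)) @^-1` E).
move=> mE.
rewrite (_ : mu (_ @^-1` E) = pushforward mu (fun x : RM => (x + t : RM)) E) //.
apply: (@lebesgue_measure_unique R (pushforward mu (fun x : RM => (x + t : RM)))) mE.
 exact: meas_shift.
move=> mp _ [[a b] _ <-]; rewrite /= /pushforward.
have -> : (fun x : R => x + t) @^-1` `]a, b]%classic = `]a - t, b - t]%classic.
 by apply/seteqP; split => x /=; rewrite !in_itv /= => /andP[h1 h2]; apply/andP; split; lra.
rewrite [LHS]lebesgue_measure_itv [RHS]lebesgue_measure_itv /= !lte_fin ltrD2r.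
by case: ifP => // _; congr (_%:E); ring.
Qed.

Definition pshift (t : RR) (z : PT) : PT := (z.1 + t.1, z.2 + t.2).

Lemma meas_pshift t : mfun setT (pshift t).
apply/measurable_fun_pairP; split.
 exact: (mcomp (meas_shift t.1) measurable_fst).
exact: (mcomp (meas_shift t.2) measurable_snd).
Qed.

Lemma area_shift t (E : set PT) : measurable E -> A E = pushforward A (pshift t) E.
move=> mE; apply: (@product_measure_unique _ _ RM RM R mu mu (pushforward A (pshift t))) mE.
 exact: meas_pshift.
move=> mp X Y mX mY; rewrite /pushforward.
transitivity (A (((fun x : RM => (x + t.1 : RM)) @^-1` X) `*` ((fun x : RM => (x + t.2 : RM)) @^-1` Y))) => //.
rewrite [LHS]product_measure1E.
- by congr (_ * _)%E; apply/esym; [exact: (lebesgue_shift t.1 mX)|exact: (lebesgue_shift t.2 mY)].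
- by rewrite -[X in measurable X]setTI; apply: meas_shift.
- by rewrite -[X in measurable X]setTI; apply: meas_shift.
Qed.

Lemma ge0_integral_shift t (f : PT -> \bar R) : mfun setT f -> (forall z, (0 <= f z)%E) ->
 (\int[A]_z f z = \int[A]_z f (pshift t z))%E.
move=> mf f0; transitivity (\int[pushforward A (pshift t)]_z f z)%E.
 apply: eq_measure_integral => [|mp E mE _]; [exact: meas_pshift|exact: area_shift].
exact: (ge0_integral_pushforward (meas_pshift t) A measurableT mf (fun z _ => f0 z)).
Qed.

Definition is_rect (E : set PT) := exists x0 x1 y0 y1, E = rect x0 x1 y0 y1.

Lemma area_sigma_finite : sigma_finite setT (@areaM R).
exists (fun n => rect (- n%:R) n%:R (- n%:R) n%:R).
 apply/esym/seteqP; split => // -[x y] _.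
 exists (Num.bound (`|x| + `|y|)) => //.
 have := archi_boundP (addr_ge0 (normr_ge0 x) (normr_ge0 y)); set N := _%:R => hN.
 have hx : `|x| < N by apply: lelt hN; rewrite lerDl.
 have hy : `|y| < N by apply: lelt hN; rewrite lerDr.
 move: hx hy; rewrite !ltr_norml => /andP[h1 h2] /andP[h3 h4].
 by split; rewrite /= in_itv /= ?h1 ?h3 /= ltW.
move=> n; split; first exact: mrect.
by rewrite area_rect ?ltry //; rewrite ge0_cp.
Qed.
(** The area measure repackaged with its sigma-finiteness, as the theorems of Fubini and Tonelli
    require. *)
Definition areaS : {sigma_finite_measure set PT -> \bar R} := HB.pack (product_measure1 (@lebesgue_measure R) (@lebesgue_measure R)) (lebesgue_integral_fubini_product_measure1__canonical__measure_function_Measure (@lebesgue_measure R) (@lebesgue_measure R)) (Measure_isSigmaFinite.Build _ _ _ (product_measure1 (@lebesgue_measure R) (@lebesgue_measure R)) area_sigma_finite).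

(** A generating class for Dynkin's theorem: it is closed under intersection, contains the
    horizontal and vertical strips, and its members cut a fixed rectangle in a rectangle, where the
    hypothesis on rectangles applies. *)
Definition rect_compat (E : set PT) := measurable E /\
 forall Q, is_rect Q -> is_rect (E `&` Q).

Lemma setI_closed_rect_compat : setI_closed rect_compat.
move=> E F [mE hE] [mF hF]; split; first exact: measurableI.
by move=> Q hQ; rewrite -setIA; apply: hE; exact: hF.
Qed.

Lemma rect_compat_strip1 a b : rect_compat (`]a, b]%classic `*` setT).
split; first by apply: measurableX => //; exact: measurable_itv.
move=> _ [a' [b' [c' [d' ->]]]].
exists (Num.max a a'), (Num.min b b'), c', d'.
apply/seteqP; split => z; rewrite /rect /= !in_itv /= !gt_max !le_min.
 by move=> [[/andP[-> ->] _] [/andP[-> ->] /andP[-> ->]]].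
by move=> [/andP[/andP[-> ->] /andP[-> ->]] /andP[-> ->]].
Qed.

Lemma rect_compat_strip2 a b : rect_compat (setT `*` `]a, b]%classic).
split; first by apply: measurableX => //; exact: measurable_itv.
move=> _ [a' [b' [c' [d' ->]]]].
exists a', b', (Num.max a c'), (Num.min b d').
apply/seteqP; split => z; rewrite /rect /= !in_itv /= !gt_max !le_min.
 by move=> [[_ /andP[-> ->]] [/andP[-> ->] /andP[-> ->]]].
by move=> [/andP[-> ->] /andP[/andP[-> ->] /andP[-> ->]]].
Qed.

Lemma meas_rect_compat : @measurable _ PT = <<s rect_compat >>.
apply/seteqP; split; last first.
 apply: smallest_sub; first exact: sigma_algebra_measurable.
 by move=> E [].
have sg : sigma_algebra setT <<s rect_compat >> by exact: smallest_sigma_algebra.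
have [s0 sC sU] := sg.
have strip (f : PT -> R) : (forall a b, rect_compat (f @^-1` `]a, b]%classic)) ->
  forall X : set RM, measurable X -> <<s rect_compat >> (f @^-1` X).
 move=> hf; apply: smallest_sub.
  split.
  - by rewrite preimage_set0.
  - by move=> X hX; rewrite setTD preimage_setC -setTD; exact: sC.
  - by move=> F hF; rewrite preimage_bigcup; exact: sU.
 move=> _ [[a b] _ <-]; exact: sub_sigma_algebra.
rewrite measurable_prod_measurableType; apply: smallest_sub => //.
move=> _ [X mX [Y mY <-]].
rewrite (_ : X `*` Y = (fst : PT -> R) @^-1` X `&` (snd : PT -> R) @^-1` Y) //.
have SI (E F : set PT) : <<s rect_compat >> E -> <<s rect_compat >> F -> <<s rect_compat >> (E `&` F).
 move=> hE hF; rewrite -[E]setCK -[F]setCK -setCU -setTD; apply: (sC).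
 rewrite -bigcup2E; apply: (sU) => -[|[|n]] /=; rewrite -?setTD; [exact: sC|exact: sC|exact: s0].
apply: SI; apply: strip => // a b.
 by have := rect_compat_strip1 a b; congr rect_compat; apply/seteqP; split => z //= [].
by have := rect_compat_strip2 a b; congr rect_compat; apply/seteqP; split => z //= [].
Qed.

(** The sets over which [v] has integral zero inside the rectangle form a Dynkin system containing
    [rect_compat], hence all measurable sets; so [v] vanishes almost everywhere. *)
Lemma ae_zero_rect x0 x1 y0 y1 (v : PT -> R) : A.-integrable (rect x0 x1 y0 y1) (EFin \o v) ->
 (forall E, is_rect E -> E `<=` rect x0 x1 y0 y1 -> (\int[A]_(z in E) (v z)%:E = 0)%E) ->
 ae_eq A (rect x0 x1 y0 y1) (EFin \o v) (cst 0%E).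
set Q := rect _ _ _ _ => iv hv.
have mQ : measurable Q by exact: mrect.
have rQ : is_rect Q by exists x0, x1, y0, y1.
have H E : measurable E -> (\int[A]_(z in E `&` Q) (v z)%:E = 0)%E.
 rewrite meas_rect_compat.
 have iS F : measurable F -> F `<=` Q -> A.-integrable F (EFin \o v).
  by move=> mF sF; exact: integrableS iv.
 apply: (@dynkin_induction _ PT rect_compat (fun E => (\int[A]_(z in E `&` Q) (v z)%:E)%E = 0%E) meas_rect_compat setI_closed_rect_compat) => {E}.
 - by rewrite setTI; exact: hv.
 - by move=> E [mE hE]; apply: hv; [exact: hE|exact: subIsetr].
 - move=> E mE hE; have := hv _ rQ (@subset_refl _ _).
  rewrite -{1}(setUIDK Q E) integral_setU //=.
  + by rewrite setIC hE add0e setDE setIC.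
  + exact: measurableI.
  + exact: measurableD.
  + by rewrite setUIDK; apply: measurable_int iv.
  + by rewrite disj_set2E; apply/eqP; rewrite -subset0 => z [[_ h1] [_ h2]].
 - move=> F mF tF hF; rewrite setI_bigcupl integral_bigcup //.
  + by apply: eseries0 => n _ _; exact: hF.
  + exact: trivIset_setIr.
  + by move=> n; exact: measurableI.
  + rewrite -setI_bigcupl; apply: iS; [|exact: subIsetr].
   by apply: measurableI => //; exact: bigcupT_measurable.
apply: integral_ae_eq => // E sE mE.
by rewrite integral0 -(H _ mE); congr integral; apply/seteqP; split => z //=; [move=> h; split => //; exact: sE|case].
Qed.

Lemma fubini_restrict (D1 D2 : set PT) (f : PP -> R) (g := EFin \o (f \_ (D1 `*` D2)) : PP -> \bar R) :
 [/\ forall x y, g (x, y) = if (x \in D1) && (y \in D2) then (f (x, y))%:E else 0%E,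
 forall x, (\int[A]_y g (x, y) = ((fun x => \int[A]_(y in D2) (f (x, y))%:E) \_ D1) x)%E &
 forall y, (\int[A]_x g (x, y) = ((fun y => \int[A]_(x in D1) (f (x, y))%:E) \_ D2) y)%E].
have gE x y : g (x, y) = if (x \in D1) && (y \in D2) then (f (x, y))%:E else 0%E.
 by rewrite /g /= patchE in_setX; case: ifP.
split=> // [x|y]; rewrite patchE [in RHS]integral_mkcond; case: ifPn => xD.
- by apply: eq_integral => y _; rewrite gE xD patchE.
- by apply: integral0_eq => y _; rewrite gE (negbTE xD).
- by apply: eq_integral => x _; rewrite gE xD patchE andbT.
- by apply: integral0_eq => x _; rewrite gE (negbTE xD) andbF.
Qed.

Lemma rfubini D1 D2 (f : PP -> R) : measurable D1 -> measurable D2 ->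
 mfun (D1 `*` D2) f ->
 (\int[A]_(x in D1) \int[A]_(y in D2) `|f (x, y)|%:E < +oo)%E ->
 [/\ A.-integrable D1 (fun x => (Rintegral A D2 (fun y => f (x, y)))%:E),
   A.-integrable D2 (fun y => (Rintegral A D1 (fun x => f (x, y)))%:E) &
   Rintegral A D1 (fun x => Rintegral A D2 (fun y => f (x, y))) =
   Rintegral A D2 (fun y => Rintegral A D1 (fun x => f (x, y)))].
move=> mD1 mD2 mf fi.
set g : PP -> \bar R := EFin \o (f \_ (D1 `*` D2)).
have mg : mfun setT g.
 by apply/mEFP; apply/(measurable_restrictT _ (measurableX mD1 mD2)).
have [gE gF gG] := fubini_restrict D1 D2 f; rewrite -/g in gE gF gG.
have gi : (product_measure1 areaS areaS).-integrable setT g.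
 apply/(integrable12ltyP areaS areaS mg); apply: lelt fi.
 rewrite [in leRHS]integral_mkcond; apply: le_int => x _; first exact: integral_ge0.
 rewrite patchE [in leRHS]integral_mkcond; case: ifPn => xD.
  by apply: le_int => y _ //; rewrite gE xD patchE /=; case: ifP => //=; rewrite normr0.
 by rewrite (_ : \int[A]_y _ = 0)%E //; apply: integral0_eq => y _; rewrite gE (negbTE xD) /= normr0.
have key D (h : PT -> PT -> R) (G : PT -> \bar R) (E : set PT) : measurable D -> A.-integrable setT G ->
  (forall x, G x = ((fun x => \int[A]_(y in E) (h x y)%:E) \_ D) x)%E ->
  A.-integrable D (fun x => (Rintegral A E (h x))%:E) /\
  Rintegral A D (fun x => Rintegral A E (h x)) = fine (\int[A]_x G x)%E.
 move=> mD iG hG.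
 have e x : ((fun x => (Rintegral A E (h x))%:E) \_ D) x = (fine (G x))%:E.
  by rewrite hG !patchE /Rintegral; case: ifP.
 (* Passing from [G] to [fine G] changes it only where it is infinite, which is a null set. *)
 have ae : ae_eq A setT G (fun x => (fine (G x))%:E).
  have := integrable_ae measurableT iG; apply: filterS => x hx _.
  by rewrite fineK //; exact: hx.
 have mfG : mfun setT (fun x => (fine (G x))%:E).
  by apply/mEFP; apply: mcomp => //; exact: measurable_int iG.
 split.
  apply/(integrable_mkcond _ mD); rewrite (funext e).
  apply: (le_integrable measurableT _ _ iG) => // x _.
  by case: (G x) => //=; rewrite normr0 leey.
 rewrite [LHS]Rintegral_mkcond /Rintegral; congr fine; symmetry.
 have mG : mfun setT G by exact: measurable_int iG.
 rewrite (ae_eq_integral (fun x => (fine (G x))%:E) G measurableT mG mfG ae).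
 by apply: eq_integral => x _; rewrite -e restrict_EFin.
have [i1 e1] := key D1 (fun x y => f (x, y)) _ D2 mD1 (integrable_fubini_F gi) gF.
have iG : A.-integrable setT (fubini_G areaS g).
 apply/integrableP; split; first exact: measurable_fubini_G gi.
 apply: lelt ((integrable21ltyP areaS areaS mg).1 gi).
 apply: le_int => y _ //; rewrite /fubini_G.
 by apply: le_abse_integral => //; apply: mcomp mg _.
have [i2 e2] := key D2 (fun y x => f (x, y)) _ D1 mD2 iG gG.
split => //; rewrite e1 e2; congr fine; exact: (Fubini gi).
Qed.

Definition cmeas2 (D : set PP) (K : PT -> PT -> C) :=
 mfun D (fun z : PP => re (K z.1 z.2)) /\
 mfun D (fun z : PP => im (K z.1 z.2)).

Lemma cfubini D1 D2 (K : PT -> PT -> C) : measurable D1 -> measurable D2 ->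
 cmeas2 (D1 `*` D2) K ->
 (\int[A]_(x in D1) \int[A]_(y in D2) (cabs (K x y))%:E < +oo)%E ->
 [/\ cL1 D1 (fun x => cinteg D2 (K x)), cL1 D2 (fun y => cinteg D1 (K^~ y)) &
   cinteg D1 (fun x => cinteg D2 (K x)) = cinteg D2 (fun y => cinteg D1 (K^~ y))].
move=> mD1 mD2 [m1 m2] Ki.
have F (f : PP -> R) : (forall x y, `|f (x, y)| <= cabs (K x y)) ->
  (\int[A]_(x in D1) \int[A]_(y in D2) `|f (x, y)|%:E < +oo)%E.
 move=> h; apply: lelt Ki; apply: le_int => x _; first exact: integral_ge0.
 by apply: le_int => y _ //; rewrite lee_fin.
have [i1 i2 e] := rfubini mD1 mD2 m1 (F _ (fun x y => Re_le_cabs _)).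
have [i3 i4 e'] := rfubini mD1 mD2 m2 (F _ (fun x y => Im_le_cabs _)).
split; [exact: (conj i1 i3)|exact: (conj i2 i4)|exact: (congr2 (@Complex R) e e')].
Qed.
End PlaneFubini.

Arguments cabs : simpl never.
Arguments toC : simpl never.

Implicit Types (Psi G f u : RR -> C) (Z : set RR) (b w z : RR) (eps e : R).

(** * Test functions and weakly holomorphic functions *)

Section WeakHolomorphy.
Implicit Types (g phi : RR -> C) (v : RR) (r M : R) (h : RR -> R) (D : set PT).
Local Notation Ii := (Complex 0 1 : C).

Definition dball r : set PT := [set z | nC z < r].

Lemma mdball r : measurable (dball r).
rewrite (_ : dball r = setT `&` [set z | nC z < r]); last by rewrite setTI.
by apply: meas_lt_cabs => //; exact: cmeas_toC.
Qed.

Lemma dball_disk r : r <= 1 -> dball r `<=` Dk.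
by move=> r1 z hz; have h : nC z < r := hz; exact: ltle h r1. Qed.

Lemma open_disk : open Dk.
rewrite openE => z hz; apply/nbhs_eballP; exists (dd z); first by rewrite subr_gt0.
exact: eball_disk.
Qed.

Lemma compact_closed_dball r : compact [set z : RR | nC z <= r].
have sq z : nC z ^+ 2 = z.1 ^+ 2 + z.2 ^+ 2 by rewrite sqr_cabs.
apply: (@subclosed_compact _ _ (`[(- `|r|), `|r|]%classic `*` `[(- `|r|), `|r|]%classic)).
- have [r0|r0] := ltP r 0.
  rewrite (_ : [set _ | _] = set0); first exact: closed0.
  by rewrite -subset0 => z /= h; have := lelt (letr (nc_ge0 (toC z)) h) r0; rewrite ltxx.
 rewrite (_ : [set _ | _] = (sqdist (0 : RR)) @^-1` [set x | x <= r ^+ 2]).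
  apply: closed_comp; last exact: closed_le.
  by move=> z _; apply: smooth_cont; exact: smooth_sqdist.
 apply/seteqP; split => z /=; rewrite sqdistE (_ : toC (0 : RR) = 0) // subr0 => h.
  by rewrite ler_pXn2r ?nnegrE ?nc_ge0.
 by move: h; rewrite ler_pXn2r ?nnegrE ?nc_ge0.
- by apply: compact_setX; exact: segment_compact.
- move=> z /= h.
 have := Re_le_cabs (toC z); have := Im_le_cabs (toC z) => h1 h2.
 have hr := ler_norm r.
 by split; rewrite /= in_itv /= -ler_norml; [apply: letr h2 _|apply: letr h1 _]; apply: letr hr.
Qed.

Lemma compact_disk_radius (K : set RR) : compact K -> K `<=` Dk ->
 exists r, [/\ 0 < r, r < 1 & forall z, K z -> nC z <= r].
move=> cK sK; have [[z0 Kz0]|K0] := pselect (K !=set0); last first.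
 by exists (1 / 2); split; [lra|lra|move=> z Kz; exfalso; apply: K0; exists z].
have [||z Kz hz] := @compact_EVT_max _ _ (sqdist (0 : RR)) K _ cK.
- by exists z0.
- by apply: continuous_subspaceT; apply: smooth_cont; exact: smooth_sqdist.
move: hz; rewrite /= => hz.
exists ((1 + nC z) / 2); have := sK _ (set_mem Kz) => z1; have {}z1 : nC z < 1 := z1.
have := nc_ge0 (toC z) => z00; split; [lra|lra|move=> w Kw].
have : sqdist (0 : RR) w <= sqdist (0 : RR) z by apply: hz; exact/mem_set.
rewrite !sqdistE (_ : toC (0 : RR) = 0) // !subr0 ler_pXn2r ?nnegrE ?nc_ge0 // => h; lra.
Qed.

Lemma cont_bounded_dball h r :
 (forall z, nC z <= r -> {for z, continuous h}) ->
 exists2 M, 0 < M & forall z, nC z <= r -> `|h z| <= M.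
move=> ch; have cK := @compact_closed_dball r.
have wc : {within [set z : RR | nC z <= r], continuous h}.
 by apply: continuous_in_subspaceT => z /set_mem; exact: ch.
have /compact_bounded [M [_ hM]] := continuous_compact wc cK.
have M1 : M < `|M| + 1 by rewrite (lelt (ler_norm M)) // ltrDl.
exists (`|M| + 1) => [|z hz]; first by rewrite ltr_wpDl.
by apply: (hM _ M1); exists z.
Qed.

Definition ccontinuous_at g z :=
 {for z, continuous (fun z => re (g z))} /\ {for z, continuous (fun z => im (g z))}.

Lemma ccontinuous_bounded g r :
 (forall z, nC z <= r -> ccontinuous_at g z) ->
 exists2 M, 0 < M & forall z, nC z <= r -> cabs (g z) <= M.
move=> cg.
have [M1 M10 h1] := cont_bounded_dball (fun z hz => (cg z hz).1).
have [M2 M20 h2] := cont_bounded_dball (fun z hz => (cg z hz).2).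
exists (M1 + M2) => [|z hz]; first exact: addr_gt0.
by apply: letr (nc_le_ReIm _) _; apply: lerD; [exact: h1|exact: h2].
Qed.

Lemma csmooth_ccontinuous g z : csmooth g -> ccontinuous_at g z.
by move=> [s1 s2]; split; apply: smooth_cont. Qed.

Lemma cderiv_ccontinuous f z l : cderiv f z l -> ccontinuous_at f z.
exact: cderiv_cont. Qed.

Lemma ccontinuous_cmeas D f : open D -> (forall z, D z -> ccontinuous_at f z) -> cmeas D f.
move=> oD cf; split; apply: open_continuous_measurable => // z /set_mem; [exact: (fun zD => (cf z zD).1)|exact: (fun zD => (cf z zD).2)].
Qed.

Lemma csmooth_cmeas D g : measurable D -> csmooth g -> cmeas D g.
move=> mD sg; have [m1 m2] : cmeas setT g.
 by apply: ccontinuous_cmeas => [|z _]; [exact: openT|exact: csmooth_ccontinuous].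
by split; [exact: measurable_funTS|exact: measurable_funTS].
Qed.

Lemma holo_cmeas f : holo Dk f -> cmeas Dk f.
move=> hf; apply: ccontinuous_cmeas => [|z /hf[l hl]]; first exact: open_disk.
exact: cderiv_ccontinuous hl.
Qed.

Lemma holo_bounded f r : holo Dk f -> r < 1 ->
 exists2 M, 0 < M & forall z, nC z <= r -> cabs (f z) <= M.
move=> hf r1; apply: ccontinuous_bounded => z hz.
have [l hl] : exists l, cderiv f z l by apply: hf; exact: lelt hz r1.
exact: cderiv_ccontinuous hl.
Qed.

Lemma csmooth_cdbar g : csmooth g -> csmooth (cdbar g).
move=> [s1 s2]; have sh h : smooth h -> smooth (fun z => h z / 2).
 by move=> sh; apply: smoothM => //; exact: smooth_cst.
split.
 rewrite (_ : (fun z => _) = (fun z => ('D_(1, 0) (fun z => re (g z)) z - 'D_(0, 1) (fun z => im (g z)) z) / 2)).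
  by apply: (sh); apply: smoothB; exact: smooth_derive.
 by apply/funext => z; rewrite cdbarE.
rewrite (_ : (fun z => _) = (fun z => ('D_(0, 1) (fun z => re (g z)) z + 'D_(1, 0) (fun z => im (g z)) z) / 2)).
 by apply: (sh); apply: smoothD; exact: smooth_derive.
by apply/funext => z; rewrite cdbarE.
Qed.

(** Every compact subset of the disk lies in a concentric disk of radius less than [1], so testing
    on these is enough; [locintP] states the equivalence. *)
Definition locint u := forall r, r < 1 -> cL1 (dball r) u.

Lemma locintP u : loc_integrable_disk u <-> locint u.
have mC r : measurable ([set z : RR | nC z <= r] : set PT).
 rewrite -[X in measurable X]setCK; apply: measurableC; apply: open_plane_measurable.
 by apply: closed_openC; apply: compact_closed; [exact: norm_hausdorff|exact: compact_closed_dball].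
split=> h.
 move=> r r1; have sD : [set z : RR | nC z <= r] `<=` Dk.
  by move=> z /= hz; exact: lelt hz r1.
 have [h1 h2] := h _ (@compact_closed_dball r) sD.
 apply: (cL1S (mdball r) (mC r)) => // z hz.
 by have {}hz : nC z < r := hz; exact: ltW.
move=> K cK sK; have [r [r0 r1 hr]] := compact_disk_radius cK sK.
have mK : measurable (K : set PT).
 rewrite -[X in measurable X]setCK; apply: measurableC; apply: open_plane_measurable.
 by apply: closed_openC; apply: compact_closed; first exact: norm_hausdorff.
apply: (cL1S mK (mdball ((1 + r) / 2))) => [z Kz|].
 by change (nC z < (1 + r) / 2); have := hr _ Kz; lra.
apply: h; lra.
Qed.

Definition ctest phi := csmooth phi /\
 exists r, r < 1 /\ forall z, r <= nC z -> phi z = 0.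

Lemma ctest_test phi : ctest phi -> test_fun (fun z => re (phi z)) /\ test_fun (fun z => im (phi z)).
move=> [[s1 s2] [r [r1 hr]]].
have H : exists K : set RR, compact K /\ K `<=` Dk /\ forall z, ~ K z -> phi z = 0.
 exists [set z : RR | nC z <= r]; split; first exact: compact_closed_dball.
 split=> [z /= hz|z /= /negP]; first exact: lelt hz r1.
 by rewrite -ltNge => /ltW; exact: hr.
have [K [cK [sK hK]]] := H.
by split; split => //; exists K; split => //; split => // z /hK ->.
Qed.

Lemma test_ctest (phi : RR -> R) : test_fun phi -> ctest (fun z => rC (phi z)).
move=> [sp [K [cK [sK hK]]]]; split; first exact: csmooth_rC.
have [r [r0 r1 hr]] := compact_disk_radius cK sK.
exists ((1 + r) / 2); split=> [|z hz]; first lra.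
by rewrite hK // => /hr h; lra.
Qed.

Lemma ctest_cdbar phi : ctest phi -> ctest (cdbar phi).
move=> [s [r [r1 hr]]]; split; first exact: csmooth_cdbar.
exists ((1 + r) / 2); split=> [|z hz]; first lra.
have H : exists2 d : R, 0 < d & forall w, dC w z < d -> phi w = 0.
 exists ((1 - r) / 2) => [|w hw]; first lra.
 by apply: hr; have := nc_leB (toC z) (toC w); rewrite nc_distC; lra.
rewrite cdbarE !vanish_dbar; first by rewrite subrr addr0 mul0r.
all: by have [d d0 hd] := H; exists d => // w /hd ->.
Qed.

Lemma ctestM phi g : ctest phi -> csmooth g -> ctest (fun z => phi z * g z).
move=> [s [r [r1 hr]]] sg; split; first exact: csmoothM.
by exists r; split => // z hz; rewrite hr // mul0r.
Qed.

Lemma cint_dball g r : r <= 1 -> (forall z, r <= nC z -> g z = 0) ->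
 ID g = cinteg (dball r) g.
move=> r1 hr; apply: cinteg_sub; [exact: mdball|exact: mdisk|exact: dball_disk|].
by move=> z _ /negP; rewrite -leNgt => h; exact: hr.
Qed.

Lemma locint_bounded u g r M : r < 1 -> locint u -> cmeas Dk g ->
 (forall z, r <= nC z -> g z = 0) -> (forall z, nC z <= r -> cabs (g z) <= M) ->
 L1D (fun z => u z * g z).
move=> r1 lu mg g0 gM.
have sD : dball r `<=` Dk by apply: dball_disk; exact: ltW.
refine (cL1_sub (f := fun z => u z * g z) (@mdball r) (@mdisk) sD _ _).
 by move=> z _ /negP; rewrite -leNgt => h; rewrite g0 ?mulr0.
apply: (eq_cL1 (mdball r) (f := fun z => g z * u z)); first by move=> z _; rewrite mulrC.
apply: (@cL1M_bounded _ _ _ M); [exact: mdball|exact: lu| |].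
 by case: mg => m1 m2; split; [apply: measurable_funS m1|apply: measurable_funS m2] => //; exact: mdisk.
by move=> z hz; apply: gM; have {}hz : nC z < r := hz; exact: ltW.
Qed.

Lemma locint_ctest u phi : locint u -> ctest phi -> L1D (fun z => u z * phi z).
move=> lu [s [r [r1 hr]]].
have [M M0 hM] := ccontinuous_bounded (r := r) (fun z _ => csmooth_ccontinuous z s).
apply: (locint_bounded r1 lu _ hr hM); apply: csmooth_cmeas s; exact: mdisk.
Qed.

Definition weakhol u := locint u /\ forall phi, ctest phi -> ID (fun z => u z * cdbar phi z) = 0.

Lemma holo_locint f : holo Dk f -> locint f.
move=> hf r r1; have [M M0 hM] := holo_bounded hf r1.
have sD : dball r `<=` Dk by apply: dball_disk; exact: ltW.
apply: (@cL1_bounded _ _ M); first exact: mdball.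
- by apply: area_lty => //; exact: mdball.
- by case: (holo_cmeas hf) => m1 m2; split; [apply: measurable_funS m1|apply: measurable_funS m2] => //; exact: mdisk.
- by move=> z hz; apply: hM; have {}hz : nC z < r := hz; exact: ltW.
Qed.

Lemma holo_weak_real f (phi : RR -> R) : holo Dk f -> ctest (fun z => rC (phi z)) ->
 ID (fun z => f z * dbar phi z) = 0.
move=> hf ht; have [[sphi _] [r [r1 hr]]] := ht.
have [_ [r' [r'1 hr']]] := ctest_cdbar ht.
have hz g : holo Dk g -> hol0 g phi.
 move=> hg z; have [z1|z1] := ltP (nC z) 1; first by left; exact: hg.
 right; exists (1 - r) => [|w hw]; first lra.
 suff /(congr1 re) : rC (phi w) = 0 by [].
 by apply: hr; have := nc_leB (toC z) (toC w); rewrite nc_distC; lra.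
have key g : holo Dk g ->
  Rintegral A Dk (fun z => re (g z * dbar phi z)) = 0.
 move=> hg; rewrite -[RHS](hol_weak_rect sphi (hz _ hg) ltr01); last first.
  move=> z h; suff /(congr1 re) : rC (phi z) = 0 by [].
  by apply: hr; lra.
 have z0 z : 1 <= nC z -> re (g z * dbar phi z) = 0.
  by move=> h; rewrite -cdbar_rC hr' ?mulr0 //; lra.
 have e : cinteg (rect (-1) 1 (-1) 1) (fun z => rC (re (g z * dbar phi z))) =
  ID (fun z => rC (re (g z * dbar phi z))).
  apply: cinteg_sub; [exact: mdisk|exact: mrect| |].
  + move=> z hz'; have {}hz' : nC z < 1 := hz'.
   have /lelt/(_ hz') := Re_le_cabs (toC z); have /lelt/(_ hz') := Im_le_cabs (toC z).
   rewrite !ltr_norml => /andP[h1 h2] /andP[h3 h4].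
   by split; rewrite /= in_itv /= ?h1 ?h3 /= ltW.
  + by move=> z _ /negP; rewrite -leNgt => h; rewrite z0.
 by have := congr1 re e => /= ->.
apply: ceqP; first exact: key.
(* Multiplication by [-i] turns the imaginary part into a real part, so the real case gives both. *)
have := key (fun z => (- Ii) * f z) (holoM (@holo_cst _ (- Ii)) hf).
rewrite /= => <-; apply: eq_Rintegral => z _.
by rewrite -mulrA; case: (f z * dbar phi z) => a b /=; ring.
Qed.

Lemma holo_weak f : holo Dk f -> weakhol f.
move=> hf; split; first exact: holo_locint.
move=> phi tp; have [t1 t2] := ctest_test tp.
have := test_ctest t1 => {}t1; have := test_ctest t2 => {}t2.
have i1 := locint_ctest (holo_locint hf) (ctest_cdbar t1).
have i2 := locint_ctest (holo_locint hf) (ctest_cdbar t2).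
have e := holo_weak_real hf t1; have e' := holo_weak_real hf t2.
transitivity (ID (fun z => f z * cdbar (fun z => rC (re (phi z))) z +
  Ii * (f z * cdbar (fun z => rC (im (phi z))) z))).
 by apply: eq_cinteg => z _; rewrite !cdbar_rC /cdbar mulrDr; congr (_ + _); rewrite mulrCA.
rewrite cintegD ?cintegZ //; try exact: mdisk; last by apply: cL1Z => //; exact: mdisk.
rewrite (eq_cinteg (g := fun z => f z * dbar (fun z => re (phi z)) z)) ?e; last by move=> z _; rewrite cdbar_rC.
rewrite (eq_cinteg (g := fun z => f z * dbar (fun z => im (phi z)) z)) ?e'; last by move=> z _; rewrite cdbar_rC.
by rewrite mulr0 addr0.
Qed.
End WeakHolomorphy.

Arguments dstep : simpl never.
Arguments step : simpl never.

(** * The Cauchy kernel on an annulus and the constant [kappa] *)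

Section CauchyKernel.
Implicit Types (phi : RR -> C) (c : RR) (x rho B : R).

Lemma ler_sqrn (x y : R) : 0 <= x -> 0 <= y -> (x ^+ 2 <= y ^+ 2) = (x <= y).
by move=> x0 y0; rewrite ler_pXn2r // nnegrE. Qed.

Definition bump_arg c rho z : R := (rho ^+ 2)^-1 * sqdist c z + (-1).
(** Falls from [1] to [0] where [|z - c|^2] goes from [rho^2] to [2 rho^2]; since [(3/2)^2 > 2], the
    transition lies in the annulus between the radii [rho] and [3 rho / 2]. *)
Definition bump c rho z : C := rC (1 - step (bump_arg c rho z)).

Lemma smooth_bump_arg c rho : smooth (bump_arg c rho).
by apply: smooth_affine; exact: smooth_sqdist. Qed.

Lemma csmooth_bump c rho : csmooth (bump c rho).
apply: csmooth_rC; apply: smoothB; first exact: smooth_cst.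
by apply: smooth_step; exact: smooth_bump_arg.
Qed.

Lemma bump_arg_le0 c rho z : 0 < rho -> dC z c <= rho -> bump_arg c rho z <= 0.
move=> r0 h; rewrite /bump_arg sqdistE subr_le0 mulrC ler_pdivrMr ?exprn_gt0 // mul1r.
by rewrite ler_sqrn ?nc_ge0 // ltW.
Qed.

Lemma bump_arg_ge1 c rho z : 0 < rho -> 3 / 2 * rho <= dC z c -> 1 <= bump_arg c rho z.
move=> r0 h; have r20 : 0 < rho ^+ 2 by rewrite exprn_gt0.
rewrite /bump_arg sqdistE -lerBlDr opprK mulrC ler_pdivlMr //.
have : (3 / 2 * rho) ^+ 2 <= dC z c ^+ 2 by rewrite ler_sqrn ?nc_ge0 //; lra.
rewrite exprMn; move: r20; set a := rho ^+ 2; set b := cabs _ ^+ 2; lra.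
Qed.

Lemma bump_eq1 c rho z : 0 < rho -> dC z c <= rho -> bump c rho z = 1.
by move=> r0 h; rewrite /bump step_le0 ?subr0 //; exact: bump_arg_le0. Qed.

Lemma bump_eq0 c rho z : 0 < rho -> 3 / 2 * rho <= dC z c -> bump c rho z = 0.
by move=> r0 h; rewrite /bump step_ge1 ?subrr //; exact: bump_arg_ge1. Qed.

Lemma nc_bump_le1 c rho z : cabs (bump c rho z) <= 1.
rewrite nc_rC ger0_norm ?subr_ge0 ?step_le1 //.
by have := step_ge0 (bump_arg c rho z); lra.
Qed.

Lemma ctest_bump c rho : 0 < rho -> nC c + 2 * rho <= 1 -> ctest (bump c rho).
move=> r0 h; split; first exact: csmooth_bump.
exists (nC c + 3 / 2 * rho); split=> [|z hz]; first lra.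
by apply: bump_eq0 => //; have := nc_leB (toC z) (toC c); lra.
Qed.

(** Integrating against the derivative of a cutoff replaces the contour integral of Cauchy's formula
    by an area integral over an annulus, which makes sense for functions that are merely locally
    integrable. *)
Definition cker c rho z : C := - cdbar (bump c rho) z.

Lemma ckerE c rho z : cker c rho z = rC ((rho ^+ 2)^-1 * dstep (bump_arg c rho z)) * (tz z c).
rewrite /cker /bump cdbar_rC.
have -> : (fun z => 1 - step (bump_arg c rho z)) = (fun z => (-1) * step (bump_arg c rho z) + 1).
 by apply/funext => x; rewrite mulN1r addrC.
rewrite dbar_affine; last by apply: smooth_step; exact: smooth_bump_arg.
rewrite dbar_step; last exact: smooth_bump_arg.
rewrite /bump_arg dbar_affine; last exact: smooth_sqdist.
rewrite dbar_sqdist rCN rC1 mulN1r opprK mulrA -rCM; congr (rC _ * _); exact: mulrC.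
Qed.

Lemma cker_eq0 c rho z : 0 < rho ->
 dC z c <= rho \/ 3 / 2 * rho <= dC z c -> cker c rho z = 0.
move=> r0 [h|h]; rewrite ckerE.
 by rewrite dstep_le0 ?mulr0 ?mul0r //; exact: bump_arg_le0.
by rewrite dstep_ge1 ?mulr0 ?mul0r //; exact: bump_arg_ge1.
Qed.

Lemma cker_neq0 c rho z : 0 < rho -> cker c rho z != 0 -> rho < dC z c < 3 / 2 * rho.
by move=> r0 h; rewrite !ltNge; apply/andP; split; apply: contra h => h; rewrite cker_eq0 //; [left|right].
Qed.

Lemma ctest_cker c rho : 0 < rho -> nC c + 2 * rho <= 1 -> ctest (cker c rho).
move=> r0 h.
have -> : cker c rho = (fun z => cdbar (bump c rho) z * (-1)).
 by apply/funext => z; rewrite /cker mulrN1.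
by apply: ctestM; [apply: ctest_cdbar; exact: ctest_bump|exact: csmooth_cst].
Qed.

Lemma dstep_bounded : exists2 B, 0 < B & forall x, dstep x <= B.
have s : smooth (fun z => dstep z.1) by apply: smooth_dstep; exact: smooth_fst.
have [M M0 hM] := cont_bounded_dball (h := fun z => dstep z.1) (r := 1)
  (fun z _ => @smooth_cont _ s z).
exists M => // x; have [x0|x0] := leP x 0; first by rewrite dstep_le0 // ltW.
have [x1|x1] := leP 1 x; first by rewrite dstep_ge1 // ltW.
apply: (letr (ler_norm _)); apply: (hM (x, 0)).
rewrite -(@ler_sqrn _ 1) ?nc_ge0 //.
rewrite sqr_cabs /toC /= expr0n /= addr0 expr1n expr_le1 //; exact: ltW.
Qed.

Lemma cker_bound : exists2 B, 0 < B & forall c rho z, 0 < rho -> cabs (cker c rho z) <= B / rho.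
have [B B0 hB] := dstep_bounded; exists (3 / 2 * B) => [|c rho z r0]; first lra.
have [->|/(cker_neq0 r0)/andP[_ h]] := eqVneq (cker c rho z) 0.
 by rewrite cabs0 divr_ge0 //; lra.
rewrite ckerE cabsM nc_rC normrM !ger0_norm ?dstep_ge0 ?invr_ge0 ?exprn_ge0 ?(ltW r0) //.
have -> : 3 / 2 * B / rho = (rho ^+ 2)^-1 * B * (3 / 2 * rho).
 by field; rewrite gt_eqF.
have r20 : 0 <= (rho ^+ 2)^-1 by rewrite invr_ge0 exprn_ge0 // ltW.
apply: ler_pM; [|exact: nc_ge0| |exact: ltW].
 by apply: mulr_ge0 => //; exact: dstep_ge0.
exact: lerMl.
Qed.

Lemma pole_arg_ge1 w e z : 0 < e -> e <= dC z w ^+ 2 -> 1 <= 2 / e * sqdist w z + (-1).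
move=> e0 h; rewrite sqdistE -lerBlDr opprK mulrAC ler_pdivlMr //; lra.
Qed.

Lemma pole_far w e z : 0 < e -> e <= dC z w ^+ 2 -> pole w e z = (tz z w)^-1.
by move=> e0 h; rewrite poleE // step_ge1 ?rC1 ?mul1r //; exact: pole_arg_ge1. Qed.

Lemma pmass_far w e z : 0 < e -> e <= dC z w ^+ 2 -> pmass w e z = 0.
by move=> e0 h; rewrite /pmass dstep_ge1 ?mulr0 //; exact: pole_arg_ge1. Qed.

Lemma pmass_near w e z : 0 < e -> pmass w e z != 0 -> dC z w ^+ 2 < e.
by move=> e0 h; rewrite ltNge; apply: contra h => h; rewrite pmass_far. Qed.

Lemma pmass_ge0 w e z : 0 < e -> 0 <= pmass w e z.
by move=> e0; rewrite /pmass mulr_ge0 ?dstep_ge0 // divr_ge0 // ltW. Qed.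

Lemma pmass_sym w e z : pmass w e z = pmass z e w.
by rewrite /pmass !sqdistE nc_distC. Qed.

Lemma smooth_pmass w e : smooth (pmass w e).
apply: smoothM; first exact: smooth_cst.
by apply: smooth_dstep; apply: smooth_affine; exact: smooth_sqdist.
Qed.

Lemma ctest_pmass w (e s : R) : 0 < e -> 0 < s -> e <= s ^+ 2 -> nC w + s < 1 ->
 ctest (fun z => rC (pmass w e z)).
move=> e0 s0 es h; split; first by apply: csmooth_rC; exact: smooth_pmass.
exists (nC w + s); split => // z hz; rewrite pmass_far //.
apply: (letr es); rewrite ler_sqrn ?nc_ge0 //; last exact: ltW.
by have := nc_leB (toC z) (toC w); lra.
Qed.

(** Test the weak equation against [phi] times the smoothed pole and use the product rule. *)
Lemma weak_pole u phi w e : weakhol u -> ctest phi -> 0 < e ->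
 ID (fun z => u z * (phi z * rC (pmass w e z))) =
 - ID (fun z => u z * (cdbar phi z * pole w e z)).
move=> [lu hu] tp e0; have sp := csmooth_pole w e0.
have := hu _ (ctestM tp sp).
rewrite (eq_cinteg (g := fun z => u z * (phi z * rC (pmass w e z)) + u z * (cdbar phi z * pole w e z))); last first.
 by move=> z _; rewrite cdbarM ?cdbar_pole //; [rewrite mulrDr (mulrC (pole _ _ _))|case: tp].
rewrite cintegD; first by move/eqP; rewrite addr_eq0 => /eqP.
- exact: mdisk.
- apply: locint_ctest => //; apply: ctestM => //; apply: csmooth_rC; exact: smooth_pmass.
- by apply: locint_ctest => //; apply: ctestM => //; exact: ctest_cdbar.
Qed.

(** The right-hand side is free of [e]; this is the source of every independence statement below
    and, as [e] tends to [0], of Cauchy's formula. The smoothing disk lies where the cutoff is [1],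
    and on the annulus the smoothed pole is exactly [1 / (z - w)]. *)
Lemma cauchy_pole u c w rho e : weakhol u -> 0 < rho -> nC c + 2 * rho <= 1 ->
 dC w c <= rho / 2 -> 0 < e -> 4 * e <= rho ^+ 2 ->
 ID (fun z => u z * rC (pmass w e z)) =
 ID (fun z => u z * (cker c rho z / tz z w)).
move=> wu r0 hc hw e0 he.
have he' : e <= (rho / 2) ^+ 2 by rewrite exprMn; lra.
transitivity (ID (fun z => u z * (bump c rho z * rC (pmass w e z)))).
 apply: eq_cinteg => z _; have [->|h] := eqVneq (pmass w e z) 0.
  by rewrite rC0 !mulr0.
 rewrite bump_eq1 ?mul1r //.
 have := ltle (pmass_near e0 h) he'.
 rewrite ltr_pXn2r ?nnegrE ?nc_ge0 //; last lra.
 by have := nc_distD (toC w) (toC z) (toC c); lra.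
rewrite weak_pole //; last exact: ctest_bump.
have i : L1D (fun z => u z * (cdbar (bump c rho) z * pole w e z)).
 apply: locint_ctest; first by case: wu.
 by apply: ctestM; [apply: ctest_cdbar; exact: ctest_bump|exact: csmooth_pole].
rewrite -cintegN //; last exact: mdisk.
apply: eq_cinteg => z _; rewrite -mulrN -mulNr -/(cker c rho z).
have [->|/(cker_neq0 r0)/andP[h _]] := eqVneq (cker c rho z) 0; first by rewrite !mul0r.
rewrite pole_far //; apply: (letr he'); rewrite ler_sqrn ?nc_ge0 //; last lra.
by have := nc_distD (toC w) (toC z) (toC c); lra.
Qed.

Definition mass w e : R := Rintegral A Dk (pmass w e).
(** In polar coordinates this mass is pi. Only its positivity and its independence of the centre and
    the scale are needed. *)
Definition kappa : R := mass (0, 0) (1 / 16).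

Lemma toC00 : toC (0, 0) = 0 :> C. by []. Qed.

Lemma weak_pole_indep u w e e' : weakhol u -> nC w < 1 -> 0 < e -> 0 < e' ->
 16 * e <= dd w ^+ 2 -> 16 * e' <= dd w ^+ 2 ->
 ID (fun z => u z * rC (pmass w e z)) = ID (fun z => u z * rC (pmass w e' z)).
move=> wu w1 e0 e'0 h h'.
set rho := dd w / 2.
have r0 : 0 < rho by rewrite /rho; lra.
have hr : nC w + 2 * rho <= 1 by rewrite /rho; lra.
have hw : dC w w <= rho / 2 by rewrite subrr cabs0; lra.
have k (t : R) : 16 * t <= dd w ^+ 2 -> 4 * t <= rho ^+ 2 by rewrite /rho exprMn; lra.
by rewrite (cauchy_pole wu r0 hr hw e0 (k _ h)) (cauchy_pole wu r0 hr hw e'0 (k _ h')).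
Qed.

Lemma mass_indep w e e' : nC w < 1 -> 0 < e -> 0 < e' ->
 16 * e <= dd w ^+ 2 -> 16 * e' <= dd w ^+ 2 -> mass w e = mass w e'.
move=> w1 e0 e'0 h h'; have w1' : weakhol (fun _ : RR => 1 : C) by apply: holo_weak; exact: holo_cst.
have key (t : R) : mass w t = re (ID (fun z => (1 : C) * rC (pmass w t z))).
 by rewrite /=; congr Rintegral; apply/funext => z; rewrite mul1r mul0r subr0.
by rewrite !key (weak_pole_indep w1' w1 e0 e'0 h h').
Qed.

Lemma mass_shift w e : 0 < e -> nC w < 1 -> e <= dd w ^+ 2 -> mass w e = mass (0, 0) e.
move=> e0 w1 he.
have full v : nC v < 1 -> e <= dd v ^+ 2 ->
  (\int[A]_(z in Dk) (pmass v e z)%:E = \int[A]_z (pmass v e z)%:E)%E.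
 move=> v1 hv; rewrite integral_mkcond; apply: eq_integral => z _.
 rewrite patchE; case: ifPn => // /negP hz; rewrite pmass_far //.
 apply: (letr hv); rewrite ler_sqrn ?nc_ge0 ?subr_ge0 //; last exact: ltW.
 have : ~ nC z < 1 by move=> h; apply: hz; rewrite inE.
 by move/negP; rewrite -leNgt; have := nc_leB (toC z) (toC v); lra.
have e1 : e <= 1 by apply: (letr he); rewrite expr_le1 ?subr_ge0 ?(ltW w1) //; have := nc_ge0 (toC w); lra.
have z1 : nC (0 : R, 0 : R) < 1 by rewrite toC00 cabs0.
have z2 : e <= (dd (0 : R, 0 : R)) ^+ 2 by rewrite toC00 cabs0 subr0 expr1n.
rewrite /mass /Rintegral (full _ w1 he) (full _ z1 z2); apply: (congr1 fine).
rewrite [RHS](ge0_integral_shift (- w.1, - w.2)).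
- apply: eq_integral => z _; congr (_%:E); rewrite /pmass; congr (_ * dstep (_ * _ + _)).
 by rewrite /sqdist /pshift /= !subr0.
- apply/mEFP; have := csmooth_cmeas (@measurableT _ PT) (csmooth_rC (smooth_pmass (0, 0) e)).
 by case.
- by move=> z; rewrite lee_fin pmass_ge0.
Qed.

Lemma massE w e : nC w < 1 -> 0 < e -> 16 * e <= dd w ^+ 2 -> mass w e = kappa.
move=> w1 e0 he.
have le1 : (dd w) ^+ 2 <= 1.
 by rewrite expr_le1 ?subr_ge0 ?(ltW w1) //; have := nc_ge0 (toC w); lra.
have he' : e <= dd w ^+ 2 by lra.
rewrite (mass_shift e0 w1 he').
by apply: mass_indep; rewrite ?toC00 ?cabs0 ?subr0 ?expr1n; lra.
Qed.

Lemma kappa_gt0 : 0 < kappa.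
have e0 : 0 < 1 / 16 :> R by lra.
have k0 : 0 <= kappa by apply: Rintegral_ge0 => z _; exact: pmass_ge0.
rewrite lt_neqAle k0 andbT; apply/negP => /eqP k00.
have tm : ctest (fun z => rC (pmass (0, 0) (1 / 16) z)).
 by apply: (@ctest_pmass _ _ (1 / 2)); rewrite ?toC00 ?cabs0 //; lra.
have l1 : locint (fun _ : RR => 1 : C) by apply: holo_locint; exact: holo_cst.
have [imm _] : L1D (fun z => 1 * rC (pmass (0, 0) (1 / 16) z)).
 exact: locint_ctest.
have imm' : A.-integrable Dk (fun z => (pmass (0, 0) (1 / 16) z)%:E).
 by apply: eq_integrable imm => [|z _]; [exact: mdisk|rewrite mul1r].
have z0 : (\int[A]_(z in Dk) `|(pmass (0, 0) (1 / 16) z)%:E| = 0)%E.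
 under eq_integral do rewrite gee0_abs ?lee_fin ?pmass_ge0 //.
 rewrite -[LHS]fineK; last exact: (integrable_fin_num (@mdisk) imm').
 by move: k00; rewrite /kappa /mass /Rintegral => <-.
have /(ae_eq_integral_abs _ (@mdisk)) := z0.
move=> /(_ (measurable_int _ imm')) [N [mN N0 hN]].
(* For [e = 1/16] the integrand is positive where [1/32 < |z|^2 < 1/16]; a disk of radius [1/64]
   about [7/32] lies there and has positive area. *)
have sN : eball (7 / 32, 0) (1 / 64) `<=` N.
 move=> z hz; have {}hz : dC z (7 / 32, 0) < 1 / 64 := hz.
 have c7 : nC (7 / 32 : R, 0 : R) = 7 / 32.
  have -> : toC (7 / 32 : R, 0 : R) = rC (7 / 32) by [].
  by rewrite nc_rC ger0_norm //; lra.
 have h1 := nc_leB (toC z) (toC (7 / 32 : R, 0 : R)); have h2 := nc_leB (toC (7 / 32 : R, 0 : R)) (toC z).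
 rewrite nc_distC in h2; rewrite c7 in h1 h2.
 apply: hN => /= h; have zd : disk z by change (nC z < 1); lra.
 have := h zd; apply/eqP; rewrite eqe /pmass mulf_neq0 // ?gt_eqF //.
 apply: dstep_gt0; rewrite sqdistE toC00 subr0.
 have l : (13 / 64) ^+ 2 < nC z ^+ 2 by rewrite ltr_pXn2r ?nnegrE ?nc_ge0 //; lra.
 have r : nC z ^+ 2 < (15 / 64) ^+ 2 by rewrite ltr_pXn2r ?nnegrE ?nc_ge0 //; lra.
 move: l r; set a := cabs _ ^+ 2; clearbody a => l r; apply/andP; split; lra.
have : (((1 / 64) ^+ 2)%:E <= A N :> \bar R)%E.
 apply: (letr (@area_eball_ge (7 / 32, 0) (1 / 64) _)); first lra.
 by apply: le_measure; rewrite ?inE //; exact: meball.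
have -> : A N = 0%E by exact: N0.
by rewrite lee_fin; apply/negP; rewrite -ltNge; lra.
Qed.
End CauchyKernel.

(** * Cauchy's formula and differentiation of Cauchy integrals *)

Section CauchyFormula.
Implicit Types (g : RR -> C) (c : RR) (h : RR -> R) (rho M : R) (D : set PT).

Lemma rC_nat n : rC (n%:R : R) = n%:R.
by elim: n => [|n IH] //; rewrite -!natr1 rCD IH. Qed.

Lemma nc_nat n : cabs (n%:R : C) = n%:R.
by rewrite -rC_nat nc_rC ger0_norm. Qed.

Lemma cinteg_rC D h : cinteg D (fun z => rC (h z)) = rC (Rintegral A D h).
rewrite /cinteg; congr Complex; rewrite -[RHS](congr1 im (@cinteg0 D)) //.
Qed.

Lemma ctest_pmass_disk w e : nC w < 1 -> 0 < e -> 16 * e <= dd w ^+ 2 ->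
 ctest (fun z => rC (pmass w e z)).
move=> w1 e0 he; apply: (@ctest_pmass _ _ (dd w / 2)) => //; [lra| |lra].
by rewrite exprMn; lra.
Qed.

Lemma nc_cint_le D g h : measurable D -> cL1 D g ->
 (forall z, D z -> cabs (g z) <= h z) ->
 ((cabs (cinteg D g))%:E <= 2%:E * \int[A]_(z in D) (h z)%:E)%E.
move=> mD ig gh; apply: (letr (cinteg_bound mD ig)).
apply: leeMl; first by rewrite lee_fin.
by apply: le_int => z Dz; rewrite lee_fin ?nc_ge0 ?gh.
Qed.

Lemma pmass_avg u w e eps v : locint u -> nC w < 1 -> 0 < e ->
 16 * e <= dd w ^+ 2 -> 0 <= eps ->
 (forall z, dC z w ^+ 2 < e -> cabs (u z - v) <= eps) ->
 cabs (ID (fun z => u z * rC (pmass w e z)) - rC (kappa) * v) <= 2 * (eps * kappa).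
move=> lu w1 e0 he eps0 huv.
have tp := ctest_pmass_disk w1 e0 he.
have l1 : locint (fun _ : RR => 1 : C) by apply: holo_locint; exact: holo_cst.
have i1 : L1D (fun z => rC (pmass w e z)).
 apply: (eq_cL1 (@mdisk) _ (locint_ctest l1 tp)) => z _; exact: mul1r.
have iu := locint_ctest lu tp.
have e1 : rC (kappa) * v = ID (fun z => v * rC (pmass w e z)).
 rewrite (cintegZ _ (@mdisk) i1) cinteg_rC.
 by rewrite -[Rintegral _ _ _]/(mass w e) massE // mulrC.
have iv := cL1Z v (@mdisk) i1.
rewrite e1 -cintegB //; last exact: mdisk.
rewrite -lee_fin.
apply: (letr (@nc_cint_le _ _ (fun z => eps * pmass w e z) (@mdisk) (cL1B (@mdisk) iu iv) _)).
 move=> z _; rewrite -mulrBl cabsM nc_rC ger0_norm ?pmass_ge0 //.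
 have [->|h] := eqVneq (pmass w e z) 0; first by rewrite !mulr0.
 by rewrite lerMr ?pmass_ge0 // huv //; exact: pmass_near.
rewrite EFinM; apply: leeMl; first by rewrite lee_fin.
case: i1 => i1 _.
under eq_integral do rewrite EFinM.
rewrite (integralZl (@mdisk) i1) EFinM leeMl ?lee_fin //.
rewrite -[kappa](massE w1 e0 he) /mass /Rintegral fineK //.
exact: (integrable_fin_num (@mdisk) i1).
Qed.

Lemma ccontinuous_eballP u w : ccontinuous_at u w -> forall eps, 0 < eps -> exists2 d : R, 0 < d &
 forall z, dC z w < d -> cabs (u z - u w) <= eps.
move=> [/cont_eballP c1 /cont_eballP c2] eps e0.
have e2 : 0 < eps / 2 by rewrite divr_gt0.
have [d1 d10 h1] := c1 _ e2; have [d2 d20 h2] := c2 _ e2.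
exists (Num.min d1 d2) => [|z]; first by rewrite lt_min d10.
rewrite lt_min => /andP[/h1 k1 /h2 k2].
apply: (letr (nc_le_ReIm _)); rewrite ReD ReN ImD ImN.
by move: k1 k2; set a := `|_|; set b := `|_|; clearbody a b => k1 k2; lra.
Qed.

Lemma nc_small (x : C) (K : R) : 0 <= K -> (forall eps, 0 < eps -> cabs x <= K * eps) -> x = 0.
move=> K0 h; apply/eqP; rewrite -nc_eq0 eq_le nc_ge0 andbT leNgt; apply/negP => x0.
have e0 : 0 < cabs x / (2 * (K + 1)) by rewrite divr_gt0 //; lra.
have := h _ e0; apply/negP; rewrite -ltNge.
have K1 : 0 < 2 * (K + 1) by lra.
have : 0 <= K * cabs x by rewrite mulr_ge0 // ltW.
by rewrite mulrA ltr_pdivrMr // ; move: x0; set t := cabs x; lra.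
Qed.

(** At a point of continuity the averages of [u] against [pmass w e] tend to [kappa u(w)], while
    [cauchy_pole] shows that they are all equal to the annulus integral. *)
Lemma cauchy_formula u c w rho : weakhol u -> ccontinuous_at u w -> 0 < rho ->
 nC c + 2 * rho <= 1 -> dC w c <= rho / 2 ->
 rC (kappa) * u w = ID (fun z => u z * (cker c rho z / tz z w)).
move=> wu cu r0 hc hw; have k0 := kappa_gt0.
have w1 : nC w + rho < 1 by have := nc_leB (toC w) (toC c); lra.
apply/esym/eqP; rewrite -subr_eq0; apply/eqP; apply: (@nc_small _ (2 * kappa)); first lra.
move=> eps e0; have [d d0 hd] := ccontinuous_eballP cu e0.
set s := Num.min d (rho / 4); have s0 : 0 < s by rewrite /s lt_min d0; lra.
have sd : s <= d by rewrite /s ge_min lexx.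
have sr : s <= rho / 4 by rewrite /s ge_min lexx orbT.
have s2 : s ^+ 2 <= (rho / 4) ^+ 2 by rewrite ler_sqrn //; lra.
have r2 : rho ^+ 2 <= dd w ^+ 2 by rewrite ler_sqrn //; lra.
have s20 : 0 < s ^+ 2 by rewrite exprn_gt0.
rewrite -(@cauchy_pole _ _ w _ (s ^+ 2) wu r0 hc hw s20); last by rewrite exprMn in s2; lra.
rewrite -mulrA (mulrC (kappa)); apply: pmass_avg => //; [by case: wu|lra| |exact: ltW|].
 by rewrite exprMn in s2; lra.
move=> z; rewrite ltr_pXn2r ?nnegrE ?nc_ge0 //; last exact: ltW.
by move=> h; apply: hd; exact: ltle h sd.
Qed.

Lemma cL1_mul_supp D g (h : RR -> C) M : measurable D -> cL1 D g -> cmeas D h ->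
 (forall z, D z -> g z != 0 -> cabs (h z) <= M) -> cL1 D (fun z => g z * h z).
move=> mD ig mh hM; have mg := cL1_meas mD ig.
apply: (le_cL1 mD (g := fun z => rC M * g z)); first exact: cmeasM.
 move=> z Dz; rewrite !cabsM nc_rC mulrC.
 have [->|g0] := eqVneq (g z) 0; first by rewrite cabs0 !mulr0.
 by rewrite lerMr ?nc_ge0 //; apply: letr (ler_norm _); exact: hM.
exact: cL1Z.
Qed.

(** Differentiation under the integral sign: a quadratic remainder, uniform on the support of [g],
    integrates to a quadratic remainder. *)
Lemma cint_cderiv g (K : RR -> RR -> C) L w0 (d M : R) : L1D g ->
 0 < d -> 0 <= M ->
 (forall w, dC w w0 < d -> L1D (fun z => g z * K z w)) ->
 L1D (fun z => g z * L z) ->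
 (forall z w, g z != 0 -> dC w w0 < d ->
  cabs (K z w - K z w0 - tz w w0 * L z) <= M * dC w w0 ^+ 2) ->
 cderiv (fun w => ID (fun z => g z * K z w)) w0 (ID (fun z => g z * L z)).
move=> ig d0 M0 iK iL hK eps e0.
have [_ gfin] := (cL1P g (@mdisk)).1 ig.
set I := (\int[A]_(z in Dk) (cabs (g z))%:E)%E in gfin.
have I0 : (0 <= I)%E by apply: integral_ge0 => z _; rewrite lee_fin nc_ge0.
have IE : I = (fine I)%:E by rewrite fineK // ge0_fin_numE.
have i0 : 0 <= fine I by exact: fine_ge0.
set B := 2 * (M * fine I) + 1; have B0 : 0 < B by rewrite ltr_wpDl // mulr_ge0 // mulr_ge0.
exists (Num.min d (eps / B)) => [|w]; first by rewrite lt_min d0 divr_gt0.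
rewrite lt_min => /andP[wd wB]; set h := cabs _ in wd wB *.
have md := @mdisk.
have i1 := iK _ wd; have i2 : L1D (fun z => g z * K z w0) by apply: iK; rewrite subrr cabs0.
have i3 := cL1Z (tz w w0) md iL.
rewrite mulrC -cintegZ // -cintegB // -cintegB //; last exact: cL1B.
have h0 : 0 <= h by exact: nc_ge0.
apply: (le_via (2 * (M * h ^+ 2 * fine I))).
 rewrite -lee_fin; apply: (letr (@nc_cint_le _ _ (fun z => M * h ^+ 2 * cabs (g z)) md _ _)).
 - exact: cL1B (cL1B md i1 i2) i3.
 - move=> z _; rewrite mulrCA -!mulrBr cabsM mulrC.
  have [->|gz] := eqVneq (g z) 0; first by rewrite cabs0 !mulr0.
  by rewrite lerMr ?nc_ge0 // hK.
 - rewrite EFinM; apply: leeMl; first by rewrite lee_fin.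
  under eq_integral do rewrite EFinM.
  rewrite (integralZl md); last exact: cL1_cabs.
  by rewrite -/I {1}IE -EFinM.
have -> : 2 * (M * h ^+ 2 * fine I) = h * (2 * (M * fine I)) * h by ring.
apply: lerMr => //.
have : h * B <= eps by rewrite -ler_pdivlMr // ltW.
by rewrite /B mulrDr mulr1 => hB; apply: letr hB; rewrite lerDl.
Qed.

Lemma cmeas_toCB D w : cmeas D (fun z => toC z - toC w).
by apply: cmeasB; [exact: cmeas_toC|exact: cmeas_cst]. Qed.

Section Kernel.
Variables (g : RR -> C) (w0 : RR) (d : R).
Hypotheses (ig : L1D g) (d0 : 0 < d)
 (gd : forall z, g z != 0 -> 2 * d <= dC z w0).

Let far z w : g z != 0 -> dC w w0 < d -> d <= dC z w.
by move=> /gd h1 h2; have := nc_distD (toC w) (toC z) (toC w0); lra. Qed.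

Lemma cL1_kernel n w : dC w w0 < d ->
 L1D (fun z => g z * (tz z w ^+ n)^-1).
move=> hw; apply: (@cL1_mul_supp _ _ _ ((d ^+ n)^-1)) => //; first exact: mdisk.
 by apply: cmeasV; apply: cmeasX; exact: cmeas_toCB.
move=> z _ gz; rewrite cabsV cabsX lef_pV2 ?posrE ?exprn_gt0 //; last by apply: ltle d0 (far gz hw).
by apply: lerXn2r; rewrite ?nnegrE ?nc_ge0 ?(ltW d0) //; exact: far gz hw.
Qed.

Lemma kernel_cderiv1 : cderiv (fun w => ID (fun z => g z * (tz z w)^-1)) w0
 (ID (fun z => g z * (tz z w0 ^+ 2)^-1)).
have w00 : dC w0 w0 < d by rewrite subrr cabs0.
apply: (@cint_cderiv _ _ _ _ d ((d ^+ 3)^-1)) => //.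
- by rewrite invr_ge0 exprn_ge0 // ltW.
- exact: (@cL1_kernel 1).
- exact: cL1_kernel.
move=> z w gz hw; have h1 := far gz hw; have h2 := far gz w00.
have n1 : toC z - toC w != 0 by rewrite -nc_gt0; exact: ltle d0 h1.
have n2 : toC z - toC w0 != 0 by rewrite -nc_gt0; exact: ltle d0 h2.
move: n1 n2 h1 h2; set h := toC w - toC w0.
have -> : toC z - toC w = tz z w0 - h by rewrite /h; ring.
move: (tz z w0) h => a h n1 n2 h1 h2.
have -> : (a - h)^-1 - a^-1 - h * (a ^+ 2)^-1 = h ^+ 2 * ((a - h) * a ^+ 2)^-1 by field; rewrite n2.
rewrite cabsM cabsX mulrC lerMr ?exprn_ge0 ?nc_ge0 //.
rewrite cabsV lef_pV2 ?posrE ?exprn_gt0 ?nc_gt0 ?mulf_neq0 ?expf_neq0 //.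
by rewrite cabsM cabsX exprS ler_pM ?exprn_ge0 ?(ltW d0) // ler_sqrn ?nc_ge0 // ltW.
Qed.

Lemma kernel_cderiv2 : cderiv (fun w => ID (fun z => g z * (tz z w ^+ 2)^-1)) w0
 (ID (fun z => g z * (2 * (tz z w0 ^+ 3)^-1))).
have w00 : dC w0 w0 < d by rewrite subrr cabs0.
apply: (@cint_cderiv _ _ _ _ d (4 * (d ^+ 4)^-1)) => //.
- by rewrite mulr_ge0 // invr_ge0 exprn_ge0 // ltW.
- exact: cL1_kernel.
- apply: (eq_cL1 (@mdisk) (f := fun z => 2 * (g z * (tz z w0 ^+ 3)^-1))).
  by move=> z _; rewrite mulrCA.
 by apply: cL1Z; [exact: mdisk|exact: cL1_kernel].
move=> z w gz hw; have h1 := far gz hw; have h2 := gd gz.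
have n1 : toC z - toC w != 0 by rewrite -nc_gt0; exact: ltle d0 h1.
have n2 : toC z - toC w0 != 0 by rewrite -nc_gt0; apply: ltle h2; rewrite mulr_gt0.
move: n1 n2 h1 h2 hw; set h := toC w - toC w0.
have -> : toC z - toC w = tz z w0 - h by rewrite /h; ring.
move: (tz z w0) h => a h n1 n2 h1 h2 h3.
(* The last factor has modulus at most [4], because [|h| < d] and [|a| >= 2 d]. *)
have -> : ((a - h) ^+ 2)^-1 - (a ^+ 2)^-1 - h * (2 * (a ^+ 3)^-1) =
  h ^+ 2 * (((a - h) ^+ 2 * a ^+ 2)^-1 * ((3 * a - 2 * h) / a)) by field; rewrite n2.
rewrite cabsM cabsX mulrC lerMr ?exprn_ge0 ?nc_ge0 //.
rewrite cabsM mulrC; apply: ler_pM; rewrite ?nc_ge0 //.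
 rewrite nc_div ler_pdivrMr ?nc_gt0 //; apply: (letr (cabsB _ _)); rewrite !cabsM.
 rewrite !nc_nat; lra.
rewrite cabsV lef_pV2 ?posrE ?exprn_gt0 ?nc_gt0 ?mulf_neq0 ?expf_neq0 //.
have h2' : d <= cabs a by apply: letr h2; rewrite ler_peMl ?(ltW d0) // ler1n.
rewrite cabsM !cabsX (exprD d 2 2); apply: ler_pM; [exact/exprn_ge0/ltW|exact/exprn_ge0/ltW| |]; rewrite ler_sqrn ?nc_ge0 //; exact: ltW.
Qed.
End Kernel.

Lemma cker_supp c rho u z : 0 < rho -> u z * cker c rho z != 0 -> 2 * (rho / 2) <= dC z c.
by move=> r0; rewrite mulf_eq0 negb_or => /andP[_ /(cker_neq0 r0)/andP[/ltW h _]]; lra.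
Qed.

Lemma locint_cker u c rho : locint u -> 0 < rho -> nC c + 2 * rho <= 1 ->
 L1D (fun z => u z * cker c rho z).
by move=> lu r0 hc; apply: locint_ctest => //; exact: ctest_cker. Qed.

(** The annulus stays away from [w], so any function given locally by the Cauchy integral of a
    locally integrable [u] is holomorphic. *)
Lemma cauchy_holo u f : locint u ->
 (forall c, Dk c -> exists2 rho, 0 < rho & nC c + 2 * rho <= 1 /\
  forall w, dC w c < rho / 2 ->
   f w = (rC (kappa))^-1 * ID (fun z => u z * (cker c rho z / tz z w))) ->
 holo Dk f.
move=> lu h c dc; have [rho r0 [hc hf]] := h c dc.
set l := ID (fun z => u z * cker c rho z * (tz z c ^+ 2)^-1).
exists (0 * ID (fun z => u z * cker c rho z * (tz z c)^-1) + (rC (kappa))^-1 * l).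
have r2 : 0 < rho / 2 by lra.
have k1 := kernel_cderiv1 (locint_cker lu r0 hc) r2 (fun z => @cker_supp c rho u z r0).
apply: cderiv_eq (erefl _) (cderivM (cderiv_cst (rC (kappa))^-1 c) k1).
exists (rho / 2) => // w hw; rewrite hf //; congr (_ * _); apply: eq_cinteg => z _; exact/esym/mulrA.
Qed.
End CauchyFormula.

(** * Weyl's lemma *)

Section Weyl.
Implicit Types (c : RR) (y : R) (h : RR -> R).

(** The average of [u] at a scale proportional to the distance to the circle. By independence of the
    scale it is locally a Cauchy integral over a fixed annulus, hence holomorphic; it is the
    holomorphic representative of [u]. *)
Definition weyl u w : C :=
 (rC (kappa))^-1 * ID (fun z => u z * rC (pmass w ((dd w / 16) ^+ 2) z)).

Lemma weyl_holo u : weakhol u -> holo Dk (weyl u).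
move=> wu; apply: (@cauchy_holo u); first by case: wu.
move=> c dc; have {}dc : nC c < 1 := dc.
exists (dd c / 2); first lra.
split=> [|w hw]; first lra.
have h1 := nc_leB (toC w) (toC c); have h2 := nc_leB (toC c) (toC w); rewrite nc_distC in h2.
rewrite /weyl; congr (_ * _); apply: cauchy_pole => //; try lra.
 by rewrite exprn_gt0 //; lra.
have : (dd w / 16) ^+ 2 <= (dd c / 4) ^+ 2 by rewrite ler_sqrn //; lra.
by rewrite !exprMn; lra.
Qed.

Lemma area_vline (x : R) : A [set z : RR | z.1 = x] = 0%E.
have -> : [set z : RR | z.1 = x] = [set x] `*` setT by apply/seteqP; split => [z /= ->|z [/= ->]].
rewrite [LHS]product_measure1E //.
by rewrite [X in (X * _)%E]lebesgue_measure_set1 mul0e.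
Qed.

Lemma area_hline y : A [set z : RR | z.2 = y] = 0%E.
have -> : [set z : RR | z.2 = y] = setT `*` [set y] by apply/seteqP; split => [z /= ->|z [_ /= ->]].
rewrite [LHS]product_measure1E //.
by rewrite [X in (_ * X)%E]lebesgue_measure_set1 mule0.
Qed.

Lemma meas_vline (x : R) : measurable ([set z : RR | z.1 = x] : set PT).
have -> : [set z : RR | z.1 = x] = [set x] `*` setT by apply/seteqP; split => [z /= ->|z [/= ->]].
by apply: measurableX => //; exact: measurable_set1.
Qed.

Lemma meas_hline y : measurable ([set z : RR | z.2 = y] : set PT).
have -> : [set z : RR | z.2 = y] = setT `*` [set y] by apply/seteqP; split => [z /= ->|z [_ /= ->]].
by apply: measurableX => //; exact: measurable_set1.
Qed.

Lemma side_const (x a b : R) : `|b - a| < `|a - x| -> (x < b) = (x < a).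
have [h|h|->] := ltgtP a x; last by rewrite subrr normr0 normr_lt0.
 rewrite (ltr0_norm (x := a - x)) ?subr_lt0 // ltr_norml => /andP[h1 h2].
 by apply/negbTE; rewrite -leNgt; lra.
by rewrite (gtr0_norm (x := a - x)) ?subr_gt0 // ltr_norml => /andP[h1 h2]; lra.
Qed.

(** Off the four side lines, which are null sets, the indicator of the rectangle is locally
    constant, so its mollifications are eventually exact. *)
Lemma rect_locally_const (x0 x1 y0 y1 : R) z : z.1 != x0 -> z.1 != x1 -> z.2 != y0 -> z.2 != y1 ->
 exists2 d : R, 0 < d & forall w, dC w z < d -> rect x0 x1 y0 y1 w <-> rect x0 x1 y0 y1 z.
move=> n1 n2 n3 n4.
exists (Num.min (Num.min `|z.1 - x0| `|z.1 - x1|) (Num.min `|z.2 - y0| `|z.2 - y1|)).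
 by rewrite !lt_min !normr_gt0 !subr_eq0 n1 n2 n3 n4.
move=> w; rewrite !lt_min => /andP[/andP[h1 h2] /andP[h3 h4]].
have hx : `|w.1 - z.1| <= dC w z by have := Re_le_cabs (tz w z); rewrite ReD ReN.
have hy : `|w.2 - z.2| <= dC w z by have := Im_le_cabs (tz w z); rewrite ImD ImN.
have e1 := side_const (lelt hx h1); have e2 := side_const (lelt hx h2).
have e3 := side_const (lelt hy h3); have e4 := side_const (lelt hy h4).
by rewrite /rect /= !in_itv /= e1 e3 !leNgt e2 e4.
Qed.

Lemma meas_dstep : mfun setT (dstep : measurableTypeR R -> measurableTypeR R).
have s : smooth (fun z => dstep z.1) by apply: smooth_dstep; exact: smooth_fst.
have [m _] := csmooth_cmeas (@measurableT _ PT) (csmooth_rC s).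
have mp : mfun setT (fun x : measurableTypeR R => (x, 0) : PT).
 by apply/measurable_fun_pairP; split; [exact: measurable_id|exact: measurable_cst].
exact: (mcomp m mp).
Qed.

Lemma meas_coordB : mfun setT (fun v : PP => v.1.1 - v.2.1) /\ mfun setT (fun v : PP => v.1.2 - v.2.2).
have m1 : mfun setT (fun v : PP => v.1) by exact: measurable_fst.
have m2 : mfun setT (fun v : PP => v.2) by exact: measurable_snd.
have f1 : mfun setT (fun v : PT => v.1) by exact: measurable_fst.
have f2 : mfun setT (fun v : PT => v.2) by exact: measurable_snd.
by split; apply: measurable_funB; [exact: (mcomp f1 m1)|exact: (mcomp f1 m2)|exact: (mcomp f2 m1)|exact: (mcomp f2 m2)].
Qed.
Lemma meas_pmass2 e : mfun setT (fun v : PP => pmass v.1 e v.2).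
apply: mfunM; first exact: measurable_cst.
apply: (mcomp meas_dstep); apply: measurable_funD; last exact: measurable_cst.
apply: mfunM; first exact: measurable_cst.
have [h1 h2] := meas_coordB; have ms := @measurable_swap _ _ PT PT.
by apply: measurable_funD; apply: measurable_funX; [exact: (mcomp h1 ms)|exact: (mcomp h2 ms)].
Qed.

Section OnRect.
Variables (u : RR -> C) (r x0 x1 y0 y1 : R).
Hypotheses (wu : weakhol u) (r1 : r < 1) (r0 : 0 < r).
Let Q := rect x0 x1 y0 y1.
Hypothesis hQ : forall w, Q w -> nC w <= r.

Let s : R := (1 + r) / 2.
Let ee (n : nat) : R := ((1 - r) / 16) ^+ 2 / n.+1%:R.
(** Equals [kappa] times the indicator of [Q] mollified at the squared scale [ee n], which tends to
    [0]. *)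
Let M (n : nat) z : R := Rintegral A Q (fun w => pmass w (ee n) z).

Let ee0 n : 0 < ee n.
by rewrite /ee divr_gt0 // exprn_gt0 //; (move: r1 r0; lra). Qed.

Let eele n : ee n <= ((1 - r) / 16) ^+ 2.
by rewrite /ee ler_pdivrMr // ler_peMr ?exprn_ge0 ?ler1n //; (move: r1 r0; lra). Qed.

Let eeS n z : nC z <= s -> 16 * ee n <= dd z ^+ 2.
move=> hz; apply: (le_via (((1 - r) / 4) ^+ 2)).
 by have := eele n; rewrite !exprMn; (move: r1 r0; lra).
by rewrite ler_sqrn //; move: hz; rewrite /s; (move: r1 r0; lra).
Qed.

Let mQ : measurable Q. exact: mrect. Qed.

Let QD : Q `<=` Dk.
by move=> w /hQ h; change (nC w < 1); (move: r1 r0; lra). Qed.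

Let fQ : (A Q < +oo)%E. exact: area_lty mQ QD. Qed.

Let far n z w : s <= nC z -> Q w -> pmass w (ee n) z = 0.
move=> hz /hQ hw; apply: pmass_far => //; apply: (letr (eele n)).
by rewrite ler_sqrn ?nc_ge0 //; have := nc_leB (toC z) (toC w); move: hz; rewrite /s; (move: r1 r0; lra).
Qed.

Let M_far n z : s <= nC z -> M n z = 0.
move=> hz; transitivity (Rintegral A Q (fun _ => 0 : R)); last by rewrite Rintegral_cst // mul0r.
by apply: eq_Rintegral => w /set_mem; exact: far.
Qed.

Let ctm n z : nC z <= s -> ctest (fun w => rC (pmass z (ee n) w)).
by move=> hz; apply: ctest_pmass_disk => //; [move: hz; rewrite /s; (move: r1 r0; lra)|exact: eeS]. Qed.

Let l1 : locint (fun _ : RR => 1 : C).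
by apply: holo_locint; exact: holo_cst. Qed.

Let int_pm n z : nC z <= s -> A.-integrable Dk (fun w => (pmass z (ee n) w)%:E).
move=> hz; have [i1 _] := locint_ctest l1 (ctm n hz).
by apply: eq_integrable i1 => [|w _]; [exact: mdisk|rewrite mul1r].
Qed.

Let M_bound n z : 0 <= M n z <= kappa.
apply/andP; split; first by apply: Rintegral_ge0 => w _; exact: pmass_ge0.
have [hz|hz] := leP s (nC z); first by rewrite M_far // ltW // kappa_gt0.
have {}hz := ltW hz.
have z1 : nC z < 1 by move: hz; rewrite /s; (move: r1 r0; lra).
rewrite -(massE z1 (ee0 n) (eeS n hz)).
rewrite /M /mass /Rintegral; apply: fine_le.
- apply: (integrable_fin_num mQ); apply: (integrableS (@mdisk)) (QD) _ => //.
 apply: eq_integrable (int_pm n hz) => [|w _]; [exact: mdisk|by rewrite pmass_sym].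
- exact: (integrable_fin_num (@mdisk)) (int_pm n hz).
under eq_integral do rewrite pmass_sym.
by apply: int_subset => // w _; rewrite lee_fin pmass_ge0.
Qed.

Let M_lim z : z.1 != x0 -> z.1 != x1 -> z.2 != y0 -> z.2 != y1 ->
 exists n0, forall n, (n0 <= n)%N -> M n z = kappa * (z \in Q)%:R.
move=> n1 n2 n3 n4.
have [hz|hz] := leP s (nC z).
 exists 0%N => n _; rewrite M_far //.
 suff -> : (z \in Q) = false by rewrite mulr0.
 by apply/negP => /set_mem /hQ h; move: hz; rewrite /s; (move: r1 r0; lra).
have {}hz := ltW hz.
have [d d0 hd] := rect_locally_const n1 n2 n3 n4.
have d20 : 0 < d ^+ 2 by rewrite exprn_gt0.
pose n0 := Num.bound (((1 - r) / 16) ^+ 2 / d ^+ 2); exists n0 => n hn.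
have hee : ee n <= d ^+ 2.
 rewrite /ee ler_pdivrMr // [_ * _%:R]mulrC -ler_pdivrMr //.
 have h := archi_boundP (divr_ge0 (sqr_ge0 ((1 - r) / 16)) (ltW d20)).
 by apply: (letr (ltW h)); rewrite ler_nat; exact: leq_trans hn _.
have e w : (fun w => (pmass w (ee n) z)) w * (w \in Q)%:R = pmass z (ee n) w * (z \in Q)%:R.
 rewrite /= pmass_sym; have [->|h] := eqVneq (pmass z (ee n) w) 0; first by rewrite !mul0r.
 congr (_ * _%:R); have := ltle (pmass_near (ee0 n) h) hee.
 rewrite ltr_pXn2r ?nnegrE ?nc_ge0 //; last exact: ltW.
 by move=> /hd [h1 h2]; congr nat_of_bool; apply/idP/idP => /set_mem h'; apply/mem_set; [exact: h1|exact: h2].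
transitivity (Rintegral A Dk (fun w => pmass z (ee n) w * (z \in Q)%:R)).
 rewrite /M -{1}(setIidr QD) Rintegral_mkcondr; apply: eq_Rintegral => w _.
 rewrite -e patchE; case: ifP; rewrite ?mulr1 ?mulr0 //.
rewrite (RintegralZr _ (@mdisk) (int_pm n hz)).
by rewrite -[Rintegral _ _ _]/(mass z (ee n)) massE ?eeS //; move: hz; rewrite /s; (move: r1 r0; lra).
Qed.

Let weylE n w : Q w -> rC (kappa) * weyl u w = ID (fun z => u z * rC (pmass w (ee n) z)).
move=> Qw; have hw := hQ Qw; rewrite /weyl mulrA mulfV ?mul1r; last first.
 by rewrite rC_eq0 gt_eqF // kappa_gt0.
have w1 : nC w < 1 by (move: r1 r0; lra).
have e0 : 0 < (dd w / 16) ^+ 2 by rewrite exprn_gt0 //; (move: r1 r0; lra).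
apply: weak_pole_indep => //.
 by rewrite exprMn; have := exprn_ge0 2 (ltW e0); have := sqr_ge0 (dd w); (move: r1 r0; lra).
by apply: eeS; rewrite /s; (move: r1 r0; lra).
Qed.

Let lu : locint u. by case: wu. Qed.
Let s1 : s < 1. by rewrite /s; (move: r1 r0; lra). Qed.

Let fubini_weyl n : cinteg Q (fun w => rC (kappa) * weyl u w) = ID (fun z => u z * rC (M n z)).
have md := @mdisk; have ms := @mdball s.
have sD : dball s `<=` Dk by apply: dball_disk; exact: ltW.
have lus := lu s1.
have [mu _] := (cL1P u ms).1 lus.
pose K w z : C := u z * rC (pmass w (ee n) z).
have [B B0 hB] := dstep_bounded.
have B2 : 0 <= 2 / ee n * B by apply: mulr_ge0; [apply: divr_ge0 => //; exact: ltW (ee0 n)|exact: ltW].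
have pmB w z : pmass w (ee n) z <= 2 / ee n * B.
 by rewrite /pmass lerMl // divr_ge0 // ltW.
have [_ _] : [/\ cL1 Q (fun w => cinteg (dball s) (K w)), cL1 (dball s) (fun z => cinteg Q (K^~ z)) &
   cinteg Q (fun w => cinteg (dball s) (K w)) = cinteg (dball s) (fun z => cinteg Q (K^~ z))].
 apply: cfubini => //.
  have mp : cmeas2 (Q `*` dball s) (fun w z => rC (pmass w (ee n) z)).
   split=> /=; last exact: measurable_cst.
   by apply: measurable_funTS; exact: meas_pmass2.
  have muu : cmeas2 (Q `*` dball s) (fun w z => u z).
   case: mu => m1 m2; have ms2 : mfun (Q `*` dball s) (fun v : PP => v.2) by apply: measurable_funTS; exact: measurable_snd.
   have imm : (fun v : PP => v.2) @` (Q `*` dball s) `<=` dball s by move=> _ [[a b] [/= _ hb] <-].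
   by split; [exact: (measurable_comp ms imm m1 ms2)|exact: (measurable_comp ms imm m2 ms2)].
  case: mp => p1 p2; case: muu => q1 q2; split.
   by under eq_fun do rewrite ReM; apply: measurable_funB; apply: mfunM.
  by under eq_fun do rewrite ImM; apply: measurable_funD; apply: mfunM.
 have [_ ifin] := (cL1P u ms).1 lus.
 set I := (\int[A]_(z in dball s) (cabs (u z))%:E)%E in ifin.
 have I0 : (0 <= I)%E by apply: integral_ge0 => z _; rewrite lee_fin nc_ge0.
 apply: (@lelt _ _ (\int[A]_(w in Q) cst ((2 / ee n * B)%:E * I) w)%E).
  apply: le_int => w _; first by apply: integral_ge0 => z _; rewrite lee_fin nc_ge0.
  rewrite /= /I -ge0_integralZl_EFin //.
  - apply: le_int => z _; first by rewrite lee_fin nc_ge0.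
   rewrite -EFinM lee_fin.
   by rewrite /K cabsM nc_rC mulrC ger0_norm ?pmass_ge0 // lerMr ?nc_ge0.
  - by move=> z _; rewrite lee_fin nc_ge0.
  - by apply/mEFP; exact: cmeas_cabs.
 rewrite integral_cst //; apply: lte_mul_pinfty => //.
 - by apply: mule_ge0 => //; rewrite lee_fin.
 - by rewrite ge0_fin_numE ?lte_mul_pinfty //; apply: mule_ge0 => //; rewrite lee_fin.
have e1 : cinteg Q (fun w => rC (kappa) * weyl u w) = cinteg Q (fun w => cinteg (dball s) (K w)).
 apply: eq_cinteg => w Qw; rewrite (weylE n Qw); apply: (cint_dball (ltW s1)) => z hz.
 by rewrite far // rC0 mulr0.
have e2 : ID (fun z => u z * rC (M n z)) = cinteg (dball s) (fun z => cinteg Q (K^~ z)).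
 rewrite (@cint_dball _ s (ltW s1)); last by move=> z hz; rewrite M_far // rC0 mulr0.
 apply: eq_cinteg => z hz; have {}hz : nC z < s := hz.
 rewrite /K cintegZ //; first by rewrite cinteg_rC.
 have tp := ctm n (ltW hz).
 have i1 := locint_ctest l1 tp.
 apply: (cL1S mQ md) => //; apply: (eq_cL1 md _ i1) => w _.
 by rewrite mul1r pmass_sym.
by rewrite e1 e2.
Qed.

Let meas_M n : mfun (dball s) (M n).
have ms := @mdball s.
have [B B0 hB] := dstep_bounded.
have B2 : 0 <= 2 / ee n * B by apply: mulr_ge0; [apply: divr_ge0 => //; exact: ltW (ee0 n)|exact: ltW].
have AD : (A (dball s) \is a fin_num).
 by rewrite ge0_fin_numE // area_lty //; apply: dball_disk; exact: ltW.
have [||_ i _] := @rfubini Q (dball s) (fun v => pmass v.1 (ee n) v.2) mQ ms.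
- by apply: measurable_funTS; exact: meas_pmass2.
- apply: (@lelt _ _ (\int[A]_(w in Q) cst ((2 / ee n * B)%:E * A (dball s)) w)%E).
  apply: le_int => w _; first by apply: integral_ge0 => z _; rewrite lee_fin.
  rewrite -(integral_cst A ms); apply: le_int => z _; first by rewrite lee_fin.
  by rewrite /= lee_fin ger0_norm ?pmass_ge0 // /pmass lerMl // divr_ge0 // ltW.
 rewrite integral_cst //; apply: lte_mul_pinfty => //.
 - by apply: mule_ge0 => //; rewrite lee_fin.
 - by rewrite fin_numM.
by apply/mEFP; exact: measurable_int i.
Qed.

(** Fubini transfers the mollification from [u] to the indicator of [Q], and dominated convergence
    removes it: [M n] tends to [kappa] times that indicator off the sides and is bounded by
    [kappa]. *)
Lemma weyl_rect : cinteg Q (fun w => weyl u w) = cinteg Q u.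
have k0 := kappa_gt0; have md := @mdisk; have ms := @mdball s.
have kn : rC (kappa) != 0 by rewrite rC_eq0 gt_eqF.
have sD : dball s `<=` Dk by apply: dball_disk; exact: ltW.
have Qs : Q `<=` dball s by move=> w /hQ h; change (nC w < s); rewrite /s; (move: r1 r0; lra).
have ius := lu s1; have iuQ := cL1S mQ ms Qs ius.
have iwQ : cL1 Q (weyl u) by exact: cL1S mQ ms Qs (holo_locint (weyl_holo wu) s1).
apply: (mulfI kn); rewrite -!cintegZ //.
pose g n z : R := M n z - kappa * (z \in Q)%:R.
have mg n : mfun (dball s) (g n).
 apply: measurable_funB; first exact: meas_M.
 apply: mfunM; first exact: measurable_cst.
 exact: (measurable_indic).
have gb n z : `|g n z| <= kappa.
 have /andP[h1 h2] := M_bound n z.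
 by rewrite /g ler_norml; case: (z \in Q); rewrite ?mulr1 ?mulr0; lra.
have iug n : cL1 (dball s) (fun z => u z * rC (g n z)).
 apply: (cL1_mul_supp (M := kappa)) => //; first exact: cmeas_rC.
 by move=> z _ _; rewrite nc_rC.
have key n : cinteg Q (fun w => rC (kappa) * weyl u w) - cinteg Q (fun z => rC (kappa) * u z) =
  cinteg (dball s) (fun z => u z * rC (g n z)).
 rewrite (fubini_weyl n) (@cint_dball _ s (ltW s1)); last by move=> z hz; rewrite M_far // rC0 mulr0.
 have -> : cinteg Q (fun z => rC (kappa) * u z) = cinteg (dball s) (fun z => u z * rC (kappa * (z \in Q)%:R)).
  rewrite [RHS](cinteg_sub mQ ms Qs); last by move=> z _ hz; rewrite memNset // mulr0 rC0 mulr0.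
  by apply: eq_cinteg => z hz; rewrite mem_set // mulr1 mulrC.
 rewrite -cintegB //.
 - by apply: eq_cinteg => z _; rewrite -mulrBr /g rCD rCN.
 - apply: (cL1_mul_supp (M := kappa)) => //; first by apply: cmeas_rC; exact: meas_M.
  move=> z _ _; have /andP[h1 h2] := M_bound n z; rewrite nc_rC (ger0_norm h1); exact: h2.
 - apply: (cL1_mul_supp (M := kappa)) => //.
   apply: cmeas_rC; apply: mfunM; first exact: measurable_cst.
   exact: measurable_indic.
  move=> z _ _; rewrite nc_rC ger0_norm; last by rewrite mulr_ge0 // ltW.
  by case: (z \in Q); rewrite ?mulr1 ?mulr0 // ltW.
have [|||||_ _ lim0] := @dominated_convergence _ _ R A (dball s) ms (fun n z => (cabs (u z * rC (g n z)))%:E)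
  (cst 0%E) (fun z => (kappa)%:E * (cabs (u z))%:E)%E.
- by move=> n; apply/mEFP; apply: cmeas_cabs; apply: cL1_meas.
- exact: measurable_cst.
- exists ([set z | z.1 = x0] `|` [set z | z.1 = x1] `|` ([set z | z.2 = y0] `|` [set z | z.2 = y1])); split.
 + by apply: measurableU; apply: measurableU; (exact: meas_vline || exact: meas_hline).
 + by apply: null_set_setU; [apply: measurableU; exact: meas_vline|apply: measurableU; exact: meas_hline
   |apply: null_set_setU; [exact: meas_vline|exact: meas_vline|exact: area_vline|exact: area_vline]
   |apply: null_set_setU; [exact: meas_hline|exact: meas_hline|exact: area_hline|exact: area_hline]].
 + move=> z /= hz; apply: contrapT => hb; apply: hz => _.
  have [n0 hn0] : exists n0, forall n, (n0 <= n)%N -> M n z = kappa * (z \in Q)%:R.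
   by apply: M_lim; apply/eqP => h; apply: hb; [left; left|left; right|right; left|right; right].
  apply: cvg_near_cst; exists n0 => // n /= hn; rewrite /g hn0 // subrr rC0 mulr0 cabs0 //.
- apply: integrableZl => //; exact: cL1_cabs.
- by apply: aeW => z n _; rewrite /= -EFinM lee_fin ger0_norm ?nc_ge0 // cabsM nc_rC mulrC lerMr ?nc_ge0.
rewrite integral_cst // mul0e in lim0.
apply/eqP; rewrite -subr_eq0 -nc_eq0 eq_le nc_ge0 andbT.
set x := cabs _.
have : ((x / 2)%:E <= 0 :> \bar R)%E.
 rewrite -(cvg_lim _ lim0) //; apply: lime_ge; first by apply/cvg_ex; exists 0%E.
 apply: nearW => n /=; have := cinteg_bound ms (iug n); rewrite -key -/x => h.
 by rewrite mulrC EFinM lee_pdivrMl //.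
by rewrite lee_fin; lra.
Qed.
End OnRect.

Lemma weyl_ae_rect u (r x0 x1 y0 y1 : R) : weakhol u -> 0 < r -> r < 1 ->
 (forall w, rect x0 x1 y0 y1 w -> nC w <= r) ->
 A.-negligible [set z | rect x0 x1 y0 y1 z /\ u z <> weyl u z].
move=> wu r0 r1 hQ; set Q := rect x0 x1 y0 y1 in hQ *.
have mQ : measurable Q by exact: mrect.
have s1 : (1 + r) / 2 < 1 by lra.
have ms := @mdball ((1 + r) / 2).
have Qs : Q `<=` dball ((1 + r) / 2) by move=> w /hQ h; change (nC w < (1 + r) / 2); lra.
have iu : cL1 Q u by apply: (cL1S mQ ms Qs); case: wu => lu _; exact: lu.
have iw : cL1 Q (weyl u) by exact: cL1S mQ ms Qs (holo_locint (weyl_holo wu) s1).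
have id := cL1B mQ iw iu.
have zero E : is_rect E -> E `<=` Q -> cinteg E (fun z => weyl u z - u z) = 0.
 move=> [a [b [c [d ->]]]] sE; have mE := @mrect a b c d.
 rewrite cintegB //; [|exact: cL1S iw|exact: cL1S iu].
 by rewrite (weyl_rect wu r1 r0 (fun w hw => hQ w (sE w hw))) subrr.
have fin E h : is_rect E -> E `<=` Q -> A.-integrable Q (fun z => (h z)%:E) ->
  Rintegral A E h = 0 -> (\int[A]_(z in E) (h z)%:E = 0)%E.
 move=> [a [b [c [d ->]]]] sE ih h0; have mE := @mrect a b c d.
 by rewrite -[LHS]fineK; [congr (_%:E)|apply: (integrable_fin_num mE); exact: integrableS ih].
case: id => id1 id2.
have [|N1 [mN1 N10 hN1]] := ae_zero_rect (v := fun z => re (weyl u z - u z)) id1.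
 by move=> E rE sE; apply: fin => //; exact: (congr1 re (zero E rE sE)).
have [|N2 [mN2 N20 hN2]] := ae_zero_rect (v := fun z => im (weyl u z - u z)) id2.
 by move=> E rE sE; apply: fin => //; exact: (congr1 im (zero E rE sE)).
exists (N1 `|` N2); split; [exact: measurableU|exact: null_set_setU|].
move=> z [Qz huw]; apply: contrapT => hn; apply: huw.
have h1 : re (weyl u z - u z) = 0.
 by apply: contrapT => h; apply: hn; left; apply: hN1 => /(_ Qz) [].
have h2 : im (weyl u z - u z) = 0.
 by apply: contrapT => h; apply: hn; right; apply: hN2 => /(_ Qz) [].
by apply/eqP; rewrite eq_sym -subr_eq0; apply/eqP; exact: ceqP.
Qed.

(** Equal integrals over all rectangles inside a rectangle force equality almost everywhere on it,
    and countably many rational rectangles cover the disk. *)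
Lemma weyl_ae u : weakhol u -> {ae A, forall z, Dk z -> u z = weyl u z}.
move=> wu.
(* Rectangles are coded by natural numbers. The existence of [r] is part of the set itself, so that
   rectangles reaching the circle contribute nothing. *)
pose bad (k : nat) : set PT := if unpickle k is Some (a, b, c, d) then
 [set z | (rect (ratr a) (ratr b) (ratr c) (ratr d) z /\ u z <> weyl u z) /\
   exists r : R, [/\ 0 < r, r < 1 & forall w, rect (ratr a) (ratr b) (ratr c) (ratr d) w -> nC w <= r]]
 else set0.
have badE (a b c d : rat) : bad (pickle (a, b, c, d)) =
 [set z | (rect (ratr a) (ratr b) (ratr c) (ratr d) z /\ u z <> weyl u z) /\
   exists r : R, [/\ 0 < r, r < 1 & forall w, rect (ratr a) (ratr b) (ratr c) (ratr d) w -> nC w <= r]].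
 by rewrite /bad pickleK.
have nb k : A.-negligible (bad k).
 rewrite /bad; case: unpickle => [[[[a b] c] d]|]; last exact: negligible_set0.
 have [[r [r0 r1 hr]]|h] := pselect (exists r : R, [/\ 0 < r, r < 1 &
   forall w, rect (ratr a) (ratr b) (ratr c) (ratr d) w -> nC w <= r]).
  by apply: negligibleS (weyl_ae_rect wu r0 r1 hr) => z [].
 by apply: (negligibleS _ (negligible_set0 A)) => z [_ /h].
apply: negligibleS (negligible_bigcup nb) => z /= hz.
have {hz} [dz hz] : disk z /\ u z <> weyl u z.
 by apply: contrapT => h; apply: hz => dz; apply: contrapT => h'; apply: h.
have z1 : nC z < 1 := dz.
pose d := dd z / 4; have d0 : 0 < d by rewrite /d; lra.
have lt1 (x : R) : x - d < x by lra.
have lt2 (x : R) : x < x + d by lra.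
have [a ha] := rat_in_itvoo (lt1 z.1); have [b hb] := rat_in_itvoo (lt2 z.1).
have [c hc] := rat_in_itvoo (lt1 z.2); have [e he] := rat_in_itvoo (lt2 z.2).
move: ha hb hc he; rewrite !in_itv /= => /andP[a1 a2] /andP[b1 b2] /andP[c1 c2] /andP[e1 e2].
exists (pickle (a, b, c, e)); first exact: I.
rewrite badE; split.
 by split => //; split; rewrite /= in_itv /=; apply/andP; split => //; exact: ltW.
exists ((1 + nC z) / 2); have z0 := nc_ge0 (toC z); split; [lra|lra|].
move=> w [/=]; rewrite !in_itv /= => /andP[w1 w2] /andP[w3 w4].
have h1 : `|re (tz w z)| <= d by rewrite ReD ReN /= ler_norml; apply/andP; split; lra.
have h2 : `|im (tz w z)| <= d by rewrite ImD ImN /= ler_norml; apply/andP; split; lra.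
have := nc_le_ReIm (tz w z); have := nc_leB (toC w) (toC z).
by move: h1 h2; rewrite /d; lra.
Qed.
End Weyl.

(** * Holomorphic functions are smooth *)

Section HoloSmooth.
Implicit Types (c v y : RR) (a r : R) (phi : RR -> R).

Lemma holo_ccontinuous f z : holo Dk f -> Dk z -> ccontinuous_at f z.
by move=> hf /hf[l hl]; exact: cderiv_ccontinuous hl. Qed.

Lemma holo_cauchy f c w (rho : R) : holo Dk f -> 0 < rho -> nC c + 2 * rho <= 1 ->
 dC w c <= rho / 2 ->
 f w = (rC (kappa))^-1 * ID (fun z => f z * (cker c rho z / tz z w)).
move=> hf r0 hc hw; have kn : rC (kappa) != 0 by rewrite rC_eq0 gt_eqF // kappa_gt0.
have dw : disk w by change (nC w < 1); have := nc_leB (toC w) (toC c); lra.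
by rewrite -(cauchy_formula (holo_weak hf) (holo_ccontinuous hf dw) r0 hc hw) mulrA mulVf ?mul1r.
Qed.

Lemma cderiv_uniq f z l m : cderiv f z l -> cderiv f z m -> l = m.
move=> hl hm; apply/eqP; rewrite -subr_eq0; apply/eqP; apply: (@nc_small _ 2) => // eps e0.
have [d1 d10 h1] := hl _ e0; have [d2 d20 h2] := hm _ e0.
set t := Num.min d1 d2 / 2; have t0 : 0 < t by rewrite divr_gt0 // lt_min d10.
have tm : t < Num.min d1 d2 by rewrite /t ltr_pdivrMr // ltr_pMr ?ltr1n // lt_min d10.
set w := ofC (toC z + rC t); have ww : toC w - toC z = rC t by rewrite ofCK addrC addKr.
have ct : cabs (rC t) = t by rewrite nc_rC ger0_norm // ltW.
move: tm; rewrite lt_min => /andP[td1 td2].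
have k1 := h1 w; have k2 := h2 w; rewrite ww ct in k1 k2.
have e : (l - m) * rC t = (f w - f z - m * rC t) - (f w - f z - l * rC t) by ring.
have : cabs (l - m) * t <= 2 * eps * t.
 rewrite -{1}ct -cabsM e; apply: (letr (cabsB _ _)).
 by have := k1 td1; have := k2 td2; set a := cabs _; set b := cabs _; lra.
by rewrite ler_pM2r.
Qed.

(** The derivative is the Cauchy integral with squared kernel, which can be differentiated once
    more. *)
Lemma holo_derivative f : holo Dk f -> exists2 f', holo Dk f' & forall z, Dk z -> cderiv f z (f' z).
move=> hf.
have /choice [f' hf'] : forall z, exists l : C, Dk z -> cderiv f z l.
 move=> z; have [dz|dz] := pselect (Dk z); last by exists 0.
 by have [l hl] := hf z dz; exists l.
exists f' => // c dc; have {}dc : nC c < 1 := dc.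
set rho := dd c / 2.
have r0 : 0 < rho by rewrite /rho; lra.
have hc : nC c + 2 * rho <= 1 by rewrite /rho; lra.
have r2 : 0 < rho / 4 by lra.
have ig := locint_cker (holo_locint hf) r0 hc.
have far w z : dC w c < rho / 2 -> f z * cker c rho z != 0 -> 2 * (rho / 4) <= dC z w.
 by move=> hw /(cker_supp r0); have := nc_distD (toC w) (toC z) (toC c); lra.
pose G w := (rC (kappa))^-1 * ID (fun z => f z * cker c rho z * (tz z w ^+ 2)^-1).
have hG : exists l, cderiv G c l.
 eexists; apply: cderivM; first exact: cderiv_cst.
 by apply: (kernel_cderiv2 ig r2) => z; apply: far; rewrite subrr cabs0; lra.
have [l hl] := hG; exists l; apply: cderiv_eq (erefl l) hl.
exists (rho / 4) => // w hw.
have dw : disk w by change (nC w < 1); have := nc_leB (toC w) (toC c); lra.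
apply: cderiv_uniq (hf' _ dw).
have k1 := kernel_cderiv1 ig r2 (fun z => far w z ltac:(lra)).
have := cderivM (cderiv_cst (rC (kappa))^-1 w) k1; apply: cderiv_eq.
 exists (rho / 4) => // v hv; rewrite (holo_cauchy hf r0 hc (w := v)); last first.
  by have := nc_distD (toC w) (toC v) (toC c); lra.
 by congr (_ * _); apply: eq_cinteg => z _; rewrite mulrA.
by rewrite mul0r add0r.
Qed.

Lemma cderiv_differentiable f z l v : cderiv f z l ->
 differentiable (fun z => re (f z)) z /\ 'D_v (fun z => re (f z)) z = re (l * toC v).
move=> hl.
pose L0 v : R := re (l * toC v).
have linL : forall a y b, L0 (a *: y + b) = a * L0 y + L0 b.
 move=> a [y1 y2] [b1 b2].
 rewrite (_ : a *: (y1, y2) + (b1, b2) = (a * y1 + b1, a * y2 + b2)) //.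
 by rewrite /L0 !ReM /toC /=; ring.
have cL : continuous L0.
 move=> x; rewrite /L0; under eq_fun do rewrite ReM /toC /=.
 by apply: cvgB; apply: cvgM; [exact: cvg_cst|exact: cvg_fst|exact: cvg_cst|exact: cvg_snd].
pose M := GRing.isLinear.Build R RR R^o *:%R L0 linL.
pose L : {linear RR -> R^o} := HB.pack L0 M.
have lo : (fun z => re (f z) : R^o) \o shift z = cst (re (f z) : R^o) + (L : _ -> _) +o_ (0 : RR) id.
 apply/eqaddoP => eps e0; have e2 : 0 < eps / 2 by rewrite divr_gt0.
 have [d d0 hd] := hl _ e2.
 have : nbhs (0 : RR) (eball (0 : RR) d) by apply/nbhs_eballP; exists d.
 apply: filterS => h hh; have {}hh : dC h (0 : RR) < d := hh.
 have eh : toC (h + z) - toC z = toC h.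
  by apply: ceqP; rewrite ?ReD ?ImD ?ReN ?ImN /toC /=; ring.
 rewrite [toC (0 : RR)](_ : _ = 0) // subr0 in hh.
 have := hd (h + z); rewrite eh => /(_ hh) key.
 have nh : nC h <= 2 * `|h|.
  apply: (letr (nc_le_ReIm _)); rewrite /toC /=.
  have -> : `|h| = Num.max `|h.1| `|h.2| by [].
  have : `|h.1| <= Num.max `|h.1| `|h.2| by rewrite le_max lexx.
  have : `|h.2| <= Num.max `|h.1| `|h.2| by rewrite le_max lexx orbT.
  by set m := Num.max _ _; lra.
 apply: (le_via (cabs (f (h + z) - f z - l * toC h))).
  apply: letr (Re_le_cabs _); rewrite !ReD !ReN.
  by rewrite [X in `|X| <= _](_ : _ = re (f (h + z)) - (re (f z) + L0 h)) // opprD addrA.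
 apply: (letr key); rewrite -mulrA ler_pM2l //.
 by rewrite mulrC ler_pdivrMr // mulrC.
have dL : 'd (fun z => re (f z) : R^o) z = L :> (_ -> _) by apply: diff_unique lo; exact: cL.
have df : differentiable (fun z => re (f z) : R^o) z.
 by apply/diff_locallyP; rewrite dL; split; [exact: cL|exact: lo].
by split=> //; rewrite deriveE // dL.
Qed.

(** A class closed under directional derivatives, because the derivative of a holomorphic function
    is holomorphic; [smooth_coind] then makes its members smooth. *)
Inductive hol_test : (RR -> R) -> Prop :=
| hol_test_mul f phi : holo Dk f -> ctest (fun z => rC (phi z)) ->
  hol_test (fun z => re (f z) * phi z)
| hol_test_add h1 h2 : hol_test h1 -> hol_test h2 -> hol_test (fun z => h1 z + h2 z).

Lemma hol_test_vanish phi z : ctest (fun z => rC (phi z)) -> 1 <= nC z ->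
 exists2 r, 0 < r & forall w, dC w z < r -> phi w = 0.
move=> [_ [r [r1 hr]]] hz; exists (1 - r) => [|w hw]; first lra.
suff /(congr1 re) : rC (phi w) = 0 by [].
by apply: hr; have := nc_leB (toC z) (toC w); rewrite nc_distC; lra.
Qed.

Lemma differentiable_vanish (h : RR -> R) z :
 (exists2 r, 0 < r & forall w, dC w z < r -> h w = 0) -> differentiable h z.
move=> [r r0 hr]; have c0 : cderiv (fun w => rC (h w)) z 0.
 by apply: cderiv_eq erefl (cderiv_cst 0 z); exists r => // w /hr ->.
by have [] := cderiv_differentiable 0 c0.
Qed.

Lemma smooth_ctest_rC phi : ctest (fun z => rC (phi z)) -> smooth phi.
by move=> [[s _] _]. Qed.

Lemma hol_test_diff h : hol_test h -> forall z, differentiable h z.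
elim=> [f phi hf tp|h1 h2 _ d1 _ d2] z; last exact: differentiableD.
have [hz|hz] := ltP (nC z) 1.
 have [l hl] := hf z hz; have [df _] := cderiv_differentiable (0 : RR) hl.
 exact: differentiableM df (smooth_diff z (smooth_ctest_rC tp)).
apply: differentiable_vanish; have [r r0 hr] := hol_test_vanish tp hz.
by exists r => // w /hr ->; rewrite mulr0.
Qed.

Lemma ctest_derive phi v : ctest (fun z => rC (phi z)) -> ctest (fun z => rC ('D_v phi z)).
move=> tp; have [_ [r [r1 hr]]] := tp; split.
 by apply: csmooth_rC; apply: smooth_derive; exact: smooth_ctest_rC.
exists ((1 + r) / 2); split=> [|z hz]; first lra.
rewrite vanish_dbar //; exists ((1 - r) / 2) => [|w hw]; first lra.
suff /(congr1 re) : rC (phi w) = 0 by [].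
by apply: hr; have := nc_leB (toC z) (toC w); rewrite nc_distC; lra.
Qed.

Lemma hol_test_mul_derive f phi f' z v : holo Dk f -> ctest (fun z => rC (phi z)) ->
 (forall z, Dk z -> cderiv f z (f' z)) ->
 'D_v (fun z => re (f z) * phi z) z = re (toC v * f' z) * phi z + re (f z) * 'D_v phi z.
move=> hf tp hf'; have [hz|hz] := ltP (nC z) 1.
 have [df e] := cderiv_differentiable v (hf' z hz).
 rewrite deriveM; [|exact: diff_derivable|exact/diff_derivable/smooth_diff/smooth_ctest_rC].
 rewrite [X in _ *: 'D_v phi z + phi z *: X = _]e (mulrC (toC v)) addrC; congr (_ + _); exact: mulrC.
have [r r0 hr] := hol_test_vanish tp hz.
rewrite !vanish_dbar; first by rewrite mulr0 addr0 hr ?mulr0 // subrr cabs0.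
 by exists r.
by exists r => // w /hr ->; rewrite mulr0.
Qed.

Lemma hol_test_derive h v : hol_test h -> hol_test ('D_v h).
elim=> [f phi hf tp|h1 h2 t1 d1 t2 d2].
 have [f' hf' df] := holo_derivative hf.
 have -> : 'D_v (fun z => re (f z) * phi z) =
   (fun z => re (toC v * f' z) * phi z + re (f z) * 'D_v phi z).
  by apply/funext => z; exact: hol_test_mul_derive.
 apply: hol_test_add; first by apply: hol_test_mul => //; apply: holoM => //; exact: holo_cst.
 by apply: hol_test_mul => //; exact: ctest_derive.
have -> : 'D_v (fun z => h1 z + h2 z) = (fun z => 'D_v h1 z + 'D_v h2 z); last exact: hol_test_add.
by apply/funext => z; rewrite deriveD //; apply: diff_derivable; exact: hol_test_diff.
Qed.

Lemma hol_test_smooth h : hol_test h -> smooth h.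
apply: (@smooth_coind hol_test) => [g hg z|g v hg]; [exact: hol_test_diff|exact: hol_test_derive].
Qed.

(** Makes the product of a holomorphic function and a cutoff an admissible test function, although
    [f] is arbitrary off the disk. The imaginary part is handled as the real part of [-i f]. *)
Lemma ctest_holoM f phi : holo Dk f -> ctest (fun z => rC (phi z)) ->
 ctest (fun z => f z * rC (phi z)).
move=> hf tp; have [_ [r [r1 hr]]] := tp.
split; last by exists r; split => // z /hr ->; rewrite mulr0.
split.
 rewrite (_ : (fun z => _) = (fun z => re (f z) * phi z)); first by apply: hol_test_smooth; exact: hol_test_mul.
 by apply/funext => z; rewrite ReM /= mulr0 subr0.
rewrite (_ : (fun z => _) = (fun z => re ((- Complex 0 1) * f z) * phi z)).
 by apply: hol_test_smooth; apply: hol_test_mul => //; apply: holoM => //; exact: holo_cst.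
apply/funext => z; rewrite ImM /= mulr0 add0r; congr (_ * _).
by case: (f z) => a b /=; ring.
Qed.

Lemma cdbar_holoM f phi z : holo Dk f -> ctest (fun z => rC (phi z)) ->
 cdbar (fun z => f z * rC (phi z)) z = f z * dbar phi z.
move=> hf tp; have [f' hf' df] := holo_derivative hf.
have h2f : holo Dk (fun z => (- Complex 0 1) * f z) by apply: holoM => //; exact: holo_cst.
have d2f w : Dk w -> cderiv (fun z => (- Complex 0 1) * f z) w ((- Complex 0 1) * f' w).
 move=> /df hw; have := cderivM (cderiv_cst (- Complex 0 1) w) hw.
 by rewrite mul0r add0r.
rewrite cdbarE.
have -> : (fun z => re (f z * rC (phi z))) = (fun z => re (f z) * phi z).
 by apply/funext => w; rewrite ReM /= mulr0 subr0.
have -> : (fun z => im (f z * rC (phi z))) = (fun z => re ((- Complex 0 1) * f z) * phi z).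
 apply/funext => w; rewrite ImM /= mulr0 add0r; congr (_ * _).
 by case: (f w) => a b /=; ring.
rewrite !(hol_test_mul_derive _ _ hf tp df) !(hol_test_mul_derive _ _ h2f tp d2f) /dbar.
move: ('D_(1, 0) phi z) ('D_(0, 1) phi z) (phi z) => a b p.
case: (f z) (f' z) => x y [x' y']; apply: ceqP; rewrite ?ReM ?ImM /toC /=.
 by field.
by field.
Qed.
End HoloSmooth.

(** * Mean value estimates, removable singularities, uniform limits *)

Section HoloEstimates.
Implicit Types (g : RR -> C) (c a : RR) (r rho K p x : R) (D E : set PT).

Lemma eball_ccontinuous u w : (forall eps, 0 < eps -> exists2 d : R, 0 < d &
 forall z, dC z w < d -> cabs (u z - u w) <= eps) -> ccontinuous_at u w.
move=> h; split; apply/cont_eballP => e e0; have e2 : 0 < e / 2 by rewrite divr_gt0.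
 have [d d0 hd] := h _ e2; exists d => // z /hd k; have := Re_le_cabs (u z - u w); rewrite ReD ReN.
 by move=> k'; apply: (lelt k'); lra.
have [d d0 hd] := h _ e2; exists d => // z /hd k; have := Im_le_cabs (u z - u w); rewrite ImD ImN.
by move=> k'; apply: (lelt k'); lra.
Qed.

Lemma ccontinuous_locint u : (forall z, Dk z -> ccontinuous_at u z) -> locint u.
move=> cu r r1; have sD : dball r `<=` Dk by apply: dball_disk; exact: ltW.
have [M M0 hM] := ccontinuous_bounded (g := u) (r := r) (fun z hz => cu z (lelt hz r1)).
apply: (@cL1_bounded _ _ M); first exact: mdball.
- by apply: area_lty; [exact: mdball|apply: dball_disk; exact: ltW].
- have [m1 m2] := ccontinuous_cmeas (@open_disk) cu.
 by split; [apply: measurable_funS m1|apply: measurable_funS m2] => //; exact: mdisk.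
- by move=> z hz; apply: hM; have {}hz : nC z < r := hz; exact: ltW.
Qed.

Lemma cauchy_quot_bound : exists2 B : R, 0 < B & forall c w z rho, 0 < rho -> dC w c <= rho / 2 ->
 cabs (cker c rho z / tz z w) <= B / rho ^+ 2.
have [B B0 hB] := cker_bound; exists (2 * B) => [|c w z rho r0 hw]; first by rewrite mulr_gt0.
have r20 : 0 <= 2 * B / rho ^+ 2 by rewrite divr_ge0 ?exprn_ge0 // ltW // mulr_gt0.
have [->|k0] := eqVneq (cker c rho z) 0; first by rewrite mul0r cabs0.
have /andP[h1 _] := cker_neq0 r0 k0.
have far : rho / 2 <= dC z w by have := nc_distD (toC w) (toC z) (toC c); lra.
rewrite nc_div; have -> : 2 * B / rho ^+ 2 = B / rho * (rho / 2)^-1 by field; rewrite gt_eqF.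
apply: ler_pM; rewrite ?nc_ge0 ?invr_ge0 ?nc_ge0 ?hB //.
by rewrite lef_pV2 ?posrE //; [lra|lra].
Qed.

(** Cauchy's formula at the centre, with a kernel bounded by a multiple of [1 / rho^2]. *)
Lemma sub_mean1 : exists2 K, 0 < K & forall f c rho, holo Dk f -> 0 < rho ->
 nC c + 2 * rho <= 1 ->
 ((cabs (f c))%:E <= (K / rho ^+ 2)%:E * \int[A]_(z in eball c (2 * rho)) (cabs (f z))%:E)%E.
have [B B0 hB] := cauchy_quot_bound; have k0 := kappa_gt0.
exists ((kappa)^-1 * (2 * B)) => [|f c rho hf r0 hc].
 by rewrite mulr_gt0 ?invr_gt0 // mulr_gt0.
have cc : dC c c <= rho / 2 by rewrite subrr cabs0; lra.
have me := @meball c (2 * rho); have md := @mdisk.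
have eD : eball c (2 * rho) `<=` Dk by apply: eball_disk; lra.
set g := fun z => f z * (cker c rho z / tz z c).
have r2 : 0 < rho / 2 by lra.
have ig : L1D g.
 have := cL1_kernel (locint_cker (holo_locint hf) r0 hc) r2 (fun z => @cker_supp c rho f z r0) 1.
 move=> /(_ c); rewrite subrr cabs0 => /(_ r2).
 by apply: eq_cL1 => // z _; rewrite expr1 -mulrA.
have g0 z : Dk z -> ~ eball c (2 * rho) z -> g z = 0.
 move=> _ /negP; rewrite -leNgt => h; rewrite /g cker_eq0 ?mul0r ?mulr0 //; right; lra.
rewrite (holo_cauchy hf r0 hc cc) -/g (cinteg_sub me md eD g0) cabsM cabsV nc_rC gtr0_norm //.
have ige : cL1 (eball c (2 * rho)) g by exact: cL1S md eD ig.
have hb := @nc_cint_le _ g (fun z => B / rho ^+ 2 * cabs (f z)) me ige.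
rewrite EFinM; apply: (le_via ((kappa)^-1%:E * (2%:E * \int[A]_(z in eball c (2 * rho)) (B / rho ^+ 2 * cabs (f z))%:E))%E).
 apply: leeMl; first by rewrite lee_fin invr_ge0 ltW.
 by apply: hb => z _; rewrite cabsM mulrC lerMr ?nc_ge0 // hB.
under eq_integral do rewrite EFinM.
rewrite ge0_integralZl_EFin //.
- by rewrite !muleA -!EFinM !mulrA.
- by move=> z _; rewrite lee_fin nc_ge0.
- apply/mEFP; apply: cmeas_cabs.
 by have [m1 m2] := holo_cmeas hf; split; [apply: measurable_funS m1|apply: measurable_funS m2].
- by rewrite divr_ge0 ?exprn_ge0 // ltW.
Qed.

(** By [1/(z - w) - 1/(z - a) = (w - a) / ((z - w)(z - a))], the quotient [f(w) / (w - a)] is near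
    [a] the Cauchy integral with density divided by [z - a]. It is holomorphic, and its value at [a]
    fills the gap. *)
Lemma holo_div f a : holo Dk f -> Dk a -> f a = 0 ->
 exists2 q, holo Dk q & forall z, Dk z -> f z = tz z a * q z.
move=> hf da fa; have {}da : nC a < 1 := da.
set rho := dd a / 2.
have r0 : 0 < rho by rewrite /rho; lra.
have hc : nC a + 2 * rho <= 1 by rewrite /rho; lra.
have r2 : 0 < rho / 2 by lra.
have far := fun z => @cker_supp a rho f z r0.
have ik := locint_cker (holo_locint hf) r0 hc.
pose g z := f z * cker a rho z * (tz z a)^-1.
have ig : L1D g.
 by have := cL1_kernel ik r2 far 1 (w := a); rewrite subrr cabs0 => /(_ r2).
have gfar z : g z != 0 -> 2 * (rho / 2) <= dC z a.
 by rewrite /g mulf_eq0 negb_or => /andP[/far].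
pose G w := (rC (kappa))^-1 * ID (fun z => g z * (tz z w)^-1).
have GE w : dC w a < rho / 2 -> (tz w a) * G w = f w.
 move=> hw; have hww := ltW hw.
 have aa : dC a a <= rho / 2 by rewrite subrr cabs0 ltW.
 rewrite [RHS](_ : _ = f w - f a); last by rewrite fa subr0.
 rewrite (holo_cauchy hf r0 hc hww) (holo_cauchy hf r0 hc aa).
 rewrite -mulrBr -cintegB; [|exact: mdisk| |]; last 2 first.
 - have := cL1_kernel ik r2 far 1 hw.
  by apply: eq_cL1 => [|z _]; [exact: mdisk|rewrite expr1 -mulrA].
 - have := cL1_kernel ik r2 far 1 (w := a); rewrite subrr cabs0 => /(_ r2).
  by apply: eq_cL1 => [|z _]; [exact: mdisk|rewrite expr1 -mulrA].
 rewrite /G mulrCA; congr (_ * _); rewrite -cintegZ; [|exact: mdisk|].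
  apply: eq_cinteg => z _; rewrite /g.
  have [fk0|fk] := eqVneq (f z * cker a rho z) 0.
   by rewrite fk0 !mul0r mulr0 !mulrA fk0 !mul0r subrr.
  have h1 := far z fk; have h2 : 0 < dC z w.
   by have := nc_distD (toC w) (toC z) (toC a); lra.
  have n1 : toC z - toC w != 0 by rewrite -nc_gt0.
  have n2 : toC z - toC a != 0 by rewrite -nc_gt0; lra.
  move: n1 n2; move: (f z) (cker a rho z) => k1 k2.
  move: (toC z) (toC w) (toC a) => x y t n1 n2.
  by field; rewrite n1 n2.
 by have := cL1_kernel ig r2 gfar 1 hw; apply: eq_cL1 => [|z _]; [exact: mdisk|rewrite expr1].
pose q w := if w == a then G a else f w / (tz w a).
exists q; last first.
 move=> z dz; rewrite /q; case: eqVneq => [->|za]; first by rewrite subrr mul0r.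
 have n : toC z - toC a != 0 by rewrite subr_eq0; apply: contra za => /eqP /toC_inj ->.
 by rewrite mulrCA mulfV ?mulr1.
move=> z dz; have [->|za] := eqVneq z a.
 eexists; apply: cderiv_eq (erefl _) (cderivM (cderiv_cst (rC (kappa))^-1 a) (kernel_cderiv1 ig r2 gfar)).
 exists (rho / 2) => // w hw; rewrite -/(G w) /q; case: eqVneq => [->|wa] //.
 have n : toC w - toC a != 0 by rewrite subr_eq0; apply: contra wa => /eqP /toC_inj ->.
 by rewrite -(GE w hw) mulrAC mulfV ?mul1r.
have n : toC z - toC a != 0 by rewrite subr_eq0; apply: contra za => /eqP /toC_inj ->.
have [l hl] := hf z dz.
have hz := cderivD (cderiv_toC z) (cderiv_cst (- toC a) z).
eexists; apply: cderiv_eq (erefl _) (cderivM hl (cderivV n hz)).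
exists (dC z a) => [|w hw]; first by rewrite nc_gt0.
by rewrite /q; case: eqVneq => // wa; move: hw; rewrite wa nc_distC ltxx.
Qed.

(** Cauchy's formula passes to the limit, because the kernel is bounded and supported in a compact
    annulus. *)
Lemma holo_unif_lim (f_ : nat -> RR -> C) f : (forall n, holo Dk (f_ n)) ->
 (forall r eps, r < 1 -> 0 < eps -> exists n, forall z, nC z <= r -> cabs (f_ n z - f z) <= eps) ->
 holo Dk f.
move=> hf hu; have k0 := kappa_gt0.
have cf z : Dk z -> ccontinuous_at f z.
 move=> dz; have z1 : nC z < 1 := dz.
 apply: eball_ccontinuous => eps e0; have e3 : 0 < eps / 3 by rewrite divr_gt0.
 have r1 : (1 + nC z) / 2 < 1 by lra.
 have [n hn] := hu _ _ r1 e3.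
 have [d d0 hd] := ccontinuous_eballP (holo_ccontinuous (hf n) dz) e3.
 exists (Num.min d (dd z / 2)) => [|w]; first by rewrite lt_min d0; lra.
 rewrite lt_min => /andP[w1 w2].
 have k1 := hd w w1; have k2 := hn w; have k3 := hn z.
 have c1 := nc_distD (f_ n w) (f w) (f z); have c2 := nc_distD (f_ n z) (f_ n w) (f z).
 rewrite (nc_distC (f w) (f_ n w)) in c1.
 have cw := nc_leB (toC w) (toC z).
 have {}k2 : cabs (f_ n w - f w) <= eps / 3 by apply: k2; lra.
 have {}k3 : cabs (f_ n z - f z) <= eps / 3 by apply: k3; lra.
 by move: c1 c2 k1 k2 k3; set x1 := cabs _; set x2 := cabs _; set x3 := cabs _; set x4 := cabs _; set x5 := cabs _; lra.
have lf := ccontinuous_locint cf.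
apply: (cauchy_holo lf) => c dc; have {}dc : nC c < 1 := dc.
set rho := dd c / 2.
have r0 : 0 < rho by rewrite /rho; lra.
have hc : nC c + 2 * rho <= 1 by rewrite /rho; lra.
exists rho => //; split=> // w hw; have hww := ltW hw.
have [B B0 hB] := cauchy_quot_bound; have md := @mdisk.
have r2 : 0 < rho / 2 by lra.
have K0 : 0 <= 1 + (kappa)^-1 * (2 * (B / rho ^+ 2 * 4)).
 by rewrite addr_ge0 // mulr_ge0 ?invr_ge0 ?(ltW k0) // !mulr_ge0 ?invr_ge0 ?exprn_ge0 // ltW.
apply/eqP; rewrite -subr_eq0; apply/eqP; apply: (nc_small K0) => eps e0.
have r1 : nC c + 3 / 2 * rho < 1 by lra.
have [n hn] := hu _ _ r1 e0.
have ik g : locint g -> L1D (fun z => g z * (cker c rho z / tz z w)).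
 move=> lg; have := cL1_kernel (locint_cker lg r0 hc) r2 (fun z => @cker_supp c rho g z r0) 1 hw.
 by apply: eq_cL1 => // z _; rewrite expr1 -mulrA.
have i1 := ik _ (holo_locint (hf n)); have i2 := ik _ lf.
have e : f w - (rC (kappa))^-1 * ID (fun z => f z * (cker c rho z / tz z w)) =
  (rC (kappa))^-1 * ID (fun z => (f_ n z - f z) * (cker c rho z / tz z w)) - (f_ n w - f w).
 transitivity ((rC (kappa))^-1 * (ID (fun z => f_ n z * (cker c rho z / tz z w)) -
    ID (fun z => f z * (cker c rho z / tz z w))) - (f_ n w - f w)).
  by rewrite mulrBr -(holo_cauchy (hf n) r0 hc hww); ring.
 by rewrite -cintegB //; congr (_ * _ - _); apply: eq_cinteg => z _; rewrite mulrBl.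
rewrite e; apply: (letr (cabsB _ _)).
have b1 : cabs (f_ n w - f w) <= eps by apply: hn; have := nc_leB (toC w) (toC c); lra.
have b2 : cabs (ID (fun z => (f_ n z - f z) * (cker c rho z / tz z w))) <=
  2 * (eps * (B / rho ^+ 2) * 4).
 apply: cinteg_le => //; first exact: area_disk_le.
 - have := cL1_meas md (cL1B md i1 i2); rewrite (_ : (fun z => _ - _) = (fun z => (f_ n z - f z) * (cker c rho z / tz z w))) //.
  by apply/funext => z; rewrite mulrBl.
 - by rewrite mulr_ge0 ?(ltW e0) // divr_ge0 ?exprn_ge0 // ltW.
 move=> z dz; rewrite cabsM.
 have [->|kz] := eqVneq (cker c rho z) 0.
  by rewrite mul0r cabs0 mulr0 mulr_ge0 ?(ltW e0) // divr_ge0 ?exprn_ge0 // ltW.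
 have /andP[_ h2] := cker_neq0 r0 kz.
 apply: ler_pM; rewrite ?nc_ge0 ?hB //.
 by apply: hn; have := nc_leB (toC z) (toC c); lra.
rewrite cabsM cabsV nc_rC (gtr0_norm k0) mulrDl mul1r addrC lerD //.
rewrite -[leRHS]mulrA lerMl ?invr_ge0 ?(ltW k0) //; apply: (letr b2).
by apply: eq_ler; ring.
Qed.

Lemma powR_split p x : 0 < p -> 0 <= x -> x = x `^ p * (x `^ p) `^ ((1 - p) / p).
move=> p0 x0; have [->|xn] := eqVneq x 0; first by rewrite powR0 ?mul0r // gt_eqF.
rewrite -powRrM (_ : p * ((1 - p) / p) = 1 - p); last by field; rewrite gt_eqF.
by rewrite -powRD ?xn ?implybT // addrC subrK powRr1.
Qed.

Lemma powRK p x : 0 < p -> 0 <= x -> (x `^ p) `^ p^-1 = x.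
by move=> p0 x0; rewrite -powRrM mulfV ?powRr1 // gt_eqF. Qed.

Lemma ler_powR2r (p x y : R) : 0 < p -> 0 <= x -> 0 <= y -> x <= y -> x `^ p <= y `^ p.
by move=> p0 x0 y0 xy; apply: ge0_ler_powR; rewrite ?nnegrE // ltW. Qed.

Lemma cmeas_powR D f p : cmeas D f -> mfun D (fun z => cabs (f z) `^ p).
by move=> mf; apply: (mcomp (measurable_powR p)); exact: cmeas_cabs. Qed.

Lemma cmeas_sub D E f : measurable E -> D `<=` E -> cmeas E f -> cmeas D f.
by move=> mE DE [m1 m2]; split; [apply: measurable_funS m1|apply: measurable_funS m2]. Qed.

(** Hardy and Littlewood's device for exponents below one: write [|f| = |f|^p (|f|^p)^q] with
    [q = (1 - p) / p], bound the second factor by a weighted supremum [S], and obtain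
    [S <= C S^(1-p) J^p], from which [S^(1-p)] can be absorbed. *)
Lemma sub_mean p : 0 < p < 1 -> exists2 K, 0 < K & forall f c rho, holo Dk f -> 0 < rho ->
 nC c + rho < 1 ->
 (((cabs (f c)) `^ p)%:E <= (K / rho ^+ 2)%:E * \int[A]_(z in eball c rho) ((cabs (f z)) `^ p)%:E)%E.
move=> /andP[p0 p1]; have [C0 C00 hC0] := sub_mean1.
pose q := (1 - p) / p.
pose K := 16 * C0 * 4 `^ q.
have K0 : 0 < K by rewrite !mulr_gt0 // powR_gt0.
exists K => // f c rho hf r0 hc.
have me := @meball c rho; have md := @mdisk.
have eD : eball c rho `<=` Dk by apply: eball_disk; lra.
have [M0 M00 hM0] := holo_bounded hf hc.
have mf := holo_cmeas hf.
set I := (\int[A]_(z in eball c rho) ((cabs (f z)) `^ p)%:E)%E.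
have I0 : (0 <= I)%E by apply: integral_ge0 => z _; rewrite lee_fin powR_ge0.
have fin : I \is a fin_num.
 rewrite ge0_fin_numE //; apply: (@lelt _ _ (\int[A]_(z in eball c rho) (cst (M0 `^ p)%:E z))%E).
  apply: le_int => z hz; rewrite lee_fin ?powR_ge0 // ler_powR2r ?nc_ge0 //; first exact: ltW.
  apply: hM0; have {}hz : dC z c < rho := hz.
  by have := nc_leB (toC z) (toC c); lra.
 rewrite integral_cst //; apply: lte_mul_pinfty; rewrite ?lee_fin ?powR_ge0 //.
 by apply: lelt (area_eball_le c (ltW r0)) _; exact: ltry.
set J := fine I; have J0 : 0 <= J by exact: fine_ge0.
have IE : I = J%:E by rewrite fineK.
(* The weight vanishes on the boundary of the disk, so a bound by the supremum survives passing to
   smaller disks at the cost of a constant. *)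
pose v z : R := cabs (f z) `^ p * (rho - dC z c) ^+ 2.
pose V : set R := [set v z | z in eball c rho].
have hasV : has_sup V.
 split; first by exists (v c); exists c => //; change (dC c c < rho); rewrite subrr cabs0.
 exists (M0 `^ p * rho ^+ 2) => _ [z hz <-]; have {}hz : dC z c < rho := hz.
 have z0 := nc_ge0 (tz z c).
 apply: ler_pM; rewrite ?powR_ge0 ?sqr_ge0 //.
  apply: ler_powR2r; rewrite ?nc_ge0 ?(ltW M00) //.
  by apply: hM0; have := nc_leB (toC z) (toC c); lra.
 by rewrite ler_sqrn //; lra.
set S := sup V.
have vS z : eball c rho z -> v z <= S by move=> hz; apply: sup_upper_bound => //; exists z.
have S0 : 0 <= S.
 have : v c <= S by apply: vS; change (dC c c < rho); rewrite subrr cabs0.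
 by apply: letr; rewrite mulr_ge0 ?powR_ge0 ?sqr_ge0.
have key z : eball c rho z -> v z <= (16 * C0) `^ p * (4 * S) `^ (1 - p) * J `^ p.
 move=> hz; have {}hz : dC z c < rho := hz.
 rewrite /v; set t := rho - dC z c.
 have t0 : 0 < t by rewrite subr_gt0.
 have t20 : 0 < t ^+ 2 by rewrite exprn_gt0.
 have zt : nC z + 2 * (t / 4) <= 1 by have := nc_leB (toC z) (toC c); rewrite /t; lra.
 have t4 : 0 < t / 4 by rewrite divr_gt0.
 (* On the disk of radius [t / 2] about [z] the distance to the boundary is at least [t / 2], whence
    [|f|^p <= 4 S / t^2] there. *)
 pose T := 4 * S / t ^+ 2.
 have T0 : 0 <= T by rewrite divr_ge0 ?mulr_ge0 // ltW.
 have sub : eball z (2 * (t / 4)) `<=` eball c rho.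
  move=> w hw; have {}hw : dC w z < 2 * (t / 4) := hw.
  by change (dC w c < rho); have := nc_distD (toC z) (toC w) (toC c); move: hw; rewrite /t; lra.
 have fT w : eball z (2 * (t / 4)) w -> cabs (f w) `^ p <= T.
  move=> hw; have := vS _ (sub _ hw); rewrite /v => h.
  have {}hw : dC w z < 2 * (t / 4) := hw.
  have wt : t / 2 <= rho - dC w c.
   by have := nc_distD (toC z) (toC w) (toC c); move: hw; rewrite /t; lra.
  rewrite /T ler_pdivlMr // -(ler_pM2l (x := 4^-1)) // mulKf ?pnatr_eq0 //.
  apply: letr h; rewrite mulrCA lerMl ?powR_ge0 //.
  apply: (le_via ((t / 2) ^+ 2)); first by rewrite exprMn exprVn -natrX mulrC.
  by rewrite ler_sqrn //; lra.
 have y1 : cabs (f z) <= 16 * C0 / t ^+ 2 * (T `^ q * J).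
  rewrite -lee_fin; apply: (letr (hC0 f z (t / 4) hf t4 zt)).
  have -> : C0 / (t / 4) ^+ 2 = 16 * C0 / t ^+ 2 by field; rewrite gt_eqF.
  rewrite [leRHS]EFinM; apply: leeMl.
   by rewrite lee_fin divr_ge0 ?mulr_ge0 ?(ltW C00) // ltW.
  apply: (le_via (\int[A]_(w in eball z (2 * (t / 4))) ((T `^ q)%:E * (cabs (f w) `^ p)%:E))%E).
   apply: le_int => w hw; first by rewrite lee_fin nc_ge0.
   rewrite -EFinM lee_fin {1}(powR_split p0 (nc_ge0 (f w))) mulrC lerMr ?powR_ge0 //.
   by rewrite -/q ler_powR2r ?powR_ge0 ?fT // /q divr_gt0 ?subr_gt0.
  rewrite ge0_integralZl_EFin ?powR_ge0 //.
  - rewrite [leRHS]EFinM; apply: leeMl; first by rewrite lee_fin powR_ge0.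
   by rewrite -IE; apply: int_subset => // w _; rewrite lee_fin powR_ge0.
  - exact: meball.
  - by move=> w _; rewrite lee_fin powR_ge0.
  - apply/mEFP; apply: cmeas_powR; apply: cmeas_sub mf => // w hw; exact: eD (sub _ hw).
 have yp := ler_powR2r p0 (nc_ge0 (f z)) (letr (nc_ge0 _) y1) y1.
 have e : (16 * C0 / t ^+ 2 * (T `^ q * J)) `^ p * t ^+ 2 = (16 * C0) `^ p * (4 * S) `^ (1 - p) * J `^ p.
  have c16 : 0 <= 16 * C0 by rewrite mulr_ge0 // ltW.
  have t2n : t ^+ 2 != 0 by rewrite gt_eqF.
  have eX : t ^+ 2 = (t ^+ 2) `^ p * (t ^+ 2) `^ (1 - p).
   by rewrite -powRD ?t2n ?implybT // addrC subrK powRr1 // ltW.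
  have e1 : (16 * C0 / t ^+ 2 * (T `^ q * J)) `^ p = (16 * C0) `^ p * ((t ^+ 2) `^ p)^-1 * (T `^ (1 - p) * J `^ p).
   have ti : 0 <= (t ^+ 2)^-1 by rewrite invr_ge0 ltW.
   rewrite (@powRM _ (16 * C0 / t ^+ 2)) ?mulr_ge0 ?powR_ge0 ?(ltW C00) // (@powRM _ (16 * C0)) // (@powRM _ (T `^ q)) ?powR_ge0 //.
   rewrite -[(T `^ q) `^ p]powRrM (_ : q * p = 1 - p); last by rewrite /q; field; rewrite gt_eqF.
   by rewrite -(powR_inv1 (ltW t20)) -powRrM mulN1r powRN.
  have -> : 4 * S = T * t ^+ 2 by rewrite /T divfK.
  rewrite e1 (@powRM _ T) ?(ltW t20) // {2}eX.
  have tp : (t ^+ 2) `^ p != 0 by rewrite gt_eqF // powR_gt0.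
  move: tp; move: ((t ^+ 2) `^ p) ((t ^+ 2) `^ (1 - p)) ((16 * C0) `^ p) (T `^ (1 - p)) (J `^ p) => x y k b j xn.
  by field.
 rewrite -e lerMr // ?(ltW t20) //.
have SL : S <= (16 * C0) `^ p * (4 * S) `^ (1 - p) * J `^ p.
 by apply: ge_sup; [exact: hasV.1|move=> _ [z hz <-]; exact: key].
have SK : S <= K * J.
 have [->|Sn] := eqVneq S 0; first by rewrite mulr_ge0 // ltW.
 have Sp : 0 < S by rewrite lt_neqAle eq_sym Sn.
 have S1 : S `^ p <= (16 * C0) `^ p * 4 `^ (1 - p) * J `^ p.
  rewrite -(ler_pM2r (powR_gt0 (1 - p) Sp)) -powRD ?Sn ?implybT // addrC subrK powRr1 //.
  apply: (letr SL); rewrite (@powRM _ 4 S) // le_eqVlt; apply/orP; left; apply/eqP; ring.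
 have := ler_powR2r (p := p^-1) _ (powR_ge0 _ _) (letr (powR_ge0 _ _) S1) S1.
 rewrite invr_gt0 => /(_ p0); rewrite powRK // => h; apply: (letr h).
 rewrite (@powRM _ ((16 * C0) `^ p * 4 `^ (1 - p))) ?mulr_ge0 ?powR_ge0 // (@powRM _ ((16 * C0) `^ p)) ?powR_ge0 // !powRK //; last by rewrite mulr_ge0 // ltW.
 by rewrite -powRrM /K /q.
rewrite IE -EFinM lee_fin mulrAC ler_pdivlMr ?exprn_gt0 //.
apply: letr SK; have := vS c; rewrite /v subrr cabs0 subr0; apply.
by change (dC c c < rho); rewrite subrr cabs0.
Qed.
End HoloEstimates.

(** * Pseudo-hyperbolic geometry and sums over separated points *)

Section HyperbolicGeometry.
Implicit Types (a c : RR) (s : seq RR) (x y : C) (delta : R) (D : set RR) (h : RR -> R).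

Definition den a z : R := cabs (1 - conjc (toC a) * toC z).

Lemma conjCB x y : conjc (x - y) = conjc x - conjc y. exact: (rmorphB (@conjc R)). Qed.
Lemma conjCM x y : conjc (x * y) = conjc x * conjc y. exact: (rmorphM (@conjc R)). Qed.
Lemma conjC_1 : conjc (1 : C) = 1. exact: (rmorph1 (@conjc R)). Qed.
Lemma conjC_inv x : conjc x^-1 = (conjc x)^-1. exact: conjc_inv. Qed.
Lemma conjC_K x : conjc (conjc x) = x. exact: conjcK. Qed.

Lemma psiE z w : psi z w = dC z w / den w z.
by rewrite /psi nc_div. Qed.

Lemma den_sym a z : den a z = den z a.
by rewrite /den -cabsJ conjCB conjC_1 conjCM conjC_K mulrC. Qed.

Lemma psi_sym z w : psi z w = psi w z.
by rewrite !psiE nc_distC den_sym. Qed.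

Lemma psi_ge0 z w : 0 <= psi z w.
by rewrite psiE divr_ge0 ?nc_ge0. Qed.

Lemma den_ge a z : 1 - nC a * nC z <= den a z.
by rewrite /den; have := nc_leB 1 (conjc (toC a) * toC z); rewrite cabs1 cabsM cabsJ.
Qed.

Lemma den_le a z : den a z <= 1 + nC a * nC z.
by rewrite /den; apply: (letr (cabsB _ _)); rewrite cabs1 cabsM cabsJ. Qed.

Lemma disk_cabs z : Dk z -> nC z < 1. by []. Qed.

Lemma den_ge_l a z : Dk a -> Dk z -> 1 - nC a <= den a z.
move=> /disk_cabs a1 /disk_cabs z1; apply: letr (den_ge a z); rewrite lerD2l lerN2.
by rewrite ler_piMr ?nc_ge0 // ltW.
Qed.

Lemma den_ge_r a z : Dk a -> Dk z -> 1 - nC z <= den a z.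
by move=> da dz; rewrite den_sym; exact: den_ge_l. Qed.

Lemma den_gt0 a z : Dk a -> Dk z -> 0 < den a z.
by move=> da dz; apply: ltle (den_ge_l da dz); rewrite subr_gt0. Qed.

Lemma den_neq0 a z : Dk a -> Dk z -> 1 - conjc (toC a) * toC z != 0.
by move=> da dz; rewrite -nc_gt0; exact: den_gt0. Qed.

Lemma den_sqr a z : den a z ^+ 2 = dC z a ^+ 2 +
 (1 - nC a ^+ 2) * (1 - nC z ^+ 2).
by case: a z => [a1 a2] [z1 z2]; rewrite /den !sqr_cabs /toC /=; ring.
Qed.

Lemma one_sub_psi a z : Dk a -> Dk z ->
 1 - psi a z ^+ 2 = (1 - nC a ^+ 2) * (1 - nC z ^+ 2) / den a z ^+ 2.
move=> da dz; have d0 : den a z ^+ 2 != 0 by rewrite expf_neq0 // gt_eqF // den_gt0.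
rewrite psi_sym psiE expr_div_n; apply: (mulIf d0).
rewrite mulrBl divfK // divfK // mul1r den_sqr; ring.
Qed.

Lemma sub_sqr_gt0 z : Dk z -> 0 < 1 - nC z ^+ 2.
by move=> /disk_cabs z1; rewrite subr_gt0 expr_lt1 // nc_ge0. Qed.

Lemma psi_sqr_lt1 a z : Dk a -> Dk z -> psi a z ^+ 2 < 1.
move=> da dz; rewrite -subr_gt0 one_sub_psi //; apply: divr_gt0.
 by apply: mulr_gt0; exact: sub_sqr_gt0.
by apply: exprn_gt0; exact: den_gt0.
Qed.

Lemma psi_lt1 a z : Dk a -> Dk z -> psi a z < 1.
by move=> da dz; have := psi_sqr_lt1 da dz; rewrite expr_lt1 // psi_ge0. Qed.

Lemma sep_dist delta a b : 0 <= delta -> Dk a -> Dk b -> delta <= psi a b ->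
 delta * dd a <= dC a b.
move=> d0 da db; rewrite psiE ler_pdivlMr ?den_gt0 // => h; apply: letr h.
by apply: lerMl => //; exact: den_ge_r.
Qed.

(** The disk automorphism exchanging [0] and [c]. It preserves [psi] and reduces estimates at an
    arbitrary point to estimates at the origin. *)
Definition mob c z : RR := ofC (tz c z / (1 - conjc (toC c) * toC z)).

Lemma nc_mob c z : nC (mob c z) = psi z c.
by rewrite /mob ofCK /psi !nc_div nc_distC. Qed.

Lemma mob_disk c z : Dk c -> Dk z -> Dk (mob c z).
by move=> dc dz; change (nC (mob c z) < 1); rewrite nc_mob psi_lt1. Qed.

Lemma psi_mob c a b : Dk c -> Dk a -> Dk b -> psi (mob c a) (mob c b) = psi a b.
move=> dc da db; rewrite /psi /mob !ofCK.
have n1 := den_neq0 dc da; have n2 := den_neq0 dc db.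
have n3 : 1 - toC c * conjc (toC b) != 0 by have := den_neq0 db dc; rewrite mulrC.
have n4 := den_neq0 db da; have n5 := den_neq0 dc dc.
rewrite conjCM conjCB conjC_inv conjCB conjC_1 conjCM conjC_K.
have -> : (tz c a / (1 - conjc (toC c) * toC a) - tz c b / (1 - conjc (toC c) * toC b)) /
  (1 - (conjc (toC c) - conjc (toC b)) / (1 - toC c * conjc (toC b)) * (tz c a / (1 - conjc (toC c) * toC a))) =
  - ((1 - toC c * conjc (toC b)) / (1 - conjc (toC c) * toC b)) * (tz a b / (1 - conjc (toC b) * toC a)).
 move: n1 n2 n3 n4 n5; move: (toC a) (toC b) (toC c) (conjc (toC b)) (conjc (toC c)) => x y t y' t' n1 n2 n3 n4 n5.
 have e : (1 - (t' - y') / (1 - t * y') * ((t - x) / (1 - t' * x))) = (1 - t' * t) * (1 - y' * x) / ((1 - t * y') * (1 - t' * x)).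
  by field; rewrite n1 n3.
 by rewrite e; field; rewrite n1 n2 n3 n4 n5.
have e1 : cabs ((1 - toC c * conjc (toC b)) / (1 - conjc (toC c) * toC b)) = 1.
 rewrite cabsM cabsV -{1}cabsJ conjCB conjC_1 conjCM conjC_K mulfV //.
 by rewrite nc_eq0.
by rewrite mulNr cabsN [LHS]cabsM e1 mul1r.
Qed.

(** Finite lists: every bound on a series over [Z] is proved for finite sublists and passes to the
    supremum. *)
Definition sep_seq delta s := [/\ uniq s, (forall a, a \in s -> Dk a) &
 forall a b, a \in s -> b \in s -> a <> b -> delta <= psi a b].

Lemma sep_seq_mob delta c s : Dk c -> 0 < delta -> sep_seq delta s -> sep_seq delta (map (mob c) s).
move=> dc d0 [us ds ps]; split.
- rewrite map_inj_in_uniq // => a b ha hb e; apply: contrapT => /(ps _ _ ha hb).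
 rewrite -(psi_mob dc (ds _ ha) (ds _ hb)) e psiE subrr cabs0 mul0r.
 by apply/negP; rewrite -ltNge.
- by move=> _ /mapP[a ha ->]; apply: mob_disk => //; exact: ds.
- move=> _ _ /mapP[a ha ->] /mapP[b hb ->] ab; rewrite (psi_mob dc (ds _ ha) (ds _ hb)).
 by apply: (ps _ _ ha hb) => e; apply: ab; rewrite e.
Qed.

(** The basic packing fact: separation gives [|a - b| >= delta (1 - |a|)], and the same with [b], so
    Euclidean disks of radius [delta/2] times the distance to the circle are disjoint. *)
Lemma sep_eballs delta a b w : 0 < delta -> Dk a -> Dk b -> delta <= psi a b ->
 eball a (delta / 2 * dd a) w -> eball b (delta / 2 * dd b) w -> False.
move=> d0 da db h ha hb.
have h1 := sep_dist (ltW d0) da db h; rewrite psi_sym in h; have h2 := sep_dist (ltW d0) db da h.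
have {}ha : dC w a < delta / 2 * (dd a) := ha.
have {}hb : dC w b < delta / 2 * (dd b) := hb.
have := nc_distD (toC w) (toC a) (toC b); rewrite nc_distC in h2; rewrite (nc_distC (toC a) (toC w)).
move: h1 h2 ha hb; rewrite -!mulrA !(mulrCA delta).
set x := delta * _; set y := delta * _; lra.
Qed.

Lemma sep_eball_disk delta a : 0 < delta -> delta <= 1 -> Dk a ->
 eball a (delta / 2 * dd a) `<=` Dk.
move=> d0 d1 /disk_cabs da; apply: eball_disk; rewrite ler_piMl; lra.
Qed.

Lemma sum_eballs delta s (F : RR -> \bar R) : 0 < delta -> delta <= 1 -> sep_seq delta s ->
 mfun DP F -> (forall z, (0 <= F z)%E) ->
 (\sum_(a <- s) \int[A]_(z in eball a (delta / 2 * dd a)) F z <= \int[A]_(z in Dk) F z)%E.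
move=> d0 d1 [us ds ps] mF F0.
rewrite -(@ge0_integral_bigsetU _ _ _ A _ (fun a => eball a (delta / 2 * dd a))) //.
- apply: int_subset => // z; rewrite -bigcup_seq => -[a /= ha].
 by apply: sep_eball_disk => //; exact: ds.
- by move=> a; exact: meball.
- apply/trivIsetP => a b /= ha hb /eqP ab; rewrite -subset0 => w [/= h1 h2].
 exact: (sep_eballs d0 (ds _ ha) (ds _ hb) (ps _ _ ha hb ab) h1 h2).
- apply: measurable_funS mF; first exact: mdisk.
 rewrite -bigcup_seq => z [a /= ha]; apply: sep_eball_disk => //; exact: ds.
Qed.

(** Area count: the disjoint disks of [sep_eballs] have areas at least [delta^2/4 (1 - |a|)^2], and
    the total area is at most [4]. *)
Lemma sum_sqr_dist delta s : 0 < delta -> delta <= 1 -> sep_seq delta s ->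
 \sum_(a <- s) (dd a) ^+ 2 <= 16 / delta ^+ 2.
move=> d0 d1 ss; have d20 : 0 < delta ^+ 2 by rewrite exprn_gt0.
have := sum_eballs (F := cst 1%E) d0 d1 ss (measurable_cst _) (fun _ => lee01).
rewrite integral_cst ?mul1e; last exact: mdisk.
move=> h; have := letr h area_disk_le => {}h.
have : ((\sum_(a <- s) (delta ^+ 2 / 4 * dd a ^+ 2))%:E <= 4%:E)%E.
 rewrite -sumEFin; apply: letr h; rewrite big_seq [leRHS]big_seq; apply: lee_sum => a ha.
 rewrite integral_cst ?mul1e; last exact: meball.
 have [_ ds _] := ss; have /disk_cabs a1 := ds _ ha.
 apply: letr (area_eball_ge a _); last by rewrite mulr_ge0 ?subr_ge0 ?(ltW a1) // divr_ge0 // ltW.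
 by rewrite lee_fin le_eqVlt; apply/orP; left; apply/eqP; rewrite exprMn; congr (_ * _); rewrite expr_div_n -natrX.
rewrite lee_fin -mulr_sumr; set S := \sum_(_ <- _) _ => hS.
by rewrite ler_pdivlMr // mulrC; move: hS; lra.
Qed.

Definition wgt a : R := (1 - nC a ^+ 2) ^+ 2.
Definition tval a z : R := wgt a / den a z ^+ 2.

Lemma wgt_ge0 a : 0 <= wgt a. exact: sqr_ge0. Qed.
Lemma tval_ge0 a z : 0 <= tval a z. by rewrite divr_ge0 ?sqr_ge0. Qed.

Lemma wgt_le a : Dk a -> wgt a <= 4 * dd a ^+ 2.
move=> /disk_cabs a1; have a0 := nc_ge0 (toC a).
have -> : 4 * dd a ^+ 2 = (2 * dd a) ^+ 2 by rewrite exprMn -natrX.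
rewrite /wgt ler_sqrn; [|by rewrite subr_ge0 expr_le1 // ltW|lra].
have -> : 1 - nC a ^+ 2 = (1 + nC a) * (dd a) by ring.
by rewrite lerMr; lra.
Qed.

Lemma wgt_ge a : Dk a -> (dd a) ^+ 2 <= wgt a.
move=> /disk_cabs a1; have a0 := nc_ge0 (toC a).
rewrite /wgt ler_sqrn; [|lra|by rewrite subr_ge0 expr_le1 // ltW].
by rewrite lerD2l lerN2 expr2 ler_piMr // ltW.
Qed.

Lemma sum_wgt delta s : 0 < delta -> delta <= 1 -> sep_seq delta s ->
 \sum_(a <- s) wgt a <= 64 / delta ^+ 2.
move=> d0 d1 ss; apply: (le_via (4 * \sum_(a <- s) (dd a) ^+ 2)).
 rewrite mulr_sumr big_seq [leRHS]big_seq; apply: ler_sum => a ha; apply: wgt_le.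
 by have [_ ds _] := ss; exact: ds.
by have := sum_sqr_dist d0 d1 ss; set S := \sum_(_ <- _) _; set i := (delta ^+ 2)^-1; lra.
Qed.

(** Controls the logarithmic loss of the factor at [a] seen from a far point [z]; the second term
    accounts for [|a| psi] being smaller than [psi]. *)
Definition qval a z : R := (1 - psi a z ^+ 2) ^+ 2 + wgt a.

(** The first half of [qval] is the weight of the image of [a] under the automorphism [mob z], and
    the image list is separated with the same constant. *)
Lemma sum_qval delta s z : 0 < delta -> delta <= 1 -> sep_seq delta s -> Dk z ->
 \sum_(a <- s) qval a z <= 128 / delta ^+ 2.
move=> d0 d1 ss dz; rewrite big_split /=.
have h1 := sum_wgt d0 d1 ss.
have h2 := sum_wgt d0 d1 (sep_seq_mob dz d0 ss).
have : \sum_(a <- s) (1 - psi a z ^+ 2) ^+ 2 <= 64 / delta ^+ 2.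
 apply: letr h2; rewrite big_map le_eqVlt; apply/orP; left; apply/eqP.
 by apply: eq_bigr => a _; rewrite /wgt nc_mob.
by move: h1; set S := \sum_(_ <- _) _; set S' := \sum_(_ <- _) _; set i := (delta ^+ 2)^-1; lra.
Qed.

(* [(1 - |z|^2) t_a(z) = (1 - psi^2)(1 - |a|^2)], so AM-GM applies *)
Lemma sum_tval_shift delta s z : 0 < delta -> delta <= 1 -> sep_seq delta s -> Dk z ->
 (1 - nC z ^+ 2) * \sum_(a <- s) tval a z <= 64 / delta ^+ 2.
move=> d0 d1 ss dz; have h := sum_qval d0 d1 ss dz.
apply: (le_via (1 / 2 * \sum_(a <- s) qval a z)); last by move: h; set i := (delta ^+ 2)^-1; lra.
rewrite !mulr_sumr big_seq [leRHS]big_seq; apply: ler_sum => a ha.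
have [_ ds _] := ss; have da := ds _ ha.
have -> : (1 - nC z ^+ 2) * tval a z = (1 - psi a z ^+ 2) * (1 - nC a ^+ 2).
 by rewrite one_sub_psi // /tval /wgt; ring.
rewrite /qval /wgt; set x := 1 - psi a z ^+ 2; set y := 1 - nC a ^+ 2.
by have := sqr_ge0 (x - y); rewrite sqrrB; lra.
Qed.

Lemma esum_le_seq D h (M : R) : (forall a, D a -> 0 <= h a) ->
 (forall s, uniq s -> (forall a, a \in s -> D a) -> \sum_(a <- s) h a <= M) ->
 (\esum_(a in D) (h a)%:E <= M%:E)%E.
move=> h0 hM; apply: ge_ereal_sup => _ [F [fF FD] <-].
rewrite (fsbig_finite _ _ fF) /= sumEFin lee_fin; apply: hM; first exact: finmap.fset_uniq.
by move=> a; rewrite in_fset_set // inE => /FD.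
Qed.

Lemma esum_ge_seq D h s : (forall a, D a -> 0 <= h a) ->
 uniq s -> (forall a, a \in s -> D a) -> ((\sum_(a <- s) h a)%:E <= \esum_(a in D) (h a)%:E)%E.
move=> h0 us sD; apply: esum_ge; exists [set` s].
 by split; [exact: finite_seq|move=> a /= /sD].
by rewrite -sumEFin fsbig_seq.
Qed.
End HyperbolicGeometry.

(** * The complex exponential *)

Section ComplexExponential.
Implicit Types (g : RR -> C) (a : RR) (p : R).

Lemma mvt0 (f df : R -> R) (M y : R) : (forall t : R, is_derive t 1 f (df t)) ->
 (forall t, `|t| <= `|y| -> `|df t| <= M) -> `|f y - f 0| <= M * `|y|.
move=> hf hM.
have cf (a b : R) : {within `[a, b], continuous f}.
 by apply: continuous_subspaceT => t; apply: differentiable_continuous; apply/derivable1_diffP; have := hf t; case.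
have [y0|y0] := leP 0 y.
 have [c hc ->] := MVT_segment y0 (fun t _ => hf t) (cf 0 y).
 rewrite normrM subr0 lerMr //; apply: hM; move: hc; rewrite in_itv /= => /andP[c0 cy].
 by rewrite !ger0_norm.
have [c hc e] := MVT_segment (ltW y0) (fun t _ => hf t) (cf y 0).
rewrite distrC e normrM sub0r normrN lerMr //; apply: hM; move: hc; rewrite in_itv /= => /andP[c0 cy].
by rewrite !ler0_norm ?lerN2 // ltW.
Qed.

Lemma sin_bound (y : R) : `|sin y| <= `|y|.
have := @mvt0 sin cos 1 y (fun t => is_derive_sin t).
rewrite sin0 subr0 mul1r; apply => t _; rewrite ler_norml cos_geN1 cos_le1 //.
Qed.

Lemma cos_bound (y : R) : `|cos y - 1| <= `|y| ^+ 2.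
have := @mvt0 cos (fun t => - sin t) `|y| y (fun t => is_derive_cos t).
by rewrite cos0 -expr2; apply => t h; rewrite normrN; apply: letr (sin_bound t) _.
Qed.

Lemma sinB_bound (y : R) : `|sin y - y| <= `|y| ^+ 2 * `|y|.
have : `|(sin y - y) - (sin 0 - 0)| <= `|y| ^+ 2 * `|y|; last by rewrite sin0 !subr0.
apply: (@mvt0 (fun t => sin t - t) (fun t => cos t - 1)) => t h.
by apply: letr (cos_bound t) _; apply: lerXn2r; rewrite ?nnegrE.
Qed.

Lemma expR_bound (x : R) : `|x| <= 1 / 2 -> `|expR x - 1 - x| <= 2 * `|x| ^+ 2.
rewrite ler_norml => /andP[x1 x2].
have h1 := expR_ge1Dx x; have h2 := expR_ge1Dx (- x).
rewrite real_normK ?num_real // ger0_norm; last by lra.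
have e0 := expR_gt0 x.
have e : expR x * (1 - x) <= 1.
 rewrite -[leRHS](@expRxMexpNx_1 _ x); apply: lerMl; [exact: ltW|lra].
have : expR x * (1 - x) <= (1 + x + 2 * x ^+ 2) * (1 - x).
 apply: (letr e); have -> : (1 + x + 2 * x ^+ 2) * (1 - x) = 1 + x ^+ 2 * (1 - 2 * x) by ring.
 by rewrite lerDl mulr_ge0 ?sqr_ge0 //; lra.
by rewrite ler_pM2r; lra.
Qed.

Definition cexp (w : C) : C :=
 Complex (expR (re w) * cos (im w)) (expR (re w) * sin (im w)).

Lemma cexpD (x y : C) : cexp (x + y) = cexp x * cexp y.
case: x y => [x1 x2] [y1 y2]; apply: ceqP; rewrite ?ReM ?ImM /= expRD.
 by rewrite cosD; ring.
by rewrite sinD; ring.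
Qed.

Lemma nc_cexp (x : C) : cabs (cexp x) = expR (re x).
have e : cabs (cexp x) ^+ 2 = expR (re x) ^+ 2.
 by rewrite sqr_cabs /= !exprMn -mulrDr cos2Dsin2 mulr1.
by apply/eqP; rewrite -(@eqrXn2 _ 2) ?nc_ge0 ?expR_ge0 // e.
Qed.

Lemma cexp_taylor (h : C) : cabs h <= 1 / 2 -> cabs (cexp h - 1 - h) <= 8 * cabs h ^+ 2.
move=> hh; have hx := Re_le_cabs h; have hy := Im_le_cabs h.
set x := re h in hx *; set y := im h in hy *.
have e1 : `|expR x - 1 - x| <= 2 * `|x| ^+ 2 by apply: expR_bound; exact: letr hx hh.
have e2 : expR x <= 2.
 move: e1; rewrite ler_norml => /andP[_ e1].
 have n0 := normr_ge0 x; have : `|x| ^+ 2 <= 1 / 4.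
  have -> : 1 / 4 = (1 / 2) ^+ 2 :> R by field.
  by rewrite ler_sqrn //; lra.
 by have := ler_norm x; lra.
have e0 := expR_ge0 x.
have xx : `|x| ^+ 2 <= cabs h ^+ 2 by rewrite ler_sqrn ?nc_ge0.
have yy : `|y| ^+ 2 <= cabs h ^+ 2 by rewrite ler_sqrn ?nc_ge0.
have xy : `|x| * `|y| <= cabs h ^+ 2 by rewrite expr2 ler_pM.
apply: (letr (nc_le_ReIm _)); rewrite !ReD !ImD !ReN !ImN -/x -/y /=.
have -> : expR x * cos y - 1 - x = (expR x - 1 - x) + expR x * (cos y - 1) by ring.
have -> : expR x * sin y - 0 - y = expR x * (sin y - y) + (expR x - 1) * y by ring.
have b1 : `|expR x * (cos y - 1)| <= 2 * cabs h ^+ 2.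
 rewrite normrM (ger0_norm e0); apply: ler_pM => //; exact: letr (cos_bound y) yy.
have b2 : `|expR x * (sin y - y)| <= cabs h ^+ 2.
 rewrite normrM (ger0_norm e0); apply: (le_via (2 * (`|y| ^+ 2 * `|y|))).
  by apply: ler_pM => //; exact: sinB_bound.
 rewrite mulrCA -[leRHS]mulr1; apply: ler_pM => //.
 by have := letr hy hh; lra.
have b3 : `|(expR x - 1) * y| <= 2 * cabs h ^+ 2.
 rewrite normrM; apply: (le_via ((2 * `|x|) * `|y|)); last by rewrite -mulrA; lra.
 apply: lerMr => //.
 have -> : expR x - 1 = (expR x - 1 - x) + x by ring.
 apply: (letr (ler_normD _ _)).
 have x2 : `|x| ^+ 2 <= `|x| * (1 / 2) by rewrite expr2 lerMl //; exact: letr hx hh.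
 by lra.
have t1 := ler_normD (expR x - 1 - x) (expR x * (cos y - 1)).
have t2 := ler_normD (expR x * (sin y - y)) ((expR x - 1) * y).
have key (p1 p2 p3 p4 H X : R) : p1 <= 2 * X -> p2 <= 2 * H -> p3 <= H -> p4 <= 2 * H -> X <= H -> 0 <= H ->
  (p1 + p2) + (p3 + p4) <= 8 * H by clear; lra.
exact: letr (lerD t1 t2) (key _ _ _ _ _ _ e1 b1 b2 b3 xx (sqr_ge0 _)).
Qed.

Lemma cderiv_cexp g z l : cderiv g z l -> cderiv (fun w => cexp (g w)) z (l * cexp (g z)).
move=> hg eps e0; set E := cabs (cexp (g z)).
have E0 : 0 < E by rewrite /E nc_cexp expR_gt0.
have [d1 d10 h1] := cderiv_lip hg.
set L := cabs l + 1 in h1; have L0 : 0 < L by rewrite /L ltr_wpDl ?nc_ge0.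
have e1 : 0 < eps / (2 * E) by rewrite divr_gt0 // mulr_gt0.
have [d2 d20 h2] := hg _ e1.
have D0 : 0 < eps / (16 * E * L ^+ 2) by rewrite divr_gt0 // !mulr_gt0 // exprn_gt0.
exists (Num.min (Num.min d1 d2) (Num.min ((2 * L)^-1) (eps / (16 * E * L ^+ 2)))).
 by rewrite !lt_min d10 d20 D0 invr_gt0 mulr_gt0.
move=> w; rewrite !lt_min => /andP[/andP[w1 w2] /andP[w3 w4]].
set k := dC w z in w1 w2 w3 w4 *.
have k0 : 0 <= k by exact: nc_ge0.
have H1 := h1 w w1; have H2 := h2 w w2; rewrite -/k in H1 H2.
set h := g w - g z in H1 H2.
have hs : cabs h <= 1 / 2.
 apply: (letr H1); rewrite -ler_pdivlMl //; apply: (letr (ltW w3)).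
 by rewrite invfM mulrC div1r.
have H3 := cexp_taylor hs.
have -> : cexp (g w) - cexp (g z) - l * cexp (g z) * tz w z =
  cexp (g z) * (cexp h - 1 - h) + cexp (g z) * (h - l * tz w z).
 have -> : g w = g z + h by rewrite /h addrC subrK.
 by rewrite cexpD; ring.
apply: (letr (cabsD _ _)); rewrite !cabsM -/E.
have A1 : E * cabs (cexp h - 1 - h) <= eps / 2 * k.
 apply: (le_via (E * (8 * (L * k) ^+ 2))).
  apply: lerMl; first exact: ltW.
  apply: (letr H3); apply: lerMl => //; apply: lerXn2r; rewrite ?nnegrE ?nc_ge0 //.
  by rewrite mulr_ge0 // ltW.
 have -> : E * (8 * (L * k) ^+ 2) = (8 * E * L ^+ 2 * k) * k by ring.
 apply: lerMr => //.
 have := ltW w4; rewrite ler_pdivlMr ?mulr_gt0 ?exprn_gt0 //.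
 by rewrite (_ : k * (16 * E * L ^+ 2) = 2 * (8 * E * L ^+ 2 * k)); [lra|ring].
have A2 : E * cabs (h - l * tz w z) <= eps / 2 * k.
 apply: (le_via (E * (eps / (2 * E) * k))); first by apply: lerMl => //; exact: ltW.
 by rewrite mulrA lerMr // le_eqVlt; apply/orP; left; apply/eqP; field; rewrite gt_eqF.
by apply: (letr (lerD A1 A2)); rewrite -mulrDl -splitr.
Qed.
End ComplexExponential.

(** * Elementary factors of the infinite product *)

Section Factors.
Implicit Types (a : RR) (y : R).

(** Chosen so that [|1 - s| = |a| psi(a, z)] and [|s|^2 = tval a z]. Expanding [|1 - s|^2] then
    gives [Re s], hence the exact modulus of [(1 - s) exp s]. *)
Definition sfac a z : C := rC (1 - nC a ^+ 2) / (1 - conjc (toC a) * toC z).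
(** A canonical factor of genus one. For small [|a|] the modulus [|1 - s| = |a| psi] degenerates,
    and it vanishes identically at [a = 0], so a Blaschke factor is used instead; there [tval] is
    bounded and the difference is harmless. *)
Definition fac a z : C := if 1 / 2 <= nC a then (1 - sfac a z) * cexp (sfac a z)
 else (tz z a) / (1 - conjc (toC a) * toC z).

Lemma nc_sfac a z : cabs (sfac a z) ^+ 2 = tval a z.
by rewrite /sfac nc_div nc_rC -/(den a z) expr_div_n /tval /wgt real_normK ?num_real.
Qed.

Lemma nc_1sfac a z : Dk a -> Dk z -> cabs (1 - sfac a z) = nC a * psi a z.
move=> da dz; have n := den_neq0 da dz.
have -> : 1 - sfac a z = conjc (toC a) * tz a z / (1 - conjc (toC a) * toC z).
 rewrite /sfac rCD rCN rC1 -mulJ; apply: (mulIf n); rewrite mulrBl divfK // divfK //; ring.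
by rewrite nc_div cabsM cabsJ -mulrA psi_sym psiE (nc_distC (toC a)).
Qed.

Lemma Re_sfac a z : Dk a -> Dk z ->
 re (sfac a z) = (1 - (nC a * psi a z) ^+ 2) / 2 + tval a z / 2.
move=> da dz; rewrite -nc_1sfac // -nc_sfac; case: (sfac a z) => x y.
by rewrite !sqr_cabs /=; field.
Qed.

Lemma half_exp_le y : 0 <= y -> y * expR ((1 - y ^+ 2) / 2) <= 1.
move=> y0; have e0 := expR_gt0 ((1 - y ^+ 2) / 2).
rewrite -ler_pdivlMr // mul1r -expRN.
apply: letr (expR_ge1Dx _); have := sqr_ge0 (1 - y); rewrite sqrrB mul1r expr1n; lra.
Qed.

(** The inequality [1 + x <= exp x] at [x = y^-2 - 1] gives [y >= exp((1 - y^-2)/2)]; adding the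
    exponents yields the square. *)
Lemma half_exp_ge y : 0 < y -> expR (- ((1 - y ^+ 2) ^+ 2 / (2 * y ^+ 2))) <= y * expR ((1 - y ^+ 2) / 2).
move=> y0; have y20 : 0 < y ^+ 2 by rewrite exprn_gt0.
have -> : - ((1 - y ^+ 2) ^+ 2 / (2 * y ^+ 2)) = (1 - (y ^+ 2)^-1) / 2 + (1 - y ^+ 2) / 2.
 by field; rewrite gt_eqF.
rewrite expRD lerMr ?expR_ge0 //.
rewrite -(@ler_sqrn) ?expR_ge0 ?(ltW y0) // -expRM_natl.
have -> : 2%:R * ((1 - (y ^+ 2)^-1) / 2) = - ((y ^+ 2)^-1 - 1) :> R by field; rewrite gt_eqF.
rewrite expRN -[leRHS]invrK lef_pV2 ?posrE ?expR_gt0 ?invr_gt0 //.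
by have := expR_ge1Dx ((y ^+ 2)^-1 - 1); rewrite addrC subrK.
Qed.

Lemma nc_fac a z : Dk a -> Dk z -> 1 / 2 <= nC a ->
 cabs (fac a z) = (nC a * psi a z) * expR ((1 - (nC a * psi a z) ^+ 2) / 2) * expR (tval a z / 2).
by move=> da dz ha; rewrite /fac ha cabsM nc_cexp Re_sfac // nc_1sfac // expRD mulrA.
Qed.

Lemma nc_fac_small a z : nC a < 1 / 2 -> cabs (fac a z) = psi a z.
by move=> ha; rewrite /fac leNgt ha /= nc_div psi_sym psiE. Qed.

Lemma tval_small a z : Dk a -> Dk z -> nC a < 1 / 2 -> tval a z <= 4.
move=> da dz ha; rewrite /tval ler_pdivrMr ?exprn_gt0 ?den_gt0 //.
have h : 1 / 2 <= den a z.
 apply: letr (den_ge a z); have := disk_cabs dz; have := nc_ge0 (toC z); have := nc_ge0 (toC a).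
 move=> a0 z0 z1; have : nC a * nC z <= 1 / 2 * 1 by apply: ler_pM => //; exact: ltW.
 lra.
have : (1 / 2) ^+ 2 <= den a z ^+ 2 by rewrite ler_sqrn // nc_ge0.
have : wgt a <= 1.
 rewrite /wgt expr_le1 ?(ltW (sub_sqr_gt0 da)) //.
 by rewrite gerBl sqr_ge0.
rewrite expr_div_n expr1n; lra.
Qed.

Lemma expR_ge1 (x : R) : 0 <= x -> 1 <= expR x.
by move=> x0; apply: letr (expR_ge1Dx x); rewrite lerDl. Qed.

Lemma fac_le1 a z : Dk a -> Dk z -> cabs (fac a z) <= expR (tval a z / 2).
move=> da dz; have [ha|ha] := leP (1 / 2) (nC a).
 rewrite nc_fac // ler_piMl ?expR_ge0 // half_exp_le // mulr_ge0 ?nc_ge0 ?psi_ge0 //.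
rewrite nc_fac_small //; apply: (letr (ltW (psi_lt1 da dz))); apply: expR_ge1.
by rewrite divr_ge0 ?tval_ge0.
Qed.

Lemma fac_le_psi a z : Dk a -> Dk z -> cabs (fac a z) <= expR 1 * psi a z * expR (tval a z / 2).
move=> da dz; have [ha|ha] := leP (1 / 2) (nC a).
 rewrite nc_fac // lerMr ?expR_ge0 // [leRHS]mulrC; apply: ler_pM; rewrite ?expR_ge0 ?mulr_ge0 ?nc_ge0 ?psi_ge0 //.
  by rewrite ler_piMl ?psi_ge0 // ltW.
 by rewrite ler_expR; have := sqr_ge0 (nC a * psi a z); lra.
rewrite nc_fac_small // -mulrA mulrCA ler_peMr ?psi_ge0 // mulr_ege1 ?expR_ge1 //.
by rewrite divr_ge0 ?tval_ge0.
Qed.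

(** The constant [exp(-3)] covers both definitions of the factor: it is below [1/2], and it absorbs
    [exp(tval/2) <= exp 2] when [|a| < 1/2]. *)
Lemma fac_ge_psi a z : Dk a -> Dk z -> expR (-3) * psi a z * expR (tval a z / 2) <= cabs (fac a z).
move=> da dz; have [ha|ha] := leP (1 / 2) (nC a).
 rewrite nc_fac // lerMr ?expR_ge0 //.
 have y1 : (nC a * psi a z) ^+ 2 <= 1.
  rewrite expr_le1 ?mulr_ge0 ?nc_ge0 ?psi_ge0 // mulr_ile1 ?nc_ge0 ?psi_ge0 // ltW //.
  exact: psi_lt1.
 rewrite -[leLHS]mulr1; apply: ler_pM; rewrite ?mulr_ge0 ?expR_ge0 ?psi_ge0 //.
  apply: lerMr; rewrite ?psi_ge0 //; apply: letr ha.
  rewrite expRN invf_ple ?posrE ?expR_gt0 //; apply: letr (expR_ge1Dx 3); lra.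
 by apply: expR_ge1; lra.
rewrite nc_fac_small // mulrAC ler_piMl ?psi_ge0 // -expRD -[leRHS]expR0 ler_expR.
by have := tval_small da dz ha; lra.
Qed.

(** Away from its zero a factor loses only [exp(-O(qval))] against [exp(tval/2)], and [qval] is
    summable. For [|a| >= 1/2], with [x = (|a| psi)^2], one has [(1 - x)^2 <= 2 qval] and
    [x >= eta^2/4]; for [|a| < 1/2], [qval] is bounded below. *)
Lemma fac_ge_far (eta : R) a z : Dk a -> Dk z -> 0 < eta -> eta <= psi a z ->
 expR (- (8 / eta ^+ 2 * qval a z)) * expR (tval a z / 2) <= cabs (fac a z).
move=> da dz e0 he; have e20 : 0 < eta ^+ 2 by rewrite exprn_gt0.
have q0 : 0 <= qval a z by rewrite addr_ge0 ?sqr_ge0 ?wgt_ge0.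
have e1 : eta <= 1 by apply: (letr he); exact: ltW (psi_lt1 da dz).
have [ha|ha] := leP (1 / 2) (nC a).
 have y0 : 0 < nC a * psi a z by rewrite mulr_gt0 //; lra.
 rewrite nc_fac // lerMr ?expR_ge0 //; apply: letr (half_exp_ge y0).
 rewrite ler_expR lerN2; set x := (nC a * psi a z) ^+ 2.
 have x0 : 0 < x by rewrite exprn_gt0.
 have xe : eta ^+ 2 / 4 <= x.
  have -> : eta ^+ 2 / 4 = (1 / 2 * eta) ^+ 2 by field.
  rewrite ler_sqrn ?(ltW y0) //; last lra.
  by apply: ler_pM => //; lra.
 have xq : (1 - x) ^+ 2 <= 2 * qval a z.
  have ex : 1 - x = (1 - psi a z ^+ 2) + psi a z ^+ 2 * (1 - nC a ^+ 2) by rewrite /x; ring.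
  have p1 := psi_sqr_lt1 da dz; have a1 := sub_sqr_gt0 da; have p0 := sqr_ge0 (psi a z).
  have : 1 - x <= (1 - psi a z ^+ 2) + (1 - nC a ^+ 2).
   by rewrite ex lerD2l ler_piMl // ltW.
  have x1 : 0 <= 1 - x by rewrite ex; apply: addr_ge0; [lra|apply: mulr_ge0 => //; exact: ltW].
  move=> h; apply: (le_via (((1 - psi a z ^+ 2) + (1 - nC a ^+ 2)) ^+ 2)).
   by rewrite ler_sqrn // (letr x1 h).
  rewrite /qval /wgt; move: (1 - psi a z ^+ 2) (1 - nC a ^+ 2) => s t.
  by have := sqr_ge0 (s - t); rewrite sqrrB sqrrD; lra.
 rewrite ler_pdivrMr; last by rewrite mulr_gt0.
 apply: (letr xq).
 have : 1 <= 4 * x / eta ^+ 2 by rewrite ler_pdivlMr // mul1r; lra.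
 move=> h; have := lerMl q0 h.
 have -> : 8 / eta ^+ 2 * qval a z * (2 * x) = 4 * (qval a z * (4 * x / eta ^+ 2)) by field; rewrite gt_eqF.
 by move: q0; set k := qval a z * (_ / _); lra.
rewrite nc_fac_small // -expRD; apply: letr he.
have t4 := tval_small da dz ha.
have w9 : 9 / 16 <= qval a z.
 apply: (le_via (wgt a)); last by rewrite lerDr sqr_ge0.
 have -> : 9 / 16 = (3 / 4) ^+ 2 :> R by field.
 rewrite /wgt ler_sqrn ?(ltW (sub_sqr_gt0 da)) //.
 have : nC a ^+ 2 <= (1 / 2) ^+ 2 by rewrite ler_sqrn ?nc_ge0 // ltW.
 by rewrite expr_div_n expr1n; lra.
have i1 : 1 <= eta^-1 by rewrite invf_ge1.
have : expR (1 - eta^-1) <= eta.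
 rewrite -opprB expRN invf_ple ?posrE ?expR_gt0 //.
 by have := expR_ge1Dx (eta^-1 - 1); rewrite addrC subrK.
apply: letr; rewrite ler_expR.
have -> : 8 / eta ^+ 2 * qval a z = 8 * qval a z * (eta^-1 * eta^-1) by field; rewrite gt_eqF.
have : 9 / 2 * (eta^-1 * 1) <= 8 * qval a z * (eta^-1 * eta^-1).
 apply: ler_pM; rewrite ?mulr_ge0 ?invr_ge0 ?(ltW e0) //; first lra.
 by apply: lerMl => //; rewrite invr_ge0 ltW.
by rewrite mulr1; lra.
Qed.

Lemma holo_den a : Dk a -> holo Dk (fun z => (1 - conjc (toC a) * toC z)^-1).
move=> da; apply: holoV => [z dz|]; first exact: den_neq0.
by apply: holoB; [exact: holo_cst|apply: holoM; [exact: holo_cst|exact: holo_toC]].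
Qed.

Lemma fac_holo a : Dk a -> holo Dk (fac a).
move=> da; have [ha|ha] := leP (1 / 2) (nC a); last first.
 rewrite (_ : fac a = fun z => (tz z a) / (1 - conjc (toC a) * toC z)).
  by apply: holoM; [apply: holoB; [exact: holo_toC|exact: holo_cst]|exact: holo_den].
 by apply/funext => z; rewrite /fac leNgt ha.
rewrite (_ : fac a = fun z => (1 - sfac a z) * cexp (sfac a z)); last by apply/funext => z; rewrite /fac ha.
have hs : holo Dk (sfac a) by apply: holoM; [exact: holo_cst|exact: holo_den].
apply: holoM; first by apply: holoB => //; exact: holo_cst.
by move=> z dz; have [l hl] := hs z dz; eexists; exact: cderiv_cexp hl.
Qed.

(** Convergence of the product rests on [(1 - s) exp s = 1 + O(s^2)], where on a compact disk
    [|s|^2] is at most a multiple of the summable [wgt a]. When [|a| < 1/2] the weight is bounded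
    below and a crude bound suffices. *)
Lemma fac_near1 (r : R) : r < 1 -> exists2 K : R, 0 < K & forall a z, Dk a -> nC z <= r ->
 cabs (fac a z - 1) <= K * wgt a.
move=> r1; set S := (1 - r)^-1; have S0 : 0 < S by rewrite invr_gt0 subr_gt0.
pose K := 4 + 4 * (1 + (1 + S) * expR S) * S ^+ 2 + 13 * S ^+ 2.
have P0 : 0 <= (1 + (1 + S) * expR S).
 by rewrite addr_ge0 // mulr_ge0 ?expR_ge0 // addr_ge0 // ltW.
have S2 : 0 <= S ^+ 2 by exact: sqr_ge0.
have Q1 : 0 <= 4 * (1 + (1 + S) * expR S) * S ^+ 2 by apply: mulr_ge0 => //; apply: mulr_ge0.
have Q2 : 0 <= 13 * S ^+ 2 by apply: mulr_ge0.
exists K => [|a z da hz]; first by rewrite /K -addrA ltr_pwDl // addr_ge0.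
have dz : Dk z by exact: lelt hz r1.
have w0 := wgt_ge0 a.
have [ha|ha] := leP (1 / 2) (nC a); last first.
 apply: (le_via 2).
  apply: (letr (cabsB _ _)); rewrite cabs1 nc_fac_small //.
  by have := psi_lt1 da dz; lra.
 have w9 : 9 / 16 <= wgt a.
  have -> : 9 / 16 = (3 / 4) ^+ 2 :> R by field.
  rewrite /wgt ler_sqrn ?(ltW (sub_sqr_gt0 da)) //.
  have : nC a ^+ 2 <= (1 / 2) ^+ 2 by rewrite ler_sqrn ?nc_ge0 // ltW.
  by rewrite expr_div_n expr1n; lra.
 apply: (le_via (4 * wgt a)); first lra.
 by apply: lerMr => //; rewrite /K -addrA lerDl addr_ge0.
set s := sfac a z; have hs2 : cabs s ^+ 2 <= S ^+ 2 * wgt a.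
 rewrite nc_sfac /tval mulrC lerMr // /S exprVn lef_pV2 ?posrE ?exprn_gt0 ?den_gt0 ?subr_gt0 //.
 rewrite ler_sqrn ?nc_ge0 ?subr_ge0 ?(ltW r1) //.
 by apply: letr (den_ge_r da dz); rewrite lerD2l lerN2.
have hsS : cabs s <= S.
 rewrite -(@ler_sqrn) ?nc_ge0 ?(ltW S0) //; apply: (letr hs2); rewrite ler_piMr //.
 rewrite /wgt expr_le1 ?(ltW (sub_sqr_gt0 da)) //; by rewrite gerBl sqr_ge0.
rewrite /fac ha -/s.
have [h1|h1] := leP (cabs s) (1 / 2).
 have -> : (1 - s) * cexp s - 1 = (1 - s) * (cexp s - 1 - s) - s ^+ 2 by ring.
 apply: (letr (cabsB _ _)); rewrite cabsM cabsX.
 have b1 : cabs (1 - s) <= 3 / 2 by apply: (letr (cabsB _ _)); rewrite cabs1; lra.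
 have := ler_pM (nc_ge0 _) (nc_ge0 _) b1 (cexp_taylor h1).
 move=> h; apply: (le_via (13 * cabs s ^+ 2)); first by move: h; lra.
 apply: (le_via (13 * (S ^+ 2 * wgt a))); first by rewrite lerMl.
 by rewrite mulrA lerMr // /K lerDr addr_ge0.
apply: (le_via (1 + (1 + S) * expR S)).
 apply: (letr (cabsB _ _)); rewrite cabs1 addrC lerD2l cabsM nc_cexp.
 apply: ler_pM; rewrite ?nc_ge0 ?expR_ge0 //.
  by apply: (letr (cabsB _ _)); rewrite cabs1 lerD2l.
 by rewrite ler_expR; apply: letr hsS; apply: letr (Re_le_cabs s); exact: ler_norm.
apply: (le_via (4 * (1 + (1 + S) * expR S) * (S ^+ 2 * wgt a))); last first.
 by rewrite mulrA lerMr // /K addrAC lerDr addr_ge0.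
have : 1 <= 4 * cabs s ^+ 2.
 have := h1; rewrite -(@ltr_pXn2r _ 2) ?nnegrE ?nc_ge0 // expr_div_n expr1n => h; lra.
move=> h; have : 1 <= 4 * (S ^+ 2 * wgt a) by move: hs2; set x := S ^+ 2 * _; lra.
by move=> h2; rewrite mulrAC ler_peMl.
Qed.
End Factors.

(** * Locally uniform Cauchy sequences of holomorphic functions *)

Section UniformCauchy.

Lemma real_seq_lim (f : nat -> R) :
 (forall eps, 0 < eps -> exists N, forall M, (N <= M)%N -> `|f M - f N| <= eps) ->
 exists l : R, forall eps, 0 < eps -> exists N, forall M, (N <= M)%N -> `|f M - l| <= eps.
move=> hf; have cf : cvg (f @ \oo).
 apply/cauchy_cvgP/cauchy_exP => e e0; have e2 : 0 < e / 2 by rewrite divr_gt0.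
 have [N hN] := hf _ e2; exists (f N); exists N => // M /= hM.
 by rewrite /ball /= distrC; apply: lelt (hN M hM) _; lra.
exists (limn f) => eps e0; have := cf => /cvgrPdist_le /(_ _ e0) [N _ hN].
by exists N => M hM; rewrite distrC; exact: hN.
Qed.

Lemma complex_seq_lim (f : nat -> C) :
 (forall eps, 0 < eps -> exists N, forall M, (N <= M)%N -> cabs (f M - f N) <= eps) ->
 exists l : C, forall eps, 0 < eps -> exists N, forall M, (N <= M)%N -> cabs (f M - l) <= eps.
move=> hf.
have [|x hx] := @real_seq_lim (fun n => re (f n)).
 move=> e /hf [N hN]; exists N => M /hN; apply: letr.
 by rewrite -ReN -ReD; exact: Re_le_cabs.
have [|y hy] := @real_seq_lim (fun n => im (f n)).
 move=> e /hf [N hN]; exists N => M /hN; apply: letr.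
 by rewrite -ImN -ImD; exact: Im_le_cabs.
exists (Complex x y) => eps e0; have e2 : 0 < eps / 2 by rewrite divr_gt0.
have [N1 h1] := hx _ e2; have [N2 h2] := hy _ e2; exists (maxn N1 N2) => M.
rewrite geq_max => /andP[/h1 k1 /h2 k2]; apply: (letr (nc_le_ReIm _)).
by rewrite ReD ImD ReN ImN /= (splitr eps); exact: lerD.
Qed.

Lemma holo_cauchy_lim (f_ : nat -> RR -> C) : (forall n, holo Dk (f_ n)) ->
 (forall r eps : R, r < 1 -> 0 < eps -> exists N, forall M z, (N <= M)%N -> nC z <= r ->
   cabs (f_ M z - f_ N z) <= eps) ->
 exists2 f, holo Dk f & forall z, Dk z -> forall eps, 0 < eps ->
  exists N, forall M, (N <= M)%N -> cabs (f_ M z - f z) <= eps.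
move=> hf hc.
have /choice [f fP] : forall z, exists l : C, Dk z -> forall eps, 0 < eps ->
  exists N, forall M, (N <= M)%N -> cabs (f_ M z - l) <= eps.
 move=> z; have [dz|dz] := pselect (Dk z); last by exists 0.
 have [|l hl] := @complex_seq_lim (fun n => f_ n z); last by exists l.
 move=> eps e0; have [N hN] := hc (nC z) eps dz e0.
 by exists N => M hM; exact: hN.
exists f => //; apply: (holo_unif_lim hf) => r eps r1 e0.
have e2 : 0 < eps / 2 by rewrite divr_gt0.
have [N hN] := hc r _ r1 e2; exists N => z hz.
have dz : Dk z by exact: lelt hz r1.
have [N' hN'] := fP z dz _ e2.
have h1 := hN (maxn N N') z (leq_maxl _ _) hz; have h2 := hN' (maxn N N') (leq_maxr _ _).
apply: (letr (nc_distD (f_ (maxn N N') z) _ _)); rewrite (splitr eps) lerD //.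
by rewrite nc_distC.
Qed.

Lemma nc_prod (I : Type) (s : seq I) (F : I -> C) : cabs (\prod_(i <- s) F i) = \prod_(i <- s) cabs (F i).
by elim/big_ind2: _ => [|x1 x2 y1 y2 <- <-|//]; rewrite ?cabs1 ?cabsM. Qed.

Lemma expR_sum_seq (I : Type) (s : seq I) (F : I -> R) : expR (\sum_(i <- s) F i) = \prod_(i <- s) expR (F i).
by elim/big_ind2: _ => [|x1 x2 y1 y2 <- <-|//]; rewrite ?expR0 ?expRD. Qed.
End UniformCauchy.

Lemma ler_sum_subset (I : eqType) (s s' : seq I) (f : I -> R) : (forall i, 0 <= f i) ->
 uniq s -> uniq s' -> {subset s <= s'} -> \sum_(i <- s) f i <= \sum_(i <- s') f i.
move=> f0 us us' ss; have -> : \sum_(i <- s) f i = \sum_(i <- s' | i \in s) f i.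
 rewrite -(big_filter s' (fun i => i \in s)); apply: perm_big; apply: uniq_perm => //; first exact: filter_uniq.
 by move=> i; rewrite mem_filter; case: (boolP (i \in s)) => // /ss ->.
by rewrite [leRHS](bigID (fun i => i \in s)) /= lerDl; apply: sumr_ge0.
Qed.

Lemma dd_gt0 (a : RR) : Dk a -> 0 < dd a.
by move=> h; rewrite subr_gt0; exact: disk_cabs. Qed.

(** Each point owns a rational point of its disk from [sep_eballs], and the disks are disjoint. *)
Lemma sep_countable (L : set RR) (delta : R) : 0 < delta -> (forall a : RR, L a -> Dk a) ->
 (forall a b : RR, L a -> L b -> a <> b -> delta <= psi a b) -> countable L.
move=> d0 LD Lsep.
have /choice [q hq] : forall a : RR, exists q : rat * rat, L a -> eball a (delta / 2 * dd a) (ratr q.1, ratr q.2).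
 move=> a; have [za|za] := pselect (L a); last by exists (0, 0).
 set r := delta / 2 * (dd a).
 have r0 : 0 < r by rewrite mulr_gt0 ?divr_gt0 // subr_gt0; exact: disk_cabs (LD _ za).
 have lt (x : R) : x < x + r / 2 by rewrite ltrDl divr_gt0.
 have [q1 h1] := rat_in_itvoo (lt a.1); have [q2 h2] := rat_in_itvoo (lt a.2).
 exists (q1, q2) => _; move: h1 h2; rewrite !in_itv /= => /andP[a1 a2] /andP[b1 b2].
 change (dC (ratr q1, ratr q2) a < r).
 apply: (lelt (nc_le_ReIm _)); rewrite ReD ReN ImD ImN /toC /=.
 by rewrite !ger0_norm ?subr_ge0 ?(ltW a1) ?(ltW b1) //; lra.
apply/countable_injP; exists (fun a => pickle (q a)) => a b /set_mem za /set_mem zb /(pcan_inj pickleK) e.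
apply: contrapT => ab; have h1 := hq a za; have h2 := hq b zb; rewrite -e in h2.
exact: (sep_eballs d0 (LD _ za) (LD _ zb) (Lsep _ _ za zb ab) h1 h2).
Qed.

(** * Exhaustion of the disk and integration by parts *)

Section DbarTools.
Implicit Types (g : RR -> C) (r : R) (phi : RR -> R).

Lemma disk_bigcup_dball : Dk = \bigcup_n dball (1 - n.+1%:R^-1 : R).
apply/seteqP; split=> [z hz|z [n _ hz]]; last first.
 apply: dball_disk hz; by rewrite gerBl invr_ge0.
have z1 : 0 < 1 - nC z by rewrite subr_gt0; exact: hz.
have h := archi_boundP (ltW (let: h := z1 in eqbRL (invr_gt0 _) h)).
exists (Num.bound (dd z)^-1) => //; change (nC z < 1 - (Num.bound (dd z)^-1).+1%:R^-1).
rewrite ltrBrDr addrC -ltrBrDr -[ltRHS]invrK ltf_pV2 ?posrE ?invr_gt0 ?ltr0n //.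
by apply: lt_trans h _; rewrite ltr_nat.
Qed.

Lemma dball_incr : nondecreasing_seq (fun n => dball (1 - n.+1%:R^-1 : R)).
move=> n m nm; apply/subsetPset => z hz; have {}hz : nC z < 1 - n.+1%:R^-1 := hz.
change (nC z < 1 - m.+1%:R^-1); apply: (ltle hz).
by rewrite lerD2l lerN2 lef_pV2 ?posrE ?ltr0n // ler_nat.
Qed.

Lemma dball_lt1 (n : nat) : 1 - n.+1%:R^-1 < 1 :> R.
by rewrite ltrBlDr ltrDl invr_gt0 ltr0n. Qed.

Lemma cmeas_disk_local f : (forall r, r < 1 -> cmeas (dball r) f) -> cmeas Dk f.
move=> h; rewrite disk_bigcup_dball; split; apply/measurable_fun_bigcup => n;
 by [exact: mdball|case: (h _ (dball_lt1 n))].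
Qed.

Lemma integral_disk_le (F : RR -> \bar R) (M : \bar R) : mfun DP F ->
 (forall z, (0 <= F z)%E) -> (forall r, r < 1 -> (\int[A]_(z in dball r) F z <= M)%E) ->
 (\int[A]_(z in Dk) F z <= M)%E.
move=> mF F0 h; have mb n := @mdball (1 - n.+1%:R^-1).
have := @ge0_nondecreasing_set_cvg_integral _ PT R _ F A (@dball_incr) mb.
rewrite -disk_bigcup_dball => cv; have {}cv := cv (fun n => @measurable_funS _ _ PT _ _ _ F (@mdisk)
 (dball_disk (ltW (dball_lt1 n))) mF) (fun n z _ => F0 z).
rewrite -(cvg_lim _ cv) //; apply: lime_le; first by apply/cvg_ex; eexists; exact: cv.
by apply: nearW => n; apply: h; exact: dball_lt1.
Qed.

(** The constant [1] is weakly holomorphic; testing it against [b phi] and expanding by the product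
    rule is integration by parts. *)
Lemma ibp_csmooth (b : RR -> C) phi : csmooth b -> ctest (fun z => rC (phi z)) ->
 ID (fun z => b z * dbar phi z) = - ID (fun z => cdbar b z * rC (phi z)).
move=> sb tp; have md := @mdisk.
have w1 : weakhol (fun _ : RR => 1 : C) by apply: holo_weak; exact: holo_cst.
have [sp _] := tp.
have t1 := ctestM tp sb; have := w1.2 _ t1.
rewrite (eq_cinteg (g := fun z => b z * dbar phi z + cdbar b z * rC (phi z))); last first.
 move=> z _; rewrite mul1r cdbarM // cdbar_rC; by rewrite addrC (mulrC (rC _)).
have l1 : locint (fun _ : RR => 1 : C) by case: w1.
have i1 : L1D (fun z => b z * dbar phi z).
 have := locint_ctest l1 (ctestM (ctest_cdbar tp) sb); apply: eq_cL1 => // z _.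
 by rewrite mul1r cdbar_rC mulrC.
have i2 : L1D (fun z => cdbar b z * rC (phi z)).
 have := locint_ctest l1 (ctestM tp (csmooth_cdbar sb)); apply: eq_cL1 => // z _.
 by rewrite mul1r mulrC.
by rewrite cintegD // => /eqP; rewrite addr_eq0 => /eqP.
Qed.

Lemma cint_ctest_split u (phi : RR -> C) : locint u -> ctest phi ->
 [/\ ctest (fun z => rC (re (phi z))), ctest (fun z => rC (im (phi z))) &
 ID (fun z => u z * cdbar phi z) =
 ID (fun z => u z * dbar (fun z => re (phi z)) z) +
 Complex 0 1 * ID (fun z => u z * dbar (fun z => im (phi z)) z)].
move=> lu tp; have md := @mdisk; have [t1 t2] := ctest_test tp.
have := test_ctest t1 => {}t1; have := test_ctest t2 => {}t2; split => //.
have i1 := locint_ctest lu (ctest_cdbar t1); have i2 := locint_ctest lu (ctest_cdbar t2).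
have i1' : L1D (fun z => u z * dbar (fun z => re (phi z)) z).
 by apply: eq_cL1 i1 => // z _; rewrite cdbar_rC.
have i2' : L1D (fun z => u z * dbar (fun z => im (phi z)) z).
 by apply: eq_cL1 i2 => // z _; rewrite cdbar_rC.
rewrite -cintegZ // -cintegD //; last exact: cL1Z.
by apply: eq_cinteg => z _; rewrite /cdbar mulrDr; congr (_ + _); rewrite mulrCA.
Qed.

Lemma weakhol_real u : locint u -> (forall phi, ctest (fun z => rC (phi z)) ->
 ID (fun z => u z * dbar phi z) = 0) -> weakhol u.
move=> lu h; split => // phi tp; have [t1 t2 ->] := cint_ctest_split lu tp.
by rewrite h // h // mulr0 addr0.
Qed.

Lemma solution_ctest f u (phi : RR -> C) : dbar_solution f u -> ctest phi ->
 ID (fun z => u z * cdbar phi z) =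
 - ID (fun z => f z / rC (1 - nC z ^+ 2) * phi z).
move=> [/locintP lu [/locintP lf h]] tp; have md := @mdisk.
have [t1 t2 ->] := cint_ctest_split lu tp; have [p1 p2] := ctest_test tp.
have := h _ p1; have := h _ p2; rewrite !cintE => -> ->.
have i1 := locint_ctest lf t1; have i2 := locint_ctest lf t2.
rewrite mulrN -opprD -cintegZ // -cintegD //; last exact: cL1Z.
congr (- _); apply: eq_cinteg => z _; rewrite [X in _ = _ * X](_ : _ = rC (re (phi z)) + Complex 0 1 * rC (im (phi z))).
 by rewrite mulrDr; congr (_ + _); rewrite mulrCA.
by apply: ceqP; rewrite ?ReD ?ImD ?ReM ?ImM /=; ring.
Qed.

Lemma locintM_bounded u g : locint u -> cmeas Dk g ->
 (forall r, r < 1 -> exists M : R, forall z, nC z < r -> cabs (g z) <= M) -> locint (fun z => g z * u z).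
move=> lu mg hg r r1; have [M hM] := hg r r1.
apply: (@cL1M_bounded _ _ _ M); [exact: mdball|exact: lu| |exact: hM].
by apply: cmeas_sub mg; [exact: mdisk|apply: dball_disk; exact: ltW].
Qed.

Lemma holo_locint_mul u f : locint u -> holo Dk f -> locint (fun z => f z * u z).
move=> lu hf; apply: locintM_bounded => //; first exact: holo_cmeas.
by move=> r r1; have [M M0 hM] := holo_bounded hf r1; exists M => z /ltW; exact: hM.
Qed.
End DbarTools.

(** * Local means and comparison of the two distances *)

Section LocalData.
Implicit Types (g : RR -> C) (a : RR) (s : seq RR) (D : set PT).

Lemma poweR_lty (x : \bar R) (r : R) : (0 <= r)%R -> (x < +oo)%E -> (x `^ r < +oo)%E.
by case: x => [x| |] r0 //=; rewrite ?ltry //; case: ifP => _ _; rewrite ?ltry // lte_fin. Qed.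

Lemma ler_poweR (x y : \bar R) (r : R) : 0 <= r -> (0 <= x)%E -> (x <= y)%E -> (x `^ r <= y `^ r)%E.
move=> r0 x0 xy; have y0 := letr x0 xy.
by apply: (@gt0_ler_poweR _ r) => //; rewrite in_itv /= leey andbT.
Qed.

Lemma cmeas_conj_toC D : cmeas D (fun w => conjc (toC w)).
by have [h1 h2] := @cmeas_toC D; split => //=; exact: mcomp. Qed.

Lemma cmeas_mob_arg z D : cmeas D (fun w => (tz z w) / (1 - conjc (toC w) * toC z)).
apply: cmeasM; first by apply: cmeasB; [exact: cmeas_cst|exact: cmeas_toC].
apply: cmeasV; apply: cmeasB; first exact: cmeas_cst.
by apply: cmeasM; [exact: cmeas_conj_toC|exact: cmeas_cst].
Qed.

Lemma mpdisk z (r : R) : measurable (pdisk z r : set PT).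
have -> : pdisk z r = setT `&` [set w | cabs (tz z w / (1 - conjc (toC w) * toC z)) < r].
 by rewrite setTI.
by apply: meas_lt_cabs => //; exact: cmeas_mob_arg.
Qed.

Lemma mq_le (Rr q M : R) g z : 0 < q -> 0 <= M ->
 (forall w, pdisk z Rr w -> cabs (g w) <= M) -> (mq Rr q g z <= M%:E)%E.
move=> q0 M0 h; have mD := mpdisk z Rr.
have I0 : (0 <= \int[A]_(w in pdisk z Rr) (cabs (g w) `^ q)%:E)%E.
 by apply: integral_ge0 => w _; rewrite lee_fin powR_ge0.
have le : (\int[A]_(w in pdisk z Rr) (cabs (g w) `^ q)%:E <= (M `^ q)%:E * A (pdisk z Rr))%E.
 have <- := @integral_cst _ _ R A (pdisk z Rr) mD (M `^ q)%:E.
 apply: le_int => w hw; first by rewrite lee_fin powR_ge0.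
 by rewrite lee_fin; apply: ler_powR2r; rewrite ?nc_ge0 ?h.
suff hm : ((fine (A (pdisk z Rr)))^-1%:E * \int[A]_(w in pdisk z Rr) (cabs (g w) `^ q)%:E <= (M `^ q)%:E)%E.
 have -> : M%:E = ((M `^ q)%:E `^ q^-1)%E by rewrite poweR_EFin powRK.
 apply: ler_poweR => //; first by rewrite invr_ge0 ltW.
 by rewrite mule_ge0 // lee_fin invr_ge0 fine_ge0.
have m0 : (0 <= A (pdisk z Rr))%E by [].
(* If the area is infinite or zero, the factor [(fine _)^-1] is [0] and the mean is trivially
   bounded. *)
move: le m0; case: (A (pdisk z Rr)) => [x| |] le m0 //=; last first.
 by rewrite invr0 mul0e lee_fin powR_ge0.
rewrite lee_fin in m0; have [->|x0] := eqVneq x 0; first by rewrite invr0 mul0e lee_fin powR_ge0.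
apply: letr (leeMl _ le) _; first by rewrite lee_fin invr_ge0.
by rewrite -!EFinM lee_fin mulrCA mulVf // mulr1.
Qed.

Lemma den_le_dist w z : Dk w -> den w z <= 2 * dd w + dC z w.
move=> hw; have w1 := disk_cabs hw; have w0 := nc_ge0 (toC w).
have -> : den w z = cabs (rC (1 - nC w ^+ 2) - conjc (toC w) * tz z w).
 by rewrite /den mulrBr (mulrC (conjc _) (toC w)) mulJ rCD rCN rC1; congr cabs; ring.
apply: letr (cabsB _ _) _; rewrite nc_rC cabsM cabsJ ger0_norm; last exact: ltW (sub_sqr_gt0 hw).
apply: lerD; last by rewrite ler_piMl ?nc_ge0 // ltW.
have -> : 1 - nC w ^+ 2 = dd w * (1 + nC w) by ring.
rewrite mulrC; apply: lerMr; [rewrite subr_ge0 ltW //|move: w1; lra].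
Qed.

(** A pseudo-hyperbolic disk of radius [r < 1] lies in a Euclidean disk of radius comparable to the
    distance to the circle; insert [den_le_dist] in the definition and solve for [|z - w|]. *)
Lemma psi_dist (r : R) z w : Dk z -> Dk w -> 0 < r < 1 -> psi z w < r ->
 dC z w <= 2 * r / (1 - r) * dd w.
move=> hz hw /andP[r0 r1]; rewrite psiE ltr_pdivrMr ?den_gt0 // => h.
have r1' : 0 < 1 - r by rewrite subr_gt0.
have h2 := lerMl (ltW r0) (den_le_dist z hw).
have key (x y t : R) : x < r * t -> r * t <= r * (2 * y + x) -> x * (1 - r) <= 2 * r * y by lra.
by rewrite mulrAC ler_pdivlMr //; exact: key h h2.
Qed.

Lemma csmooth_sum s (F : RR -> RR -> C) : (forall a, csmooth (F a)) ->
 csmooth (fun z => \sum_(a <- s) F a z) /\ forall z, cdbar (fun z => \sum_(a <- s) F a z) z = \sum_(a <- s) cdbar (F a) z.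
move=> h; elim: s => [|a s [h1 h2]].
 have e : (fun z => \sum_(a <- [::]) F a z) = fun _ => 0 by apply/funext => z; rewrite big_nil.
 by rewrite e; split=> [|z]; [exact: csmooth_cst|rewrite big_nil cdbar_cst].
have e : (fun z => \sum_(b <- a :: s) F b z) = fun z => F a z + \sum_(b <- s) F b z.
 by apply/funext => z; rewrite big_cons.
by rewrite e; split=> [|z]; [exact: csmoothD|rewrite cdbarD // h2 big_cons].
Qed.

Lemma cinteg_ae D f g : measurable D -> cmeas D f -> cmeas D g ->
 {ae A, forall z, D z -> f z = g z} -> cinteg D f = cinteg D g.
move=> mD [f1 f2] [g1 g2] [N [mN N0 sub]].
by apply: ceqP => /=; apply: (congr1 fine); (apply: ae_eq_integral => //; [exact/mEFP|exact/mEFP|]);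
 exists N; split => // z /= hz; apply: sub => /= fg; apply: hz => /fg ->.
Qed.
End LocalData.

(** * Division of holomorphic functions *)

Section Division.
Implicit Types (g h q : RR -> C) (c : RR).

(* A maximum principle up to a constant: the Cauchy kernel lives on the annulus. *)
Lemma annulus_bound : exists2 K : R, 0 < K & forall q c (rho M : R) z, holo Dk q -> 0 < rho -> 0 <= M ->
 nC c + 2 * rho <= 1 -> (forall w, rho < dC w c < 3 / 2 * rho -> cabs (q w) <= M) ->
 dC z c <= rho / 2 -> cabs (q z) <= K * M.
have [B B0 hB] := cauchy_quot_bound; have k0 := kappa_gt0.
exists ((kappa)^-1 * (32 * B)); first by rewrite !mulr_gt0 ?invr_gt0.
move=> q c rho M z hq r0 M0 cr hM zc; have md := @mdisk.
rewrite (holo_cauchy hq r0 cr zc) cabsM cabsV nc_rC gtr0_norm // -mulrA; apply: lerMl; first by rewrite invr_ge0 ltW.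
have me := @meball c (2 * rho).
have eD : eball c (2 * rho) `<=` Dk by apply: eball_disk; move: cr; lra.
rewrite (@cinteg_sub (eball c (2 * rho)) Dk) //; last first.
 move=> w _ /negP; rewrite -leNgt => cw; rewrite cker_eq0 ?mul0r ?mulr0 //.
 by right; apply: letr cw; move: r0; lra.
have rn : rho != 0 by rewrite gt_eqF.
have -> : 32 * B * M = 2 * (M * (B / rho ^+ 2) * (4 * (2 * rho) ^+ 2)) by field.
apply: cinteg_le => //.
- by apply: area_eball_le; rewrite mulr_ge0 // ltW.
- apply: (cmeas_sub md eD); apply: cmeasM; first exact: holo_cmeas.
 apply: cmeasM; last by apply: cmeasV; exact: cmeas_toCB.
 by apply: csmooth_cmeas => //; have [] := ctest_cker r0 cr.
- by rewrite mulr_ge0 // divr_ge0 ?exprn_ge0 ?ltW.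
- move=> w _; rewrite cabsM; have [->|k1] := eqVneq (cker c rho w) 0.
  by rewrite mul0r cabs0 mulr0 mulr_ge0 // divr_ge0 ?exprn_ge0 ?ltW.
 by apply: ler_pM; rewrite ?nc_ge0 ?hB ?hM ?(cker_neq0 r0 k1).
Qed.

Lemma cderiv_neq0_near f z l : cderiv f z l -> f z != 0 ->
 exists2 r : R, 0 < r & forall w, dC w z < r -> f w != 0.
move=> /cderiv_lip [d d0 hd] fz; have l0 : 0 < cabs l + 1 by rewrite ltr_wpDl ?nc_ge0.
exists (Num.min d (cabs (f z) / (cabs l + 1))); first by rewrite lt_min d0 divr_gt0 // nc_gt0.
move=> w; rewrite lt_min => /andP[wd]; rewrite ltr_pdivlMr // mulrC => h; rewrite -nc_gt0.
have := nc_leB (f z) (f w); rewrite nc_distC => h2.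
rewrite -subr_gt0; have := lelt (hd w wd) h; move: h2; rewrite subr0; lra.
Qed.

(** The hypothesis says that every zero of [f] is simple and is a zero of [G]. Both functions are
    divided by [z - b] there, and the quotient of the cofactors is holomorphic near [b], where [b]
    is the only zero of [f]. *)
Lemma holo_quot f G : holo Dk f -> holo Dk G ->
 (forall b, Dk b -> f b = 0 -> G b = 0 /\
  exists q, [/\ holo Dk q, forall z, Dk z -> f z = tz z b * q z & q b != 0]) ->
 exists2 h, holo Dk h & forall z, Dk z -> G z = f z * h z.
move=> hf hG hz.
have loc b : exists T : (RR -> C) * (RR -> C), Dk b -> f b = 0 ->
 [/\ holo Dk T.1, holo Dk T.2, forall z, Dk z -> f z = tz z b * T.2 z,
 forall z, Dk z -> G z = tz z b * T.1 z & T.2 b != 0].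
 have [bD|] := pselect (Dk b); last by exists (G, G).
 have [fb|/eqP fb] := eqVneq (f b) 0; last by exists (G, G) => _ /fb.
 have [Gb [q [hq fq qb]]] := hz b bD fb; have [g hg Gg] := holo_div hG bD Gb.
 by exists (g, q).
have [T hT] := choice loc.
pose h z := if f z == 0 then (T z).1 z / (T z).2 z else G z / f z.
exists h => z zD; last first.
 rewrite /h; have [fz|fz] := eqVneq (f z) 0; last by rewrite mulrC divfK.
 by rewrite fz mul0r; have [-> _] := hz z zD fz.
have [lf cf] := hf z zD; have [lG cG] := hG z zD; have [fz|fz] := eqVneq (f z) 0; last first.
 have [r r0 hr] := cderiv_neq0_near cf fz; have := cderivM cG (cderivV fz cf).
 move=> c3; eexists; apply: cderiv_eq _ erefl c3; exists r => // w /hr fw; by rewrite /h (negbTE fw).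
have [h1 h2 h3 h4 h5] := hT z zD fz; have [l1 c1] := h1 z zD; have [l2 c2] := h2 z zD.
have [r r0 hr] := cderiv_neq0_near c2 h5; have z1 : 0 < dd z by exact: dd_gt0.
have := cderivM c1 (cderivV h5 c2) => c3.
eexists; apply: cderiv_eq _ erefl c3; exists (Num.min r (dd z)); first by rewrite lt_min r0.
move=> w; rewrite lt_min => /andP[/hr qw wz].
have wD : Dk w by apply: (@eball_disk z (dd z)).
rewrite /h; have [fw|fw] := eqVneq (f w) 0; last first.
 have wz0 : toC w - toC z != 0 by apply: contra_neq fw => e; rewrite h3 // e mul0r.
 by rewrite h3 // h4 // invfM mulrACA divff // mul1r.
suff -> : w = z by [].
apply: toC_inj; apply/eqP; rewrite -subr_eq0; move: fw => /eqP; rewrite h3 // mulf_eq0.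
by rewrite (negbTE qw) orbF.
Qed.
End Division.

(** * The means [m_q] against integrals over small cells *)

Section Averages.
Implicit Types (g : RR -> C) (a : RR) (r x : R) (E : set PT).

(** [pdisk] is taken in the whole plane. Off the open unit disk [psi >= 1], except at the reflected
    point [1 / conj(z)], where division by zero makes [psi] equal to [0]; a vertical line, which is
    null, absorbs that point. *)
Lemma area_pdisk_le z r : Dk z -> 0 < r < 1 ->
 (A (pdisk z r) <= (4 * ((2 * r / (1 - r) + 1) * dd z) ^+ 2)%:E)%E.
move=> zD /andP[r0 r1]; have dz := dd_gt0 zD; pose v : R := (ofC (conjc (toC z)^-1)).1.
have r1' : 0 < 1 - r by rewrite subr_gt0.
have k0 : 0 <= 2 * r / (1 - r) by rewrite divr_ge0 ?mulr_ge0 ?ltW.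
have c0 := mulr_ge0 (addr_ge0 k0 ler01) (ltW dz).
have sub : pdisk z r `<=` eball z ((2 * r / (1 - r) + 1) * dd z) `|` [set w : RR | w.1 = v].
 move=> w zw; have {}zw : psi z w < r := zw; have [wD|/negP wD] := pselect (Dk w).
  left; apply: (@lelt _ _ (2 * r / (1 - r) * dd z)); last by rewrite [ltRHS]mulrDl mul1r ltrDl.
  by apply: psi_dist => //; rewrite ?r0 // psi_sym.
 right; rewrite -leNgt in wD; rewrite psiE in zw; have [d0|dn] := eqVneq (den w z) 0.
  have /eqP e : toC z * conjc (toC w) == 1.
   by rewrite -subr_eq0 -nc_eq0 nc_distC mulrC; apply/eqP.
  have zn : toC z != 0 by apply: contra_eq_neq e => ->; rewrite mul0r eq_sym oner_eq0.
  change (re (toC w) = v); rewrite -[toC w]conjC_K; suff -> : conjc (toC w) = (toC z)^-1 by [].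
  by rewrite -[LHS]mul1r -(mulVf zn) -mulrA e mulr1.
 exfalso; have dp : 0 < den w z by rewrite lt_neqAle eq_sym dn nc_ge0.
 move: zw; rewrite ltr_pdivrMr // => h; have : dC z w < den w z.
  by apply: ltle h _; rewrite ler_piMl // ltW.
 apply/negP; rewrite -leNgt -ler_sqrn ?nc_ge0 // den_sqr gerDl.
 by rewrite mulr_le0_ge0 ?(ltW (sub_sqr_gt0 zD)) // subr_le0 exprn_ege1.
have mE := @meball z ((2 * r / (1 - r) + 1) * dd z).
have mV := @meas_vline v; apply: (letr (y := A (eball z ((2 * r / (1 - r) + 1) * dd z) `|` [set w : RR | w.1 = v]))).
 by apply: le_measure => //; rewrite inE; [exact: mpdisk|exact: measurableU].
apply: letr (measureU2 _ mE mV) _.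
have h : (A [set w : RR | w.1 = v] <= 0)%E by rewrite area_vline.
by have := leeD (area_eball_le z c0) h; rewrite adde0; exact.
Qed.

(* Young's inequality [x <= t + t^(1-q) x^q] with [t] above the mean replaces Hoelder's. *)
Lemma mq_ge (Rr q : R) : 0 < Rr < 1 -> 1 <= q -> exists2 K : R, 0 < K & forall g a z E r,
 cmeas DP g -> Dk a -> Dk z -> measurable E -> 0 < r -> r <= 1 / 16 -> 8 * r <= Rr ->
 E `<=` Dk -> (forall w, E w -> dC w a <= r * dd a) -> dC z a <= r * dd a ->
 (\int[A]_(w in E) (cabs (g w))%:E <= (K * dd a ^+ 2)%:E * mq Rr q g z)%E.
move=> hR q1; have [R0 R1] := andP hR; have q0 : 0 < q by exact: ltle q1.
have R1' : 0 < 1 - Rr by rewrite subr_gt0.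
pose k : R := 2 * Rr / (1 - Rr) + 1; have k0 : 0 < k by rewrite ltr_wpDl // !mulr_ge0 ?invr_ge0 ?ltW.
exists (2 * (4 * (k * 2) ^+ 2)) => [|g a z E r mg aD zD mE r0 r16 rR ED Ea za].
 by rewrite !mulr_gt0 // exprn_gt0 // mulr_gt0.
have da := dd_gt0 aD; have dz := dd_gt0 zD; have md := @mdisk; have mP := mpdisk z Rr.
have ra : r * dd a <= dd a / 16 by rewrite mulrC ler_pM2l //; move: r16; lra.
have dza : dd z <= 2 * dd a.
 by have := nc_leB (toC a) (toC z); rewrite nc_distC; move: za ra da; lra.
have inP w : Dk w -> dC w a <= r * dd a -> pdisk z Rr w.
 move=> wD wa; change (psi z w < Rr); rewrite psiE ltr_pdivrMr ?den_gt0 //.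
 have h1 := nc_distD (toC a) (toC z) (toC w); rewrite (nc_distC (toC a)) in h1.
 have h2 := den_ge_l wD zD; have h3 := nc_leB (toC w) (toC a).
 have : Rr * (dd a / 2) <= Rr * den w z by apply: lerMl; [exact: ltW|move: h2 h3 wa ra da; lra].
 have := lerMr (ltW da) rR; have := mulr_gt0 r0 da.
 have -> : Rr * (dd a / 2) = Rr * dd a / 2 by ring.
 have -> : 8 * r * dd a = 8 * (r * dd a) by ring.
 have key (x1 x2 x3 y Y D : R) : x1 <= x2 + x3 -> x3 <= y -> x2 <= y -> 0 < y -> 8 * y <= Y -> Y / 2 <= D -> x1 < D by lra.
 exact: key h1 wa za.
pose al := fine (A (pdisk z Rr)); have ale : (A (pdisk z Rr) <= (4 * (k * dd z) ^+ 2)%:E)%E := area_pdisk_le zD hR.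
have alE : A (pdisk z Rr) = al%:E by rewrite fineK // ge0_fin_numE //; exact: lelt ale (ltry _).
have al1 : al <= 4 * (k * 2) ^+ 2 * dd a ^+ 2.
 rewrite alE lee_fin in ale; apply: (letr ale); rewrite -mulrA ler_pM2l // -exprMn.
 by rewrite ler_sqr ?nnegrE ?mulr_ge0 ?(ltW k0) ?(ltW dz) ?(ltW da) // -mulrA ler_pM2l.
have al0 : 0 < al.
 apply: (@ltle _ _ ((r * dd a) ^+ 2)); first by rewrite exprn_gt0 // mulr_gt0.
 rewrite -lee_fin -alE; apply: letr (area_eball_ge a (ltW (mulr_gt0 r0 da))) _.
 apply: le_measure; rewrite ?inE //; first exact: (@meball).
 move=> w wa; apply: inP; last exact: ltW wa.
 by apply: (@eball_disk a (r * dd a)) => //; move: ra da; lra.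
have EP : E `<=` pdisk z Rr by move=> w Ew; apply: inP; [exact: ED|exact: Ea].
have I0 : (0 <= \int[A]_(w in pdisk z Rr) (cabs (g w) `^ q)%:E)%E.
 by apply: integral_ge0 => w _; rewrite lee_fin powR_ge0.
have Kd : 0 < 2 * (4 * (k * 2) ^+ 2) * dd a ^+ 2 by rewrite !mulr_gt0 ?exprn_gt0 ?mulr_gt0.
have : (mq Rr q g z `^ q = al^-1%:E * \int[A]_(w in pdisk z Rr) (cabs (g w) `^ q)%:E)%E.
 rewrite /mq -/al -poweRrM mulVf ?gt_eqF // poweRe1 //.
 by rewrite mule_ge0 // lee_fin invr_ge0 ltW.
have : (0 <= mq Rr q g z)%E by exact: poweR_ge0.
case: (mq Rr q g z) => [t| |] // t0 te; last by rewrite mulry gtr0_sg ?mul1e ?leey.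
rewrite lee_fin in t0; rewrite poweR_EFin in te.
have IE : (\int[A]_(w in pdisk z Rr) (cabs (g w) `^ q)%:E = (al * t `^ q)%:E)%E.
 by rewrite EFinM te muleA -EFinM divff ?gt_eqF // mul1e.
have le (s : R) : t < s -> (\int[A]_(w in E) (cabs (g w))%:E <= (2 * al * s)%:E)%E.
 move=> ts; have s0 : 0 < s by exact: lelt ts.
 have mF : mfun E (fun w => (s `^ (1 - q) * cabs (g w) `^ q)%:E).
  by apply/mEFP; apply: mfunM => //; apply: cmeas_powR; exact: cmeas_sub mg.
 apply: (le_via (\int[A]_(w in E) (s%:E + (s `^ (1 - q) * cabs (g w) `^ q)%:E))%E).
  apply: le_int => w _; first by rewrite lee_fin nc_ge0.
  rewrite -EFinD lee_fin; have [gs|sg] := leP (cabs (g w)) s.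
   by apply: letr gs _; rewrite lerDl mulr_ge0 ?powR_ge0.
  apply: (le_via (s `^ (1 - q) * cabs (g w) `^ q)); last by rewrite lerDr ltW.
  have gp : 0 < cabs (g w) by exact: lt_trans sg.
  have e : cabs (g w) = cabs (g w) `^ (1 - q) * cabs (g w) `^ q.
   by rewrite -powRD ?subrK ?powRr1 ?(ltW gp) // (gt_eqF gp) implybT.
  rewrite {1}e; apply: lerMr; first exact: powR_ge0.
  rewrite -opprB !powRN lef_pV2 ?posrE ?powR_gt0 //.
  by have [->|qn] := eqVneq q 1; [rewrite subrr !powRr0|apply: ler_powR2r; rewrite ?subr_gt0 ?lt_neqAle ?(eq_sym 1) ?qn ?(ltW s0) ?(ltW gp) ?(ltW sg)].
 rewrite ge0_integralD //; [|by move=> w _; rewrite lee_fin ltW|by move=> w _; rewrite lee_fin mulr_ge0 ?powR_ge0].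
 have -> : 2 * al * s = s * al + s * al by ring.
 rewrite EFinD; apply: leeD.
  rewrite integral_cst // EFinM -alE; apply: leeMl; first by rewrite lee_fin ltW.
  by apply: le_measure; rewrite ?inE.
 under eq_integral do rewrite EFinM.
 have mq' : mfun E (fun w => (cabs (g w) `^ q)%:E).
  by apply/mEFP; apply: cmeas_powR; exact: cmeas_sub mg.
 rewrite ge0_integralZl //; [|by move=> w _; rewrite lee_fin powR_ge0|by rewrite lee_fin powR_ge0].
 apply: (le_via ((s `^ (1 - q))%:E * (al * t `^ q)%:E)%E).
  rewrite -IE; apply: leeMl; first by rewrite lee_fin powR_ge0.
  by apply: int_subset => // w _; rewrite lee_fin powR_ge0.
 rewrite -EFinM lee_fin mulrCA mulrC; apply: lerMr; first exact: ltW.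
 apply: (le_via (s `^ (1 - q) * s `^ q)).
  by apply: lerMl; [exact: powR_ge0|apply: ler_powR2r => //; exact: ltW].
 by rewrite -powRD ?subrK ?powRr1 ?(ltW s0) // (gt_eqF s0) implybT.
apply: (le_via (2 * al * t)%:E); last first.
 rewrite -EFinM lee_fin; apply: lerMr => //; rewrite -mulrA ler_pM2l //; exact: al1.
apply/lee_addgt0Pr => e e0; have e2 : 0 < e / (2 * al) by rewrite divr_gt0 // mulr_gt0.
have := le (t + e / (2 * al)); rewrite ltrDl => /(_ e2) /letr; apply.
by rewrite -EFinD lee_fin mulrDr mulrCA divff ?mulr1 // gt_eqF // mulr_gt0.
Qed.
End Averages.

Section Separated.
Variables (Z : set RR) (delta p : R).
Hypotheses (d0 : 0 < delta) (d1 : delta <= 1) (ZD : forall a, Z a -> Dk a)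
 (Zsep : forall a b, Z a -> Z b -> a <> b -> delta <= psi a b) (hp : 0 < p < 1).

(** * The weight [kZ] and the infinite product *)

Section Product.
Implicit Types (a c : RR) (s : seq RR) (m B : R).

Definition Tsum z : R := fine (\esum_(a in Z) (tval a z)%:E)%E.

Lemma kZE z : kZ Z z = nC z ^+ 2 / 2 * Tsum z. by []. Qed.

Lemma sep_sub s : uniq s -> (forall a, a \in s -> Z a) -> sep_seq delta s.
by move=> us sZ; split => // [a /sZ /ZD //|a b /sZ za /sZ zb]; exact: Zsep. Qed.

Lemma esum_tval_le z : Dk z ->
 (\esum_(a in Z) (tval a z)%:E <= (64 / delta ^+ 2 / (1 - nC z ^+ 2))%:E)%E.
move=> dz; apply: esum_le_seq => [a _|s us sZ]; first exact: tval_ge0.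
rewrite ler_pdivlMr ?sub_sqr_gt0 // mulrC.
by apply: sum_tval_shift => //; exact: sep_sub.
Qed.

Lemma TsumE z : Dk z -> (\esum_(a in Z) (tval a z)%:E)%E = (Tsum z)%:E.
move=> dz; rewrite /Tsum fineK // ge0_fin_numE.
 by apply: lelt (esum_tval_le dz) _; exact: ltry.
by apply: esum_ge0 => a _; rewrite lee_fin tval_ge0.
Qed.

Lemma Tsum_ge0 z : 0 <= Tsum z.
by apply: fine_ge0; apply: esum_ge0 => a _; rewrite lee_fin tval_ge0. Qed.

Lemma Tsum_ge s z : Dk z -> uniq s -> (forall a, a \in s -> Z a) -> \sum_(a <- s) tval a z <= Tsum z.
by move=> dz us sZ; rewrite -lee_fin -TsumE //; apply: esum_ge_seq => // a _; exact: tval_ge0.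
Qed.

Lemma Tsum_shift z : Dk z -> (1 - nC z ^+ 2) * Tsum z <= 64 / delta ^+ 2.
move=> dz; rewrite mulrC -ler_pdivlMr ?sub_sqr_gt0 // -lee_fin -TsumE //.
exact: esum_tval_le.
Qed.

Lemma Tsum_approx z eps : Dk z -> 0 < eps ->
 exists s, [/\ uniq s, (forall a, a \in s -> Z a) & Tsum z - eps <= \sum_(a <- s) tval a z].
move=> dz e0; apply: contrapT => h.
have : (\esum_(a in Z) (tval a z)%:E <= (Tsum z - eps)%:E)%E.
 apply: esum_le_seq => [a _|s us sZ]; first exact: tval_ge0.
 rewrite leNgt; apply/negP => hs; apply: h; exists s; split => //; exact: ltW.
by rewrite TsumE // lee_fin; lra.
Qed.

Lemma kZ_le z : Dk z -> kZ Z z <= Tsum z / 2.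
move=> dz; rewrite kZE mulrAC lerMr // ler_piMl ?Tsum_ge0 //.
by have := sub_sqr_gt0 dz; lra.
Qed.

(** [Tsum / 2] and [kZ] differ by [(1 - |z|^2) Tsum / 2], which is bounded by [Tsum_shift]. The
    product naturally compares with [exp(Tsum / 2)], so this error costs only a constant factor. *)
Lemma kZ_ge z : Dk z -> Tsum z / 2 <= kZ Z z + 32 / delta ^+ 2.
move=> dz; rewrite kZE; have := Tsum_shift dz.
set i := (delta ^+ 2)^-1; move: (Tsum z) (nC z ^+ 2) => T x.
have -> : x / 2 * T = (T - (1 - x) * T) / 2 by field.
by set y := (1 - x) * T; lra.
Qed.

Lemma kZ_ge0 z : 0 <= kZ Z z.
by rewrite kZE mulr_ge0 ?Tsum_ge0 // divr_ge0 ?sqr_ge0. Qed.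

Definition pprod s z : C := \prod_(a <- s) fac a z.

Lemma pprod_holo s : (forall a, a \in s -> Dk a) -> holo Dk (pprod s).
elim: s => [|a s IH] h.
 by rewrite (_ : pprod [::] = fun _ => 1); [exact: holo_cst|apply/funext => z; rewrite /pprod big_nil].
rewrite (_ : pprod (a :: s) = fun z => fac a z * pprod s z); last first.
 by apply/funext => z; rewrite /pprod big_cons.
apply: holoM; first by apply: fac_holo; apply: h; rewrite mem_head.
by apply: IH => b hb; apply: h; rewrite in_cons hb orbT.
Qed.

Lemma pprod_le1 s z : Dk z -> (forall a, a \in s -> Dk a) ->
 cabs (pprod s z) <= expR ((\sum_(a <- s) tval a z) / 2).
move=> dz hs; rewrite /pprod nc_prod mulr_suml expR_sum_seq big_seq [leRHS]big_seq.
by apply: ler_prod => a ha; rewrite nc_ge0 fac_le1 //; exact: hs.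
Qed.

Lemma pprod_le_psi s b z : Dk z -> (forall a, a \in s -> Dk a) -> b \in s ->
 cabs (pprod s z) <= expR 1 * psi b z * expR ((\sum_(a <- s) tval a z) / 2).
move=> dz hs hb; rewrite /pprod (big_rem b) //= [X in _ <= _ * expR (X / _)](big_rem b) //= cabsM mulrDl expRD mulrA.
apply: ler_pM; rewrite ?nc_ge0 //; first by apply: fac_le_psi => //; exact: hs.
by apply: pprod_le1 => // a /mem_rem; exact: hs.
Qed.

Definition Cfar : R := 8 / (delta / 5) ^+ 2.

Lemma pprod_ge_far s z : Dk z -> (forall a, a \in s -> Dk a) ->
 (forall a, a \in s -> delta / 5 <= psi a z) ->
 expR (- (Cfar * \sum_(a <- s) qval a z)) * expR ((\sum_(a <- s) tval a z) / 2) <= cabs (pprod s z).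
move=> dz hs hz; rewrite /pprod nc_prod mulr_suml expR_sum_seq mulr_sumr -sumrN expR_sum_seq -big_split /=.
rewrite big_seq [leRHS]big_seq; apply: ler_prod => a ha.
rewrite mulr_ge0 ?expR_ge0 //=; apply: fac_ge_far => //; [exact: hs|by rewrite divr_gt0|exact: hz].
Qed.

(** Origin of the constant [5]: from [|z - a| < (delta/5)(2 (1 - |a|) + |z - a|)] and [delta <= 1]
    follows [|z - a| < (delta/2)(1 - |a|)], the radius of the disjoint disks. *)
Lemma psi_near a z : Dk a -> Dk z -> psi a z < delta / 5 -> eball a (delta / 2 * dd a) z.
move=> da dz; rewrite psi_sym psiE ltr_pdivrMr ?den_gt0 // => h; change (dC z a < delta / 2 * dd a).
have d5 : 0 <= delta / 5 by move: d0; lra.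
have h2 := ltle h (lerMl d5 (den_le_dist z da)); have t0 := nc_ge0 (tz z a).
have : delta * dC z a <= dC z a by rewrite ler_piMl.
move: h2; rewrite mulrDr mulrCA mulrAC (mulrAC delta) [_ / 5 * cabs _]mulrAC.
set x := delta * dd a; set t := dC z a in t0 *; set y := delta * t.
by lra.
Qed.

Definition Clow : R := expR (-3) * expR (- (Cfar * (128 / delta ^+ 2))).

Lemma Cfar_ge0 : 0 <= Cfar. by rewrite /Cfar divr_ge0 ?sqr_ge0. Qed.

(** At most one point of the list is within [delta / 5] of [z], since the disks of [sep_eballs] are
    disjoint. Its factor contributes [psi], hence [m]; the others lose only the bounded amount of
    [sum_qval]. *)
Lemma pprod_ge s z m : Dk z -> uniq s -> (forall a, a \in s -> Z a) -> 0 <= m -> m <= 1 ->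
 (forall a, a \in s -> m <= psi a z) ->
 Clow * m * expR ((\sum_(a <- s) tval a z) / 2) <= cabs (pprod s z).
move=> dz us sZ m0 m1 hm; have hs a : a \in s -> Dk a by move=> /sZ/ZD.
have e3 : expR (-3) <= 1 :> R by rewrite -[leRHS]expR0 ler_expR; lra.
have [hfar|] := pselect (forall a, a \in s -> delta / 5 <= psi a z).
 apply: letr (pprod_ge_far dz hs hfar); rewrite lerMr ?expR_ge0 //.
 have q := sum_qval d0 d1 (sep_sub us sZ) dz.
 rewrite /Clow -mulrA; apply: (le_via (1 * (expR (- (Cfar * (128 / delta ^+ 2))) * 1))).
  by apply: ler_pM; rewrite ?expR_ge0 ?mulr_ge0 ?expR_ge0 // lerMl ?expR_ge0.
 by rewrite mul1r mulr1 ler_expR lerN2 lerMl ?Cfar_ge0.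
move=> /existsNP [b] /not_implyP [hb] /negP; rewrite -ltNge => hnear.
have hrem a : a \in rem b s -> delta / 5 <= psi a z.
 move=> ha; rewrite leNgt; apply/negP => hn.
 have ab : a <> b by move=> e; move: ha; rewrite e mem_rem_uniqF.
 have ha' := mem_rem ha.
 exact: (sep_eballs d0 (hs _ ha') (hs _ hb) (Zsep (sZ _ ha') (sZ _ hb) ab)
  (psi_near (hs _ ha') dz hn) (psi_near (hs _ hb) dz hnear)).
have hsr a : a \in rem b s -> Dk a by move=> /mem_rem; exact: hs.
have hfar := pprod_ge_far dz hsr hrem.
have hz := fac_ge_psi (hs _ hb) dz.
rewrite [\sum_(a <- s) tval a z](big_rem b hb) /= [pprod s z](_ : _ = fac b z * pprod (rem b s) z); last first.
 by rewrite /pprod (big_rem b hb).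
rewrite cabsM mulrDl expRD.
apply: (le_via ((expR (-3) * psi b z * expR (tval b z / 2)) *
  (expR (- (Cfar * \sum_(a <- rem b s) qval a z)) * expR ((\sum_(a <- rem b s) tval a z) / 2)))).
 have sr := sep_sub (rem_uniq b us) (fun a ha => sZ a (mem_rem ha)).
 have q := sum_qval d0 d1 sr dz.
 rewrite /Clow; set E1 := expR (-3); set E2 := expR (- (Cfar * (128 / delta ^+ 2))); set E3 := expR _; set E4 := expR (_ / 2).
 have -> : E1 * E2 * m * (E3 * E4) = E1 * m * E3 * (E2 * E4) by ring.
 apply: ler_pM; rewrite ?mulr_ge0 ?expR_ge0 //.
  by rewrite lerMr ?expR_ge0 // lerMl ?expR_ge0 // hm.
 by rewrite lerMr ?expR_ge0 // ler_expR lerN2 lerMl ?Cfar_ge0.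
by apply: ler_pM; rewrite ?mulr_ge0 ?expR_ge0 ?psi_ge0.
Qed.

(** An exhaustion of [Z] by finite lists that may stay constant at a step, so that finite and
    infinite [Z] are treated alike. *)
Lemma enum_exists : exists pts : nat -> seq RR, [/\ forall N, uniq (pts N), forall N a, a \in pts N -> Z a,
 forall N, pts N.+1 = pts N \/ exists a, pts N.+1 = rcons (pts N) a &
 forall s, (forall a, a \in s -> Z a) -> exists N, {subset s <= pts N}].
have /countable_injP [g hg] := sep_countable d0 ZD Zsep.
have /choice [en hen] : forall n, exists o : option RR, (forall a, o = Some a -> Z a /\ g a = n) /\
  (forall a, Z a -> g a = n -> o = Some a).
 move=> n; have [[a [za ga]]|h] := pselect (exists a, Z a /\ g a = n).
  exists (Some a); split=> [b [<-] //|b zb gb]; congr Some.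
  by apply: hg; rewrite ?inE // ga gb.
 by exists None; split => // a za ga; case: h; exists a.
pose pts N := pmap en (iota 0 N).
have mp N a : a \in pts N <-> Z a /\ (g a < N)%N.
 rewrite mem_pmap; split.
  move=> /mapP[n]; rewrite mem_iota add0n => /andP[_ hn] e.
  by have [za ga] := (hen n).1 a (esym e); rewrite ga.
 move=> [za ga]; apply/mapP; exists (g a); first by rewrite mem_iota.
 by have := (hen (g a)).2 a za erefl.
have hS N : pts N.+1 = pts N ++ (if en N is Some a then [:: a] else [::]).
 rewrite /pts -addn1 iotaD add0n pmap_cat /=; by case: (en N).
exists pts; split.
- elim=> [//|N IH]; rewrite hS; case e : (en N) => [a|]; last by rewrite cats0.
 rewrite cats1 rcons_uniq IH andbT; apply/negP => /mp [za].
 by have [_ ->] := (hen N).1 a e; rewrite ltnn.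
- by move=> N a /mp [].
- move=> N; rewrite hS; case: (en N) => [a|]; last by left; rewrite cats0.
 by right; exists a; rewrite cats1.
- move=> s sZ; exists (\max_(a <- s) (g a)).+1 => a ha; apply/mp; split; first exact: sZ.
 by rewrite ltnS; exact: leq_bigmax_seq.
Qed.

(** Both bounds are proved for partial products and pass to the limit. The lower bound is stated
    with a free lower estimate [m] of the distances to [Z], to serve near [Z] and away from it. *)
Lemma psi_product : exists Psi (C1 c1 : R), [/\ 0 < C1, 0 < c1, holo Dk Psi,
 (forall z, Dk z -> cabs (Psi z) <= C1 * ek Z z) &
 (forall a z, Z a -> Dk z -> cabs (Psi z) <= C1 * psi a z * ek Z z) /\
 (forall z m, Dk z -> 0 <= m -> m <= 1 -> (forall a, Z a -> m <= psi a z) ->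
   c1 * m * ek Z z <= cabs (Psi z))].
have [pts [upts ptsZ ptsS ptsC]] := enum_exists.
have ptsD N a : a \in pts N -> Dk a by move=> /ptsZ/ZD.
have psub N M : (N <= M)%N -> {subset pts N <= pts M}.
 elim: M => [|M IH]; first by rewrite leqn0 => /eqP ->.
 rewrite leq_eqVlt => /orP[/eqP -> //|]; rewrite ltnS => /IH h a /h ha.
 by case: (ptsS M) => [->|[b ->]] //; rewrite mem_rcons in_cons ha orbT.
pose W N := \sum_(a <- pts N) wgt a.
have WS N : W N <= W N.+1.
 rewrite /W; case: (ptsS N) => [->|[a ->]] //.
 by rewrite -cats1 big_cat /= big_seq1 lerDl wgt_ge0.
have Wmono : {homo W : N M / (N <= M)%N >-> N <= M} by apply: homo_leq => //; exact: letr.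
have Wb N : W N <= 64 / delta ^+ 2 by apply: sum_wgt => //; apply: sep_sub => // a; exact: ptsZ.
have Wc eps : 0 < eps -> exists N, forall M, (N <= M)%N -> W M - W N <= eps.
 move=> e0; have hsW : has_sup [set W N | N in setT].
  by split; [exists (W 0%N); exists 0%N|exists (64 / delta ^+ 2) => _ [N _ <-]].
 have [_ [N _ <-] hN] := sup_adherent e0 hsW; exists N => M _.
 have : W M <= sup [set W N | N in setT] by apply: sup_upper_bound => //; exists M.
 by move: hN; set S := sup _; lra.
pose P N z := pprod (pts N) z.
have PH N : holo Dk (P N) by apply: pprod_holo => a; exact: ptsD.
have Pb N z : Dk z -> cabs (P N z) <= expR (Tsum z / 2).
 move=> dz; apply: (letr (pprod_le1 dz (ptsD N))); rewrite ler_expR lerMr //.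
 by apply: Tsum_ge => // a; exact: ptsZ.
have step (r : R) : r < 1 -> exists2 K : R, 0 < K & forall N M z, (N <= M)%N -> nC z <= r ->
  cabs (P M z - P N z) <= K * (W M - W N).
 move=> r1; have [K K0 hK] := fac_near1 r1.
 pose B := expR (32 / delta ^+ 2 / (1 - `|r|)).
 have [r0|r0] := ltP r 0.
  exists 1 => // N M z _ hz; have := lelt (letr (nc_ge0 _) hz) r0; by rewrite ltxx.
 have TB z : nC z <= r -> expR (Tsum z / 2) <= B.
  move=> hz; have dz : Dk z by exact: lelt hz r1.
  rewrite ler_expR ler_pdivlMr ger0_norm ?subr_gt0 //.
  have h := Tsum_shift dz; have t0 := Tsum_ge0 z.
  have hr : 1 - r <= 1 - nC z ^+ 2.
   rewrite lerD2l lerN2; apply: letr hz; rewrite expr2 ler_piMr ?nc_ge0 // ltW //; exact: dz.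
  have h2 := letr (lerMr t0 hr) h.
  by rewrite mulrAC; move: h2; set i := (delta ^+ 2)^-1; rewrite mulrC; set x := Tsum z * _; lra.
 exists (B * K) => [|N M z NM hz]; first by rewrite mulr_gt0 ?expR_gt0.
 have dz : Dk z by exact: lelt hz r1.
 (* A new factor changes the product by [P n (fac - 1)], at most a constant times the new weight;
    summation bounds the variation by the increments of the convergent [W]. *)
 have one n : cabs (P n.+1 z - P n z) <= B * K * (W n.+1 - W n).
  rewrite /P /W; case: (ptsS n) => [->|[a e]]; first by rewrite !subrr cabs0 mulr0.
  have da : Dk a by apply: (ptsD n.+1); rewrite e mem_rcons mem_head.
  rewrite e /pprod -cats1 !big_cat /= !big_seq1 addrAC subrr add0r.
  rewrite -[X in _ - X]mulr1 -mulrBr cabsM -mulrA; apply: ler_pM; rewrite ?nc_ge0 //.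
   by apply: letr (TB z hz); exact: Pb.
  exact: hK.
 elim: M NM => [|M IH]; first by rewrite leqn0 => /eqP ->; rewrite !subrr cabs0 mulr0.
 rewrite leq_eqVlt => /orP[/eqP ->|]; first by rewrite !subrr cabs0 mulr0.
 rewrite ltnS => /IH h; apply: (letr (nc_distD (P M z) _ _)).
 by apply: (letr (lerD (one M) h)); rewrite -mulrDr addrA subrK.
have [|Psi hPsi lim] := holo_cauchy_lim PH.
 move=> r eps r1 e0; have [K K0 hK] := step r r1.
 have eK : 0 < eps / K by rewrite divr_gt0.
 have [N hN] := Wc _ eK; exists N => M z NM hz; apply: (letr (hK _ _ _ NM hz)).
 by rewrite -ler_pdivlMl // mulrC; exact: hN.
have upper z B : Dk z -> (exists N0, forall N, (N0 <= N)%N -> cabs (P N z) <= B) -> cabs (Psi z) <= B.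
 move=> dz [N0 hB]; rewrite leNgt; apply/negP => h.
 have e0 : 0 < (cabs (Psi z) - B) / 2 by rewrite divr_gt0 // subr_gt0.
 have [N hN] := lim z dz _ e0.
 have k1 := hN _ (leq_maxl N N0); have k2 := hB _ (leq_maxr N N0).
 have := nc_leB (Psi z) (P (maxn N N0) z); rewrite nc_distC; lra.
have lower z B : Dk z -> (exists N0, forall N, (N0 <= N)%N -> B <= cabs (P N z)) -> B <= cabs (Psi z).
 move=> dz [N0 hB]; rewrite leNgt; apply/negP => h.
 have e0 : 0 < (B - cabs (Psi z)) / 2 by rewrite divr_gt0 // subr_gt0.
 have [N hN] := lim z dz _ e0.
 have k1 := hN _ (leq_maxl N N0); have k2 := hB _ (leq_maxr N N0).
 have := nc_leB (P (maxn N N0) z) (Psi z); lra.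
pose E := expR (32 / delta ^+ 2).
have TE z : Dk z -> expR (Tsum z / 2) <= E * ek Z z.
 by move=> dz; rewrite -expRD ler_expR addrC; exact: kZ_ge.
have E0 : 0 < E by exact: expR_gt0.
exists Psi, (expR 1 * E), (Clow * expR (-1)); split => //.
- by rewrite mulr_gt0 ?expR_gt0.
- by rewrite !mulr_gt0 ?expR_gt0.
- move=> z dz; apply: upper => //; exists 0%N => N _.
 apply: (letr (Pb N z dz)); apply: (letr (TE z dz)).
 by rewrite lerMr ?expR_ge0 // ler_peMl ?(ltW E0) // expR_ge1.
- split=> [a z za dz|z m dz m0 m1 hm].
  apply: upper => //; have [|N0 hN0] := ptsC [:: a]; first by move=> b; rewrite inE => /eqP ->.
  exists N0 => N hN; have aN : a \in pts N by apply: (psub _ _ hN); apply: hN0; rewrite mem_head.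
  apply: (letr (pprod_le_psi dz (ptsD N) aN)).
  rewrite [leLHS](_ : _ = expR 1 * (psi a z * expR ((\sum_(a0 <- pts N) tval a0 z) / 2))); last by rewrite !mulrA.
  rewrite [leRHS](_ : _ = expR 1 * (psi a z * (E * ek Z z))); last by ring.
  rewrite !lerMl ?expR_ge0 ?psi_ge0 //; apply: letr (TE z dz).
  by rewrite ler_expR lerMr //; apply: Tsum_ge => // b; exact: ptsZ.
 (* A finite list reaching [Tsum z - 2] suffices; halving the exponent costs the factor [exp(-1)] in
    the lower constant. *)
 have two : 0 < 2 :> R by [].
 have [s [us sZ hs]] := Tsum_approx dz two; have [N0 hN0] := ptsC s sZ.
 apply: lower => //; exists N0 => N hN.
 apply: letr (pprod_ge dz (upts N) (ptsZ N) m0 m1 (fun a ha => hm a (ptsZ N a ha))).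
 rewrite [leLHS](_ : _ = Clow * m * expR (-1 + kZ Z z)); last by rewrite expRD; ring.
 rewrite lerMl ?mulr_ge0 ?expR_ge0 // ler_expR.
 have := ler_sum_subset (fun a => tval_ge0 a z) us (upts N) (fun a ha => psub _ _ hN a (hN0 a ha)).
 by have := kZ_le dz; move: hs; set t1 := \sum_(_ <- s) _; set t2 := \sum_(_ <- _) _; lra.
Qed.
End Product.

(** * Values on [Z] of functions in [A^p] *)

Section Sampling.
Implicit Types (c : RR -> C) (a : RR) (s : seq RR) (K L : R).

(** The sub-mean value property on disjoint disks. The constant is [K0] over [(delta/2)^2], times
    the [4] from [wgt a <= 4 (1 - |a|)^2]. *)
Lemma lp_le_Ap : exists2 K, 0 < K & forall f s, holo Dk f -> uniq s -> (forall a, a \in s -> Z a) ->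
 ((\sum_(a <- s) cabs (f a) `^ p * wgt a)%:E <= K%:E * \int[A]_(z in Dk) (cabs (f z) `^ p)%:E)%E.
have [K0 K00 hK] := sub_mean hp; exists (16 * K0 / delta ^+ 2); first by rewrite !mulr_gt0 ?invr_gt0 ?exprn_gt0.
move=> f s hf us sZ; have ss := sep_sub us sZ.
have mF : mfun DP (fun z => (cabs (f z) `^ p)%:E).
 by apply/mEFP; apply: cmeas_powR; exact: holo_cmeas.
have F0 z : (0 <= (cabs (f z) `^ p)%:E)%E by rewrite lee_fin powR_ge0.
have := sum_eballs d0 d1 ss mF F0 => h.
apply: letr (leeMl _ h); last by rewrite lee_fin !mulr_ge0 ?invr_ge0 ?exprn_ge0 ?ltW.
rewrite ge0_sume_distrr; last by move=> a _; exact: integral_ge0.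
rewrite -sumEFin big_seq [leRHS]big_seq; apply: lee_sum => a sa.
have aD := ZD (sZ _ sa); have da := dd_gt0 aD.
have r0 : 0 < delta / 2 * dd a by rewrite !mulr_gt0.
have r1 : nC a + delta / 2 * dd a < 1.
 have : delta / 2 * dd a <= 1 / 2 * dd a by rewrite ler_pM2r // ler_pM2r.
 move: da; lra.
have {}h := hK _ _ _ hf r0 r1.
rewrite mulrC EFinM; apply: letr (leeMl _ h) _; first by rewrite lee_fin wgt_ge0.
rewrite muleA -EFinM; apply: lee_wpmul2r; first exact: integral_ge0.
rewrite lee_fin; apply: letr (lerMr _ (wgt_le aD)) _; first by rewrite divr_ge0 ?ltW ?exprn_gt0.
have dn : delta != 0 by rewrite gt_eqF.
have an : dd a != 0 by rewrite gt_eqF.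
by apply: eq_ler; move: dn an; generalize (dd a) => t dn an; field; rewrite dn an.
Qed.

Lemma Ap_in_lp f : in_Ap p f -> in_lp p Z f.
move=> [/holo_diskP hf fi]; have [K K0 hK] := lp_le_Ap.
have I0 : (0 <= \int[A]_(z in Dk) (cabs (f z) `^ p)%:E)%E.
 by apply: integral_ge0 => z _; rewrite lee_fin powR_ge0.
have Ifin : (\int[A]_(z in Dk) (cabs (f z) `^ p)%:E)%E \is a fin_num by rewrite ge0_fin_numE.
apply: lelt (ltry (K * fine (\int[A]_(z in Dk) (cabs (f z) `^ p)%:E))).
apply: esum_le_seq => [a _|s us sZ]; first by rewrite mulr_ge0 ?powR_ge0 ?sqr_ge0.
by rewrite -lee_fin EFinM fineK //; exact: hK.
Qed.

(** Lists of points of [Z] in a compact disk have bounded length by [sum_sqr_dist], and a list of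
    maximal length contains all such points. *)
Lemma Z_finite_ball (t : R) : t < 1 -> exists s, [/\ uniq s, forall a, a \in s -> Z a &
 forall a, Z a -> nC a <= t -> a \in s].
move=> t1; pose good s := [/\ uniq s, forall a, a \in s -> Z a & forall a, a \in s -> nC a <= t].
have t0 : 0 < (1 - t) ^+ 2 by rewrite exprn_gt0 // subr_gt0.
have bound s : good s -> (size s)%:R * (1 - t) ^+ 2 <= 16 / delta ^+ 2.
 move=> [us sZ st]; apply: letr (sum_sqr_dist d0 d1 (sep_sub us sZ)).
 rewrite mulr_natl -iter_addr_0 -count_predT -big_const_seq big_seq [leRHS]big_seq; apply: ler_sum => a sa.
 have h := st _ sa; rewrite ler_sqr ?nnegrE; move: h t1; lra.
pose N := Num.bound (16 / delta ^+ 2 / (1 - t) ^+ 2).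
have bN s : good s -> (size s < N)%N.
 move=> /bound h; rewrite -(ltr_nat R); apply: lelt (archi_boundP _); first by rewrite ler_pdivlMr.
 by rewrite !mulr_ge0 ?invr_ge0 ?exprn_ge0 ?ltW // subr_gt0.
have [n [[s gs sn] nmax]] : exists n, (exists2 s, good s & size s = n) /\
  forall s', good s' -> (size s' <= n)%N.
 apply: contrapT => /forallNP hn.
 have big n : exists2 s, good s & (n <= size s)%N.
  elim: n => [|n [s gs ns]]; first by exists [::].
  apply: contrapT => hs; apply: (hn (size s)); split; first by exists s.
  move=> s' gs'; rewrite leqNgt; apply/negP => lt; apply: hs; exists s' => //.
  exact: leq_ltn_trans lt.
 by have [s gs] := big N; rewrite leqNgt bN.
have [us sZ st] := gs; exists s; split => // a Za at_; apply: contrapT => /negP nas.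
have : good (a :: s).
 split; first by rewrite /= nas.
 - by move=> b; rewrite inE => /orP[/eqP ->|]; [|exact: sZ].
 - by move=> b; rewrite inE => /orP[/eqP ->|]; [|exact: st].
by move=> /nmax; rewrite /= sn ltnn.
Qed.

Lemma in_lp_bound c : in_lp p Z c -> exists L, forall s, uniq s -> (forall a, a \in s -> Z a) ->
 \sum_(a <- s) cabs (c a) `^ p * wgt a <= L.
move=> cl; exists (fine (\esum_(a in Z) (cabs (c a) `^ p * wgt a)%:E)%E) => s us sZ.
rewrite -lee_fin fineK; last first.
 by rewrite ge0_fin_numE //; apply: esum_ge0 => a _; rewrite lee_fin mulr_ge0 ?powR_ge0 ?wgt_ge0.
apply: (@esum_ge_seq Z (fun a => cabs (c a) `^ p * wgt a)) => [a _||]; [|exact: us|exact: sZ].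
by rewrite mulr_ge0 ?powR_ge0 ?wgt_ge0.
Qed.

(** Provides one measurable function dominating local bounds of size [|c_a|^p]: the sum of their
    indicators over disks of radius [K (1 - |a|)], which may overlap. It is a monotone limit along
    the enumeration. *)
Lemma lp_majorant c K L : 0 <= K ->
 (forall s, uniq s -> (forall a, a \in s -> Z a) -> \sum_(a <- s) cabs (c a) `^ p * wgt a <= L) -> exists H : RR -> \bar R,
 [/\ mfun DP H, (forall z, 0 <= H z)%E,
 (\int[A]_(z in Dk) H z <= (4 * K ^+ 2 * L)%:E)%E &
 forall a z, Z a -> eball a (K * dd a) z -> ((cabs (c a) `^ p)%:E <= H z)%E].
move=> K0 cl; have [pts [pu pZ pS pex]] := enum_exists.
pose t a z : R := cabs (c a) `^ p * \1_(eball a (K * dd a)) z.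
have t0 a z : 0 <= t a z by rewrite mulr_ge0 ?powR_ge0 // indicE ler0n.
pose F N z : \bar R := (\sum_(a <- pts N) (t a z)%:E)%E.
have F0 N z : (0 <= F N z)%E by apply: sume_ge0 => a _; rewrite lee_fin.
have Fnd z : nondecreasing_seq (F ^~ z).
 apply/nondecreasing_seqP => n; rewrite /F; case: (pS n) => [->//|[a ->]].
 by rewrite -cats1 big_cat /= big_seq1 leeDl // lee_fin.
have md := @mdisk.
have mt a : mfun DP (fun z => (t a z)%:E).
 apply/mEFP; apply: mfunM => //; apply: measurable_indic.
 exact: (@meball).
have mF N : mfun DP (F N) by apply: emeasurable_sum => a; exact: mt.
pose H z := limn (F ^~ z); have cv z : cvgn (F ^~ z) by exact: ereal_nondecreasing_is_cvgn.
have HF N z : (F N z <= H z)%E by apply: lime_ge; [exact: cv|exists N => // n; exact: Fnd].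
have intF N : (\int[A]_(z in Dk) F N z <= (4 * K ^+ 2 * L)%:E)%E.
 rewrite ge0_integral_sum //; last by move=> a z _; rewrite lee_fin.
 apply: (le_via (\sum_(a <- pts N) (4 * K ^+ 2 * (cabs (c a) `^ p * wgt a))%:E)%E).
  rewrite big_seq [leRHS]big_seq; apply: lee_sum => a /pZ Za; have aD := ZD Za; have da := dd_gt0 aD.
  under eq_integral do rewrite EFinM.
  rewrite ge0_integralZl //; last first.
  - by rewrite lee_fin powR_ge0.
  - by apply/mEFP; apply: measurable_indic; exact: (@meball).
  rewrite integral_indic //; last exact: (@meball).
  apply: (le_via ((cabs (c a) `^ p)%:E * (4 * (K * dd a) ^+ 2)%:E)%E).
   apply: leeMl; first by rewrite lee_fin powR_ge0.
   apply: letr (area_eball_le a _); last by rewrite mulr_ge0 // ltW.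
   by apply: le_measure; rewrite ?inE; [apply: measurableI => //; exact: (@meball)|exact: (@meball)|exact: subIsetl].
  rewrite -EFinM lee_fin mulrCA -[leRHS]mulrA; apply: lerMl => //.
  rewrite [leRHS]mulrCA; apply: lerMl; first exact: powR_ge0.
  by rewrite exprMn lerMl ?sqr_ge0 // wgt_ge.
 rewrite sumEFin -mulr_sumr lee_fin; apply: lerMl (cl _ (pu N) (pZ N)); by rewrite mulr_ge0 ?sqr_ge0.
exists H; split.
- by apply: (@emeasurable_fun_cvg _ _ _ _ F) => // z _; exact: cv.
- by move=> z; exact: letr (F0 0%N z) (HF 0%N z).
- have -> : (\int[A]_(z in Dk) H z)%E = limn (fun N => \int[A]_(z in Dk) F N z)%E.
  apply: monotone_convergence => //; by move=> z _; exact: Fnd.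
 apply: lime_le; last by apply: nearW => N; exact: intF.
 apply: ereal_nondecreasing_is_cvgn => n m nm; apply: ge0_le_integral => // z _; exact: Fnd.
- move=> a z Za az; have [N hN] := pex [:: a] (fun b h => eq_ind_r Z Za (eqP (etrans (esym (mem_seq1 b a)) h))).
 apply: letr (HF N z); have aN : a \in pts N by apply: hN; rewrite inE.
 rewrite /F (big_rem a) //= {1}/t indicE mem_set // mulr1 leeDl //.
 by apply: sume_ge0 => b _; rewrite lee_fin.
Qed.
End Sampling.

(** * Gluing local data around the points of [Z] *)

Section Pieces.
Implicit Types (a : RR) (s : seq RR) (r : R) (phi : RR -> R).

Definition nbd a := eball a (delta / 2 * dd a).

Lemma nbd_uniq a b z : Z a -> Z b -> nbd a z -> nbd b z -> a = b.
move=> Za Zb az bz; apply: contrapT => ab.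
exact: (sep_eballs d0 (ZD Za) (ZD Zb) (Zsep Za Zb ab) az bz).
Qed.

(** The neighbourhoods are disjoint, so the chosen [a] is the only one; [piece_sum] identifies the
    result with a finite sum on each smaller disk. *)
Definition piece (h : RR -> RR -> C) z : C :=
 if pselect (exists a, Z a /\ nbd a z) is left ex then h (projT1 (cid ex)) z else 0.

Lemma pieceE h a z : Z a -> nbd a z -> piece h z = h a z.
move=> Za az; rewrite /piece; case: pselect => [ex|[]]; last by exists a.
by case: (cid ex) => b [Zb bz] /=; rewrite (nbd_uniq Zb Za bz az).
Qed.

Lemma piece_neq0 h z : piece h z != 0 -> exists a, [/\ Z a, nbd a z & piece h z = h a z].
move=> h0; have [[a [Za az]]|no] := pselect (exists a, Z a /\ nbd a z).
 by exists a; split => //; exact: pieceE.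
by exfalso; move: h0; rewrite /piece; case: pselect => // _; rewrite eqxx.
Qed.

Lemma piece_sum r : r < 1 -> exists s, [/\ uniq s, forall a, a \in s -> Z a &
 forall h z, (forall a, Z a -> ~ nbd a z -> h a z = 0) -> nC z < r -> piece h z = \sum_(a <- s) h a z].
(* If the neighbourhood of [a] meets [|z| < r], then [|a| - r < (1 - |a|)/2], that is
   [|a| < (2 r + 1)/3]. *)
move=> r1; have t1 : (2 * r + 1) / 3 < 1 by rewrite ltr_pdivrMr //; move: r1; lra.
have [s [us sZ hs]] := Z_finite_ball t1.
exists s; split => // h z h0 zr.
have [[a [Za az]]|no] := pselect (exists a, Z a /\ nbd a z); last first.
 rewrite big_seq big1 => [|a sa]; last by apply: h0; [exact: sZ|move=> az; apply: no; exists a; split => //; exact: sZ].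
 by apply: contrapT => /eqP /piece_neq0 [a [Za az _]]; apply: no; exists a.
have sa : a \in s.
 apply: hs => //; have {}az : dC z a < delta / 2 * dd a := az.
 have da := dd_gt0 (ZD Za).
 have : delta / 2 * dd a <= 1 / 2 * dd a by rewrite ler_pM2r // ler_pM2r.
 have := nc_leB (toC a) (toC z); rewrite (nc_distC (toC a)) ler_pdivlMr //.
 move: az zr; set x := nC a; set y := nC z; set t := cabs (_ - _); set v := delta / 2 * _; lra.
rewrite (pieceE _ Za az) (bigD1_seq a) //= big_seq_cond big1 ?addr0 // => b /andP[sb ba].
apply: h0 => [|bz]; first exact: sZ.
by move: ba; rewrite (nbd_uniq (sZ _ sb) Za bz az) eqxx.
Qed.

Variable c : RR -> C.
(** A quarter of [delta], so that the cutoff, which dies at [3/2] of this radius, has its support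
    well inside [nbd a]. *)
Definition crad a : R := delta / 4 * dd a.
Definition gloc := piece (fun a z => c a * bump a (crad a) z).
Definition Gloc := piece (fun a z => - (c a * cker a (crad a) z)).

Lemma crad_gt0 a : Dk a -> 0 < crad a.
by move=> /dd_gt0 h; rewrite /crad !mulr_gt0. Qed.

Lemma not_nbd a z : Dk a -> ~ nbd a z -> 3 / 2 * crad a <= dC z a.
move=> aD /negP; rewrite -leNgt; apply: letr.
have := crad_gt0 aD; rewrite /crad (_ : delta / 2 * _ = 2 * (delta / 4 * dd a)); last by field.
by generalize (delta / 4 * dd a) => x; lra.
Qed.

Lemma gloc_local r : r < 1 -> exists b : RR -> C, csmooth b /\
 forall z, nC z < r -> gloc z = b z /\ Gloc z = cdbar b z.
move=> r1; have [s [us sZ hs]] := piece_sum r1.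
have sb a : csmooth (fun z => c a * bump a (crad a) z).
 by apply: csmoothM; [exact: csmooth_cst|exact: csmooth_bump].
have [h1 h2] := csmooth_sum s sb; exists (fun z => \sum_(a <- s) c a * bump a (crad a) z); split => // z zr.
split; rewrite ?h2 /gloc /Gloc hs //.
- by move=> a Za az; rewrite bump_eq0 ?mulr0 //; [exact: crad_gt0 (ZD Za)|exact: not_nbd (ZD Za) az].
- apply: eq_bigr => a _; rewrite cdbarM; [|exact: csmooth_cst|exact: csmooth_bump].
 by rewrite cdbar_cst mulr0 addr0 /cker mulrN opprK.
- move=> a Za az; rewrite cker_eq0 ?mulr0 ?oppr0 //; first exact: crad_gt0 (ZD Za).
 by right; exact: not_nbd (ZD Za) az.
Qed.

Lemma gloc_meas : cmeas DP gloc /\ cmeas DP Gloc.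
split; apply: cmeas_disk_local => r r1; have [b [sb hb]] := gloc_local r1;
 have mb := @mdball r.
- by have [m1 m2] := csmooth_cmeas mb sb; split; [apply: eq_measurable_fun m1|apply: eq_measurable_fun m2] => z;
  rewrite inE => /hb [-> _].
- by have [m1 m2] := csmooth_cmeas mb (csmooth_cdbar sb); split; [apply: eq_measurable_fun m1|apply: eq_measurable_fun m2] => z;
  rewrite inE => /hb [_ ->].
Qed.

Lemma gloc_locint : locint gloc.
move=> r r1; have [b [sb hb]] := gloc_local r1.
have := ccontinuous_locint (fun z _ => csmooth_ccontinuous z sb) r1.
by apply: eq_cL1 => [|z /hb []]; first exact: mdball.
Qed.

Lemma gloc_weak phi : ctest (fun z => rC (phi z)) ->
 ID (fun z => gloc z * dbar phi z) = - ID (fun z => Gloc z * rC (phi z)).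
move=> tp; have [_ [r1 [r11 h1]]] := tp; have [_ [r2 [r21 h2]]] := ctest_cdbar tp.
have r1' : Num.max r1 r2 < 1 by rewrite gt_max r11.
have [b [sb hb]] := gloc_local r1'.
transitivity (ID (fun z => b z * dbar phi z)).
 apply: eq_cinteg => z _; have [/hb [-> _]//|] := ltP (nC z) (Num.max r1 r2).
 by rewrite ge_max => /andP[_ /h2]; rewrite cdbar_rC => ->; rewrite !mulr0.
rewrite ibp_csmooth //; congr (- _); apply: eq_cinteg => z _.
have [/hb [_ ->]//|] := ltP (nC z) (Num.max r1 r2).
by rewrite ge_max => /andP[/h1 -> _]; rewrite !mulr0.
Qed.

Lemma gloc_le z : gloc z != 0 -> exists a, [/\ Z a, nbd a z & cabs (gloc z) <= cabs (c a)].
move=> /piece_neq0 [a [Za az e]]; exists a; split => //.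
by rewrite /gloc e cabsM ler_piMr ?nc_ge0 // nc_bump_le1.
Qed.

(** The derivative of the cutoffs lives on annuli at pseudo-hyperbolic distance at least
    [delta / 12] from all of [Z]: [|z - a|] exceeds [delta/4 (1 - |a|)] while the denominator is at
    most [3 (1 - |a|)]. There [Psi] is bounded below. *)
Lemma Gloc_neq0 z : Gloc z != 0 -> exists a, [/\ Z a, nbd a z, Gloc z = - (c a * cker a (crad a) z),
 crad a < dC z a & forall b, Z b -> delta / 12 <= psi b z].
move=> G0; have [a [Za az e]] := piece_neq0 G0; exists a; have aD := ZD Za; have ra := crad_gt0 aD.
have far : crad a < dC z a.
 move: G0; rewrite /Gloc e oppr_eq0 mulf_eq0 negb_or => /andP[_ /(cker_neq0 ra) /andP[//]].
split => // b Zb; have zD := sep_eball_disk d0 d1 aD az.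
have [ba|ba] := pselect (b = a); last first.
 rewrite leNgt; apply/negP => lt; apply: ba; apply: (nbd_uniq Zb Za _ az).
 apply: (psi_near (ZD Zb) zD); apply: lt_trans lt _; move: d0; lra.
rewrite ba psi_sym psiE ler_pdivlMr ?den_gt0 //; apply: letr (ltW far).
have {}az : dC z a < delta / 2 * dd a := az.
have da := dd_gt0 aD; have hd := den_le_dist z aD.
have {}hd : den a z <= 3 * dd a.
 have : delta / 2 * dd a <= 1 / 2 * dd a by rewrite ler_pM2r // ler_pM2r.
 by move: az hd da; set x := dC z a; set y := den _ _; set t := dd a; set v := delta / 2 * _; lra.
apply: letr (lerMl _ hd) _; first by (move: d0; lra).
by rewrite mulrA /crad le_eqVlt; apply/orP; left; apply/eqP; field.
Qed.

Lemma Gloc_le : exists2 K : R, 0 < K & forall a z, Z a -> nbd a z -> Gloc z = - (c a * cker a (crad a) z) ->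
 (1 - nC z ^+ 2) * cabs (Gloc z) <= K * cabs (c a).
have [B B0 hB] := cker_bound; exists (16 * B / delta); first by rewrite !mulr_gt0 ?invr_gt0.
move=> a z Za az ->; have aD := ZD Za; have da := dd_gt0 aD; have ra := crad_gt0 aD.
have zD := sep_eball_disk d0 d1 aD az; have z1 := disk_cabs zD; have z0 := nc_ge0 (toC z).
have le : 1 - nC z ^+ 2 <= 4 * dd a.
 have {}az : dC z a < delta / 2 * dd a := az.
 have h : delta / 2 * dd a <= 1 / 2 * dd a by rewrite ler_pM2r // ler_pM2r.
 have := nc_leB (toC a) (toC z); rewrite (nc_distC (toC a)) => h2.
 apply: (le_via (2 * dd z)).
  have -> : 1 - nC z ^+ 2 = dd z * (1 + nC z) by ring.
  by rewrite mulrC; apply: lerMr; [rewrite subr_ge0 ltW //|move: z1; lra].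
 by move: az h h2 da; set x := nC a; set y := nC z; set t := cabs (_ - _); set v := delta / 2 * _; lra.
rewrite cabsN cabsM; apply: (le_via (4 * dd a * (cabs (c a) * (B / crad a)))).
 apply: ler_pM => //; [exact: ltW (sub_sqr_gt0 zD)|by rewrite mulr_ge0 ?nc_ge0|].
 by apply: lerMl; [exact: nc_ge0|exact: hB].
have dn : delta != 0 by rewrite gt_eqF.
have an : dd a != 0 by rewrite gt_eqF.
by rewrite /crad le_eqVlt; apply/orP; left; apply/eqP; move: dn an; generalize (dd a) => t dn an; field; rewrite dn an.
Qed.

(** The right-hand side for which a solution [u] satisfies dbar[(Psi u) = Gloc]. Off the support of
    [Gloc] it is zero, whether or not [Psi] vanishes. *)
Definition Fdat Psi z : C := rC (1 - nC z ^+ 2) * Gloc z / Psi z.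

(** If the disk [D_z] meets the support near [a], then [z] is within a multiple of [1 - |a|] of [a],
    and the mean at [z] is controlled by [|c_a|]; [lp_majorant] sums these bounds. Only a supremum
    bound on [D_z] is used, hence any [q] is allowed. *)
Lemma Fdat_Lpq Psi (c1 q Rr : R) : 0 < c1 -> holo Dk Psi ->
 (forall z (m : R), Dk z -> 0 <= m -> m <= 1 -> (forall a, Z a -> m <= psi a z) ->
  c1 * m * ek Z z <= cabs (Psi z)) ->
 in_lp p Z c -> 1 <= q -> 0 < Rr < 1 -> in_Lpq p q Rr Z (Fdat Psi).
move=> c10 hPsi hlow cl q1 hR; have /andP[p0 p1] := hp; have [R0 R1] := andP hR.
have md := @mdisk; have [_ mG] := gloc_meas.
have [mF1 mF2] : cmeas DP (Fdat Psi).
 apply: cmeasM; last by apply: cmeasV; exact: holo_cmeas.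
 apply: cmeasM => //; apply: cmeas_rC; apply: measurable_funB => //; apply: cmeas_sqr_cabs; exact: cmeas_toC.
split=> //; split=> //.
(* From [z] to [w] the distance is at most [2 Rr / (1 - Rr)] times [1 - |w| <= 2 (1 - |a|)]; the
   extra [2] covers the distance from [w] to [a]. *)
pose C' : R := 2 * (2 * Rr / (1 - Rr)) + 2.
have R1' : 0 < 1 - Rr by rewrite subr_gt0.
have R'0 : 0 <= 2 * Rr / (1 - Rr) by rewrite !mulr_ge0 ?invr_ge0 ?ltW.
have C'0 : 0 <= C' by rewrite /C' addr_ge0 // mulr_ge0.
have [L cL] := in_lp_bound cl; have [H [mH H0 HL hH]] := lp_majorant C'0 cL.
have Hfin := lelt HL (ltry _).
have [K K0 hK] := Gloc_le; pose K3 := K / (c1 * (delta / 12)).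
have cd0 : 0 < c1 * (delta / 12) by rewrite !mulr_gt0.
have K30 : 0 < K3 by rewrite divr_gt0.
have Fb z w : Dk z -> pdisk z Rr w -> Gloc w != 0 -> exists a, [/\ Z a,
  cabs (Fdat Psi w * rC (ek Z w)) <= K3 * cabs (c a) & eball a (C' * dd a) z].
 move=> zD zw /Gloc_neq0 [a [Za aw Ge far psib]]; exists a; have aD := ZD Za; have da := dd_gt0 aD.
 have wD := sep_eball_disk d0 d1 aD aw; split => //.
  have m1 : delta / 12 <= 1 by (move: d1; lra).
  have m0 : 0 <= delta / 12 by (move: d0; lra).
  have := hlow w _ wD m0 m1 psib; have := hK a w Za aw Ge.
  have e0 := expR_gt0 (kZ Z w).
  rewrite /Fdat !cabsM cabsV !nc_rC (gtr0_norm e0) gtr0_norm ?sub_sqr_gt0 //.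
  set x := _ * cabs (Gloc w) => hx hpsi.
  have P0 : 0 < cabs (Psi w) by apply: ltle hpsi; rewrite mulr_gt0.
  rewrite mulrAC ler_pdivrMr //; apply: (le_via (K3 * cabs (c a) * (c1 * (delta / 12) * ek Z w))); last first.
   by apply: lerMl => //; rewrite mulr_ge0 ?nc_ge0 // ltW.
  rewrite mulrA; apply: lerMr; first exact: ltW.
  by rewrite mulrAC /K3 divfK ?gt_eqF.
 have h1 := psi_dist zD wD hR zw.
 have {}aw : dC w a < delta / 2 * dd a := aw.
 have h2 : delta / 2 * dd a <= 1 / 2 * dd a by rewrite ler_pM2r // ler_pM2r.
 have h3 := nc_leB (toC a) (toC w); rewrite (nc_distC (toC a)) in h3.
 have h4 : dd w <= 2 * dd a.
  by move: aw h2 h3 da; set x := nC a; set y := nC w; set t := cabs (_ - _); set v := delta / 2 * _; lra.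
 have h5 := lerMl R'0 h4; have h6 := nc_distD (toC w) (toC z) (toC a).
 change (dC z a < C' * dd a).
 have e : C' * dd a = 2 * Rr / (1 - Rr) * (2 * dd a) + 2 * dd a by rewrite /C'; ring.
 rewrite e; move: h1 h5 h6 aw h2 da; set x1 := cabs _; set x2 := _ * dd w; set x3 := _ * (2 * dd a); set x4 := cabs _; set x5 := cabs _.
 set x6 := delta / 2 * _; lra.
apply: poweR_lty; first by rewrite invr_ge0 ltW.
apply: (@lelt _ _ (\int[A]_(z in Dk) ((K3 `^ p)%:E * H z))%E); last first.
 rewrite ge0_integralZl //; first by rewrite lte_mul_pinfty ?lee_fin ?powR_ge0.
 by rewrite lee_fin powR_ge0.
apply: le_int => z zD; first exact: poweR_ge0.
have := H0 z; case Hz : (H z) => [x| |] // x0; last by rewrite mulry gtr0_sg ?mul1e ?leey // powR_gt0.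
rewrite lee_fin in x0.
have -> : ((K3 `^ p)%:E * x%:E)%E = ((K3 * x `^ p^-1)%:E `^ p)%E.
 rewrite poweR_EFin -EFinM powRM ?powR_ge0 ?ltW //; congr (_ * _)%:E.
 by rewrite -powRrM mulVf ?gt_eqF // powRr1.
apply: ler_poweR; [exact: ltW|exact: poweR_ge0|].
apply: mq_le; [exact: ltle q1|by rewrite mulr_ge0 ?powR_ge0 // ltW|move=> w zw].
have [e|G0] := eqVneq (Gloc w) 0.
 by rewrite /Fdat e mulr0 !mul0r cabs0 mulr_ge0 ?powR_ge0 // ltW.
have [a [Za le az]] := Fb z w zD zw G0; apply: letr le _; apply: lerMl; first exact: ltW.
have := hH a z Za az; rewrite Hz lee_fin => hx.
rewrite -[leLHS](powRK p0) ?nc_ge0 //; apply: ler_powR2r; rewrite ?invr_gt0 ?powR_ge0 //.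
Qed.
End Pieces.

(** * From a solution to a weakly holomorphic interpolant *)

Section SolvableInterpolating.
Implicit Types (a : RR).

(** For [p < 1] and [0 <= s <= 1] one has [s <= s^p]; apply it to the proportions of [x] and [y] in
    their sum. *)
Lemma powR_subadd (x y : R) : 0 <= x -> 0 <= y -> (x + y) `^ p <= x `^ p + y `^ p.
have /andP[p0 p1] := hp; move=> x0 y0; have [xy|xy] := eqVneq (x + y) 0.
 by rewrite xy powR0 ?gt_eqF // addr_ge0 ?powR_ge0.
have s0 : 0 < x + y by rewrite lt_neqAle eq_sym xy addr_ge0.
have h (t : R) : 0 <= t -> t <= x + y -> t / (x + y) * (x + y) `^ p <= t `^ p.
 move=> t0 ts; have [->|tn] := eqVneq t 0; first by rewrite !mul0r powR_ge0.
 have tp : 0 < t by rewrite lt_neqAle eq_sym tn.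
 have e : t `^ p = (t / (x + y)) `^ p * (x + y) `^ p.
  by rewrite -powRM ?divfK ?gt_eqF ?divr_ge0 // ltW.
 rewrite e; apply: lerMr; first exact: powR_ge0.
 have tr0 : 0 < t / (x + y) by rewrite divr_gt0.
 by apply: ger1_powR (ltW p1); rewrite tr0 /= ler_pdivrMr // mul1r.
have hx := h x x0 _; have hy := h y y0 _.
have := lerD (hx _) (hy _); rewrite -mulrDl -mulrDl divff ?gt_eqF // mul1r; apply; by rewrite ?lerDl ?lerDr.
Qed.

Variable c : RR -> C.
Variable Psi : RR -> C.
Hypothesis hPsi : holo Dk Psi.
Hypothesis Psi0 : forall z, Gloc c z != 0 -> Psi z != 0.
Local Notation g := (gloc c).
Local Notation G := (Gloc c).

Lemma Fdat_quot z : Dk z -> Fdat c Psi z / rC (1 - nC z ^+ 2) * Psi z = G z.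
move=> zD; rewrite /Fdat; have [->|G0] := eqVneq (G z) 0; first by rewrite mulr0 !mul0r.
have n1 : rC (1 - nC z ^+ 2) != 0 by rewrite rC_eq0 gt_eqF // sub_sqr_gt0.
by rewrite mulrAC divfK ?Psi0 // mulrAC divff // mul1r.
Qed.

(** The product [Psi phi] is itself a test function, so the weak equation for [u] yields the one for
    [Psi u], whose right-hand side is [Gloc]. *)
Lemma gloc_sub_weakhol u : dbar_solution (Fdat c Psi) u -> weakhol (fun z => g z - Psi z * u z).
move=> su; have [/locintP lu _] := su; have md := @mdisk.
have lg := gloc_locint c; have lPu := holo_locint_mul lu hPsi.
apply: weakhol_real => [|phi tp].
 by move=> r r1; apply: cL1B; [exact: mdball|exact: lg|exact: lPu].
have td := ctest_cdbar tp; have i1 := locint_ctest lg td; have i2 := locint_ctest lPu td.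
rewrite (eq_cinteg (g := fun z => g z * cdbar (fun z => rC (phi z)) z - Psi z * u z * cdbar (fun z => rC (phi z)) z)); last first.
 by move=> z _; rewrite cdbar_rC mulrBl.
rewrite cintegB //; have := gloc_weak c tp => e1.
rewrite (eq_cinteg (g := fun z => g z * dbar phi z)); last by move=> z _; rewrite cdbar_rC.
rewrite e1 (eq_cinteg (f := fun z => Psi z * u z * _) (g := fun z => u z * cdbar (fun z => Psi z * rC (phi z)) z)); last first.
 by move=> z _; rewrite cdbar_rC cdbar_holoM // mulrA (mulrC (Psi z)).
rewrite (solution_ctest su (ctest_holoM hPsi tp)).
rewrite (eq_cinteg (f := fun z => Fdat c Psi z / _ * _) (g := fun z => G z * rC (phi z))); last first.
 by move=> z zD; rewrite mulrA Fdat_quot.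
by rewrite opprK addrC subrr.
Qed.

(** No pointwise value of [u] is available at [a]. With [Psi = (z - a) q], the equation has zero
    right-hand side near [a], so [u q] integrates to zero against the Cauchy kernel. On the annulus
    [u q = (c_a - f) / (z - a)] almost everywhere, so this integral is a multiple of the Cauchy
    integral of [c_a - f] at [a]. *)
Lemma gloc_sub_value u f a : dbar_solution (Fdat c Psi) u -> holo Dk f ->
 {ae A, forall z, Dk z -> g z - Psi z * u z = f z} -> Z a -> Psi a = 0 -> f a = c a.
move=> su hf fae Za Pa; have aD := ZD Za; have ra := crad_gt0 aD; have da := dd_gt0 aD.
have md := @mdisk; have [/locintP lu _] := su.
have [q hq Pq] := holo_div hPsi aD Pa.
(* Half of [crad a] keeps the annulus of the kernel, up to [3/2 rho], inside the region where [gloc]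
   is the constant [c a]. *)
pose rho := crad a / 2; have r0 : 0 < rho by rewrite divr_gt0.
have rd : nC a + 2 * rho <= 1.
 have : delta / 4 * dd a <= 1 / 4 * dd a by rewrite ler_pM2r // ler_pM2r.
 have -> : 2 * rho = delta / 4 * dd a by rewrite /rho /crad; field.
 by move: da; lra.
have tb : ctest (bump a rho) by exact: ctest_bump.
pose phi z : R := re (bump a rho z).
have bE z : bump a rho z = rC (phi z) by [].
have tp : ctest (fun z => rC (phi z)) := tb.
have near z : dC z a <= crad a -> G z = 0 /\ g z = c a.
 move=> za; have az : nbd a z.
  apply: lelt za _; rewrite /crad; apply: (@ltle _ _ (2 * (delta / 4 * dd a))).
   by rewrite ltr_pMl ?ltr1n // !mulr_gt0.
  by apply: eq_ler; field.
 rewrite /gloc /Gloc !(pieceE _ Za az) bump_eq1 // mulr1; split => //.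
 by rewrite cker_eq0 ?mulr0 ?oppr0 //; left.
have z0 : ID (fun z => u z * q z * cker a rho z) = 0.
 have := solution_ctest su (ctest_holoM hq tp).
 rewrite (eq_cinteg (f := fun z => Fdat c Psi z / _ * _) (g := fun _ => 0)); last first.
  move=> z zD; have [zn|zf] := leP (dC z a) (crad a).
   by rewrite /Fdat (near z zn).1 mulr0 !mul0r.
  rewrite -bE bump_eq0 ?mulr0 //; apply: ltW; apply: lelt zf.
  by rewrite /rho; move: ra; lra.
 rewrite cinteg0 oppr0 => e; rewrite (eq_cinteg (g := fun z => -1 * (u z * cdbar (fun z => q z * rC (phi z)) z))).
  rewrite cintegZ ?e ?mulr0 //; exact: locint_ctest lu (ctest_cdbar (ctest_holoM hq tp)).
 by move=> z _; rewrite cdbar_holoM // -cdbar_rC -/(bump a rho) /cker mulrN mulN1r mulrA.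
have mfw : cmeas DP (fun z => (c a - f z) * (cker a rho z / tz z a)).
 apply: cmeasM; first by apply: cmeasB; [exact: cmeas_cst|exact: holo_cmeas].
 apply: cmeasM; last by apply: cmeasV; exact: cmeas_toCB.
 by apply: csmooth_cmeas => //; have [] := ctest_cker r0 rd.
have mu : cmeas DP u.
 by apply: cmeas_disk_local => r r1; apply: cL1_meas (lu r r1); exact: mdball.
have muq : cmeas DP (fun z => u z * q z * cker a rho z).
 apply: cmeasM; first by apply: cmeasM => //; exact: holo_cmeas.
 by apply: csmooth_cmeas => //; have [] := ctest_cker r0 rd.
have ae : {ae A, forall z, Dk z -> u z * q z * cker a rho z = (c a - f z) * (cker a rho z / tz z a)}.
 have [N [mN N0 sub]] := fae; exists N; split => // z hz; apply: sub => fg; apply: hz => zD.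
 have [->|k0] := eqVneq (cker a rho z) 0; first by rewrite mul0r !mulr0.
 have /andP[zn zf] := cker_neq0 r0 k0.
 have zc : dC z a <= crad a.
  by apply: ltW; apply: ltle zf _; rewrite /rho; move: ra; lra.
 have za : toC z - toC a != 0 by rewrite -nc_gt0; exact: lt_trans zn.
 rewrite -(fg zD) (near z zc).2 opprB addrC subrK (Pq z zD).
 by rewrite mulrA -[in RHS](mulrA (tz z a)) [in RHS]mulrC !mulrA mulVf // mul1r (mulrC (q z)).
have hcf : holo Dk (fun z => c a - f z) by apply: holoB => //; exact: holo_cst.
have := holo_cauchy (w := a) hcf r0 rd; rewrite subrr cabs0 => /(_ (ltW (divr_gt0 r0 (ltr0n _ 2)))).
by rewrite -(cinteg_ae md muq mfw ae) z0 mulr0 => /eqP; rewrite subr_eq0 eq_sym => /eqP.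
Qed.
End SolvableInterpolating.

(** * Solvability implies interpolation *)

Section SolvableInterpolatingMain.
Implicit Types (h : RR -> C).

Lemma meas_Tsum : mfun DP (Tsum).
have [pts [pu pZ pS pex]] := enum_exists; have md := @mdisk.
apply: (@measurable_fun_cvg _ PT R _ (fun N z => \sum_(a <- pts N) tval a z)) => [N|z zD].
 apply: measurable_sum => a; apply: mfunM => //.
 apply: meas_fun_inv => [z _|]; first exact: sqr_ge0.
 apply: cmeas_sqr_cabs; apply: cmeasB; first exact: cmeas_cst.
 by apply: cmeasM; [exact: cmeas_cst|exact: cmeas_toC].
apply/cvgrPdist_le => eps e0; have [s [us sZ hs]] := Tsum_approx zD e0.
have [N hN] := pex s sZ; exists N => // n /= nN.
have sub : {subset s <= pts n}.
 move=> a /hN; elim: n nN => [|n IH]; first by rewrite leqn0 => /eqP ->.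
 rewrite leq_eqVlt => /predU1P[<-//|nN aN]; have := IH nN aN.
 by case: (pS n) => [->//|[b ->]]; rewrite mem_rcons inE orbC => ->.
have := Tsum_ge zD (pu n) (pZ n); have := ler_sum_subset (fun a => tval_ge0 a z) us (pu n) sub.
by move: hs => /= h1 h2 h3; rewrite ger0_norm ?subr_ge0 //; move: h1 h2 h3; lra.
Qed.

Lemma meas_kZ : mfun DP (kZ Z).
apply: mfunM; last exact: meas_Tsum.
by apply: mfunM => //; apply: cmeas_sqr_cabs; exact: cmeas_toC.
Qed.

Lemma poweR_lty_inv (x : \bar R) (r : R) : 0 < r -> (x `^ r < +oo)%E -> (x < +oo)%E.
by case: x => [x| |] r0 //=; rewrite ?ltry // gt_eqF. Qed.

Lemma solvable_interpolating (q Rr : R) : 0 < Rr < 1 -> 1 <= q -> dbar_solvable p q Rr Z -> interpolating p Z.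
move=> hR q1 [K hK]; split=> [f|c cl]; first exact: (Ap_in_lp).
have /andP[p0 p1] := hp; have md := @mdisk.
have [Psi [C1 [c1 [C10 c10 hPsi hup [hupa hlow]]]]] := psi_product.
have Psi0 z : Gloc c z != 0 -> Psi z != 0.
 move=> /(Gloc_neq0) [a [Za az _ _ hb]]; rewrite -nc_gt0.
 have m1 : delta / 12 <= 1 by (move: d1; lra).
 have m0 : 0 <= delta / 12 by (move: d0; lra).
 apply: ltle (hlow z _ (sep_eball_disk d0 d1 (ZD Za) az) m0 m1 hb).
 by rewrite !mulr_gt0 ?expR_gt0.
have FL := Fdat_Lpq c10 hPsi hlow cl q1 hR.
have [u [su nu]] := hK _ FL; have [_ [_ Nfin]] := FL; have [/locintP lu _] := su.
have mu : cmeas DP u.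
 by apply: cmeas_disk_local => r r1; apply: cL1_meas (lu r r1); exact: mdball.
have ufin : (\int[A]_(z in Dk) ((cabs (u z) * ek Z z) `^ p)%:E < +oo)%E.
 apply: (@poweR_lty_inv _ p^-1); first by rewrite invr_gt0.
 apply: lelt nu _; have N0 : (0 <= normpqZ p q Rr Z (Fdat c Psi))%E by exact: poweR_ge0.
 move: N0 Nfin; case: (normpqZ _ _ _ _ _) => [x| |] //= _ _; by rewrite -EFinM ltry.
have wv := gloc_sub_weakhol hPsi Psi0 su.
pose v z := gloc c z - Psi z * u z.
have hf := weyl_holo wv; have fae := weyl_ae wv.
exists (weyl v); split; last first.
 move=> a Za; apply: (gloc_sub_value hPsi su hf fae Za).
 apply/eqP; rewrite -nc_eq0 eq_le nc_ge0 andbT; apply: letr (hupa a a Za (ZD Za)) _.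
 by rewrite psiE subrr cabs0 mul0r mulr0 mul0r.
split; first exact/holo_diskP.
have mf : cmeas DP (weyl v) by exact: holo_cmeas.
have [mg _] := gloc_meas c.
have mPu : cmeas DP (fun z => Psi z * u z) by apply: cmeasM => //; exact: holo_cmeas.
have mv : cmeas DP v by exact: cmeasB.
have mp h : cmeas DP h -> mfun DP (fun z => (cabs (h z) `^ p)%:E).
 by move=> mh; apply/mEFP; exact: cmeas_powR.
have -> : (\int[A]_(z in Dk) (cabs (weyl v z) `^ p)%:E = \int[A]_(z in Dk) (cabs (v z) `^ p)%:E)%E.
 apply: ae_eq_integral => //; [exact: mp|exact: mp|].
 by have [N [mN N0 sub]] := fae; exists N; split => // z hz; apply: sub => fg; apply: hz => zD; rewrite -(fg zD).
apply: (@lelt _ _ (\int[A]_(z in Dk) ((cabs (gloc c z) `^ p)%:E + (cabs (Psi z * u z) `^ p)%:E))%E).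
 apply: le_int => z _; first by rewrite lee_fin powR_ge0.
 rewrite -[leRHS]EFinD lee_fin.
 apply: letr _ (powR_subadd (nc_ge0 (gloc c z)) (nc_ge0 (Psi z * u z))).
 by apply: ler_powR2r => //; rewrite ?addr_ge0 ?nc_ge0 // cabsB.
rewrite ge0_integralD //; [|by move=> z _; rewrite lee_fin powR_ge0|exact: mp|by move=> z _; rewrite lee_fin powR_ge0|exact: mp].
(* The glued data are integrable by [lp_majorant]; the other term is controlled by the weighted norm
   of [u], because [|Psi| <= C1 exp kZ]. *)
apply: lte_add_pinfty.
 have [L cL] := in_lp_bound cl; have [H [mH H0 HL hH]] := lp_majorant ler01 cL.
 have Hfin := lelt HL (ltry _).
 apply: lelt Hfin; apply: le_int => z _; first by rewrite lee_fin powR_ge0.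
 have [->|g0] := eqVneq (gloc c z) 0; first by rewrite cabs0 powR0 ?gt_eqF.
 have [a [Za az le]] := gloc_le g0; apply: letr (hH a z Za _).
  by rewrite lee_fin; apply: ler_powR2r => //; exact: nc_ge0.
 have {}az : dC z a < delta / 2 * dd a := az.
 apply: ltle az _; apply: lerMr; [exact: ltW (dd_gt0 (ZD Za))|move: d1; lra].
apply: (@lelt _ _ (\int[A]_(z in Dk) ((C1 `^ p)%:E * ((cabs (u z) * ek Z z) `^ p)%:E))%E).
 apply: le_int => z zD; first by rewrite lee_fin powR_ge0.
 rewrite -EFinM lee_fin -powRM ?mulr_ge0 ?nc_ge0 ?expR_ge0 ?(ltW C10) //.
 apply: ler_powR2r => //; rewrite ?mulr_ge0 ?nc_ge0 ?expR_ge0 ?(ltW C10) //.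
 rewrite cabsM mulrCA mulrC; apply: lerMl; [exact: nc_ge0|exact: hup].
have mk := meas_kZ.
have me : mfun DP (fun z => ((cabs (u z) * ek Z z) `^ p)%:E).
 apply/mEFP.
 have := @cmeas_powR Dk (fun z => u z * rC (ek Z z)) p _; rewrite (_ : (fun z => cabs (u z * _) `^ p) = fun z => (cabs (u z) * ek Z z) `^ p).
  apply; apply: cmeasM => //; apply: cmeas_rC; exact: mcomp.
 by apply/funext => z; rewrite cabsM nc_rC gtr0_norm ?expR_gt0.
rewrite ge0_integralZl //; [|by move=> z _; rewrite lee_fin powR_ge0|by rewrite lee_fin powR_ge0].
by rewrite lte_mul_pinfty ?lee_fin ?powR_ge0.
Qed.
End SolvableInterpolatingMain.

(** * Interpolation with uniform constants *)

Section OpenMapping.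
Implicit Types (g c : RR -> C) (a : RR) (s : seq RR) (M K : R) (D : set PT).

Let p0 : 0 < p. by case/andP: hp. Qed.

(** The [p]-th power of the [l^p] quasi-norm is at most [M]. The [p]-th power is kept because it is
    subadditive for [p < 1] and so gives a metric. *)
Definition lpn c M := forall s, uniq s -> (forall a, a \in s -> Z a) ->
 \sum_(a <- s) cabs (c a) `^ p * wgt a <= M.

Lemma wgt_gt0 a : Dk a -> 0 < wgt a.
by move=> aD; rewrite /wgt exprn_gt0 // sub_sqr_gt0. Qed.

Lemma lpn_in_lp c M : lpn c M -> in_lp p Z c.
move=> h; apply: lelt (ltry M); apply: esum_le_seq => // a _.
by rewrite mulr_ge0 ?powR_ge0 ?sqr_ge0.
Qed.

Lemma lpn_point c M a : Z a -> lpn c M -> cabs (c a) `^ p * wgt a <= M.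
move=> Za /(_ [:: a] isT); rewrite big_seq1; apply => b; by rewrite inE => /eqP ->.
Qed.

Lemma lpn_le c c' M : (forall a, Z a -> cabs (c' a) <= cabs (c a)) -> lpn c M -> lpn c' M.
move=> h hc s us sZ; apply: letr (hc s us sZ); rewrite big_seq [leRHS]big_seq.
apply: ler_sum => a /sZ Za; apply: lerMr; first exact: wgt_ge0.
by apply: ler_powR2r; rewrite ?nc_ge0 ?h.
Qed.

Lemma lpnD c c' M M' : lpn c M -> lpn c' M' -> lpn (fun a => c a + c' a) (M + M').
move=> h h' s us sZ; apply: letr (lerD (h s us sZ) (h' s us sZ)); rewrite -big_split /=.
apply: ler_sum => a _; rewrite -mulrDl; apply: lerMr; first exact: wgt_ge0.
apply: letr (powR_subadd (nc_ge0 _) (nc_ge0 _)).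
by apply: ler_powR2r; rewrite ?addr_ge0 ?nc_ge0 ?cabsD.
Qed.

Lemma lpnB c c' M M' : lpn c M -> lpn c' M' -> lpn (fun a => c a - c' a) (M + M').
by move=> h h'; apply: lpnD => //; apply: lpn_le h' => a _; rewrite cabsN.
Qed.

Lemma lpnZ c (t : C) M : lpn c M -> lpn (fun a => t * c a) (cabs t `^ p * M).
move=> h s us sZ; apply: letr (lerMl (powR_ge0 _ _) (h s us sZ)).
rewrite mulr_sumr; apply: ler_sum => a _.
by rewrite cabsM powRM ?nc_ge0 // -mulrA lexx.
Qed.

Lemma sum_lim_small (c_ : nat -> RR -> C) c s eps : 0 < eps ->
 (forall a, a \in s -> forall e, 0 < e -> exists N, forall m, (N <= m)%N -> cabs (c_ m a - c a) <= e) ->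
 exists N, forall m, (N <= m)%N -> \sum_(a <- s) cabs (c a - c_ m a) `^ p * wgt a <= eps.
move=> e0 h; elim: s eps e0 h => [|a s IH] eps e0 h; first by exists 0%N => m _; rewrite big_nil ltW.
have [|b bs|N1 h1] := IH (eps / 2); rewrite ?divr_gt0 //; first by apply: h; rewrite inE bs orbT.
pose k := wgt a + 1; have k0 : 0 < k by rewrite ltr_wpDl // wgt_ge0.
have [|N2 h2] := h a (mem_head a s) ((eps / 2 / k) `^ p^-1); first by rewrite powR_gt0 // !divr_gt0.
exists (maxn N1 N2) => m; rewrite geq_max => /andP[m1 m2]; rewrite big_cons.
have -> : eps = eps / 2 + eps / 2 by field.
apply: lerD (h1 m m1); rewrite nc_distC.
apply: (le_via (eps / 2 / k * wgt a)); last first.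
 by rewrite mulrAC ler_pdivrMr // lerMl ?divr_ge0 ?(ltW e0) // lerDl.
apply: lerMr; first exact: wgt_ge0.
apply: letr (ler_powR2r p0 (nc_ge0 _) (powR_ge0 _ _) (h2 m m2)) _.
by rewrite -powRrM mulVf ?gt_eqF // powRr1 // !divr_ge0 // ltW.
Qed.

Lemma lpn_point_small (r : nat -> R) a eps : Z a -> 0 < eps ->
 (forall e, 0 < e -> exists n, r n <= e) -> exists n, forall c, lpn c (r n) -> cabs (c a) <= eps.
move=> Za e0 hr; have wa := wgt_gt0 (ZD Za).
have [|n hn] := hr (eps `^ p * wgt a); first by rewrite mulr_gt0 // powR_gt0.
exists n => c /(lpn_point Za) h; rewrite -(powRK p0 (nc_ge0 (c a))) -(powRK p0 (ltW e0)).
apply: ler_powR2r; rewrite ?invr_gt0 ?powR_ge0 //.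
by have := letr h hn; rewrite ler_pM2r.
Qed.

(** Coordinates converge, and on each finite list the bounds pass to the limit. *)
Lemma lp_complete (c_ : nat -> RR -> C) (r : nat -> R) :
 (forall n k, lpn (fun a => c_ (n + k)%N a - c_ n a) (r n)) ->
 (forall e, 0 < e -> exists n, r n <= e) -> exists c, forall n, lpn (fun a => c a - c_ n a) (r n).
move=> hc hr.
have lim a : exists l, Z a -> forall e, 0 < e -> exists N, forall m, (N <= m)%N -> cabs (c_ m a - l) <= e.
 have [Za|nZ] := pselect (Z a); last by exists 0 => /nZ.
 have [|l hl] := @complex_seq_lim (c_ ^~ a); last by exists l.
 move=> e e0; have [n hn] := lpn_point_small Za e0 hr; exists n => m nm.
 by apply: (hn (fun a => c_ m a - c_ n a)); rewrite -(subnKC nm); exact: hc.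
have [c hlim] := choice lim; exists c => n s us sZ.
apply/ler_addgt0Pr => e e0; have [N hN] := @sum_lim_small c_ c s e e0 (fun a h => hlim a (sZ a h)).
have := lerD (hc n N s us sZ) (hN (n + N)%N (leq_addl n N)); apply: letr.
rewrite -big_split; apply: ler_sum => a _ /=; rewrite -mulrDl; apply: lerMr; first exact: wgt_ge0.
have -> : c a - c_ n a = (c_ (n + N)%N a - c_ n a) + (c a - c_ (n + N)%N a) by ring.
apply: letr (powR_subadd (nc_ge0 _) (nc_ge0 _)).
by apply: ler_powR2r; rewrite ?addr_ge0 ?nc_ge0 ?cabsD.
Qed.

Lemma half_small (x : R) : 0 <= x -> forall e, 0 < e -> exists n : nat, x / 2 ^+ n <= e.
move=> x0 e e0; exists (Num.bound (x / e)); have := archi_boundP (divr_ge0 x0 (ltW e0)).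
set n := Num.bound _; rewrite ltr_pdivrMr // => h; rewrite ler_pdivrMr ?exprn_gt0 // mulrC.
apply: letr (ltW h) _; apply: lerMr; first exact: ltW.
by rewrite -natrX ler_nat ltnW // ltn_expl.
Qed.

(* Baire's theorem in the complete metric space of sequences, by nested balls. *)
Lemma lp_baire (E : nat -> (RR -> C) -> Prop) : (forall c, in_lp p Z c -> exists n, E n c) ->
 exists n c0 r, [/\ 0 < r, exists M, lpn c0 M & forall c, lpn (fun a => c a - c0 a) r ->
  forall e, 0 < e -> exists2 x, E n x & lpn (fun a => x a - c a) e].
move=> hE; apply: contrapT => no.
pose good (st : (RR -> C) * R) := 0 < st.2 /\ exists M, lpn st.1 M.
have step (v : nat * ((RR -> C) * R)) : exists st' : (RR -> C) * R, good v.2 ->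
 [/\ good st', lpn (fun a => st'.1 a - v.2.1 a) (v.2.2 / 2), st'.2 <= v.2.2 / 2 &
 forall x, E v.1 x -> ~ lpn (fun a => x a - st'.1 a) st'.2].
 case: v => n [c0 r] /=; have [[/= r0 [M hM]]|ng] := pselect (good (c0, r)); last by exists (c0, r).
 apply: contrapT => no'; apply: no; exists n, c0, (r / 2); split; [by rewrite divr_gt0|by exists M|].
 move=> c hc e e0; apply: contrapT => no2; apply: no'.
 exists (c, Num.min e (r / 2)) => _; split => //=; last first.
 - move=> x Ex hx; apply: no2; exists x => // s us sZ; apply: letr (hx s us sZ) _.
  by rewrite ge_min lexx.
 - by rewrite ge_min lexx orbT.
 - split; first by rewrite /= lt_min e0 divr_gt0.
  exists (r / 2 + M); have := lpnD hc hM; apply: lpn_le => a _; by rewrite subrK.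
have [F hF] := choice step.
pose st := fix st n := if n is m.+1 then F (m, st m) else (fun _ => 0, 1) : (RR -> C) * R.
have gst n : good (st n).
 elim: n => [|n IH]; last by have [] := hF (n, st n) IH.
 split => //=; exists 0 => s us sZ; rewrite big1 // => a _; by rewrite cabs0 powR0 ?mul0r // gt_eqF.
have r2 n : (st n).2 <= 1 / 2 ^+ n.
 elim: n => [|n IH]; first by rewrite expr0 divr1.
 have [_ _ h _] := hF (n, st n) (gst n); apply: letr h _.
 by rewrite exprS invfM mulrA mulrAC lerMr.
have cau n k : lpn (fun a => (st (n + k)%N).1 a - (st n).1 a) (st n).2.
 elim: k n => [|k IH] n.
  rewrite addn0 => s us sZ; rewrite big1 => [|a _]; first by have [/ltW] := gst n.
  by rewrite subrr cabs0 powR0 ?mul0r // gt_eqF.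
 have [_ h1 h2 _] := hF (n, st n) (gst n); have := lpnD (IH n.+1) h1.
 rewrite -addSnnS => h s us sZ; have := h s us sZ; rewrite /=.
 under eq_bigr do rewrite addrA subrK.
 move=> /letr; apply; move: h2 => /=; lra.
have [|c hc] := lp_complete cau.
 by move=> e e0; have [n hn] := half_small ler01 e0; exists n; exact: letr (r2 n) hn.
have [|n En] := hE c.
 have [_ [M hM]] := gst 0%N; apply: (@lpn_in_lp _ ((st 0%N).2 + M)).
 by have := lpnD (hc 0%N) hM; apply: lpn_le => a _; rewrite subrK.
have [_ _ _ h] := hF (n, st n) (gst n); exact: h c En (hc n.+1).
Qed.

Definition apn f M := (\int[A]_(z in Dk) (cabs (f z) `^ p)%:E <= M%:E)%E.

Lemma meas_pow D f : measurable D -> D `<=` Dk -> holo Dk f ->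
 mfun D (fun z => (cabs (f z) `^ p)%:E).
move=> mD DD hf; apply/mEFP; apply: cmeas_powR.
by apply: cmeas_sub (holo_cmeas hf) => //; exact: mdisk.
Qed.

Lemma integral_powD D f g h : measurable D -> D `<=` Dk -> holo Dk f -> holo Dk g ->
 (forall z, D z -> cabs (h z) <= cabs (f z) + cabs (g z)) ->
 (\int[A]_(z in D) (cabs (h z) `^ p)%:E <=
  \int[A]_(z in D) (cabs (f z) `^ p)%:E + \int[A]_(z in D) (cabs (g z) `^ p)%:E)%E.
move=> mD DD hf hg le; rewrite -ge0_integralD //.
- apply: le_int => z Dz; first by rewrite lee_fin powR_ge0.
 rewrite -[leRHS]EFinD lee_fin; apply: letr (powR_subadd (nc_ge0 (f z)) (nc_ge0 (g z))).
 by apply: ler_powR2r; rewrite ?addr_ge0 ?nc_ge0 ?le.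
- by move=> z _; rewrite lee_fin powR_ge0.
- exact: meas_pow.
- by move=> z _; rewrite lee_fin powR_ge0.
- exact: meas_pow.
Qed.

Lemma apnD f g M M' : holo Dk f -> holo Dk g -> apn f M -> apn g M' ->
 apn (fun z => f z + g z) (M + M') /\ apn (fun z => f z - g z) (M + M').
move=> hf hg h h'; have md := @mdisk; rewrite /apn EFinD.
by split; apply: letr (leeD h h'); apply: integral_powD => // z _; [exact: cabsD|exact: cabsB].
Qed.

Lemma apnM f g K M : 0 <= K -> holo Dk f -> (forall z, Dk z -> cabs (g z) <= K * cabs (f z)) ->
 apn f M -> apn g (K `^ p * M).
move=> K0 hf le h; have md := @mdisk; rewrite /apn EFinM.
apply: letr (leeMl _ h); last by rewrite lee_fin powR_ge0.
rewrite -ge0_integralZl //; [|exact: meas_pow|by move=> z _; rewrite lee_fin powR_ge0|by rewrite lee_fin powR_ge0].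
apply: le_int => z Dz; first by rewrite lee_fin powR_ge0.
rewrite -EFinM lee_fin -powRM ?nc_ge0 //; apply: ler_powR2r; rewrite ?mulr_ge0 ?nc_ge0 ?le //.
Qed.

Lemma apn_point : exists2 K, 0 < K & forall f (M rho : R) z, holo Dk f -> apn f M -> 0 < rho ->
 nC z + rho < 1 -> cabs (f z) `^ p <= K / rho ^+ 2 * M.
have [K K0 hK] := sub_mean hp; exists K => // f M rho z hf hM r0 zr.
have Kr : 0 <= K / rho ^+ 2 by rewrite divr_ge0 ?exprn_ge0 ?ltW.
rewrite -lee_fin EFinM; apply: letr (hK f z rho hf r0 zr) _; apply: leeMl; first by rewrite lee_fin.
apply: letr hM; apply: int_subset => [|w _]; last by rewrite lee_fin powR_ge0.
by apply: eball_disk; move: zr; lra.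
Qed.

(** Point evaluations are controlled by the norm, so the sequence converges locally uniformly to a
    holomorphic function. The norm bound is checked on smaller disks, where the convergence is
    uniform, and passes to the full disk by exhaustion. *)
Lemma Ap_complete (f_ : nat -> RR -> C) (r : nat -> R) : (forall n, holo Dk (f_ n)) ->
 (forall n k, apn (fun z => f_ (n + k)%N z - f_ n z) (r n)) ->
 (forall e, 0 < e -> exists n, r n <= e) ->
 exists f, [/\ holo Dk f, forall n, apn (fun z => f z - f_ n z) (r n) &
  forall z, Dk z -> forall e, 0 < e -> exists N, forall m, (N <= m)%N -> cabs (f_ m z - f z) <= e].
move=> hf hr r0; have [K K0 hK] := apn_point.
have cau (t e : R) : t < 1 -> 0 < e -> exists N, forall m z, (N <= m)%N -> nC z <= t -> cabs (f_ m z - f_ N z) <= e.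
 move=> t1 e0; pose rho := (1 - t) / 2; have rho0 : 0 < rho by rewrite divr_gt0 // subr_gt0.
 have [|n hn] := r0 (e `^ p * (rho ^+ 2 / K)).
  by rewrite mulr_gt0 ?powR_gt0 // divr_gt0 // exprn_gt0.
 exists n => m z nm zt; rewrite -(powRK p0 (nc_ge0 _)) -(powRK p0 (ltW e0)).
 apply: ler_powR2r; rewrite ?invr_gt0 ?powR_ge0 //.
 have hB := holoB (hf m) (hf n); have := hr n (m - n)%N; rewrite (subnKC nm) => hA.
 apply: letr (hK _ _ _ z hB hA rho0 _) _; first by (move: zt t1; rewrite /rho; lra).
 apply: letr (lerMl _ hn) _; first by rewrite divr_ge0 ?exprn_ge0 ?ltW.
 have kn : K != 0 by rewrite gt_eqF.
 have rn : rho != 0 by rewrite gt_eqF.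
 by apply: eq_ler; field; rewrite kn rn.
have [f hol lim] := holo_cauchy_lim hf cau; exists f; split => // n.
have unif (t e : R) : t < 1 -> 0 < e -> exists N, forall z, nC z <= t -> cabs (f z - f_ (n + N)%N z) <= e.
 move=> t1 e0; have e3 : 0 < e / 3 by rewrite divr_gt0.
 have [N hN] := cau t _ t1 e3; exists N => z zt.
 have [N' hN'] := lim z (lelt zt t1) _ e3.
 pose m := maxn N' N; have hm := hN m z (leq_maxr _ _) zt.
 have hm2 := hN (n + N)%N z (leq_addl _ _) zt; have hm3 := hN' m (leq_maxl _ _).
 have := nc_distD (f_ m z) (f z) (f_ (n + N)%N z); have := nc_distD (f_ N z) (f_ m z) (f_ (n + N)%N z).
 rewrite (nc_distC (f z) (f_ m z)) (nc_distC (f_ N z)); move: hm hm2 hm3; lra.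
apply: integral_disk_le => [|z|t t1]; [|by rewrite lee_fin powR_ge0|].
 by apply: meas_pow => //; [exact: mdisk|exact: holoB].
have md := @mdisk; have mb := @mdball t.
apply/lee_addgt0Pr => e e0; have [|N hN] := unif t ((e / 4) `^ p^-1) t1; first by rewrite powR_gt0 // divr_gt0.
have tD := dball_disk (ltW t1).
apply: letr (integral_powD (h := fun z => f z - f_ n z) mb tD (holoB (hf (n + N)%N) (hf n)) (holoB hol (hf (n + N)%N)) _) _.
 move=> z _; apply: letr (nc_distD (f_ (n + N)%N z) _ _) _; by rewrite addrC.
apply: leeD.
 by apply: letr (hr n N); apply: int_subset => // z _; rewrite lee_fin powR_ge0.
apply: (le_via (\int[A]_(z in dball t) (e / 4)%:E)%E).
 apply: le_int => z zt; first by rewrite lee_fin powR_ge0.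
 rewrite lee_fin; apply: letr (ler_powR2r p0 (nc_ge0 _) (powR_ge0 _ _) (hN z (ltW zt))) _.
 by rewrite -powRrM mulVf ?gt_eqF // powRr1 // divr_ge0 // ltW.
rewrite integral_cst //; apply: (le_via ((e / 4)%:E * 4%:E)%E); last by rewrite -EFinM divfK.
apply: leeMl; first by rewrite lee_fin divr_ge0 // ltW.
by apply: letr area_disk_le; apply: le_measure; rewrite ?inE.
Qed.

(** The classical scheme in a quasi-normed setting: Baire makes the data interpolated with norm at
    most [n] dense in some ball, differences and scaling bring that ball to the origin, and
    successive approximation removes the word dense. *)
Lemma open_mapping : interpolating p Z -> exists2 M, 0 < M & forall c (r : R), 0 < r -> lpn c r ->
 exists f, [/\ holo Dk f, apn f (M * r) & forall a, Z a -> f a = c a].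
move=> [_ hI].
pose E (n : nat) c := exists f, [/\ holo Dk f, apn f n%:R & forall a, Z a -> f a = c a].
have [|n [c0 [r0 [r00 [M0 hM0] hE]]]] := @lp_baire E.
 move=> c /hI [f [[/holo_diskP hf fi] fc]].
 have I0 : (0 <= \int[A]_(z in Dk) (cabs (f z) `^ p)%:E)%E.
  by apply: integral_ge0 => z _; rewrite lee_fin powR_ge0.
 exists (Num.bound (fine (\int[A]_(z in Dk) (cabs (f z) `^ p)%:E)%E)), f; split => //.
 rewrite /apn -[leLHS]fineK ?ge0_fin_numE // lee_fin ltW //.
 by apply: archi_boundP; rewrite fine_ge0.
have Z0 : lpn (fun _ => 0) r0.
 by move=> s us sZ; rewrite big1 ?ltW // => a _; rewrite cabs0 powR0 ?mul0r // gt_eqF.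
(* Approximate [c0] and [c0 + c] and subtract: data near the origin are approximated with twice the
   norm. *)
have app c e : lpn c r0 -> 0 < e -> exists f, [/\ holo Dk f, apn f (n%:R + n%:R) & lpn (fun a => c a - f a) e].
 move=> hc e0; have e2 : 0 < e / 2 by rewrite divr_gt0.
 have [|x1 [f1 [hf1 a1 v1]] h1] := hE (fun a => c0 a + c a) _ (e / 2) e2.
  by apply: lpn_le hc => a _; rewrite addrC addKr.
 have [|x2 [f2 [hf2 a2 v2]] h2] := hE c0 _ (e / 2) e2.
  by apply: lpn_le Z0 => a _; rewrite subrr.
 exists (fun z => f1 z - f2 z); split; [exact: holoB|by have [] := apnD hf1 hf2 a1 a2|].
 have := lpnB h2 h1; rewrite -[e / 2 + e / 2]splitr; apply: lpn_le => a Za.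
 by rewrite v1 // v2 // le_eqVlt; apply/orP; left; apply/eqP; congr cabs; ring.
(* As [lpn] and [apn] bound [p]-th powers, multiplying the bounds by [t] means scaling the functions
   by [t^(1/p)]. *)
have sc c (t e : R) : 0 < t -> lpn c (t * r0) -> 0 < e ->
  exists f, [/\ holo Dk f, apn f (t * (n%:R + n%:R)) & lpn (fun a => c a - f a) e].
 move=> t0 hc e0; pose s := t `^ p^-1; have s0 : 0 < s by rewrite powR_gt0.
 have sp : s `^ p = t by rewrite -powRrM mulVf ?gt_eqF // powRr1 // ltW.
 have sn : rC s != 0 by rewrite rC_eq0 gt_eqF.
 have cs : cabs (rC s) = s by rewrite nc_rC gtr0_norm.
 have [||f [hf af lf]] := app (fun a => (rC s)^-1 * c a) (e / t).
 - have := lpnZ (rC s)^-1 hc; rewrite cabsV cs -powR_inv1 ?(ltW s0) // -powRrM mulN1r powRN sp mulrA mulVf ?mul1r //.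
  by rewrite gt_eqF.
 - by rewrite divr_gt0.
 exists (fun z => rC s * f z); split.
 - by apply: holoM => //; exact: holo_cst.
 - have := @apnM f (fun z => rC s * f z) s _ (ltW s0) hf _ af; rewrite sp; apply => z _.
  by rewrite cabsM cs.
 - have := lpnZ (rC s) lf; rewrite cs sp mulrC divfK ?gt_eqF //; apply: lpn_le => a _.
  by rewrite mulrBr mulrA divff // mul1r.
pose M : R := (n%:R + n%:R) / r0 * 2 + 1.
have n0 : 0 <= (n%:R + n%:R) / r0 by rewrite divr_ge0 ?addr_ge0 // ltW.
exists M => [|c r rr hc]; first by rewrite ltr_wpDl // mulr_ge0.
(* Successive approximation: after [k] corrections the error on [Z] is at most [r / 2^k]. *)
pose P k F := holo Dk F /\ lpn (fun a => c a - F a) (r / 2 ^+ k).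
have h2 k : 0 < 2 ^+ k :> R by rewrite exprn_gt0.
have step (v : nat * (RR -> C)) : exists F', P v.1 v.2 ->
  P v.1.+1 F' /\ apn (fun z => F' z - v.2 z) (r / 2 ^+ v.1 * ((n%:R + n%:R) / r0)).
 case: v => k F /=; have [[hF lF]|] := pselect (P k F); last by exists F.
 have [|||f [hf af lf]] := sc (fun a => c a - F a) (r / 2 ^+ k / r0) (r / 2 ^+ k.+1).
 - by rewrite !divr_gt0.
 - by rewrite divfK // gt_eqF.
 - by rewrite divr_gt0.
 exists (fun z => F z + f z) => _; split; [split; [exact: holoD|]|].
  by apply: lpn_le lf => a _; rewrite opprD addrA.
 have -> : (fun z => F z + f z - F z) = f by apply/funext => z; rewrite addrC addKr.
 by rewrite mulrA mulrAC.
have [S hS] := choice step.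
pose F := fix F k := if k is m.+1 then S (m, F m) else (fun _ => 0) : RR -> C.
have PF k : P k (F k).
 elim: k => [|k IH]; last by have [] := hS (k, F k) IH.
 by split; [exact: holo_cst|rewrite expr0 divr1; apply: lpn_le hc => a _; rewrite subr0].
pose B : R := (n%:R + n%:R) / r0.
(* Correction [k] costs [r B / 2^k], so a tail costs at most twice its first term; [tail] at [0]
   gives the norm and for large [k] the convergence. *)
have tail k l : apn (fun z => F (k + l)%N z - F k z) (r / 2 ^+ k * B * 2).
 elim: l k => [|l IH] k.
  rewrite addn0 /apn; under eq_integral do rewrite subrr cabs0 powR0 ?gt_eqF //.
  by rewrite integral0 lee_fin mulr_ge0 // mulr_ge0 // ltW // divr_gt0.
 have [_ h1] := hS (k, F k) (PF k); have hS1 := (PF k.+1).1.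
 have := (apnD (holoB (PF (k.+1 + l)%N).1 hS1) (holoB hS1 (PF k).1) (IH k.+1) h1).1.
 rewrite -addSnnS /apn /=; under eq_integral do rewrite addrA subrK.
 move=> /letr; apply; rewrite lee_fin exprS -/B.
 apply: eq_ler; move: (B) (2 ^+ k) (lt0r_neq0 (h2 k)) => B' t tn; by field.
have [|f [hf af lf]] := Ap_complete (fun k => (PF k).1) tail.
 have B0 : 0 <= r * B * 2 by rewrite mulr_ge0 // mulr_ge0 // ltW.
 move=> e e0; have [k hk] := half_small B0 e0; exists k; apply: letr hk.
 apply: eq_ler; move: (B) (2 ^+ k) (lt0r_neq0 (h2 k)) => B' t tn; by field.
exists f; split => // [|a Za].
 have := af 0%N; rewrite /apn /=; under eq_integral do rewrite subr0.
 move=> /letr; apply; rewrite lee_fin expr0 divr1 /M -/B.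
 have -> : r * B * 2 = B * 2 * r by ring.
 by rewrite mulrDl mul1r lerDl ltW.
apply/eqP; rewrite -subr_eq0; apply/eqP; apply: (@nc_small _ 2) => // e e0.
have [N hN] := lf a (ZD Za) e e0.
have [k hk] := lpn_point_small Za e0 (half_small (ltW rr)).
pose m := maxn N k; have := hN m (leq_maxl _ _); have := hk (fun a => c a - F m a).
have : lpn (fun a => c a - F m a) (r / 2 ^+ k).
 move=> s us sZ; apply: letr ((PF m).2 s us sZ) _; apply: lerMl; first exact: ltW.
 by rewrite lef_pV2 ?posrE // ler_weXn2l ?ler1n // leq_maxr.
move=> h /(_ h) h1 h3; have := nc_distD (F m a) (f a) (c a).
rewrite (nc_distC (f a) (F m a)) (nc_distC (F m a) (c a)); move: h1 h3; lra.
Qed.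
End OpenMapping.

(** * Division by the product with weighted estimates *)

Section PsiQuotient.
Implicit Types (h q : RR -> C) (a : RR) (s : seq RR).
Variables (Psi : RR -> C) (C1 c1 : R).
Hypotheses (C10 : 0 < C1) (c10 : 0 < c1) (hPsi : holo Dk Psi)
 (hupa : forall a z, Z a -> Dk z -> cabs (Psi z) <= C1 * psi a z * ek Z z)
 (hlow : forall z (m : R), Dk z -> 0 <= m -> m <= 1 -> (forall a, Z a -> m <= psi a z) ->
   c1 * m * ek Z z <= cabs (Psi z)).
Let p0 : 0 < p. by case/andP: hp. Qed.
Local Notation theta := (delta / 96).

(** Estimates for quotients by [Psi] are claimed only off [Z], so the integral bounds discard [Z] as
    a null set: countably many points, each on a vertical line. *)
Lemma Z_negligible : A.-negligible Z.
have [pts [_ pZ _ pex]] := enum_exists.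
apply: (@negligibleS _ PT R A (\bigcup_N [set a | a \in pts N])).
 by move=> a Za; have [|N hN] := pex [:: a]; [move=> b; rewrite inE => /eqP ->|exists N => //=; apply: hN; rewrite inE].
apply: negligible_bigcup => N; elim: (pts N) => [|a s IH].
 by rewrite (_ : [set a | _] = set0); [exact: negligible_set0|apply/seteqP; split].
apply: negligibleS (negligibleU _ IH) => [b /=|]; first by rewrite inE => /orP[/eqP|] h; [left; exact: h|right].
exists [set z : RR | z.1 = a.1]; split; [exact: meas_vline|exact: area_vline|by move=> b ->].
Qed.

Lemma psi_min b z : Dk z -> Z b -> psi b z < theta -> forall a, Z a -> psi b z <= psi a z.
move=> zD Zb bz a Za; rewrite leNgt; apply/negP => lt.
have t5 : theta <= delta / 5 by (move: d0; lra).
have h1 := psi_near (ZD Zb) zD (ltle bz t5).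
have h2 := psi_near (ZD Za) zD (ltle (lt_trans lt bz) t5).
by move: lt; rewrite (nbd_uniq Zb Za h1 h2) ltxx.
Qed.

Lemma near_or_far z : (forall a, Z a -> theta <= psi a z) \/ exists b, Z b /\ psi b z < theta.
have [h|/existsNP[b /not_implyP[Zb /negP]]] := pselect (forall a, Z a -> theta <= psi a z); first by left.
by rewrite -ltNge => bz; right; exists b.
Qed.

Lemma Psi_Z a : Z a -> Psi a = 0.
move=> Za; apply/eqP; rewrite -nc_eq0 eq_le nc_ge0 andbT.
by apply: letr (hupa Za (ZD Za)) _; rewrite psiE subrr cabs0 mul0r mulr0 mul0r.
Qed.

Lemma psi_gt0 a z : Dk a -> Dk z -> a <> z -> 0 < psi a z.
move=> aD zD az; rewrite psiE divr_gt0 ?den_gt0 // nc_gt0 subr_eq0.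
by apply/eqP => /toC_inj.
Qed.

Lemma Psi_eq0 z : Dk z -> Psi z = 0 -> Z z.
move=> zD Pz; apply: contrapT => nZ.
suff : exists m : R, [/\ 0 < m, m <= 1 & forall a, Z a -> m <= psi a z].
 move=> [m [m0 m1 hm]]; have := hlow zD (ltW m0) m1 hm.
 by rewrite Pz cabs0 leNgt !mulr_gt0 ?expR_gt0.
have [h|[b [Zb bz]]] := near_or_far z.
 exists theta; split => //; (move: d0 d1; lra).
exists (psi b z); split => //; [|by (move: bz d1; lra)|exact: psi_min].
by apply: psi_gt0 => //; [exact: ZD|move=> e; apply: nZ; rewrite -e].
Qed.

(** The zeros are simple: if the cofactor vanished at [b], then [|Psi|] would be [o(|z - b|)] along
    a horizontal approach, contradicting the lower bound by [psi]. *)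
Lemma Psi_factor b : Z b -> exists q, [/\ holo Dk q,
 forall z, Dk z -> Psi z = tz z b * q z & q b != 0].
move=> Zb; have bD := ZD Zb; have [q hq Pq] := holo_div hPsi bD (Psi_Z Zb).
exists q; split => //; apply/eqP => qb.
have [e e0 he] := ccontinuous_eballP (holo_ccontinuous hq bD) (divr_gt0 c10 (ltr0n _ 4)).
have db := dd_gt0 bD; pose t := Num.min (e / 2) (theta / 2 * dd b).
have t0 : 0 < t by rewrite lt_min !divr_gt0 //= mulr_gt0 // !divr_gt0.
pose w : RR := (b.1 + t, b.2).
have wb : toC w - toC b = rC t by apply: ceqP => /=; ring.
have cw : dC w b = t by rewrite wb nc_rC gtr0_norm.
have te : t < e by apply: (@lelt _ _ (e / 2)); [rewrite ge_min lexx|move: e0; lra].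
have tb : t <= theta / 2 * dd b by rewrite ge_min lexx orbT.
have wD : Dk w.
 have h : theta / 2 * dd b <= 1 / 192 * dd b by apply: lerMr; [exact: ltW|move: d1; lra].
 by apply: (@eball_disk b (dd b)) => //; rewrite /eball /= cw; move: tb h db; lra.
have bw : psi b w < theta.
 rewrite psi_sym psiE cw ltr_pdivrMr ?den_gt0 //.
 apply: (lelt tb); apply: (@ltle _ _ (theta * dd b)).
  by rewrite ltr_pM2r //; move: d0; lra.
 by apply: lerMl; [move: d0; lra|exact: den_ge_l].
have m1 : psi b w <= 1 by (move: bw d1; lra).
have := hlow wD (psi_ge0 b w) m1 (psi_min wD Zb bw).
have := he w; rewrite cw qb subr0 => /(_ te) hq1; rewrite Pq // cabsM cw psi_sym psiE cw.
have dn : den b w <= 2 by apply: letr (den_le b w) _; have := disk_cabs wD; have := disk_cabs bD;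
 have := ler_pM (nc_ge0 (toC b)) (nc_ge0 (toC w)) (ltW (disk_cabs bD)) (ltW (disk_cabs wD)); rewrite mulr1; lra.
apply/negP; rewrite -ltNge; apply: (@lelt _ _ (t * (c1 / 4))); first by rewrite ler_pM2l.
apply: (@ltle _ _ (c1 * (t / 2))).
 have key (x y : R) : 0 < x * y -> x * (y / 4) < y * (x / 2) by lra.
 exact: key (mulr_gt0 t0 c10).
apply: letr (ler_peMr _ (expR_ge1 (kZ_ge0 w))); last by rewrite mulr_ge0 ?divr_ge0 ?(ltW c10) ?(ltW t0) ?nc_ge0.
apply: lerMl; first exact: ltW.
by rewrite ler_pM2l // lef_pV2 ?posrE ?den_gt0.
Qed.

(** Away from [Z] the lower bound on [Psi] suffices. Near [b] in [Z] both [Psi] and [G] have a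
    factor [z - b]; the cofactor of [G] is bounded through the surrounding annulus, where sub-mean
    values reduce it to the [L^p] mean of [G] over [nbd b]. These means are summable against the
    weights. *)
Lemma quot_bound : exists2 K : R, 0 < K & forall G (M : R), holo Dk G -> (forall a, Z a -> G a = 0) -> apn G M ->
 exists h, [/\ holo Dk h, forall z, Dk z -> G z = Psi z * h z,
  forall z, Dk z -> ~ Z z -> (cabs (h z) * ek Z z) `^ p <= K / dd z ^+ 2 * M &
  (\int[A]_(z in Dk) ((cabs (h z) * ek Z z) `^ p)%:E <= (K * M)%:E)%E].
have [Ka Ka0 hKa] := annulus_bound; have [Ks Ks0 hKs] := sub_mean hp; have [Kp Kp0 hKp] := apn_point.
(* [K1] serves far from [Z]. In [S] the [64 / delta^2] comes from sub-mean disks of radius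
   [delta/8 (1 - |b|)]; in [K2] the [36 / delta] is [3], from the denominator of [psi], times
   [12 / delta], from [1 / rho]. *)
pose K1 : R := (c1 * theta)^-1; pose S : R := (64 * Ks / delta ^+ 2) `^ p^-1; pose K2 : R := 36 * Ka * S / (c1 * delta).
have t0 : 0 < theta by rewrite divr_gt0.
have K10 : 0 < K1 by rewrite invr_gt0 mulr_gt0.
have S0 : 0 < S by rewrite powR_gt0 // !mulr_gt0 ?invr_gt0 ?exprn_gt0.
have K20 : 0 < K2 by rewrite !mulr_gt0 ?invr_gt0 ?mulr_gt0.
have K1p : 0 <= K1 `^ p by exact: powR_ge0.
have K2p : 0 < K2 `^ p by exact: powR_gt0.
exists (K1 `^ p + K2 `^ p * 16 + K1 `^ p * Kp * 4); first by have := mulr_ge0 K1p (ltW Kp0); move: K1p K2p; lra.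
move=> G M hG GZ aG; have md := @mdisk.
have [h hh Gh] : exists2 h, holo Dk h & forall z, Dk z -> G z = Psi z * h z.
 by apply: holo_quot => // b bD /(Psi_eq0 bD) Zb; split; [exact: GZ|exact: Psi_factor].
exists h; have far z : Dk z -> (forall a, Z a -> theta <= psi a z) -> cabs (h z) * ek Z z <= K1 * cabs (G z).
 move=> zD hz; have := hlow zD (ltW t0) _ hz => /(_ _) hl; rewrite Gh // cabsM mulrCA mulrC.
 have {}hl : c1 * theta * ek Z z <= cabs (Psi z) by apply: hl; move: d1; lra.
 rewrite mulrA; apply: lerMr; first exact: nc_ge0.
 by rewrite ler_pdivlMr ?mulr_gt0 // mulrC.
have F0 z : (0 <= (cabs (G z) `^ p)%:E)%E by rewrite lee_fin powR_ge0.
have mG : mfun DP (fun z => (cabs (G z) `^ p)%:E) by exact: meas_pow.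
have I0 b : (0 <= \int[A]_(z in nbd b) (cabs (G z) `^ p)%:E)%E by exact: integral_ge0.
have IM b : Z b -> (\int[A]_(z in nbd b) (cabs (G z) `^ p)%:E <= M%:E)%E.
 by move=> Zb; apply: letr aG; apply: int_subset => //; exact: sep_eball_disk d0 d1 (ZD Zb).
pose I b : R := fine (\int[A]_(z in nbd b) (cabs (G z) `^ p)%:E)%E.
have IE b : Z b -> ((I b)%:E = \int[A]_(z in nbd b) (cabs (G z) `^ p)%:E)%E.
 by move=> Zb; rewrite fineK // ge0_fin_numE //; apply: lelt (IM b Zb) (ltry _).
have Ige b : 0 <= I b by rewrite fine_ge0.
(* The size of [G] near [b], as an [L^p] mean over [nbd b]. *)
pose X b : R := (I b / dd b ^+ 2) `^ p^-1.
have X0 b : 0 <= X b by exact: powR_ge0.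
have Xp b : X b `^ p = I b / dd b ^+ 2.
 by rewrite /X -powRrM mulVf ?gt_eqF // powRr1 // divr_ge0 ?sqr_ge0.
have near b z : Dk z -> Z b -> psi b z < theta -> z <> b -> cabs (h z) * ek Z z <= K2 * X b.
 move=> zD Zb bz zb; have bD := ZD Zb; have db := dd_gt0 bD; have e0 := expR_gt0 (kZ Z z).
 have [g hg Gg] := holo_div hG bD (GZ _ Zb).
 have m1 : psi b z <= 1 by (move: bz d1; lra).
 have hl := hlow zD (psi_ge0 b z) m1 (psi_min zD Zb bz).
 have zb0 : 0 < dC z b by rewrite nc_gt0 subr_eq0; apply/eqP => /toC_inj.
 have dn0 := den_gt0 bD zD.
 have zbt : dC z b <= 4 * theta * dd b.
  have t12 : 0 < theta < 1 by rewrite t0 /=; move: d1; lra.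
  rewrite psi_sym in bz; apply: letr (psi_dist zD bD t12 bz) _; apply: lerMr; first exact: ltW.
  have t2 : 0 < 1 - theta by rewrite subr_gt0; move: d1; lra.
  have key (t : R) : 0 < t -> t <= 1 / 2 -> 2 * t <= 4 * t * (1 - t) by move=> *; nra.
  by rewrite ler_pdivrMr //; apply: key => //; move: d1; lra.
 (* Matches the threshold [delta / 96]: points with [psi b z] below it satisfy [|z - b| <= rho / 2],
    as [annulus_bound] demands. *)
 pose rho := delta / 12 * dd b; have r0 : 0 < rho by rewrite !mulr_gt0.
 have rb : rho <= dd b / 12 by rewrite /rho (mulrC (dd b)) ler_pM2r //; move: d1; lra.
 have dz : den b z <= 3 * dd b.
  apply: letr (den_le_dist z bD) _; have : 4 * theta * dd b = rho / 2 by rewrite /rho; field.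
  by move: zbt rb db; set x := _ * _ * dd b; lra.
 pose Mb := S * X b / rho.
 have gM w : rho < dC w b < 3 / 2 * rho -> cabs (g w) <= Mb.
  move=> /andP[w1 w2]; have wD : Dk w by apply: (@eball_disk b (dd b)) => //; rewrite /eball /=; move: w2 rb db; lra.
  pose r2 := delta / 8 * dd b; have r20 : 0 < r2 by rewrite !mulr_gt0.
  have er : 2 * r2 = 3 * rho by rewrite /r2 /rho; field.
  have w3 := nc_leB (toC w) (toC b).
  have w4 : nC w + r2 < 1 by move: w3 w2 er rb db; lra.
  have sub : eball w r2 `<=` nbd b.
   move=> v; rewrite /eball /nbd /= => vw; apply: lelt (nc_distD (toC w) _ _) _.
   have -> : delta / 2 * dd b = 6 * rho by rewrite /rho; field.
   by move: vw w2 er r0; rewrite /eball /=; lra.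
  have := hKs G w r2 hG r20 w4; have := int_subset A sub (fun v _ => F0 v).
  rewrite -IE // => h1 h2; have {h2} : ((cabs (G w) `^ p)%:E <= (Ks / r2 ^+ 2)%:E * (I b)%:E)%E.
   by apply: letr h2 (leeMl _ h1); rewrite lee_fin divr_ge0 ?exprn_ge0 ?ltW.
  rewrite -EFinM lee_fin => h2; have {h2} : cabs (G w) <= S * X b.
   rewrite -(powRK p0 (nc_ge0 (G w))) /S /X -powRM ?divr_ge0 ?sqr_ge0 ?mulr_ge0 ?(ltW Ks0) //.
   apply: ler_powR2r; rewrite ?invr_gt0 ?powR_ge0 //; first by rewrite mulr_ge0 ?divr_ge0 ?sqr_ge0 ?mulr_ge0 ?(ltW Ks0).
   apply: letr h2 _; have dn := lt0r_neq0 d0; have an := lt0r_neq0 db.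
   by rewrite /r2 le_eqVlt; apply/orP; left; apply/eqP; move: dn an; generalize (dd b) (I b) => t v dn an; field; rewrite dn an.
  rewrite Gg // cabsM => h2; rewrite /Mb ler_pdivlMr // mulrC; apply: letr h2.
  by apply: lerMr; [exact: nc_ge0|exact: ltW].
 have gz : cabs (g z) <= Ka * Mb.
  have Mb0 : 0 <= Mb by rewrite !mulr_ge0 ?invr_ge0 ?(ltW S0) ?(ltW r0).
  apply: (hKa g b rho Mb z hg r0 Mb0 _ gM); first by (move: rb db; lra).
  by have : 4 * theta * dd b = rho / 2 by [rewrite /rho; field]; move: zbt => /[swap] ->.
 have : c1 * ek Z z * cabs (h z) <= den b z * cabs (g z).
  have : c1 * psi b z * ek Z z * cabs (h z) <= dC z b * cabs (g z).
   by rewrite -cabsM -Gg // Gh // cabsM; apply: lerMr; [exact: nc_ge0|exact: hl].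
  rewrite psi_sym psiE -(ler_pM2r dn0) => h1; rewrite -(ler_pM2l zb0); apply: letr (letr h1 _).
   by apply: eq_ler; field; rewrite gt_eqF.
  by rewrite -mulrA (mulrC (cabs (g z))).
 move=> h1; have h2 := ler_pM (ltW dn0) (nc_ge0 (g z)) dz gz.
 rewrite -(ler_pM2l c10) mulrA mulrAC; apply: letr h1 (letr h2 _).
 have dn := lt0r_neq0 d0; have an := lt0r_neq0 db; have cn := lt0r_neq0 c10.
 rewrite /Mb /K2 /rho le_eqVlt; apply/orP; left; apply/eqP; move: dn an cn; generalize (dd b) (X b) => t v dn an cn.
 by field; rewrite dn an cn.
have ddl b z : Z b -> Dk z -> psi b z < theta -> eball b (1 * dd b) z /\ dd z <= 2 * dd b.
 move=> Zb zD bz; have t5 : theta <= delta / 5 by (move: d0; lra).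
 have db := dd_gt0 (ZD Zb); have := psi_near (ZD Zb) zD (ltle bz t5); rewrite /eball /= => h1.
 have h2 : delta / 2 * dd b <= 1 / 2 * dd b by apply: lerMr; [exact: ltW|move: d1; lra].
 have := nc_leB (toC b) (toC z); rewrite nc_distC => h3; split; first by rewrite mul1r; move: h1 h2 db; lra.
 by move: h1 h2 h3 db; lra.
split => //.
- move=> z zD nZ; have dz := dd_gt0 zD; have dz2 : 0 < dd z ^+ 2 by rewrite exprn_gt0.
 have M0 : 0 <= M by rewrite -lee_fin; apply: letr aG; exact: integral_ge0.
 have Md : 0 <= M / dd z ^+ 2 by rewrite divr_ge0 // ltW.
 suff [h1|h1] : (cabs (h z) * ek Z z) `^ p <= K1 `^ p * Kp * 4 * (M / dd z ^+ 2) \/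
   (cabs (h z) * ek Z z) `^ p <= K2 `^ p * 16 * (M / dd z ^+ 2).
 + rewrite mulrAC -mulrA; apply: letr h1 _; apply: lerMr => //; move: K1p K2p; lra.
 + rewrite mulrAC -mulrA; apply: letr h1 _; apply: lerMr => //; have := mulr_ge0 K1p (ltW Kp0); move: K1p; lra.
 have [hz|[b [Zb bz]]] := near_or_far z; [left|right].
  apply: letr (ler_powR2r p0 _ _ (far z zD hz)) _; rewrite ?mulr_ge0 ?nc_ge0 ?expR_ge0 ?(ltW K10) //.
  rewrite powRM ?nc_ge0 ?(ltW K10) // -!mulrA; apply: lerMl => //.
  have z2 : nC z + dd z / 2 < 1 by (move: dz; lra).
  apply: letr (hKp G M _ z hG aG (divr_gt0 dz (ltr0n _ 2)) z2) _.
  have an := lt0r_neq0 dz; apply: eq_ler; move: an; generalize (dd z) => t an; by field.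
 have zb : z <> b by move=> e; apply: nZ; rewrite e.
 apply: letr (ler_powR2r p0 _ _ (near b z zD Zb bz zb)) _;
  [by rewrite mulr_ge0 ?nc_ge0 ?expR_ge0|exact: mulr_ge0 (ltW K20) (X0 b)|].
 rewrite powRM ?(ltW K20) // Xp -mulrA; apply: lerMl; first exact: ltW.
 have [_ hd] := ddl b z Zb zD bz; have db := dd_gt0 (ZD Zb); have IbM : I b <= M by rewrite -lee_fin IE // IM.
 have e : 16 * (M / dd z ^+ 2) * dd b ^+ 2 = M * (16 * dd b ^+ 2) / dd z ^+ 2 by ring.
 rewrite ler_pdivrMr ?exprn_gt0 // e ler_pdivlMr //; apply: ler_pM => //; first exact: sqr_ge0.
 have : dd z ^+ 2 <= (2 * dd b) ^+ 2 by rewrite ler_sqr ?nnegrE // ?(ltW dz) // mulr_ge0 // ltW.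
 by rewrite exprMn; have := sqr_ge0 (dd b); lra.
(* The factor [4] compares [wgt a] with [(1 - |a|)^2], and the neighbourhoods are disjoint, so the
   masses [I a] add up to at most [M]. *)
have cL s : uniq s -> (forall a, a \in s -> Z a) -> \sum_(a <- s) cabs (rC (X a)) `^ p * wgt a <= 4 * M.
 move=> us sZ; apply: (le_via (\sum_(a <- s) 4 * I a)).
  rewrite big_seq [leRHS]big_seq; apply: ler_sum => a /sZ Za; have da := dd_gt0 (ZD Za).
  rewrite nc_rC ger0_norm // Xp mulrAC ler_pdivrMr ?exprn_gt0 //.
  by rewrite (mulrC 4) -mulrA; apply: lerMl => //; exact: wgt_le (ZD Za).
 rewrite -mulr_sumr ler_pM2l // -lee_fin -sumEFin.
 rewrite big_seq (eq_bigr (fun a => \int[A]_(z in nbd a) (cabs (G z) `^ p)%:E)%E) => [|a /sZ /IE //].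
 by rewrite -big_seq; apply: letr aG; exact: sum_eballs d0 d1 (sep_sub us sZ) mG F0.
have [H [mH H0 HL hH]] := lp_majorant ler01 cL.
have [N [mN N0 ZN]] := Z_negligible.
have mh : mfun DP (fun z => ((cabs (h z) * ek Z z) `^ p)%:E).
 apply/mEFP; have := @cmeas_powR Dk (fun z => h z * rC (ek Z z)) p.
 rewrite (_ : (fun z => cabs (h z * _) `^ p) = fun z => (cabs (h z) * ek Z z) `^ p); last first.
  by apply/funext => z; rewrite cabsM nc_rC gtr0_norm ?expR_gt0.
 apply; apply: cmeasM; first exact: holo_cmeas.
 by apply: cmeas_rC; apply: mcomp => //; exact: meas_kZ.
have mT : mfun DP (fun z => ((K2 `^ p)%:E * H z)%E) by apply: measurable_funeM.
have mT1 : mfun DP (fun z => ((K1 `^ p)%:E * (cabs (G z) `^ p)%:E)%E) by apply: measurable_funeM.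
have T0 z : (0 <= (K2 `^ p)%:E * H z)%E by rewrite mule_ge0 // lee_fin ltW.
have T10 z : (0 <= (K1 `^ p)%:E * (cabs (G z) `^ p)%:E)%E by rewrite mule_ge0 // lee_fin.
rewrite (ge0_negligible_integral mN md mh) //; last by move=> z _; rewrite lee_fin powR_ge0.
apply: (le_via (\int[A]_(z in Dk) ((K1 `^ p)%:E * (cabs (G z) `^ p)%:E + (K2 `^ p)%:E * H z))%E).
 apply: (le_via (\int[A]_(z in Dk `\` N) ((K1 `^ p)%:E * (cabs (G z) `^ p)%:E + (K2 `^ p)%:E * H z))%E); last first.
  by apply: int_subset => [z []//|z _]; rewrite adde_ge0.
 apply: le_int => z [zD zN]; first by rewrite lee_fin powR_ge0.
 have nZ : ~ Z z by move=> /ZN.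
 have [hz|[b [Zb bz]]] := near_or_far z.
  apply: letr (leeDl _ (T0 z)); rewrite -EFinM lee_fin -powRM ?nc_ge0 ?(ltW K10) //.
  by apply: ler_powR2r; rewrite ?mulr_ge0 ?nc_ge0 ?expR_ge0 ?(ltW K10) ?far.
 have zb : z <> b by move=> e; apply: nZ; rewrite e.
 have [bz1 _] := ddl b z Zb zD bz.
 apply: letr (leeDr _ (T10 z)); apply: letr (leeMl _ (hH b z Zb bz1)); last by rewrite lee_fin ltW.
 rewrite -EFinM lee_fin nc_rC ger0_norm // -powRM ?(ltW K20) //.
 apply: (ler_powR2r p0 _ (mulr_ge0 (ltW K20) (X0 b)) (near b z zD Zb bz zb)).
 by rewrite mulr_ge0 ?nc_ge0 ?expR_ge0.
rewrite ge0_integralD // !ge0_integralZl ?lee_fin ?(ltW K2p) //.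
apply: (le_via ((K1 `^ p)%:E * M%:E + (K2 `^ p)%:E * (4 * 1 ^+ 2 * (4 * M))%:E)%E).
 by apply: leeD; apply: leeMl => //; rewrite lee_fin ltW.
have M0 : 0 <= M by rewrite -lee_fin; apply: letr aG; exact: integral_ge0.
rewrite -!EFinM -EFinD lee_fin expr1n; have := mulr_ge0 (mulr_ge0 K1p (ltW Kp0)) M0.
by move: (K1 `^ p) (K2 `^ p) => x y; nra.
Qed.
End PsiQuotient.

(** * Functions concentrated near one point *)

Section TestFunctions.
Implicit Types (a : RR).
Let p0 : 0 < p. by case/andP: hp. Qed.

(** The quotient [(G - 1) / (z - a)] is bounded on an annulus by the norm of [G], hence near [a] by
    [annulus_bound]. The choice of [e] makes [|G - 1| <= 1/16], independently of [a] and [G]. *)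
Lemma half_ball (M : R) : 0 < M -> exists e : R, [/\ 0 < e, e <= 1 / 16 & forall G a, Dk a -> holo Dk G ->
 apn G (M * dd a ^+ 2) -> G a = 1 -> forall z, dC z a <= e * dd a -> 1 / 2 <= cabs (G z)].
move=> M0; have [Ka Ka0 hKa] := annulus_bound; have [Kp Kp0 hKp] := apn_point.
pose B : R := (4 * Kp * M) `^ p^-1; have B0 : 0 <= B by exact: powR_ge0.
pose L : R := Ka * ((B + 1) * 8); have L0 : 0 <= L by rewrite !mulr_ge0 ?addr_ge0 ?(ltW Ka0).
exists (16 * (L + 1))^-1; split; first by rewrite invr_gt0; move: L0; lra.
 by rewrite div1r lef_pV2 ?posrE //; move: L0; lra.
move=> G a aD hG aG Ga z za; have da := dd_gt0 aD.
have e16 : (16 * (L + 1))^-1 * dd a <= dd a / 16.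
 by rewrite mulrC ler_pM2l // lef_pV2 ?posrE //; move: L0; lra.
pose rho := dd a / 8; have r0 : 0 < rho by rewrite divr_gt0.
have hG1 : holo Dk (fun z => G z - 1) by apply: holoB => //; exact: holo_cst.
have [|q hq Gq] := holo_div hG1 aD; first by rewrite Ga subrr.
have qM w : rho < dC w a < 3 / 2 * rho -> cabs (q w) <= (B + 1) / rho.
 move=> /andP[w1 w2]; have wD : Dk w by apply: (@eball_disk a (dd a)) => //; rewrite /eball /=; move: w2 da; rewrite /rho; lra.
 have w3 := nc_leB (toC w) (toC a).
 have w4 : nC w + dd a / 2 < 1 by (move: w3 w2 da; rewrite /rho; lra).
 have := hKp G _ _ w hG aG (divr_gt0 da (ltr0n _ 2)) w4 => h1.
 have GB : cabs (G w) <= B.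
  rewrite -(powRK p0 (nc_ge0 (G w))); apply: ler_powR2r; rewrite ?invr_gt0 ?powR_ge0 ?mulr_ge0 ?(ltW Kp0) ?(ltW M0) //.
  by apply: letr h1 _; apply: eq_ler; field; rewrite gt_eqF.
 have := cabsB (G w) 1; rewrite Gq // cabsM cabs1 => h2.
 rewrite ler_pdivlMr // mulrC; apply: (le_via (B + 1)); last by [].
 apply: letr (letr h2 _); last by rewrite lerD2r.
 by apply: lerMr; [exact: nc_ge0|exact: ltW].
have z8 : dC z a <= rho / 2 by (move: za e16; rewrite /rho; lra).
have zD : Dk z by apply: (@eball_disk a (dd a)) => //; rewrite /eball /=; move: z8 da; rewrite /rho; lra.
have BM : 0 <= (B + 1) / rho by rewrite divr_ge0 ?addr_ge0 ?(ltW r0).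
have ar : nC a + 2 * rho <= 1 by (move: da; rewrite /rho; lra).
have qz := hKa q a rho _ z hq r0 BM ar qM z8.
have := nc_leB 1 (G z); rewrite cabs1 nc_distC Gq // cabsM => h3.
have h4 : dC z a * cabs (q z) <= (16 * (L + 1))^-1 * dd a * (Ka * ((B + 1) / rho)).
 by apply: ler_pM => //; exact: nc_ge0.
have e : (16 * (L + 1))^-1 * dd a * (Ka * ((B + 1) / rho)) = L / (16 * (L + 1)).
 rewrite /rho /L; set L' := 16 * _; rewrite invf_div; have := lt0r_neq0 da; move: L'^-1 => v; generalize (dd a) => t tn; by field.
have h5 : L / (16 * (L + 1)) <= 1 / 16 by rewrite ler_pdivrMr; move: L0; lra.
by move: h3 h4 h5; rewrite e; lra.
Qed.

(** [sfac a] is at most [2] and at most twice [(1 - |a|) / |z - a|]. Once [N p >= 4], the [p]-th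
    power of [sfac^N] decays fast enough for dyadic disks about [a] to sum to a multiple of
    [(1 - |a|)^2]. *)
Lemma int_sfac : exists2 K : R, 0 < K & exists N : nat, forall a, Dk a -> apn (fun z => sfac a z ^+ N) (K * dd a ^+ 2).
pose N := Num.bound (4 / p); have Np : 4 <= N%:R * p.
 by rewrite -ler_pdivrMr // ltW //; apply: archi_boundP; rewrite divr_ge0 // ltW.
exists ((2 `^ (N%:R * p)) * 256); first by apply: mulr_gt0; [exact: powR_gt0|exact: ltr0n].
exists N => a aD; have da := dd_gt0 aD; have md := @mdisk.
(* The disk of radius [2^J (1 - |a|) >= 2] about [a] contains the whole unit disk, so finitely many
   dyadic disks suffice. *)
have [J hJ] : exists J : nat, 2 <= 2 ^+ J * dd a.
 have [J hJ] := half_small (ler0n R 2) da; exists J; by rewrite mulrC -ler_pdivrMr ?exprn_gt0.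
pose t (j : nat) z : R := 16 * (16 ^+ j)^-1 * \1_(eball a (2 ^+ j * dd a)) z.
have t0 j z : 0 <= t j z by rewrite !mulr_ge0 ?invr_ge0 ?exprn_ge0 // indicE ler0n.
have le z : Dk z -> cabs (sfac a z ^+ N) `^ p <= 2 `^ (N%:R * p) * \sum_(j < J.+1) t j z.
 move=> zD; have dn := den_gt0 aD zD; have a1 := sub_sqr_gt0 aD.
 pose x := cabs (sfac a z); have xE : x = (1 - nC a ^+ 2) / den a z.
  by rewrite /x cabsM cabsV nc_rC gtr0_norm.
 have x0 : 0 <= x by exact: nc_ge0.
 have a2 : 1 - nC a ^+ 2 <= 2 * dd a.
  have := disk_cabs aD; have := nc_ge0 (toC a); generalize (nC a) => v; nra.
 have x2 : x <= 2.
  rewrite xE ler_pdivrMr //; apply: letr a2 _; rewrite ler_pM2l //; exact: den_ge_l.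
 have xd : x * dC z a <= 2 * dd a.
  rewrite xE mulrAC ler_pdivrMr //; apply: ler_pM => //; rewrite ?(ltW a1) ?nc_ge0 //.
  rewrite -ler_sqrn ?nc_ge0 // den_sqr lerDl mulr_ge0 ?ltW //; exact: sub_sqr_gt0.
 rewrite cabsX -/x -powR_mulrn // -powRrM -[x in leLHS](@divfK _ 2) // powRM ?divr_ge0 // mulrC; apply: lerMl; first exact: powR_ge0.
 have y1 : x / 2 <= 1 by rewrite ler_pdivrMr // mul1r.
 have y0 : 0 <= x / 2 by rewrite divr_ge0.
 apply: (le_via ((x / 2) ^+ 4)).
  have [->|yn] := eqVneq (x / 2) 0.
   by rewrite powR0 ?exprn_ge0 // gt_eqF // (ltle _ Np).
  have yp : 0 < x / 2 by rewrite lt_neqAle eq_sym yn.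
  by rewrite -powR_mulrn //; apply: ger_powR => //; rewrite yp.
 have ex : exists j : nat, dC z a < 2 ^+ j * dd a.
  exists J; apply: ltle hJ; apply: lelt (cabsB _ _) _.
  by have := disk_cabs aD; have := disk_cabs zD; lra.
 (* In the smallest dyadic disk containing [z] the decay gives [(x / 2)^4 <= 16^-(j-1)], hence the
    factor [16] in [t]. *)
 case: (ex_minnP ex) => j jz jmin; have jJ : (j < J.+1)%N.
  rewrite ltnS; apply: jmin; apply: ltle hJ; apply: lelt (cabsB _ _) _.
  by have := disk_cabs aD; have := disk_cabs zD; lra.
 rewrite (bigD1 (Ordinal jJ)) //=; apply: (le_via (t j z)); last first.
  by rewrite lerDl; apply: sumr_ge0 => i _; exact: t0.
 rewrite /t indicE mem_set // mulr1; case: j jz jmin {jJ} => [|j] jz jmin.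
  by rewrite expr0 invr1 mulr1; apply: (le_via 1); [rewrite exprn_ile1|rewrite ler1n].
 have h : 2 ^+ j * dd a <= dC z a.
  by rewrite leNgt; apply/negP => /jmin; rewrite ltnn.
 have e2 : 0 < 2 ^+ j * dd a by rewrite mulr_gt0 // exprn_gt0.
 have xj : x / 2 <= (2 ^+ j)^-1.
  have := letr (lerMl x0 h) xd; rewrite mulrA ler_pM2r // => h2.
  rewrite -[leRHS]div1r ler_pdivlMr ?exprn_gt0 // mulrAC ler_pdivrMr // mul1r; exact: h2.
 have -> : 16 / 16 ^+ j.+1 = (2 ^+ j)^-1 ^+ 4 :> R.
  by rewrite exprS invfM mulrA divff // mul1r exprVn -exprM mulnC exprM; congr (_ ^+ _)^-1; ring.
 by apply: lerXn2r => //; rewrite nnegrE ?invr_ge0 ?exprn_ge0.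
apply: (le_via (\int[A]_(z in Dk) ((2 `^ (N%:R * p))%:E * \sum_(j < J.+1) (t j z)%:E))%E).
 apply: le_int => z zD; first by rewrite lee_fin powR_ge0.
 by rewrite sumEFin -EFinM lee_fin le.
have mt j : mfun DP (fun z => (t j z)%:E).
 by apply/mEFP; apply: mfunM => //; apply: measurable_indic; exact: (@meball).
rewrite ge0_integralZl //; [|by apply: emeasurable_sum => j; exact: mt|by move=> z _; apply: sume_ge0 => j _; rewrite lee_fin].
rewrite -mulrA EFinM; apply: leeMl; first by rewrite lee_fin powR_ge0.
rewrite ge0_integral_sum //; last by move=> j z _; rewrite lee_fin.
apply: (le_via (\sum_(j < J.+1) (128 * dd a ^+ 2 * (2^-1 ^+ j.+1))%:E)%E).
 apply: lee_sum => j _; under eq_integral do rewrite EFinM.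
 have c0 : 0 <= 16 * (16 ^+ j)^-1 :> R by rewrite mulr_ge0 // invr_ge0 exprn_ge0.
 have me : measurable (eball a (2 ^+ j * dd a) : set PT) by exact: (@meball).
 rewrite ge0_integralZl //; [|by apply/mEFP; apply: measurable_indic].
 rewrite integral_indic //.
 have h4 : (A (eball a (2 ^+ j * dd a) `&` Dk) <= (4 * (2 ^+ j * dd a) ^+ 2)%:E)%E.
  apply: letr (area_eball_le a _); last by rewrite mulr_ge0 ?exprn_ge0 // ltW.
  by apply: le_measure; rewrite ?inE; [exact: measurableI| |exact: subIsetl].
 apply: letr (leeMl _ h4) _; first by rewrite lee_fin.
 rewrite -EFinM lee_fin.
 have e1 : 16 ^+ j = (2 ^+ j) ^+ 4 :> R by rewrite -exprM mulnC exprM; congr (_ ^+ _); ring.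
 have j1 : 1 <= 2 ^+ j :> R by rewrite exprn_ege1 // ler1n.
 have key (v y : R) : 1 <= v -> 16 / v ^+ 4 * (4 * (v * y) ^+ 2) <= 128 * y ^+ 2 / (2 * v).
  move=> v1; have vn : v != 0 by rewrite gt_eqF // (ltle _ v1).
  have -> : 16 / v ^+ 4 * (4 * (v * y) ^+ 2) = 64 * y ^+ 2 / v / v by field.
  have -> : 128 * y ^+ 2 / (2 * v) = 64 * y ^+ 2 / v by field.
  rewrite ler_pdivrMr ?(ltle _ v1) //; apply: ler_peMr => //.
  by apply: divr_ge0; [rewrite mulr_ge0 ?sqr_ge0|exact: letr ler01 v1].
 by rewrite e1 exprVn [2 ^+ j.+1]exprS; exact: key.
rewrite sumEFin -mulr_sumr lee_fin (mulrC 256) -mulrA mulrCA; apply: lerMl; first exact: sqr_ge0.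
suff : \sum_(j < J.+1) 2^-1 ^+ j.+1 <= 1 :> R by lra.
have -> : \sum_(j < J.+1) 2^-1 ^+ j.+1 = 1 - 2^-1 ^+ J.+1 :> R.
 elim: (J.+1) => [|n IH]; first by rewrite big_ord0 expr0 subrr.
 by rewrite big_ord_recr /= IH exprS; field.
by rewrite gerBl exprn_ge0 // invr_ge0.
Qed.
End TestFunctions.

(** * Functions concentrated at grid points, with weighted bounds *)

Section BasisFunctions.
Implicit Types (h c : RR -> C) (a : RR) (K x y t : R).
Hypothesis hI : interpolating p Z.

(** All bounds scale like [(1 - |a|)^2], the area of a cell at [a]. The lower bound, on a disk of
    relative radius [e], permits division by [h] there. *)
Definition bumplike (K e c : R) a h := [/\ holo Dk h,
 forall z, Dk z -> ~ Z z -> (cabs (h z) * ek Z z) `^ p <= K * dd a ^+ 2 / dd z ^+ 2,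
 (\int[A]_(z in Dk) ((cabs (h z) * ek Z z) `^ p)%:E <= (K * dd a ^+ 2)%:E)%E &
 forall z, Dk z -> ~ Z z -> dC z a <= e * dd a -> c <= cabs (h z) * ek Z z].

Lemma holo_mob a : Dk a -> holo Dk (fun z => (tz z a) / (1 - conjc (toC a) * toC z)).
by move=> aD; apply: holoM; [apply: holoB; [exact: holo_toC|exact: holo_cst]|exact: holo_den]. Qed.

(** In both cases one builds [G] vanishing on [Z], of norm [O((1 - |a|)^2)] and not small near [a],
    and takes [h = G / Psi]. For [a] in [Z] the zero of [G] at [a] is matched by the factor [psi] in
    the upper bound of [Psi]; for [a] far from [Z] the bound by [exp kZ] alone is enough. *)
Lemma basis_functions (r0 : R) : 0 < r0 -> exists2 c : R, 0 < c & exists2 e, 0 < e <= r0 & exists2 K, 0 < K &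
 (forall a, Z a -> exists h, bumplike K e c a h) /\
 exists2 e', 0 < e' <= r0 & exists2 K', 0 < K' & forall a, Dk a -> (forall b, Z b -> e * dd b <= dC a b) ->
  exists h, bumplike K' e' c a h.
move=> r00; have [Psi [C1 [c1 [C10 c10 hPsi hup [hupa hlow]]]]] := psi_product.
have [Kq Kq0 hq] := quot_bound c10 hPsi hupa hlow.
have [M M0 hM] := open_mapping hI.
exists (1 / 2 / C1); first by rewrite !divr_gt0.
have M4 : 0 < M * 4 by rewrite mulr_gt0.
have shrink x y t : x <= Num.min y r0 * t -> 0 < t -> x <= y * t.
 by move=> h t0; apply: letr h _; rewrite ler_pM2r // ge_min lexx.
have [eA [e10 e16 he]] := half_ball M4; pose e := Num.min eA r0.
have e0 : 0 < e by rewrite lt_min e10.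
have {e16} e16 : e <= 1 / 16 by rewrite ge_min e16.
exists e; first by rewrite e0 ge_min lexx orbT.
exists (Kq * (M * 4)); first by rewrite mulr_gt0.
split=> [a Za|].
 have aD := ZD Za; have da := dd_gt0 aD; pose c b : C := if b == a then 1 else 0.
 have lc : lpn c (4 * dd a ^+ 2).
  move=> s us sZ; apply: (le_via (wgt a)); last exact: wgt_le.
  have [sa|sa] := boolP (a \in s).
   rewrite (bigD1_seq a) //= /c eqxx cabs1 powR1 mul1r big1 ?addr0 // => b /negbTE ->.
   by rewrite cabs0 powR0 ?mul0r // gt_eqF //; case/andP: hp.
  rewrite big_seq big1 ?wgt_ge0 // => b sb; rewrite /c; have [e1|_] := eqVneq b a; first by rewrite -e1 sb in sa.
  by rewrite cabs0 powR0 ?mul0r // gt_eqF //; case/andP: hp.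
 have [|f [hf af fc]] := hM c _ _ lc; first by rewrite mulr_gt0 // exprn_gt0.
 (* [f] interpolates the indicator of [a]; the Blaschke factor kills its one non-zero value on [Z]
    without increasing the norm. *)
 rewrite mulrA in af; pose G z := f z * (tz z a / (1 - conjc (toC a) * toC z)).
 have cG z : cabs (G z) = cabs (f z) * psi a z by rewrite psi_sym cabsM.
 have hG : holo Dk G by apply: holoM => //; exact: holo_mob.
 have GZ b : Z b -> G b = 0.
  move=> Zb; rewrite /G fc // /c; case: eqP => [->|_]; last by rewrite mul0r.
  by rewrite subrr mul0r mulr0.
 have aG : apn G (M * 4 * dd a ^+ 2).
  have := @apnM f G 1 _ ler01 hf _ af; rewrite powR1 mul1r; apply=> z zD.
  by rewrite mul1r cG; apply: ler_piMr; [exact: nc_ge0|exact: ltW (psi_lt1 aD zD)].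
 have [h [hh Gh hb hi]] := hq G _ hG GZ aG; exists h; split => //.
 - by move=> z zD nZ; apply: letr (hb z zD nZ) _; apply: eq_ler; ring.
 - by move: hi; rewrite mulrA.
 - move=> z zD nZ za; have az : a <> z by move=> e1; apply: nZ; rewrite -e1.
  have pz := psi_gt0 aD zD az.
  have fz : 1 / 2 <= cabs (f z) by apply: (he f a aD hf af) (shrink _ _ _ za da); rewrite fc // /c eqxx.
  rewrite ler_pdivrMr //; apply: (letr fz).
  rewrite -(ler_pM2r pz) -cG Gh // cabsM mulrAC.
  apply: letr (lerMr (nc_ge0 _) (hupa a z Za zD)) _; apply: eq_ler; ring.
have [Ks Ks0 [N hN]] := int_sfac; have [Kl Kl0 hl] := lp_le_Ap.
(* Norm of the starting power plus that of its correction; [3 / e] is the cost of dividing by a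
   Blaschke factor which is at least [e / 3] on [Z]. *)
pose M2 : R := Ks + M * ((3 / e) `^ p * (Kl * Ks)).
have e3 : 0 < 3 / e by rewrite divr_gt0.
have ep : 0 < (3 / e) `^ p by exact: powR_gt0.
have M20 : 0 < M2 by rewrite addr_gt0 // !mulr_gt0.
have [e2 [e20 _ he']] := half_ball M20.
exists (Num.min e2 r0); first by rewrite lt_min e20 r00 ge_min lexx orbT.
exists (Kq * M2); first by rewrite mulr_gt0.
move=> a aD far; have da := dd_gt0 aD.
pose f0 z := sfac a z ^+ N; pose phi z := tz z a / (1 - conjc (toC a) * toC z).
have hf0 : holo Dk f0.
 by apply: holoX; apply: holoM; [exact: holo_cst|exact: holo_den].
have a0 : apn f0 (Ks * dd a ^+ 2) by exact: hN.
have l0 : lpn f0 (Kl * (Ks * dd a ^+ 2)).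
 move=> s us sZ; rewrite -lee_fin; apply: letr (hl f0 s hf0 us sZ) _; rewrite EFinM.
 by apply: leeMl => //; rewrite lee_fin ltW.
have phiE z : cabs (phi z) = psi z a by [].
have psib b : Z b -> e / 3 <= psi b a.
 move=> Zb; have bD := ZD Zb; rewrite psi_sym psiE ler_pdivlMr ?den_gt0 //.
 have key x y t : e * t <= e * (2 * y + x) -> e * y <= x -> e * x <= x -> e / 3 * t <= x by lra.
 apply: key (lerMl (ltW e0) (den_le_dist a bD)) (far b Zb) _.
 by apply: ler_piMl; [exact: nc_ge0|move: e16; lra].
have phin b : Z b -> phi b != 0.
 by move=> Zb; rewrite -nc_gt0 phiE; apply: ltle (psib b Zb); rewrite divr_gt0.
have lc : lpn (fun b => f0 b / phi b) ((3 / e) `^ p * (Kl * (Ks * dd a ^+ 2))).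
 have := lpnZ (rC (3 / e)) l0; rewrite nc_rC gtr0_norm //; apply: lpn_le => // b Zb.
 rewrite !cabsM nc_rC gtr0_norm // cabsV mulrC; apply: lerMr; first exact: nc_ge0.
 by rewrite phiE -invf_div lef_pV2 ?posrE ?psib ?divr_gt0 // (ltle _ (psib b Zb)) // divr_gt0.
have [|H [hH aH Hc]] := hM _ _ _ lc; first by rewrite !mulr_gt0 // exprn_gt0.
(* [H] interpolates [f0 / phi] on [Z], so [G] vanishes there, while [phi a = 0] leaves
   [G a = f0 a = 1]. *)
pose G z := f0 z - phi z * H z.
have hphi : holo Dk phi by exact: holo_mob.
have hpH : holo Dk (fun z => phi z * H z) by exact: holoM.
have hG : holo Dk G by exact: holoB.
have GZ b : Z b -> G b = 0 by move=> Zb; rewrite /G Hc // mulrC divfK ?phin // subrr.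
have aG : apn G (M2 * dd a ^+ 2).
 have := @apnM H (fun z => phi z * H z) 1 _ ler01 hH _ aH; rewrite powR1 mul1r => aH'.
 have {}aH' : apn (fun z => phi z * H z) (M * ((3 / e) `^ p * (Kl * (Ks * dd a ^+ 2)))).
  apply: aH' => z zD; rewrite mul1r cabsM phiE; apply: ler_piMl; [exact: nc_ge0|exact: ltW (psi_lt1 zD aD)].
 have := (apnD hf0 hpH a0 aH').2; rewrite (_ : _ + _ = M2 * dd a ^+ 2) //.
 by rewrite /M2; ring.
have Ga : G a = 1.
 rewrite /G /phi subrr mul0r mul0r subr0 /f0 /sfac (mulrC (conjc _)) mulJ rCD rCN rC1 divff ?expr1n //.
 by rewrite -rC1 -rCN -rCD rC_eq0 gt_eqF // sub_sqr_gt0.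
have [h [hh Gh hb hi]] := hq G _ hG GZ aG; exists h; split => //.
- by move=> z zD nZ; apply: letr (hb z zD nZ) _; apply: eq_ler; ring.
- by move: hi; rewrite mulrA.
- move=> z zD nZ za; have Gz := he' G a aD hG aG Ga z (shrink _ _ _ za da).
 rewrite ler_pdivrMr //; apply: (letr Gz); rewrite Gh // cabsM.
 apply: letr (lerMr (nc_ge0 _) (hup z zD)) _; apply: eq_ler; ring.
Qed.
End BasisFunctions.

(** * Tonelli, subadditivity of [p]-th powers, and the Cauchy transform *)

Section Tools.
Implicit Types (phi : RR -> C) (D : set PT).
Let p0 : 0 < p. by case/andP: hp. Qed.

Lemma ctonelli D1 D2 (f : PP -> R) : measurable D1 -> measurable D2 ->
 mfun (D1 `*` D2) f -> (forall v, 0 <= f v) ->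
 mfun D1 (fun x => \int[A]_(y in D2) (f (x, y))%:E)%E /\
 (\int[A]_(x in D1) \int[A]_(y in D2) (f (x, y))%:E = \int[A]_(y in D2) \int[A]_(x in D1) (f (x, y))%:E)%E.
move=> mD1 mD2 mf f0.
set g : PP -> \bar R := EFin \o (f \_ (D1 `*` D2)).
have mg : mfun setT g.
 by apply/mEFP; apply/(measurable_restrictT _ (measurableX mD1 mD2)).
have g0 v : (0 <= g v)%E by rewrite /g /= lee_fin patchE; case: ifP.
have [gE gF gG] := fubini_restrict D1 D2 f; rewrite -/g in gE gF gG.
split.
 have := @measurable_fun_fubini_tonelli_F _ _ PT PT R (@areaS) g mg g0.
 rewrite (_ : fubini_F _ g = (fun x => \int[A]_(y in D2) (f (x, y))%:E)%E \_ D1); last by apply/funext => x; exact: gF.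
 by move/(measurable_restrictT _ mD1).
rewrite [LHS]integral_mkcond [RHS]integral_mkcond.
transitivity (\int[A]_x \int[A]_y g (x, y))%E; first by apply: eq_integral => x _; rewrite gF.
transitivity (\int[A]_y \int[A]_x g (x, y))%E; last by apply: eq_integral => y _; rewrite gG.
exact: (@fubini_tonelli _ _ PT PT R (@areaS) (@areaS) g mg g0).
Qed.

Lemma poweR_subadd (x y : \bar R) : (0 <= x)%E -> (0 <= y)%E -> ((x + y) `^ p <= x `^ p + y `^ p)%E.
case: x y => [x| |] [y| |] //= x0 y0; rewrite ?gt_eqF ?leey //.
by rewrite -EFinD lee_fin powR_subadd.
Qed.

(** Countable subadditivity of the [p]-th power; finite sums are compared after undoing the power,
    where the limit is a supremum. *)
Lemma nneseries_poweR (x : nat -> \bar R) : (forall n, (0 <= x n)%E) ->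
 ((\sum_(0 <= n <oo) x n) `^ p <= \sum_(0 <= n <oo) (x n `^ p))%E.
move=> x0; set W := (\sum_(0 <= n <oo) _ `^ _)%E.
have W0 : (0 <= W)%E by apply: nneseries_ge0 => n _ _; exact: poweR_ge0.
have part m : (((\sum_(0 <= n < m) x n) `^ p) <= \sum_(0 <= n < m) (x n `^ p))%E.
 elim: m => [|m IH]; first by rewrite !big_geq // poweR_EFin powR0 ?gt_eqF.
 rewrite !big_nat_recr //=; apply: letr (poweR_subadd _ _) _ => //; first by apply: sume_ge0 => n _.
 exact: leeD2r.
have -> : W = ((W `^ p^-1) `^ p)%E by rewrite -poweRrM mulVf ?gt_eqF // poweRe1.
apply: ler_poweR; [exact: ltW|exact: nneseries_ge0|].
apply: lime_le; first by apply: is_cvg_nneseries => n _ _.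
apply: nearW => m; have h : (0 <= \sum_(0 <= n < m) x n)%E by apply: sume_ge0 => n _.
have -> : (\sum_(0 <= n < m) x n = ((\sum_(0 <= n < m) x n) `^ p) `^ p^-1)%E.
 by rewrite -poweRrM divff ?gt_eqF // poweRe1.
apply: ler_poweR; [by rewrite invr_ge0 ltW|exact: poweR_ge0|].
by apply: letr (part m) _; apply: nneseries_lim_ge => n _ _; exact: poweR_ge0.
Qed.

(** Linearizes a [p]-th power at level [t]: below [t] the first term dominates, above it the second.
    The linear term can then be integrated by Tonelli. *)
Lemma poweR_young (y : \bar R) (t : R) : 0 < t -> (0 <= y)%E -> (y `^ p <= (t `^ p)%:E + (t `^ (p - 1))%:E * y)%E.
have /andP[_ p1] := hp; move=> t0; case: y => [y| |] //=; rewrite ?gt_eqF //; last first.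
 by move=> _; rewrite mulry gtr0_sg ?mul1e ?addey ?leey // powR_gt0.
rewrite lee_fin => y0; rewrite -EFinM -EFinD lee_fin.
have [yt|ty] := leP y t.
 by apply: letr (ler_powR2r p0 y0 (ltW t0) yt) _; rewrite lerDl mulr_ge0 ?powR_ge0.
have yp : 0 < y by exact: lt_trans ty.
apply: (le_via (t `^ (p - 1) * y)); last by rewrite lerDr powR_ge0.
have -> : y `^ p = y `^ (p - 1) * y.
 have e : p = p - 1 + 1 by rewrite subrK.
 by rewrite {1}e powRD ?(gt_eqF yp) ?implybT // powRr1.
apply: lerMr => //; rewrite -opprB !powRN lef_pV2 ?posrE ?powR_gt0 //.
by apply: ler_powR2r; rewrite ?subr_gt0 ?ltW.
Qed.

(** The fundamental solution of dbar. Replacing [1 / (z - w)] by the smoothed pole at scale [s]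
    costs [O(s)], and for that pole the identity is [weak_pole] for the constant [1], up to the
    averaging error of [pmass_avg]. *)
Lemma dbar_pole phi w : ctest phi -> Dk w ->
 L1D (fun z => cdbar phi z / tz z w) /\
 ID (fun z => cdbar phi z / tz z w) = - (rC (kappa) * phi w).
move=> tp wD; have md := @mdisk; have [sp _] := tp.
have [sb [r [r1 b0]]] := ctest_cdbar tp.
have [B B0 hB0] := ccontinuous_bounded (fun z (_ : nC z <= r) => csmooth_ccontinuous z sb).
have hB z : cabs (cdbar phi z) <= B.
 by have [/hB0//|/ltW/b0 ->] := leP (nC z) r; rewrite cabs0 ltW.
have near (s : R) g : 0 < s -> cmeas DP g ->
  (forall z, cabs (g z) <= B * (dC z w)^-1) -> (forall z, Dk z -> ~ eball w s z -> g z = 0) ->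
  (\int[A]_(z in Dk) (cabs (g z))%:E <= (B * (16 * s))%:E)%E.
 move=> s0 mg gB g0; apply: (le_via (\int[A]_(z in eball w s) (B%:E * ((dC z w)^-1)%:E))%E).
  rewrite integral_mkcond [leRHS]integral_mkcond; apply: le_int => z _.
   by rewrite patchE; case: ifP => _; rewrite // lee_fin nc_ge0.
  rewrite !patchE; case: ifPn => [zD|_]; last by case: ifPn => // _; rewrite -EFinM lee_fin mulr_ge0 ?invr_ge0 ?nc_ge0 ?(ltW B0).
  case: ifPn => [_|ze]; first by rewrite -EFinM lee_fin.
  by rewrite g0 ?cabs0 //; [rewrite inE in zD|move=> h; rewrite mem_set in ze].
 have me := @meball w s.
 rewrite ge0_integralZl //; first by rewrite EFinM; apply: leeMl; [rewrite lee_fin ltW|exact: integral_inv_dist].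
 - apply/mEFP; apply: meas_fun_inv => [z _|]; [exact: nc_ge0|].
  by apply: cmeas_cabs; exact: cmeas_toCB.
 - by move=> z _; rewrite lee_fin invr_ge0 nc_ge0.
 - by rewrite lee_fin ltW.
have mb : cmeas DP (cdbar phi) by exact: csmooth_cmeas.
have mi : cmeas DP (fun z => (tz z w)^-1) by apply: cmeasV; exact: cmeas_toCB.
have i1 : L1D (fun z => cdbar phi z / tz z w).
 apply/cL1P => //; split; first exact: cmeasM.
 apply: lelt (near 2 _ _ _ _ _) (ltry _) => //; first exact: cmeasM.
  by move=> z; rewrite cabsM cabsV; apply: lerMr; rewrite ?invr_ge0 ?nc_ge0 ?hB.
 move=> z zD; case; apply: lelt (cabsB _ _) _; have := disk_cabs zD; have := disk_cabs wD; lra.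
split=> //; apply/eqP; rewrite -subr_eq0 opprK; apply/eqP.
apply: (@nc_small _ (32 * B + 2 * kappa)) => [|eps e0].
 by rewrite addr_ge0 ?mulr_ge0 ?ltW ?kappa_gt0.
have [d dp hd] := ccontinuous_eballP (csmooth_ccontinuous w sp) e0.
have w1 : 0 < dd w by exact: dd_gt0.
pose s := Num.min eps (Num.min d (dd w / 4)).
have s0 : 0 < s by rewrite !lt_min e0 dp divr_gt0.
have [s1 s2 s3] : [/\ s <= eps, s <= d & s <= dd w / 4] by rewrite /s !ge_min !lexx !orbT.
have ss : 0 < s ^+ 2 by rewrite exprn_gt0.
have s16 : 16 * s ^+ 2 <= dd w ^+ 2.
 have -> : dd w ^+ 2 = 16 * (dd w / 4) ^+ 2 by field.
 by rewrite ler_pM2l // ler_sqr ?nnegrE ?(ltW s0) //; exact: divr_ge0 (ltW w1) _.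
have one : weakhol (fun _ : RR => 1 : C) by apply: holo_weak; exact: holo_cst.
have wp := weak_pole w one tp ss.
have lp : locint phi by apply: ccontinuous_locint => z _; exact: csmooth_ccontinuous.
have ctr : forall z, dC z w ^+ 2 < s ^+ 2 -> cabs (phi z - phi w) <= eps.
 move=> z h; apply: hd; apply: ltle s2; move: h; rewrite ltr_pXn2r ?nnegrE ?nc_ge0 ?ltW //.
have avg := pmass_avg lp wD ss s16 (ltW e0) ctr.
have ip : L1D (fun z => 1 * (cdbar phi z * pole w (s ^+ 2) z)).
 by apply: locint_ctest; [case: one|apply: ctestM; [exact: ctest_cdbar|exact: csmooth_pole]].
pose T := ID (fun z => 1 * (cdbar phi z * pole w (s ^+ 2) z)).
(* The two kernels differ only within distance [s] of [w], where the integral of [1 / |z - w|] is at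
   most [16 s]. *)
have diff : cabs (ID (fun z => cdbar phi z / tz z w) - T) <= 32 * B * eps.
 rewrite -cintegB // -lee_fin; apply: letr (cinteg_bound md (cL1B md i1 ip)) _.
 have mg := cL1_meas md (cL1B md i1 ip).
 apply: letr (leeMl _ (near s _ s0 mg _ _)) _ => //.
 - move=> z; rewrite mul1r -mulrBr poleE // -{1}[(tz z w)^-1]mul1r -mulrBl -rC1 -rCN -rCD mulrA !cabsM cabsV nc_rC.
  apply: lerMr; first by rewrite invr_ge0 nc_ge0.
  rewrite -[leRHS]mulr1; apply: ler_pM; rewrite ?nc_ge0 ?hB //.
  by rewrite ger0_norm ?subr_ge0 ?step_le1 // gerBl step_ge0.
 - move=> z _ /negP; rewrite -leNgt => zs; rewrite mul1r pole_far ?subrr //.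
  by rewrite ler_sqr ?nnegrE ?nc_ge0 // ltW.
 - rewrite -EFinM lee_fin; have := lerMl (ltW B0) s1; lra.
have TE : ID (fun z => phi z * rC (pmass w (s ^+ 2) z)) = - T.
 by rewrite -wp; apply: eq_cinteg => z _; rewrite mul1r.
rewrite TE in avg; set I0 := cinteg _ _ in diff *; have -> : I0 + rC (kappa) * phi w = (I0 - T) + - (- T - rC (kappa) * phi w).
 by rewrite opprD !opprK addrA subrK.
apply: letr (cabsD _ _) _; rewrite cabsN; move: diff avg; lra.
Qed.
End Tools.

(** * A separated grid containing [Z] and a partition into cells *)

Section Grid.
Implicit Types (a : RR) (X : set RR) (t K : R).
Hypothesis hI : interpolating p Z.

Lemma far_psi e a b : 0 < e <= 1 -> Dk a -> Dk b -> e * dd b <= dC a b -> e / 3 <= psi b a.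
move=> /andP[e0 e1] aD bD far; rewrite psi_sym psiE ler_pdivlMr ?den_gt0 //.
have key (x y t : R) : e * t <= e * (2 * y + x) -> e * y <= x -> e * x <= x -> e / 3 * t <= x by lra.
by apply: key (lerMl (ltW e0) (den_le_dist a bD)) far _; apply: ler_piMl; rewrite ?nc_ge0.
Qed.

(** A maximal separated set among the points far from [Z]. Maximality makes it a net: [psi < e'/4]
    implies a Euclidean distance at most [e' (1 - |a|)]. *)
Lemma maximal_far e e' : 0 < e' <= 1 -> exists X,
 [/\ forall a, X a -> Dk a /\ forall b, Z b -> e * dd b <= dC a b,
   forall a b, X a -> X b -> a <> b -> e' / 4 <= psi a b &
   forall z, Dk z -> (forall b, Z b -> e * dd b <= dC z b) ->
    exists2 a, X a & dC z a <= e' * dd a].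
move=> /andP[e'0 e'1]; pose far z := Dk z /\ forall b, Z b -> e * dd b <= dC z b.
pose P X := X `<=` far /\ forall a b, X a -> X b -> a <> b -> e' / 4 <= psi a b.
have [|X [[Xf Xs] Xmax]] := @Zorn_bigcup _ P.
 move=> F FP tot; split=> [a [X FX Xa]|a b [X FX Xa] [Y FY Yb]]; first by have [h _] := FP X FX; exact: h.
 have [h|h] := tot X Y FX FY; first by have [_ hY] := FP Y FY; exact: hY (h _ Xa) Yb.
 by have [_ hX] := FP X FX; exact: hX Xa (h _ Yb).
exists X; split => // z zD zfar; have [Xz|nX] := pselect (X z).
 by exists z => //; rewrite subrr cabs0 mulr_ge0 ?(ltW e'0) ?(ltW (dd_gt0 zD)).
apply: contrapT => no; apply: (Xmax (X `|` [set z])).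
 by split=> [a Xa|h]; [left|apply: nX; apply: h; right].
have zX a : X a -> e' / 4 <= psi z a.
 move=> Xa; rewrite leNgt; apply/negP => lt; apply: no; exists a => //; have [aD _] := Xf a Xa.
 have e4 : 0 < e' / 4 < 1 by apply/andP; split; move: e'0 e'1; lra.
 apply: letr (psi_dist zD aD e4 lt) _; apply: lerMr; first exact: ltW (dd_gt0 aD).
 have key t : 0 < t -> t <= 1 -> 2 * (t / 4) <= t * (1 - t / 4) by move=> *; nra.
 rewrite ler_pdivrMr; [exact: key|move: e'1; lra].
split=> [a [/Xf//|->]//|a b [Xa|->] [Xb|->]//]; [exact: Xs|by rewrite psi_sym => _; exact: zX|by move=> _; exact: zX].
Qed.

(** The grid is [Z] together with a maximal separated set of points far from it, each with its own
    relative radius. The balls cover the disk, and disjointification turns them into cells. A null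
    set containing [Z] is removed so that every cell enjoys the bounds claimed off [Z]. *)
Lemma grid (r0 : R) : 0 < r0 -> r0 <= 1 -> exists (c K eta : R) (lam : nat -> RR) (An : nat -> set PT)
  (h : nat -> RR -> C) N,
 [/\ [/\ 0 < c, 0 < K, 0 < eta & eta <= 1], [/\ measurable N, A N = 0%E & Z `<=` N],
  [/\ forall n, Dk (lam n), forall n, measurable (An n), trivIset setT An & \bigcup_n An n = Dk `\` N],
  (forall n m, An n !=set0 -> An m !=set0 -> n <> m -> eta <= psi (lam n) (lam m)) &
  [/\ forall n, bumplike K 0 c (lam n) (h n),
  forall n w, An n w -> dC w (lam n) <= r0 * dd (lam n) &
  forall n w, An n w -> c <= cabs (h n w) * ek Z w]].
move=> r00 r01; have [c c0 [e /andP[e0 er] [K K0 [near [e' /andP[e'0 e'r] [K' K'0 far]]]]]] := basis_functions hI r00.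
have e1 : 0 < e <= 1 by rewrite e0 (letr er).
have e'1 : 0 < e' <= 1 by rewrite e'0 (letr e'r).
have [X [Xf Xs Xmax]] := maximal_far e e'1.
pose L := Z `|` X; pose rad a := if pselect (Z a) then e else e'.
have LD a : L a -> Dk a by case=> [/ZD|/Xf[]].
have radr a : 0 < rad a <= r0 by rewrite /rad; case: (pselect (Z a)) => /= _; rewrite ?e0 ?e'0.
pose eta := Num.min delta (Num.min (e / 3) (e' / 4)).
have eta0 : 0 < eta by rewrite !lt_min d0 !divr_gt0.
have [eta1 eta2 eta3] : [/\ eta <= delta, eta <= e / 3 & eta <= e' / 4] by rewrite /eta !ge_min !lexx !orbT.
have Lsep a b : L a -> L b -> a <> b -> eta <= psi a b.
 have mix a' b' : Z a' -> X b' -> eta <= psi a' b'.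
  move=> Za /Xf [bD bf]; apply: (letr eta2); exact: far_psi e1 bD (ZD Za) (bf _ Za).
 move=> [Za|Xa] [Zb|Xb] ab; [exact: letr eta1 (Zsep Za Zb ab)|exact: mix|by rewrite psi_sym; exact: mix|exact: letr eta3 (Xs _ _ Xa Xb ab)].
have cover z : Dk z -> exists2 a, L a & dC z a <= rad a * dd a.
 move=> zD; have [hz|/existsNP[b /not_implyP[Zb /negP]]] := pselect (forall b, Z b -> e * dd b <= dC z b).
  have [a Xa za] := Xmax z zD hz; have [Za|nZ] := pselect (Z a).
   exists a; [by left|]; have := hz a Za; have [_ /(_ a Za)] := Xf a Xa.
   by rewrite subrr cabs0 => h; exfalso; have := mulr_gt0 e0 (dd_gt0 (ZD Za)); move: h; lra.
  by exists a; [right|rewrite /rad; case: (pselect (Z a))].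
 by rewrite -ltNge => zb; exists b; [left|rewrite /rad; case: (pselect (Z b)) => //= _; exact: ltW].
have hex a : exists h, L a -> bumplike (K + K') (rad a) c a h.
 have wid K1 e1' h : K1 <= K + K' -> bumplike K1 e1' c a h -> L a -> bumplike (K + K') e1' c a h.
  move=> KK [h1 h2 h3 h4] La; split => //.
   move=> z zD nZ; apply: letr (h2 z zD nZ) _; apply: lerMr; first by rewrite invr_ge0 sqr_ge0.
   by apply: lerMr; rewrite ?sqr_ge0.
  by apply: letr h3 _; rewrite lee_fin; apply: lerMr; rewrite ?sqr_ge0.
 rewrite /rad; have [La|] := pselect (L a); last by exists (fun _ => 0).
 case: (pselect (Z a)) => /= [Za|nZ].
  by have [h hh] := near a Za; exists h; apply: wid hh; rewrite lerDl ltW.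
 have [aD af] : Dk a /\ forall b, Z b -> e * dd b <= dC a b by case: La => // /Xf.
 by have [h hh] := far a aD af; exists h; apply: wid hh; rewrite lerDr ltW.
have [hh hhP] := choice hex.
(* The enumeration of the grid by natural numbers may repeat points. *)
have [lam lamL lamS] : exists2 lam : nat -> RR, (forall n, L (lam n)) & forall a, L a -> exists n, lam n = a.
 have /pfcard_geP[L0|[f]] := sep_countable eta0 LD Lsep.
  have [|a] := cover (0, 0); last by rewrite L0.
  by change (cabs (toC (0, 0) : C) < 1); rewrite toC00 cabs0.
 exists f => [n|a La]; first by apply: (@funS _ _ setT L f).
 by have [n _ fn] := (@surj _ _ setT L f) a La; exists n.
have [N [mN N0 ZN]] := Z_negligible.
have md := @mdisk.
pose cball a : set PT := [set w | dC w a <= rad a * dd a].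
have mc a : measurable (cball a).
 rewrite (_ : cball a = ~` (setT `&` [set w : PT | rad a * dd a < dC w a])); last first.
  by apply/seteqP; rewrite setTI; split=> w /=; rewrite /cball /= leNgt => /negP.
 apply: measurableC; apply: (@measurable_fun_ltr _ PT R setT (fun _ => rad a * dd a)) => //.
 by apply: cmeas_cabs; exact: cmeas_toCB.
pose U n : set PT := (Dk `\` N) `&` cball (lam n).
have mU n : measurable (U n) by apply: measurableI => //; exact: measurableD.
exists c, (K + K'), eta, lam, (seqDU U), (fun n => hh (lam n)), N; split => //.
- by split => //; [rewrite addr_gt0|exact: letr eta1 d1].
- split; [by move=> n; exact: LD|exact: seqDU_measurable|exact: trivIset_seqDU|].
 rewrite -seqDU_bigcup_eq; apply/seteqP; split=> [w [n _ []]//|w wD].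
 have [a La wa] := cover w wD.1; have [n e2] := lamS a La; exists n => //; split => //.
 by rewrite /cball /= e2.
(* A repeated point gets an empty cell at its later occurrence, so non-empty cells belong to
   distinct points. *)
- have uni n m : (n < m)%N -> lam n = lam m -> seqDU U m !=set0 -> False.
  by move=> nm e2 [w [Uw]]; apply; rewrite -bigcup_mkord; exists n => //; rewrite /U e2.
 move=> n m An0 Am0 nm; apply: Lsep => // e2.
 by case: (ltngtP n m) => // [lt|lt]; [exact: uni lt e2 Am0|exact: uni lt (esym e2) An0].
- split=> [n|n w [[_ wc] _]|n w [[[wD wN] wc] _]].
 + have [h1 h2 h3 h4] := hhP _ (lamL n); split => // z zD nZ; rewrite mul0r => z0; apply: h4 => //.
  apply: letr z0 _; have /andP[r1 _] := radr (lam n); by rewrite mulr_ge0 ?(ltW r1) ?(ltW (dd_gt0 (LD _ (lamL n)))).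
 + apply: (letr wc); apply: lerMr; first exact: ltW (dd_gt0 (LD _ (lamL n))).
  by have /andP[] := radr (lam n).
 + by have [_ _ _ h4] := hhP _ (lamL n); apply: h4 => // /ZN.
Qed.
End Grid.

(** * The solution as a sum of Cauchy transforms over the cells *)

Section SolutionOperator.
Implicit Types (k : R) (D : set PT).
Variables (c K : R) (lam : nat -> RR) (An : nat -> set PT) (h : nat -> RR -> C) (N : set PT).
Hypotheses (mk : mfun DP (kZ Z)) (c0 : 0 < c) (K0 : 0 < K)
 (mN : measurable N) (N0 : A N = 0%E) (ZN : Z `<=` N) (lamD : forall n, Dk (lam n))
 (mA : forall n, measurable (An n)) (triv : trivIset setT An) (AU : \bigcup_n An n = Dk `\` N)
 (hB : forall n, bumplike K 0 c (lam n) (h n))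
 (near : forall n w, An n w -> dC w (lam n) <= 1 / 16 * (dd (lam n)))
 (low : forall n w, An n w -> c <= cabs (h n w) * ek Z w).
Variables (f : RR -> C) (X : nat -> R) (S : R).
Local Notation F w := (cabs (f w * rC (ek Z w))).
Local Notation dn n := (dd (lam n)).
Local Notation y n := (X n `^ p * dn n ^+ 2).
Hypotheses (mf : cmeas DP f) (X0 : forall n, 0 <= X n)
 (hX : forall n, (\int[A]_(w in An n) (F w)%:E <= (dn n ^+ 2 * X n)%:E)%E)
 (hS : forall m, \sum_(n < m) y n <= S).
Let p0 : 0 < p. by case/andP: hp. Qed.
Let md := @mdisk.
Let dn0 n : 0 < dn n. exact: dd_gt0 (lamD n). Qed.
Let AD n : An n `<=` Dk `\` N.
by move=> w Aw; rewrite -AU; exists n. Qed.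
Let mD' : measurable (Dk `\` N). exact: measurableD. Qed.
Let ADd n : An n `<=` Dk. by move=> w /AD[]. Qed.
Let hh n : holo Dk (h n). by case: (hB n). Qed.
Let y0 n : 0 <= y n. by rewrite mulr_ge0 ?powR_ge0 ?sqr_ge0. Qed.
Let yS n : y n <= S.
by apply: letr (hS n.+1); rewrite big_ord_recr /= lerDr sumr_ge0. Qed.
Let S0 : 0 <= S. exact: letr (y0 0) (yS 0). Qed.
Let mF : cmeas DP (fun w => f w * rC (ek Z w)).
by apply: cmeasM => //; apply: cmeas_rC; exact: mcomp. Qed.
Let mFA n : mfun (An n) (fun w => (F w)%:E).
by apply/mEFP; apply: cmeas_cabs; exact: cmeas_sub mF. Qed.

Let sum_le (x : nat -> \bar R) k : 0 <= k -> (forall n, (0 <= x n <= (k * y n)%:E)%E) ->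
 (\sum_(0 <= n <oo) x n <= (k * S)%:E)%E.
move=> k0 hx; apply: lime_le; first by apply: is_cvg_nneseries => n _ _; case/andP: (hx n).
apply: nearW => m; apply: (le_via (\sum_(0 <= n < m) (k * y n)%:E)%E).
 by apply: lee_sum => n _; case/andP: (hx n).
by rewrite sumEFin lee_fin -mulr_sumr big_mkord lerMl.
Qed.

(** Bounds [1 / (kappa |h| (1 - |w|^2))] on cell [n] relative to [exp kZ]: [c] is the lower bound of
    [|h| exp kZ], and [2] comes from [1 - |w|^2 >= dn n / 2]. *)
Let a n : R := 2 / (c * kappa) / dn n.
Let P n z : \bar R := (\int[A]_(w in An n) (F w * (dC z w)^-1)%:E)%E.
Let a0 n : 0 < a n. by rewrite !divr_gt0 ?mulr_gt0 ?kappa_gt0. Qed.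
Let q0 z w : 0 <= F w * (dC z w)^-1. by rewrite divr_ge0 ?nc_ge0. Qed.
Let P0 n z : (0 <= P n z)%E. by apply: integral_ge0 => w _; rewrite lee_fin. Qed.

Let m2 : mfun setT (fun v : PP => (dC v.1 v.2)^-1).
have [h1 h2] := meas_coordB.
apply: (@eq_measurable_fun _ _ _ _ _ (fun v : PP => ((v.1.1 - v.2.1) ^+ 2 + (v.1.2 - v.2.2) ^+ 2) `^ (- 2^-1))).
 move=> v _; have -> : dC v.1 v.2 = Num.sqrt ((v.1.1 - v.2.1) ^+ 2 + (v.1.2 - v.2.2) ^+ 2) by [].
 by rewrite powRN powR12_sqrt ?addr_ge0 ?sqr_ge0.
by apply: (mcomp (measurable_powR _)); apply: measurable_funD; exact: measurable_funX.
Qed.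

(** Tonelli moves the singular kernel to the variable [z], over which it is integrable uniformly in
    [w]. *)
Let tonP n (E : set PT) : measurable E -> mfun E (P n) /\
 forall k, 0 <= k -> (forall w, An n w -> (\int[A]_(z in E) ((dC z w)^-1)%:E <= k%:E)%E) ->
 (\int[A]_(z in E) P n z <= (k * (dn n ^+ 2 * X n))%:E)%E.
move=> mE; have mq : mfun (E `*` An n) (fun v : PP => F v.2 * (dC v.1 v.2)^-1).
 apply: mfunM; last by apply: measurable_funS m2.
 apply: (@measurable_comp _ _ _ _ _ _ (An n) (fun w => F w)) => //; [by move=> _ [[u v] [_ hv] <-]| |exact: measurable_funTS].
 by move/mEFP: (@mFA n).
have [h1 h2] := ctonelli mE (mA n) mq (fun v => q0 v.1 v.2); split; [exact: h1|move=> k k0 hk].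
rewrite /P h2 EFinM; apply: letr (leeMl _ (hX n)); last by rewrite lee_fin.
rewrite -(@ge0_integralZl _ PT R A _ (mA n) _ (@mFA n) k%:E (fun w _ => (nc_ge0 _ : (0 <= (F w)%:E)%E)) k0).
apply: le_int => w Aw; first by apply: integral_ge0 => z _; rewrite lee_fin.
have mi : mfun E (fun z => ((dC z w)^-1)%:E).
 apply/mEFP; apply: meas_fun_inv => [z _|]; [exact: nc_ge0|].
 by apply: cmeas_cabs; exact: cmeas_toCB.
under eq_integral do rewrite /= EFinM.
have i0 z : E z -> (0 <= ((dC z w)^-1)%:E)%E by move=> _; rewrite lee_fin invr_ge0 nc_ge0.
rewrite (@ge0_integralZl _ PT R A E mE _ mi (F w)%:E i0 (nc_ge0 _)) muleC.
by apply: lee_wpmul2r; [exact: nc_ge0|exact: hk].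
Qed.

Let W n z : \bar R := ((cabs (h n z) * ek Z z * a n)%:E * P n z)%E.
Let W0 n z : (0 <= W n z)%E.
by rewrite mule_ge0 // lee_fin mulr_ge0 ?(ltW (a0 n)) // mulr_ge0 ?nc_ge0 ?expR_ge0. Qed.
Let mb n : mfun DP (fun z => cabs (h n z) * ek Z z).
by apply: mfunM; [apply: cmeas_cabs; exact: holo_cmeas|exact: mcomp]. Qed.
Let mW n : mfun DP (W n).
apply: emeasurable_funM; last by have [] := tonP n md.
by apply/mEFP; apply: mfunM.
Qed.

(** The first term comes from the region away from the grid point. In the second, [4 K] bounds the
    [p]-th power of [|h| exp kZ] near it, and [17 = 1 + 16] adds the area bound [dn n ^+ 2] to the
    bound [16 * dn n] for the kernel integral, both entering through Young's inequality. *)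
Let C3 : R := (8 / (c * kappa)) `^ p * K + 4 * K * (2 / (c * kappa)) `^ p * 17.
Let C30 : 0 <= C3.
by rewrite addr_ge0 ?mulr_ge0 ?powR_ge0 ?(ltW K0). Qed.

(* Away from [lam n] the kernel is at most [4 / dn n]; near it, Young's inequality linearizes the [p]-th power. *)
Let W_le n t : 0 < t -> X n <= t -> (\int[A]_(z in Dk `\` N) (W n z `^ p) <= (C3 * (t `^ p * dn n ^+ 2))%:E)%E.
move=> t0 Xt; have [_ hpt hint _] := hB n; have dp := dn0 n.
pose g : R := 2 / (c * kappa); have g0 : 0 < g by rewrite divr_gt0 // mulr_gt0 // kappa_gt0.
pose E := eball (lam n) (dn n / 2); have mE : measurable (E : set PT) by exact: (@meball).
have E0 : 0 < dn n / 2 by rewrite divr_gt0.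
have ED : E `<=` Dk by apply: eball_disk; move: dp; lra.
have tp : 0 <= t `^ p by exact: powR_ge0.
have mWp D : D `<=` Dk -> mfun D (fun z => W n z `^ p)%E.
 by move=> DD; apply: (mcomp (@measurable_poweR R p)); exact: measurable_funS md DD (mW n).
have split2 : Dk `\` N = ((Dk `\` N) `\` E) `|` ((Dk `\` N) `&` E) by rewrite setUC setUIDK.
rewrite [X in integral _ X]split2 ge0_integral_setU; last first.
- by apply/disj_setPLR => z [_ zE] [_].
- by move=> z _; exact: poweR_ge0.
- by rewrite -split2; apply: mWp => z [].
- exact: measurableI.
- exact: measurableD.
have -> : C3 * (t `^ p * dn n ^+ 2) = (4 * g * t) `^ p * (K * dn n ^+ 2) + 4 * K * g `^ p * (17 * (t `^ p * dn n ^+ 2)).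
 have -> : 4 * g * t = 8 / (c * kappa) * t by rewrite /g; ring.
 by rewrite powRM ?(ltW t0) ?divr_ge0 ?mulr_ge0 ?(ltW c0) ?(ltW (kappa_gt0)) // /C3 -/g; ring.
rewrite EFinD; apply: leeD.
 apply: (le_via (\int[A]_(z in Dk) (((4 * g * t) `^ p)%:E * ((cabs (h n z) * ek Z z) `^ p)%:E))%E).
  apply: (le_via (\int[A]_(z in (Dk `\` N) `\` E) (((4 * g * t) `^ p)%:E * ((cabs (h n z) * ek Z z) `^ p)%:E))%E); last first.
   by apply: int_subset => [z [[]]//|z _]; rewrite -EFinM lee_fin mulr_ge0 ?powR_ge0.
  apply: le_int => z [[zD zN] /negP zE]; first exact: poweR_ge0.
  have b0 : 0 <= cabs (h n z) * ek Z z by rewrite mulr_ge0 ?nc_ge0 ?expR_ge0.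
  have g4 : 0 <= 4 * g * t by apply: mulr_ge0 (ltW t0); apply: mulr_ge0 => //; exact: ltW.
  rewrite -EFinM -powRM // -poweR_EFin; apply: ler_poweR; [exact: ltW|exact: W0|].
  have hP : (P n z <= (4 / dn n * (dn n ^+ 2 * X n))%:E)%E.
   rewrite EFinM; apply: letr (leeMl _ (hX n)); last by rewrite lee_fin divr_ge0 // ltW.
   rewrite -ge0_integralZl //; [|by move=> w _; rewrite lee_fin nc_ge0|by rewrite lee_fin divr_ge0 // ltW].
   apply: le_int => w Aw; first by rewrite lee_fin.
   rewrite -EFinM lee_fin mulrC; apply: lerMr; first exact: nc_ge0.
   have h1 := near Aw; have h2 := nc_distD (toC w) (toC z) (toC (lam n)).
   have h3 : dn n / 4 <= dC z w.
    by move: zE; rewrite -leNgt; move: h1 h2 dp; lra.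
   by rewrite -invf_div lef_pV2 ?posrE ?divr_gt0 // (ltle _ h3) // divr_gt0.
  apply: letr (leeMl _ hP) _; first by rewrite lee_fin mulr_ge0 ?(ltW (a0 n)).
  move: b0; set b := cabs _ * expR _ => b0; rewrite -EFinM lee_fin -(mulrA b) (mulrC _ b); apply: lerMl => //.
  have -> : a n * (4 / dn n * (dn n ^+ 2 * X n)) = 4 * g * X n.
   by rewrite /a -/g; move: (g) (dn n) (lt0r_neq0 dp) => g' d dnz; field.
  by rewrite ler_pM2l // mulr_gt0.
 rewrite ge0_integralZl //; [|by apply/mEFP; apply: (mcomp (measurable_powR _)); exact: mb|by move=> z _; rewrite lee_fin powR_ge0|by rewrite lee_fin powR_ge0].
 by rewrite EFinM; apply: leeMl => //; rewrite lee_fin powR_ge0.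
pose k : R := 4 * K * g `^ p; have k0 : 0 <= k by rewrite !mulr_ge0 ?powR_ge0 // ltW.
pose B z : \bar R := ((t `^ p)%:E + (t `^ (p - 1) / dn n)%:E * P n z)%E.
have B0 z : (0 <= B z)%E by rewrite adde_ge0 ?mule_ge0 // lee_fin // divr_ge0 ?powR_ge0 // ltW.
have [mP hPE] := tonP n mE.
have mPB : mfun E (fun z => (t `^ (p - 1) / dn n)%:E * P n z)%E by exact: measurable_funeM.
apply: (le_via (\int[A]_(z in E) (k%:E * B z))%E).
 apply: (le_via (\int[A]_(z in (Dk `\` N) `&` E) (k%:E * B z))%E); last first.
  by apply: int_subset => [z []//|z _]; rewrite mule_ge0 // lee_fin.
 apply: le_int => z [[zD zN] zE]; first exact: poweR_ge0.
 have nZ : ~ Z z by move=> /ZN.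
 have b0 : 0 <= cabs (h n z) * ek Z z by rewrite mulr_ge0 ?nc_ge0 ?expR_ge0.
 have dz := dd_gt0 zD; have hd : dn n <= 2 * dd z.
  have {}zE : dC z (lam n) < dn n / 2 := zE.
  by have := nc_leB (toC z) (toC (lam n)); move: zE; lra.
 have b4 : (cabs (h n z) * ek Z z) `^ p <= 4 * K.
  apply: letr (hpt z zD nZ) _; rewrite ler_pdivrMr ?exprn_gt0 // mulrAC mulrC.
  apply: lerMr; first exact: ltW.
  have : dn n ^+ 2 <= (2 * dd z) ^+ 2 by rewrite ler_sqr ?nnegrE ?mulr_ge0 ?(ltW dp) ?(ltW dz).
  by rewrite exprMn; lra.
 have e1 : W n z = ((cabs (h n z) * ek Z z * g)%:E * ((dn n)^-1%:E * P n z))%E.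
  by rewrite muleA -EFinM /W /a -/g !mulrA.
 have Q0 : (0 <= (dn n)^-1%:E * P n z)%E by rewrite mule_ge0 // lee_fin invr_ge0 ltW.
 have bg : (0 <= (cabs (h n z) * ek Z z * g)%:E)%E := mulr_ge0 b0 (ltW g0).
 rewrite e1 (poweRM _ bg Q0) poweR_EFin (powRM _ b0 (ltW g0)).
 apply: lee_pmul; rewrite ?poweR_ge0 ?lee_fin ?mulr_ge0 ?powR_ge0 //; first by apply: lerMr; rewrite ?powR_ge0.
 by apply: letr (poweR_young t0 Q0) _; rewrite muleA -EFinM.
rewrite ge0_integralZl //; last by apply: emeasurable_funD => //; exact: measurable_cst.
rewrite [leRHS]EFinM -/k; apply: leeMl; first by rewrite lee_fin.
rewrite ge0_integralD //; last by move=> z _; rewrite mule_ge0 // lee_fin divr_ge0 ?powR_ge0 // ltW.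
have -> : 17 * (t `^ p * dn n ^+ 2) = t `^ p * (4 * (dn n / 2) ^+ 2) + t `^ p * (16 * dn n ^+ 2) by field.
rewrite EFinD; apply: leeD.
 by rewrite integral_cst // EFinM; apply: leeMl; [rewrite lee_fin|apply: area_eball_le; exact: ltW].
rewrite ge0_integralZl //; last by rewrite lee_fin divr_ge0 ?powR_ge0 // ltW.
have k16 : 0 <= 16 * dn n by rewrite mulr_ge0 // ltW.
apply: letr (leeMl _ (hPE _ k16 _)) _; first by rewrite lee_fin divr_ge0 ?powR_ge0 // ltW.
 move=> w Aw; apply: letr (int_inv_dist (lam n) w E0) _; rewrite lee_fin ler_pM2l //.
 by have := near Aw; rewrite nc_distC; move: dp; lra.
have e2 : t `^ p = t `^ (p - 1) * t by rewrite -{3}[t](@powRr1 _ t) ?(ltW t0) // -powRD ?subrK // (gt_eqF t0) implybT.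
rewrite -EFinM lee_fin e2.
have -> : t `^ (p - 1) / dn n * (16 * dn n * (dn n ^+ 2 * X n)) = t `^ (p - 1) * X n * (16 * dn n ^+ 2) by field; rewrite gt_eqF.
by apply: lerMr; [rewrite mulr_ge0 ?sqr_ge0|apply: lerMl; rewrite ?powR_ge0].
Qed.

Let W_int n : (\int[A]_(z in Dk `\` N) (W n z `^ p) <= (C3 * y n)%:E)%E.
have [x0|xn] := eqVneq (X n) 0; last by apply: W_le => //; rewrite lt_neqAle eq_sym xn X0.
(* [W_le] wants a positive level; when the mean is zero the level is sent to [0]. *)
rewrite x0 powR0 ?gt_eqF // mul0r mulr0; apply/lee_addgt0Pr => e e0; rewrite add0e.
pose k := C3 * dn n ^+ 2 + 1; have k0 : 0 < k by rewrite ltr_wpDl // mulr_ge0 ?sqr_ge0.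
have ek : 0 < e / k by rewrite divr_gt0.
have := @W_le n ((e / k) `^ p^-1); rewrite x0 powR_ge0 powR_gt0 // => /(_ isT isT) /letr; apply.
rewrite lee_fin -powRrM mulVf ?gt_eqF // powRr1 ?(ltW ek) //.
have -> : C3 * (e / k * dn n ^+ 2) = e * (C3 * dn n ^+ 2) / k by ring.
by rewrite ler_pdivrMr // ler_pM2l // lerDl.
Qed.

(** The index of the cell containing [w], with default [0] on the null set and off the disk. *)
Let sel w : nat := xget 0 [set n | An n w].
Let selE n w : An n w -> sel w = n.
by move=> Aw; apply: xget_unique => // m Am; apply: triv => //; exists w. Qed.
(** The density is divided by [h] of its own cell at [w], and [Ker] multiplies back by the same [h]
    at [z]: the two agree on the diagonal, so the derivative is unchanged while the kernel gains
    decay. *)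
Let gk w : C := f w / (h (sel w) w * rC (1 - nC w ^+ 2) * rC (kappa)).
Let Ker z w : C := h (sel w) z * gk w / (tz z w).

Let hn0 n w : An n w -> h n w != 0.
move=> Aw; rewrite -nc_gt0 lt_neqAle nc_ge0 andbT eq_sym; apply/eqP => h0.
by have := low Aw; rewrite h0 mul0r leNgt c0.
Qed.

Let gk_le n w : An n w -> cabs (gk w) <= a n * F w.
move=> Aw; have [wD _] := AD Aw; have k0 := kappa_gt0; have hw : 0 < cabs (h n w) by rewrite nc_gt0 hn0.
have w1 := sub_sqr_gt0 wD; have dp := dn0 n; have e0 := expR_gt0 (kZ Z w).
have dw : dn n <= 2 * (1 - nC w ^+ 2).
 have h1 := near Aw; have := nc_leB (toC w) (toC (lam n)); have := disk_cabs wD; have := nc_ge0 (toC w).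
 have key (x l v : R) : 0 <= x -> x < 1 -> x - l <= v -> v <= 1 / 16 * (1 - l) -> 0 < 1 - l -> 1 - l <= 2 * (1 - x ^+ 2) by move=> *; nra.
 move=> x0 x1 h2; exact: key x0 x1 h2 h1 dp.
rewrite /gk (selE Aw) nc_div !cabsM !nc_rC (gtr0_norm w1) (gtr0_norm k0) (gtr0_norm e0).
have den0 : 0 < cabs (h n w) * (1 - nC w ^+ 2) * kappa by rewrite !mulr_gt0.
rewrite ler_pdivrMr // /a; have cn := lt0r_neq0 c0; have kn := lt0r_neq0 k0; have dnn := lt0r_neq0 dp.
have -> : 2 / (c * kappa) / dn n * (cabs (f w) * ek Z w) * (cabs (h n w) * (1 - nC w ^+ 2) * kappa) =
 cabs (f w) * ((cabs (h n w) * ek Z w) / c * (2 * (1 - nC w ^+ 2) / dn n)).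
 by move: (dn n) dnn (1 - nC w ^+ 2) => d dnn v; field; rewrite cn kn dnn.
apply: ler_peMr; first exact: nc_ge0.
by apply: mulr_ege1; rewrite ler_pdivlMr // mul1r ?low.
Qed.

Let gk_meas n : cmeas (An n) gk.
have mAf (g : RR -> C) : cmeas DP g -> cmeas (An n) g by exact: cmeas_sub.
have m1 : cmeas (An n) (fun w => f w / (h n w * rC (1 - nC w ^+ 2) * rC (kappa))).
 apply: mAf; apply: cmeasM => //; apply: cmeasV; apply: cmeasM; last exact: cmeas_cst.
 apply: cmeasM; first exact: holo_cmeas.
 by apply: cmeas_rC; apply: measurable_funB => //; apply: cmeas_sqr_cabs; exact: cmeas_toC.
by case: m1 => m1 m1'; split; [apply: eq_measurable_fun m1|apply: eq_measurable_fun m1'] => w;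
 rewrite inE => Aw; rewrite /gk (selE Aw).
Qed.

Let Ker_le n z w : An n w -> cabs (Ker z w) <= cabs (h n z) * a n * (F w * (dC z w)^-1).
move=> Aw; rewrite /Ker (selE Aw) nc_div (cabsM (h n z)) [leRHS]mulrA; apply: lerMr; first by rewrite invr_ge0 nc_ge0.
by rewrite -mulrA; apply: lerMl; [exact: nc_ge0|exact: gk_le].
Qed.

Let Ker_meas z : cmeas (Dk `\` N) (Ker z).
have m n : cmeas (An n) (Ker z).
 have : cmeas (An n) (fun w => h n z * gk w / tz z w).
  apply: cmeasM; first by apply: cmeasM; [exact: cmeas_cst|exact: gk_meas].
  by apply: cmeasV; apply: cmeasB; [exact: cmeas_cst|exact: cmeas_toC].
 by move=> [m1 m1']; split; [apply: eq_measurable_fun m1|apply: eq_measurable_fun m1'] => w;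
  rewrite inE => Aw; rewrite /Ker (selE Aw).
by rewrite -AU; split; apply/measurable_fun_bigcup => // n; case: (m n).
Qed.

Let Ker_int z : (\int[A]_(w in Dk `\` N) (cabs (Ker z w))%:E <= \sum_(0 <= n <oo) ((cabs (h n z) * a n)%:E * P n z))%E.
have mk' : mfun (\bigcup_n An n) (fun w => (cabs (Ker z w))%:E).
 by rewrite AU; apply/mEFP; apply: cmeas_cabs; exact: Ker_meas.
have k0 w : (\bigcup_n An n) w -> (0 <= (cabs (Ker z w))%:E)%E by rewrite lee_fin nc_ge0.
rewrite -AU (ge0_integral_bigcup A mA mk' k0 triv); apply: lee_nneseries => n _.
 by move=> _; apply: integral_ge0 => w _; rewrite lee_fin nc_ge0.
have ca : 0 <= cabs (h n z) * a n by rewrite mulr_ge0 ?nc_ge0 ?(ltW (a0 n)).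
have mq : mfun (An n) (fun w => (F w * (dC z w)^-1)%:E).
 apply/mEFP; apply: mfunM; first by move/mEFP: (@mFA n).
 apply: meas_fun_inv => [w _|]; first exact: nc_ge0.
 by apply: cmeas_cabs; apply: cmeasB; [exact: cmeas_cst|exact: cmeas_toC].
rewrite -(@ge0_integralZl _ PT R A _ (mA n) _ mq (cabs (h n z) * a n)%:E (fun w _ => q0 z w) ca).
by apply: le_int => w Aw; rewrite lee_fin ?nc_ge0 // Ker_le.
Qed.

(** Done cell by cell, where the index is constant. The reciprocal [1 / (z - w)] is written as the
    conjugate over the squared modulus, whose components are visibly jointly measurable. *)
Let Ker_meas2 D1 : measurable D1 -> D1 `<=` Dk -> cmeas2 (D1 `*` (Dk `\` N)) Ker.
move=> mD1 D1D; have mD n : measurable (D1 `*` An n) by exact: measurableX.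
have [h1' h2'] := meas_coordB.
have mx n : mfun (D1 `*` An n) (fun v : PP => v.1.1 - v.2.1) by exact: measurable_funTS.
have my n : mfun (D1 `*` An n) (fun v : PP => v.1.2 - v.2.2) by exact: measurable_funTS.
have mi n : mfun (D1 `*` An n) (fun v : PP => (dC v.1 v.2)^-1) by apply: measurable_funS m2.
have c1 n (g : PT -> R) : mfun D1 g -> mfun (D1 `*` An n) (fun v : PP => g v.1).
 by move=> mg; apply: (@measurable_comp _ _ _ _ _ _ D1 g) => //; [by move=> _ [[u v] [hu _] <-]|exact: measurable_funTS].
have c2 n (g : PT -> R) : mfun (An n) g -> mfun (D1 `*` An n) (fun v : PP => g v.2).
 by move=> mg; apply: (@measurable_comp _ _ _ _ _ _ (An n) g) => //; [by move=> _ [[u v] [_ hv] <-]|exact: measurable_funTS].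
have K2 n : mfun (D1 `*` An n) (fun v : PP => re (Ker v.1 v.2)) /\
  mfun (D1 `*` An n) (fun v : PP => im (Ker v.1 v.2)).
 have [h1 h2] : cmeas D1 (h n) by apply: (cmeas_sub md) => //; exact: holo_cmeas.
 have [g1 g2] := gk_meas n.
 have {}h1 := c1 n _ h1; have {}h2 := c1 n _ h2; have {}g1 := c2 n _ g1; have {}g2 := c2 n _ g2.
 have e : forall v : PP, (D1 `*` An n) v -> Ker v.1 v.2 = h n v.1 * gk v.2 *
   (Complex (v.1.1 - v.2.1) (- (v.1.2 - v.2.2)) * rC ((dC v.1 v.2)^-1 * (dC v.1 v.2)^-1)).
  move=> v [_ Av]; rewrite /Ker (selE Av); congr (_ * _).
  by apply: ceqP; rewrite ?ReV ?ImV ?ReM ?ImM /= expr2 invfM; ring.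
 have I := mfunM (mi n) (mi n).
 have MP := measurable_funB (mfunM h1 g1) (mfunM h2 g2).
 have MQ := measurable_funD (mfunM h1 g2) (mfunM h2 g1).
 split.
  apply: eq_measurable_fun (mfunM (measurable_funD (mfunM MP (mx n)) (mfunM MQ (my n))) I) => v /set_mem hv.
  by rewrite /= (e v hv) !(ReM, ImM) /=; ring.
 apply: eq_measurable_fun (mfunM (measurable_funB (mfunM MQ (mx n)) (mfunM MP (my n))) I) => v /set_mem hv.
 by rewrite /= (e v hv) !(ReM, ImM) /=; ring.
by rewrite -AU setX_bigcupr; split; apply/measurable_fun_bigcup => // n; case: (K2 n).
Qed.

Let u z : C := cinteg (Dk `\` N) (Ker z).

Let u_le z : ((cabs (u z) * ek Z z)%:E <= 2%:E * \sum_(0 <= n <oo) W n z)%E.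
have e0 := expR_ge0 (kZ Z z); have s0 n : (0 <= (cabs (h n z) * a n)%:E * P n z)%E.
 by rewrite mule_ge0 // lee_fin mulr_ge0 ?nc_ge0 ?(ltW (a0 n)).
have uS : ((cabs (u z))%:E <= 2%:E * \sum_(0 <= n <oo) ((cabs (h n z) * a n)%:E * P n z))%E.
 have := Ker_int z; case: (ltP (\int[A]_(w in Dk `\` N) (cabs (Ker z w))%:E)%E +oo%E) => [fi hi|].
  have ci : cL1 (Dk `\` N) (Ker z) by apply/cL1P.
  by apply: letr (cinteg_bound mD' ci) _; apply: leeMl.
 (* If the kernel is not integrable at [z], the right-hand side is infinite. *)
 by rewrite leye_eq => /eqP ->; rewrite leye_eq => /eqP ->; rewrite mulry gtr0_sg // mul1e leey.
rewrite EFinM muleC; apply: letr (leeMl _ uS) _; first by rewrite lee_fin.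
rewrite muleCA; apply: leeMl => //; rewrite -nneseriesZl //.
by apply: lee_nneseries => n _; [rewrite mule_ge0|rewrite /W muleA -EFinM mulrA (mulrC (expR _))].
Qed.

Let u_norm : cmeas DP u ->
 (\int[A]_(z in Dk) ((cabs (u z) * ek Z z) `^ p)%:E <= (2 `^ p * C3 * S)%:E)%E.
move=> mu; have mW' n : mfun (Dk `\` N) (fun z => W n z `^ p)%E.
 by apply: (mcomp (@measurable_poweR R p)); exact: measurable_funS md _ (mW n).
rewrite (@ge0_negligible_integral _ PT R A _ N _ mN md _ _ N0); first last.
- by move=> z _; rewrite lee_fin powR_ge0.
- apply/mEFP; apply: (mcomp (measurable_powR _)).
 by apply: mfunM; [exact: cmeas_cabs|exact: mcomp].
apply: (le_via (\int[A]_(z in Dk `\` N) ((2 `^ p)%:E * \sum_(0 <= n <oo) (W n z `^ p))%E)%E).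
 apply: le_int => z _; first by rewrite lee_fin powR_ge0.
 have e0 : 0 <= cabs (u z) * ek Z z by rewrite mulr_ge0 ?nc_ge0 ?expR_ge0.
 have e1 : (0 <= (cabs (u z) * ek Z z)%:E)%E := e0.
 rewrite -poweR_EFin; apply: letr (ler_poweR (ltW p0) e1 (u_le z)) _.
 rewrite poweRM ?nneseries_ge0 // poweR_EFin; apply: leeMl; first by rewrite lee_fin powR_ge0.
 exact: nneseries_poweR.
have W1 n z : (0 <= W n z `^ p)%E by exact: poweR_ge0.
have mS : mfun (Dk `\` N) (fun z => \sum_(0 <= n <oo) (W n z `^ p))%E.
 exact: (@ge0_emeasurable_sum _ PT R _ (fun n z => W n z `^ p)%E xpredT (fun n z _ _ => W1 n z) (fun n _ => mW' n)).
rewrite (@ge0_integralZl _ PT R A _ mD' _ mS (2 `^ p)%:E (fun z _ => nneseries_ge0 (fun n _ _ => W1 n z)) (powR_ge0 _ _)).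
rewrite -mulrA EFinM; apply: leeMl; first by rewrite lee_fin powR_ge0.
rewrite integral_nneseries //; apply: sum_le => // n.
by rewrite W_int andbT; apply: integral_ge0.
Qed.

(** Turns sums of [p]-th powers into plain sums: [y^(1/p) <= S^(1/p - 1) y] because [y <= S] and
    [1/p >= 1]. Local integrability of [u] and of the data follows from it. *)
Let hy n : (dn n ^+ 2) `^ p^-1 * X n <= S `^ (p^-1 - 1) * y n.
have -> : (dn n ^+ 2) `^ p^-1 * X n = y n `^ p^-1.
 by rewrite powRM ?powR_ge0 ?sqr_ge0 // -powRrM mulfV ?gt_eqF // powRr1 // mulrC.
have [->|yn] := eqVneq (y n) 0; first by rewrite mulr0 powR0 // invr_eq0 gt_eqF.
have -> : y n `^ p^-1 = y n `^ (p^-1 - 1) * y n.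
 rewrite -[X in _ = _ * X](@powRr1 _ (y n)) //.
 by rewrite -powRD ?subrK // yn implybT.
apply: lerMr => //; apply: ge0_ler_powR; rewrite ?nnegrE //.
by rewrite subr_ge0 invf_ge1 //; case/andP: hp => _ /ltW.
Qed.

(** On a compact disk [|h_n|] is bounded by its norm through [apn_point], and the kernel integrates
    to a constant; [hy] makes the resulting series converge. This licenses Fubini for [u]. *)
Let Ker_fin r : 0 < r -> r < 1 -> (\int[A]_(z in dball r) \int[A]_(w in Dk `\` N) (cabs (Ker z w))%:E < +oo)%E.
move=> r0 r1; have [Q Q0 hQ] := apn_point; have mB := @mdball r.
pose rho := (1 - r) / 2; have rho0 : 0 < rho by rewrite divr_gt0 // subr_gt0.
pose B := Q / rho ^+ 2 * K; have B0 : 0 <= B by rewrite mulr_ge0 ?divr_ge0 ?sqr_ge0 ?ltW.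
have BD : dball r `<=` Dk by apply: dball_disk; exact: ltW.
have hb n z : dball r z -> cabs (h n z) <= B `^ p^-1 * (dn n ^+ 2) `^ p^-1.
 move=> zr; have [_ _ hi _] := hB n.
 have ha : apn (h n) (K * dn n ^+ 2).
  apply: letr hi; apply: le_int => x _; first by rewrite lee_fin powR_ge0.
  rewrite lee_fin; apply: ge0_ler_powR; rewrite ?nnegrE ?mulr_ge0 ?nc_ge0 ?expR_ge0 ?(ltW p0) //.
  by apply: ler_peMr; [exact: nc_ge0|by rewrite -expR0 ler_expR; exact: kZ_ge0].
 have zr' : nC z + rho < 1 by move: zr r1; rewrite /dball /rho /=; lra.
 have := hQ _ _ rho z (hh n) ha rho0 zr'; rewrite mulrA -/B -powRM ?sqr_ge0 // => hz.
 rewrite -[leLHS](@powRr1 _ (cabs (h n z))) ?nc_ge0 // -{1}(mulfV (lt0r_neq0 p0)) powRrM.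
 apply: ge0_ler_powR hz; rewrite ?nnegrE ?invr_ge0 ?powR_ge0 ?(ltW p0) //.
 by apply: mulr_ge0 => //; exact: sqr_ge0.
pose g : R := 2 / (c * kappa); have g0 : 0 <= g by rewrite divr_ge0 // mulr_ge0 ?ltW ?kappa_gt0.
pose k : R := B `^ p^-1 * g * 32 * S `^ (p^-1 - 1).
have Bg : 0 <= B `^ p^-1 * g * 32 by apply: mulr_ge0 => //; apply: mulr_ge0 => //; exact: powR_ge0.
have k0 : 0 <= k by apply: mulr_ge0 => //; exact: powR_ge0.
have hn n : 0 <= B `^ p^-1 * (dn n ^+ 2) `^ p^-1 * a n.
 by apply: mulr_ge0 (ltW (a0 n)); apply: mulr_ge0; exact: powR_ge0.
have mP n : mfun (dball r) (P n) by have [] := tonP n mB.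
apply: (@lelt _ _ (k * S)%:E); last exact: ltry.
apply: (le_via (\int[A]_(z in dball r) \sum_(0 <= n <oo) ((B `^ p^-1 * (dn n ^+ 2) `^ p^-1 * a n)%:E * P n z))%E).
 apply: le_int => z zr; first by apply: integral_ge0 => w _; rewrite lee_fin nc_ge0.
 apply: letr (Ker_int z) _; apply: lee_nneseries => n _; first by rewrite mule_ge0 // lee_fin mulr_ge0 ?nc_ge0 ?(ltW (a0 n)).
 by apply: lee_wpmul2r => //; rewrite lee_fin; apply: lerMr; [exact: ltW|exact: hb].
rewrite integral_nneseries //; [|by move=> n; exact: measurable_funeM|by move=> n z _; rewrite mule_ge0 // lee_fin].
apply: sum_le => // n; rewrite integral_ge0 /=; last by move=> z _; rewrite mule_ge0 // lee_fin.
rewrite ge0_integralZl //; last by rewrite lee_fin.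
have [_ /(_ 32 (ler0n _ _)) h2] := tonP n mB.
apply: letr (leeMl _ (h2 _)) _; first by rewrite lee_fin.
 move=> w Aw; apply: letr (letr _ (int_inv_dist (0, 0) w ltr01)) _.
  apply: int_subset => [z zr|z _]; last by rewrite lee_fin invr_ge0 nc_ge0.
  by rewrite /eball /= toC00 subr0; exact: lt_trans zr r1.
 by rewrite lee_fin toC00 sub0r cabsN; have := disk_cabs (ADd Aw); lra.
have dq : dn n <= 1 by rewrite gerBl nc_ge0.
rewrite -EFinM lee_fin /a -/g; have x0 : 0 <= (dn n ^+ 2) `^ p^-1 * X n by rewrite mulr_ge0 ?powR_ge0.
have -> : B `^ p^-1 * (dn n ^+ 2) `^ p^-1 * (g / dn n) * (32 * (dn n ^+ 2 * X n)) =
  B `^ p^-1 * g * 32 * ((dn n ^+ 2) `^ p^-1 * X n) * dn n by field; exact: lt0r_neq0 (dn0 n).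
have -> : k * y n = B `^ p^-1 * g * 32 * (S `^ (p^-1 - 1) * y n) by rewrite /k; ring.
apply: letr (ler_piMr _ dq) _; first exact: mulr_ge0.
by apply: lerMl => //; exact: hy.
Qed.

Let cinteg_null (g : RR -> C) : L1D g -> cinteg (Dk `\` N) g = ID g.
by move=> [g1 g2]; congr Complex; rewrite /Rintegral (negligible_integral mN md _ N0). Qed.

Let g w := f w / rC (1 - nC w ^+ 2).
(** Cells meeting a compact disk have grid points at distance at least [(1 - r) / 2] from the
    circle, so the powers of [dn n] are harmless and [hy] sums the cell bounds. *)
Let locint_g : locint g.
have mg : cmeas DP g.
 apply: cmeasM => //; apply: cmeasV; apply: cmeas_rC; apply: measurable_funB => //.
 by apply: cmeas_sqr_cabs; exact: cmeas_toC.
move=> r r1; have mB := @mdball r; have BD : dball r `<=` Dk by apply: dball_disk; exact: ltW.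
have mgB : cmeas (dball r) g by exact: cmeas_sub mg.
apply/cL1P => //; split=> //.
have r0 : 0 < 1 - r by rewrite subr_gt0.
pose t := ((1 - r) / 2) ^+ 2; have t0 : 0 < t by rewrite exprn_gt0 // divr_gt0.
pose k : R := (1 - r)^-1 * (t `^ p^-1)^-1 * S `^ (p^-1 - 1).
have k0 : 0 <= k by rewrite !mulr_ge0 ?powR_ge0 ?invr_ge0 ?powR_ge0 ?ltW.
have mc : mfun (dball r) (fun w => (cabs (g w))%:E) by apply/mEFP; exact: cmeas_cabs.
apply: (@lelt _ _ (k * S)%:E); last exact: ltry.
rewrite (@ge0_negligible_integral _ PT R A _ N _ mN mB mc _ N0); last by move=> z _; rewrite lee_fin nc_ge0.
have U : dball r `\` N = \bigcup_n (An n `&` dball r).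
 by rewrite -setI_bigcupl AU; apply/seteqP; split=> z [] => [zr zN|[_ zN] zr]; split=> //; split=> //; exact: BD.
have tr : trivIset setT (fun n => An n `&` dball r) by apply: trivIset_setIr.
rewrite U ge0_integral_bigcup //; last first.
- by move=> z _; rewrite lee_fin nc_ge0.
- by rewrite -U; apply: measurable_funS mc => // z [].
- by move=> n; exact: measurableI.
apply: sum_le => // n; rewrite integral_ge0 /=; last by move=> z _; rewrite lee_fin nc_ge0.
case: (pselect (exists w, (An n `&` dball r) w)) => [[w [Aw wr]]|no]; last first.
 rewrite (_ : An n `&` dball r = set0) ?integral_set0 ?lee_fin ?(mulr_ge0 k0) //.
 by rewrite -subset0 => w hw; apply: no; exists w.
have dr : (1 - r) / 2 <= dn n.
 have {}wr : nC w < r := wr.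
 by have := near Aw; have := nc_leB (toC (lam n)) (toC w); rewrite nc_distC; have := dn0 n; move: wr; lra.
apply: (le_via (\int[A]_(w in An n) ((1 - r)^-1%:E * (F w)%:E))%E).
 apply: (le_via (\int[A]_(w in An n `&` dball r) ((1 - r)^-1%:E * (F w)%:E))%E); last first.
  by apply: int_subset => [v []|v _] //; rewrite -EFinM lee_fin mulr_ge0 ?invr_ge0 ?nc_ge0 ?ltW.
 apply: le_int => v [Av vr]; first by rewrite lee_fin nc_ge0.
 have v1 := sub_sqr_gt0 (ADd Av).
 have v2 : 1 - r <= 1 - nC v ^+ 2.
  have {}vr : nC v < r := vr.
  have key (x y : R) : 0 <= x -> x < 1 -> x < y -> 1 - y <= 1 - x ^+ 2 by move=> *; nra.
  by apply: key; rewrite ?nc_ge0 // disk_cabs //; exact: ADd Av.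
 rewrite -EFinM lee_fin /g nc_div nc_rC (gtr0_norm v1) mulrC; apply: ler_pM; rewrite ?nc_ge0 ?invr_ge0 ?(ltW v1) //.
  by rewrite lef_pV2 // posrE.
 rewrite cabsM nc_rC (gtr0_norm (expR_gt0 _)); apply: ler_peMr; first exact: nc_ge0.
 by rewrite -expR0 ler_expR; exact: kZ_ge0.
rewrite ge0_integralZl //; [|by move=> w' _; rewrite lee_fin nc_ge0|by rewrite lee_fin invr_ge0 ltW].
have i0 : 0 <= (1 - r)^-1 by rewrite invr_ge0 ltW.
apply: letr (leeMl _ (hX n)) _ => //; rewrite -EFinM lee_fin.
have -> : k * y n = (1 - r)^-1 * ((t `^ p^-1)^-1 * (S `^ (p^-1 - 1) * y n)) by rewrite /k; ring.
apply: lerMl => //.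
have tp : 0 < t `^ p^-1 by exact: powR_gt0.
apply: (le_via ((t `^ p^-1)^-1 * ((dn n ^+ 2) `^ p^-1 * X n))); last by apply: lerMl; [rewrite invr_ge0 ltW|exact: hy].
rewrite mulrA; apply: lerMr => //; rewrite mulrC ler_pdivlMr //.
apply: (le_via (t `^ p^-1)); first by apply: ler_piMl; [exact: ltW|rewrite expr_le1 ?gerBl ?nc_ge0 ?(ltW (dn0 n))].
apply: ge0_ler_powR; rewrite ?nnegrE ?invr_ge0 ?sqr_ge0 ?(ltW p0) ?(ltW t0) //.
by rewrite /t ler_sqr ?nnegrE ?divr_ge0 ?(ltW r0) ?(ltW (dn0 n)).
Qed.

Let locint_u : locint u.
move=> r r1; have [r0|r0] := ltP 0 r.
 have BD : dball r `<=` Dk by apply: dball_disk; exact: ltW.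
 by have [] := cfubini (@mdball r) mD' (Ker_meas2 (@mdball r) BD) (Ker_fin r0 r1).
have -> : dball r = set0 by apply/seteqP; split=> // z /(lelt (nc_ge0 _)); rewrite ltNge r0.
by split; exact: integrable_set0.
Qed.

Let pole_cancel (E : fieldType) (v x1 x2 x3 t : E) : x1 != 0 -> x2 != 0 -> x3 != 0 ->
 v / (x1 * x3 * x2) * (x2 * (x1 * t)) = v / x3 * t.
by move=> h1 h2 h3; field; rewrite h1 h2 h3. Qed.

(** After Fubini, for fixed [w] in cell [n] the inner integral is the Cauchy transform of the
    derivative of [h n phi], itself a test function. By [dbar_pole] it equals
    [- kappa h_n(w) phi(w)], and the density was divided by exactly this factor. *)
Let weak_eq phi : test_fun phi -> cint (fun z => u z * dbar phi z) = - cint (fun z => g z * rC (phi z)).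
move=> tphi; have ct := test_ctest tphi; have cb : ctest (dbar phi).
 by have := ctest_cdbar ct; congr ctest; apply/funext => z; rewrite cdbar_rC.
have [sb [r0 [r01 vb0]]] := cb; pose r := Num.max r0 (1 / 2).
have rp : 0 < r by rewrite lt_max divr_gt0 // orbT.
have r1 : r < 1 by rewrite gt_max r01 /=; lra.
have vb z : r <= nC z -> dbar phi z = 0 by rewrite ge_max => /andP[hz _]; exact: vb0.
have [M M0 hM] := ccontinuous_bounded (r := r) (fun z _ => csmooth_ccontinuous z sb).
have mB := @mdball r; have BD : dball r `<=` Dk by apply: dball_disk; exact: ltW.
have mb' : cmeas (dball r) (dbar phi) by exact: csmooth_cmeas.
pose K2 z w : C := Ker z w * dbar phi z.
have [k1 k2] := Ker_meas2 mB BD.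
have mK2 : cmeas2 (dball r `*` (Dk `\` N)) K2.
 have c1 (q : PT -> R) : mfun (dball r) q -> mfun (dball r `*` (Dk `\` N)) (fun v : PP => q v.1).
  by move=> mq; apply: (@measurable_comp _ _ _ _ _ _ (dball r) q) => //; [by move=> _ [[v w] [hv _] <-]|exact: measurable_funTS].
 have [b1 b2] := mb'; have {}b1 := c1 _ b1; have {}b2 := c1 _ b2; split.
  by apply: eq_measurable_fun (measurable_funB (mfunM k1 b1) (mfunM k2 b2)) => v _; rewrite /K2 ReM.
 by apply: eq_measurable_fun (measurable_funD (mfunM k1 b2) (mfunM k2 b1)) => v _; rewrite /K2 ImM.
have mV : mfun (dball r) (fun z => (\int[A]_(w in Dk `\` N) (cabs (Ker z w))%:E)%E).
 have mc : mfun (dball r `*` (Dk `\` N)) (fun v : PP => cabs (Ker v.1 v.2)).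
  apply: eq_measurable_fun (mcomp (measurable_powR 2^-1) (measurable_funD (measurable_funX 2 k1) (measurable_funX 2 k2))) => v _ /=.
  by rewrite powR12_sqrt ?addr_ge0 ?sqr_ge0 //; case: (Ker _ _).
 by have [] := ctonelli mB mD' mc (fun v => nc_ge0 _).
have V0 z : (0 <= \int[A]_(w in Dk `\` N) (cabs (Ker z w))%:E)%E by apply: integral_ge0 => w _; rewrite lee_fin nc_ge0.
have fin2 : (\int[A]_(z in dball r) \int[A]_(w in Dk `\` N) (cabs (K2 z w))%:E < +oo)%E.
 apply: (@lelt _ _ (M%:E * \int[A]_(z in dball r) \int[A]_(w in Dk `\` N) (cabs (Ker z w))%:E)%E); last first.
  by rewrite lte_mul_pinfty ?Ker_fin ?lee_fin ?(ltW M0).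
 rewrite -(@ge0_integralZl _ PT R A _ mB _ mV M%:E (fun z _ => V0 z) (ltW M0)).
 apply: le_int => z zr; first by apply: integral_ge0 => w _; rewrite lee_fin nc_ge0.
 have mKz : mfun (Dk `\` N) (fun w => (cabs (Ker z w))%:E).
  by apply/mEFP; apply: cmeas_cabs; exact: Ker_meas.
 rewrite -(@ge0_integralZl _ PT R A _ mD' _ mKz M%:E (fun w _ => nc_ge0 _) (ltW M0)).
 apply: le_int => w _; rewrite lee_fin cabsM ?mulr_ge0 ?nc_ge0 //.
 by rewrite mulrC; apply: lerMr; [exact: nc_ge0|apply: hM; exact: ltW zr].
have [i1 i2 e12] := cfubini mB mD' mK2 fin2.
have eK w : (Dk `\` N) w -> cinteg (dball r) (K2^~ w) = - (g w * rC (phi w)).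
 rewrite -AU => -[n _ Aw]; have wD := ADd Aw; have cth := ctest_holoM (hh n) ct.
 have [j1 j2] := dbar_pole cth wD.
 have e z : K2 z w = gk w * (cdbar (fun z => h n z * rC (phi z)) z / tz z w).
  by rewrite /K2 /Ker (selE Aw) (cdbar_holoM _ (hh n) ct); move: (_^-1) => v; ring.
 have vK z : r <= nC z -> K2 z w = 0 by move=> /vb b0; rewrite /K2 b0 mulr0.
 rewrite -(cint_dball (ltW r1) vK).
 have -> : ID (K2^~ w) = gk w * - (rC (kappa) * (h n w * rC (phi w))).
  by rewrite -j2 -(cintegZ (gk w) md j1); apply: eq_cinteg => z _; exact: e.
 rewrite mulrN; congr (- _).
 rewrite /gk (selE Aw) /g; have hw := hn0 Aw; have k0 := kappa_gt0; have w1 := sub_sqr_gt0 wD.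
 have kn : rC (kappa) != 0 by rewrite rC_eq0 gt_eqF.
 have wn : rC (1 - nC w ^+ 2) != 0 by rewrite rC_eq0 gt_eqF.
 exact: pole_cancel.
change (ID (fun z => u z * dbar phi z) = - ID (fun z => g z * rC (phi z))).
have lgp := locint_ctest locint_g ct.
have lg2 : cL1 (Dk `\` N) (fun z => g z * rC (phi z)) by apply: (cL1S mD' md _ lgp) => z [].
rewrite -(cinteg_null lgp) -(cintegN mD' lg2).
rewrite -(eq_cinteg eK) -e12.
have vu z : r <= nC z -> u z * dbar phi z = 0 by move=> /vb ->; rewrite mulr0.
rewrite (cint_dball (ltW r1) vu).
apply: (cinteg_ae mB _ (cL1_meas mB i1)).
 apply: cmeasM mb'; exact: (cL1_meas mB (@locint_u r r1)).
have iV : A.-integrable (dball r) (fun z => (\int[A]_(w in Dk `\` N) (cabs (Ker z w))%:E)%E).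
 apply/integrableP; split; [exact: mV|apply: lelt (Ker_fin rp r1)].
 by apply: le_int => z _; [exact: abse_ge0|rewrite gee0_abs].
apply: filterS (integrable_ae mB iV) => z hz zr; rewrite [RHS](_ : _ = cinteg (Dk `\` N) (fun w => dbar phi z * Ker z w)); last first.
 by apply: eq_cinteg => w _; rewrite /K2 mulrC.
have iz : cL1 (Dk `\` N) (Ker z).
 by apply/(cL1P _ mD'); split; [exact: Ker_meas|move: (hz zr); rewrite fin_numElt; case/andP].
by rewrite (cintegZ _ mD' iz) mulrC.
Qed.

Lemma solution_operator : exists u, dbar_solution f u /\
 (\int[A]_(z in Dk) ((cabs (u z) * ek Z z) `^ p)%:E <=
  (2 `^ p * ((8 / (c * kappa)) `^ p * K + 4 * K * (2 / (c * kappa)) `^ p * 17) * S)%:E)%E.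
exists u; split; last by apply: u_norm; apply: cmeas_disk_local => r r1; apply: (cL1_meas (@mdball r)); exact: locint_u.
by split; [apply/locintP; exact: locint_u|split; [apply/locintP; exact: locint_g|exact: weak_eq]].
Qed.
End SolutionOperator.

(** * Interpolation implies solvability *)

Section Equivalence.
Let p0 : 0 < p. by case/andP: hp. Qed.

(** The disks carrying a non-zero value are disjoint, so at each point at most one term is present
    and [g] dominates it. *)
Lemma sum_le_integral_powR (eta : R) (lam : nat -> RR) (x : nat -> R) (g : RR -> \bar R) m :
 0 < eta -> eta <= 1 -> (forall n, Dk (lam n)) -> (forall n, 0 <= x n) -> (forall z, (0 <= g z)%E) ->
 (forall n k z, x n != 0 -> x k != 0 -> eball (lam n) (eta * dd (lam n)) z -> eball (lam k) (eta * dd (lam k)) z -> n = k) ->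
 (forall n z, eball (lam n) (eta * dd (lam n)) z -> ((x n)%:E <= g z)%E) ->
 ((\sum_(n < m) x n `^ p * (eta * dd (lam n)) ^+ 2)%:E <= \int[A]_(z in Dk) (g z `^ p))%E.
move=> e0 e1 lamD x0 g0 dis xg; pose B n := eball (lam n) (eta * dd (lam n)).
have mB n : measurable (B n : set PT) by exact: (@meball).
have BD n : B n `<=` Dk.
 by apply: eball_disk; rewrite ler_piMl // ltW // dd_gt0.
pose iB n (z : PT) : R := \1_(B n) z.
have miB n : mfun DP (iB n) by exact: measurable_indic.
have m1 n : mfun DP (fun z => (x n `^ p * iB n z)%:E).
 by apply/mEFP; exact: mfunM.
have t0 n z : (0 <= (x n `^ p * iB n z)%:E)%E by rewrite lee_fin mulr_ge0 ?powR_ge0.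
apply: (le_via (\int[A]_(z in Dk) \sum_(n < m) (x n `^ p * iB n z)%:E)%E).
 rewrite (@ge0_integral_sum _ PT R A _ (@mdisk) _ (fun (n : 'I_m) z => (x n `^ p * iB n z)%:E)) // -sumEFin.
 apply: lee_sum => n _; under eq_integral do rewrite EFinM.
 have mi : mfun DP (fun z => (iB n z)%:E) by apply/mEFP.
 have i0 z : DP z -> (0 <= (iB n z)%:E)%E by rewrite lee_fin.
 rewrite (@ge0_integralZl _ PT R A _ (@mdisk) _ mi (x n `^ p)%:E i0 (powR_ge0 _ _)).
 rewrite (integral_indic _ (@mdisk) (mB n)).
 rewrite EFinM; apply: leeMl; first by rewrite lee_fin powR_ge0.
 rewrite setIidl //; apply: area_eball_ge; apply: mulr_ge0; apply: ltW => //; exact: dd_gt0.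
apply: le_int => z zD; first exact: sume_ge0.
case: (pselect (exists n : 'I_m, x n != 0 /\ B n z)) => [[n [xn Bn]]|no].
 rewrite (bigD1 n) //= big1 ?adde0 => [|k kn].
  rewrite /iB indicE mem_set // mulr1 -poweR_EFin.
  by apply: ler_poweR; [exact: ltW|rewrite lee_fin|exact: xg].
 have [->|xk] := eqVneq (x k) 0; first by rewrite powR0 ?mul0r // gt_eqF.
 rewrite /iB indicE memNset ?mulr0 // => Bk; move/eqP: kn; apply; apply/val_inj.
 exact: dis xk xn Bk Bn.
rewrite big1 => [|n _]; first exact: poweR_ge0.
have [->|xn] := eqVneq (x n) 0; first by rewrite powR0 ?mul0r // gt_eqF.
by rewrite /iB indicE memNset ?mulr0 // => Bn; apply: no; exists n.
Qed.

Lemma interpolating_solvable (q Rr : R) : 0 < Rr < 1 -> 1 <= q -> interpolating p Z -> dbar_solvable p q Rr Z.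
move=> hR q1 hI; have mk := meas_kZ.
have Rp : 0 < Rr by case/andP: hR.
(* The two requirements of [mq_ge] on the relative size of cells; [1/16] is also what the solution
   operator asks for. *)
pose r0 : R := Num.min (1 / 16) (Rr / 8).
have r00 : 0 < r0 by rewrite lt_min !divr_gt0.
have r016 : r0 <= 1 / 16 by rewrite ge_min lexx.
have r08 : 8 * r0 <= Rr by rewrite mulrC -ler_pdivlMr // ge_min lexx orbT.
have r01 : r0 <= 1 by apply: letr r016 _; lra.
have [c [K [eta [lam [An [h [N [[c0 K0 eta0 eta1] [mN N0 ZN] [lamD mA triv AU] sep [hB near low]]]]]]]]] := grid hI r00 r01.
have [Kq Kq0 hmq] := mq_ge hR q1.
(* [eta / 2] makes the disks of non-empty cells disjoint; [r0] keeps their points close enough for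
   [mq_ge] to bound the cell integral by the mean there. *)
pose et := Num.min (eta / 2) r0.
have et0 : 0 < et by rewrite lt_min r00 divr_gt0.
have et1 : et <= 1 by rewrite ge_min r01 orbT.
pose Q : R := 2 `^ p * ((8 / (c * kappa)) `^ p * K + 4 * K * (2 / (c * kappa)) `^ p * 17).
have Q0 : 0 <= Q by rewrite mulr_ge0 ?powR_ge0 // addr_ge0 ?mulr_ge0 ?powR_ge0 ?ltW.
pose L : R := Q * (Kq `^ p / et ^+ 2).
have L0 : 0 <= L by apply: mulr_ge0 => //; rewrite divr_ge0 ?powR_ge0 ?sqr_ge0.
exists (L `^ p^-1) => f [f1 [f2 fJ]].
have mf : cmeas DP f by split.
pose G w := f w * rC (ek Z w).
have mG : cmeas DP G by apply: cmeasM => //; apply: cmeas_rC; exact: mcomp.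
pose g z := mq Rr q G z; have g0 z : (0 <= g z)%E by exact: poweR_ge0.
pose J := (\int[A]_(z in Dk) (g z `^ p))%E.
have J0 : (0 <= J)%E by apply: integral_ge0 => z _; exact: poweR_ge0.
have JE : normpqZ p q Rr Z f = (J `^ p^-1)%E by [].
have pV : 0 < p^-1 by rewrite invr_gt0.
have Jf : (J < +oo)%E.
 exact: poweR_lty_inv pV fJ.
have JF : J = (fine J)%:E by rewrite fineK // ge0_fin_numE.
pose I n : \bar R := (\int[A]_(w in An n) (cabs (G w))%:E)%E.
have I0 n : (0 <= I n)%E by apply: integral_ge0 => w _; rewrite lee_fin nc_ge0.
have AD n : An n `<=` Dk by move=> w Aw; have [] : (Dk `\` N) w by rewrite -AU; exists n.
have dn0 n : 0 < dd (lam n) by exact: dd_gt0.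
have gI n z : eball (lam n) (et * dd (lam n)) z -> (I n <= (Kq * dd (lam n) ^+ 2)%:E * g z)%E.
 move=> zB; have ez : et * dd (lam n) <= r0 * dd (lam n) by apply: lerMr; [exact: ltW|rewrite ge_min lexx orbT].
 have zD : Dk z by apply: (@eball_disk (lam n) (et * dd (lam n))) zB; rewrite ler_piMl // ltW.
 apply: (hmq G (lam n) z (An n) r0) => //; first exact: near.
 by apply: letr ez; exact: ltW.
have dis n k z : An n !=set0 -> An k !=set0 -> eball (lam n) (et * dd (lam n)) z -> eball (lam k) (et * dd (lam k)) z -> n = k.
 move=> An0 Ak0 zn zk; apply/eqP/negPn/negP => /eqP nk.
 have sub m : eball (lam m) (et * dd (lam m)) `<=` eball (lam m) (eta / 2 * dd (lam m)).
  by move=> w hw; apply: ltle hw _; apply: lerMr; [exact: ltW|rewrite ge_min lexx].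
 exact: (sep_eballs eta0 (lamD n) (lamD k) (sep _ _ An0 Ak0 nk) (sub _ _ zn) (sub _ _ zk)).
have I00 n : ~ (An n !=set0) -> I n = 0%E.
 by move=> no; rewrite /I (_ : An n = set0) ?integral_set0 // -subset0 => w hw; apply: no; exists w.
(* An infinite cell integral would make the mean infinite on a whole disk. A single value [t] with
   [t^p] times the squared radius equal to the norm integral plus one then gives a contradiction. *)
have Ifin n : (I n < +oo)%E.
 case: (pselect (An n !=set0)) => [An0|/I00 -> //]; rewrite ltey; apply/eqP => Iy.
 pose D := (et * dd (lam n)) ^+ 2; have D0 : 0 < D by rewrite exprn_gt0 // mulr_gt0.
 pose t := ((fine J + 1) / D) `^ p^-1.
 have t0 : 0 <= (fine J + 1) / D by rewrite divr_ge0 ?(ltW D0) // addr_ge0 // fine_ge0.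
 have gy z : eball (lam n) (et * dd (lam n)) z -> g z = +oo%E.
  move=> /gI; rewrite Iy leye_eq; case: (g z) (g0 z) => // r _; by rewrite -EFinM.
 have x0 k : 0 <= if k == n then t else 0 by case: ifP => // _; exact: powR_ge0.
 have := @sum_le_integral_powR et lam (fun k => if k == n then t else 0) g n.+1 et0 et1 lamD x0 g0.
 have h1 k m z : (if k == n then t else 0) != 0 -> (if m == n then t else 0) != 0 ->
   eball (lam k) (et * dd (lam k)) z -> eball (lam m) (et * dd (lam m)) z -> k = m.
  have E l : (if l == n then t else 0) != 0 -> l = n by case: (l =P n) => // _; rewrite eqxx.
  by move=> /E -> /E ->.
 have h2 k z : eball (lam k) (et * dd (lam k)) z -> ((if k == n then t else 0)%:E <= g z)%E.
  by case: (k =P n) => [->|_] // /gy ->; rewrite leey.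
 move=> /(_ h1 h2); rewrite big_ord_recr /= eqxx -/J JF lee_fin leNgt => /negP; apply.
 apply: (@ltle _ _ (t `^ p * D)); last first.
  by rewrite lerDr; apply: sumr_ge0 => k _; rewrite mulr_ge0 ?powR_ge0 ?sqr_ge0.
 by rewrite /t -powRrM mulVf ?gt_eqF // powRr1 // divfK ?gt_eqF // ltrDl.
pose X n := fine (I n) / dd (lam n) ^+ 2.
have XE n : I n = (dd (lam n) ^+ 2 * X n)%:E.
 by rewrite /X mulrCA mulfV ?mulr1 ?fineK ?ge0_fin_numE // expf_neq0 // gt_eqF.
have X0 n : 0 <= X n by rewrite divr_ge0 ?sqr_ge0 // fine_ge0.
(* Normalized so that the mean is at least [x n] on the disk of cell [n]; the value is zero when the
   cell is empty, as disjointness fails there. *)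
pose x n := X n / Kq; have x0 n : 0 <= x n by rewrite divr_ge0 // ltW.
have xA n : x n != 0 -> An n !=set0.
 by move=> xn; apply: contrapT => /I00 In0; move: xn; rewrite /x /X In0 /= !mul0r eqxx.
have hsum m : \sum_(n < m) x n `^ p * (et * dd (lam n)) ^+ 2 <= fine J.
 rewrite -lee_fin -JF; apply: sum_le_integral_powR => // [n k z /xA An0 /xA Ak0|n z /gI]; first exact: dis.
 rewrite XE; case: (g z) (g0 z) => [r|_ _|//]; last by rewrite leey.
 rewrite !lee_fin => r0' hr; rewrite ler_pdivrMr //.
 rewrite -(ler_pM2l (exprn_gt0 2 (dn0 n))); apply: letr hr _.
 by have -> : Kq * dd (lam n) ^+ 2 * r = dd (lam n) ^+ 2 * (r * Kq) by ring.
pose S := Kq `^ p / et ^+ 2 * fine J.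
have hS m : \sum_(n < m) X n `^ p * dd (lam n) ^+ 2 <= S.
 have -> : \sum_(n < m) X n `^ p * dd (lam n) ^+ 2 = Kq `^ p / et ^+ 2 * \sum_(n < m) x n `^ p * (et * dd (lam n)) ^+ 2.
  rewrite mulr_sumr; apply: eq_bigr => n _.
  have {1}-> : X n = Kq * x n by rewrite /x mulrCA mulfV ?mulr1 // gt_eqF.
  by rewrite powRM ?(ltW Kq0) // exprMn; move: (Kq `^ p) (x n `^ p) (dd (lam n) ^+ 2) => a1 a2 a3; field; rewrite gt_eqF.
 by apply: lerMl; rewrite ?divr_ge0 ?powR_ge0 ?sqr_ge0.
have near' n w : An n w -> dC w (lam n) <= 1 / 16 * dd (lam n).
 by move=> /near hw; apply: letr hw _; apply: lerMr => //; exact: ltW.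
have hX n : (\int[A]_(w in An n) (cabs (f w * rC (ek Z w)))%:E <= (dd (lam n) ^+ 2 * X n)%:E)%E by rewrite -XE.
have [u [hu hn]] := solution_operator mk c0 K0 mN N0 ZN lamD mA triv AU hB near' low mf X0 hX hS.
exists u; split=> //; rewrite JE /normZ.
have n0 : (0 <= \int[A]_(z in Dk) ((cabs (u z) * ek Z z) `^ p)%:E)%E.
 by apply: integral_ge0 => z _; rewrite lee_fin powR_ge0.
apply: letr (ler_poweR (ltW pV) n0 hn) _.
rewrite JF !poweR_EFin -EFinM lee_fin -powRM //; last by rewrite fine_ge0.
by apply: eq_ler; congr (_ `^ _); rewrite /L /S -/Q; ring.
Qed.
End Equivalence.
End Separated.
End Disk.

Theorem mainTheorem10 (R : realType) (p Rr : R) (Z : set (R * R)) :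
  0 < p < 1 -> 0 < Rr < 1 ->
  (forall a, Z a -> @disk R a) -> ph_separated Z ->
  (interpolating p Z <-> (forall q : R, 1 <= q -> dbar_solvable p q Rr Z)) /\
  (interpolating p Z <-> (exists q : R, 1 <= q /\ dbar_solvable p q Rr Z)).
Proof.
move=> hp hR ZD [delta [d0 Zsep]].
(* The packing constants assume a separation constant at most [1]. *)
pose d := Num.min delta 1; have dp : 0 < d by rewrite lt_min d0 ltr01.
have d1 : d <= 1 by rewrite ge_min lexx orbT.
have Zd a b : Z a -> Z b -> a <> b -> d <= psi a b by move=> Za Zb ab; rewrite ge_min Zsep.
have ab q : 1 <= q -> interpolating p Z -> dbar_solvable p q Rr Z by exact: interpolating_solvable dp d1 ZD Zd hp _ _ hR.
have ca q : 1 <= q -> dbar_solvable p q Rr Z -> interpolating p Z by exact: solvable_interpolating dp d1 ZD Zd hp _ _ hR.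
(* Every exponent [q] gives both implications; for the statement quantified over all [q] the value
   [q = 1] is taken. *)
split; split=> [hI|]; [by move=> q q1; exact: ab|by move=> /(_ 1 (lexx 1)); exact: ca|by exists 1; split; [|exact: ab]|].
by move=> [q [q1]]; exact: ca.
Qed.
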